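(* Let $U\subseteq\mathbb{R}^m$ be finite, let $\widetilde{\mathcal{U}}_{pc}$ be an admissible set of inputs with values in $U$, and let $p:\widetilde{\mathcal{U}}_{pc}\to\mathbb{R}^r$ be a response map which has an extension to negative times. Then the following hold. (i) $\operatorname{trdeg}A_{obs}(p)<+\infty$ if and only if there exists $u\in\widetilde{\mathcal{U}}_{pc}$ such that $p_u$ has a local (Nash) realization. (ii) If $\operatorname{trdeg}A_{obs}(p)=d<+\infty$, then for any $\epsilon>0$ there exist an input $u\in\widetilde{\mathcal{U}}_{pc}$ with $T_u<\epsilon$ and a local Nash realization $\Sigma$ of $p_u$ such that $\dim\Sigma=d$ and $\Sigma$ is semi-algebraically reachable and semi-algebraically observable. (iii) Let $u\in\widetilde{\mathcal{U}}_{pc}$ and let $\Sigma$ be a local realization of $p_u$. Then $\Sigma$ is minimal $\iff$ $\dim\Sigma=\operatorname{trdeg}A_{obs}(p)$ $\iff$ $\Sigma$ is semi-algebraically reachable and semi-algebraically observable. (iv) Let $\Sigma_1=(X_1,f^1,h^1,x_0^1)$ and $\Sigma_2=(X_2,f^2,h^2,x_0^2)$ be local realizations of $p$ which are both semi-algebraically reachable and semi-algebraically observable. For any $\epsilon>0$ there exist $u\in\widetilde{\mathcal{U}}_{pc}$ with $T_u<\epsilon$ and open semi-algebraic sets $V_1\subseteq X_1$, $V_2\subseteq X_2$ such that $\Sigma_{V_1}=(V_1,f^{V_1},h^{V_1},x_0^{V_1})$ and $\Sigma_{V_2}=(V_2,f^{V_2},h^{V_2},x_0^{V_2})$ are local Nash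 realizations of $p_u$ which are isomorphic. Here $f^{V_i}$ and $h^{V_i}$ denote the restrictions of $f^i$ and $h^i$ to $V_i$, respectively, and $x_0^{V_i}=x_{\Sigma_i}(T_u;x_0^i,u)$.
   Context: **Inputs.** $\mathcal{U}_{pc}$ is the set of piecewise-constant inputs $u=(\alpha_1,t_1)\cdots(\alpha_k,t_k)$ with values $\alpha_i\in U$ and durations $t_i\in[0,\infty)$, regarded as piecewise-constant functions on $[0,T_u]$, $T_u=\sum_i t_i$ (so $(\alpha,0)$ may be deleted and $(\alpha,s)(\alpha,t)=(\alpha,s+t)$); $e$ is the empty input, $T_e=0$; $uv$ is concatenation. A nonempty subset $\widetilde{\mathcal{U}}_{pc}\subseteq\mathcal{U}_{pc}$ is an admissible set of inputs if: (i) for all $u\in\widetilde{\mathcal{U}}_{pc}$, $t\in[0,T_u]$, the restriction $u_{[0,t]}\in\widetilde{\mathcal{U}}_{pc}$; (ii) for all $u\in\widetilde{\mathcal{U}}_{pc}$, $\alpha\in U$ there is $t>0$ with $u(\alpha,t)\in\widetilde{\mathcal{U}}_{pc}$; (iii) for all $u=(\alpha_1,t_1)\cdots(\alpha_k,t_k)\in\widetilde{\mathcal{U}}_{pc}$ there is $\delta>0$ such that $(\alpha_1,\bar t_1)\cdots(\alpha_k,\bar t_k)\in\widetilde{\mathcal{U}}_{pc}$ for all $\bar t_i\in[0,t_i+\delta]$. **Response maps.** $\mathcal{A}(\widetilde{\mathcal{U}}_{pc}\to\mathbb{R})$ is the algebra of maps $p:\widetilde{\mathcal{U}}_{pc}\to\mathbb{R}$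 such that for all $k>0$, $\alpha_1,\dots,\alpha_k\in U$, the map $(t_1,\dots,t_k)\mapsto p((\alpha_1,t_1)\cdots(\alpha_k,t_k))$ is analytic on the set of those $(t_1,\dots,t_k)\in[0,\infty)^k$ with $(\alpha_1,t_1)\cdots(\alpha_k,t_k)\in\widetilde{\mathcal{U}}_{pc}$. A map $p=(p_1,\dots,p_r):\widetilde{\mathcal{U}}_{pc}\to\mathbb{R}^r$ is a response map if all $p_i\in\mathcal{A}(\widetilde{\mathcal{U}}_{pc}\to\mathbb{R})$. $A_{obs}(p)$ is the smallest subalgebra of $\mathcal{A}(\widetilde{\mathcal{U}}_{pc}\to\mathbb{R})$ containing $p_1,\dots,p_r$ and closed under the operators $D_\alpha f(u)=\frac{d}{dt}f(u(\alpha,t))|_{t=0+}$, $\alpha\in U$. For an integral domain $A$ over $\mathbb{R}$, $\operatorname{trdeg}A$ is the transcendence degree over $\mathbb{R}$ of its fraction field. For $u\in\widetilde{\mathcal{U}}_{pc}$, let $\widetilde{\mathcal{U}}_{pc}^u=\{v\in\widetilde{\mathcal{U}}_{pc}\mid uv\in\widetilde{\mathcal{U}}_{pc}\}$ and $p_u:\widetilde{\mathcal{U}}_{pc}^u\to\mathbb{R}^r$, $p_u(v)=p(uv)$; this is again a response map. **Extension to negative times.** $\mathcal{U}_{pc}^-$ is the set of generalized inputs $(\alpha_1,t_1)\cdots(\alpha_k,t_k)$ with $\alpha_i\in U$, $t_i\in\mathbb{R}$. Let $I(0,a)=[0,a]$ if $a\ge0$ and $[a,0]$ if $a<0$. A nonempty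 $\overline{\mathcal{U}}_{pc}\subseteq\mathcal{U}_{pc}^-$ is an admissible set of generalized inputs if: (i) for $u=(\alpha_1,t_1)\cdots(\alpha_k,t_k)\in\overline{\mathcal{U}}_{pc}$, each $i$ and $t\in I(0,t_i)$, $(\alpha_1,t_1)\cdots(\alpha_{i-1},t_{i-1})(\alpha_i,t)\in\overline{\mathcal{U}}_{pc}$; (ii) for $u\in\overline{\mathcal{U}}_{pc}$, $\alpha\in U$ there is $\delta>0$ with $u(\alpha,t)\in\overline{\mathcal{U}}_{pc}$ for all $t\in(-\delta,\delta)$; (iii) for $u=(\alpha_1,t_1)\cdots(\alpha_k,t_k)\in\overline{\mathcal{U}}_{pc}$ there is $\delta>0$ with $(\alpha_1,\bar t_1)\cdots(\alpha_k,\bar t_k)\in\overline{\mathcal{U}}_{pc}$ for all $\bar t_i\in I(0,\mathrm{sgn}(t_i)(|t_i|+\delta))$. A map $\bar p:\overline{\mathcal{U}}_{pc}\to\mathbb{R}^r$ is a generalized response map if each component is analytic in $(t_1,\dots,t_k)$ for each fixed $\alpha_1,\dots,\alpha_k$ (on the set of tuples in $\mathbb{R}^k$ giving elements of $\overline{\mathcal{U}}_{pc}$) and satisfies $\bar p(u(\alpha,0)v)=\bar p(uv)$ and $\bar p(u(\alpha,t_1)(\alpha,t_2)v)=\bar p(u(\alpha,t_1+t_2)v)$ whenever these generalized inputs lie in $\overline{\mathcal{U}}_{pc}$. A response map $p:\widetilde{\mathcal{U}}_{pc}\to\mathbb{R}^r$ has an extension to negative times if there are an admissible set of generalized inputs $\overline{\mathcal{U}}_{pc}\supseteq\widetilde{\mathcal{U}}_{pc}$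 and a generalized response map $\bar p:\overline{\mathcal{U}}_{pc}\to\mathbb{R}^r$ with $\bar p|_{\widetilde{\mathcal{U}}_{pc}}=p$. **Nash systems.** A Nash function on an open semi-algebraic $X\subseteq\mathbb{R}^n$ is an analytic semi-algebraic function $X\to\mathbb{R}$; $\mathcal{N}(X)$ is the ring of these; an $\mathbb{R}^k$-valued map is Nash if its components are. A Nash system $\Sigma=(X,f,h,x_0)$ with input space $U$ and output space $\mathbb{R}^r$ consists of an open connected semi-algebraic $X\subseteq\mathbb{R}^n$, $f:X\times U\to\mathbb{R}^n$ with $f_\alpha=f(\cdot,\alpha)$ Nash for every $\alpha\in U$, a Nash map $h:X\to\mathbb{R}^r$, and an initial state $x_0\in X$; the dynamics is $\dot x(t)=f(x(t),u(t))$, $x(0)=x_0$. $\dim\Sigma$ is the dimension of $X$. $\widetilde{\mathcal{U}}_{pc}(\Sigma)$ is the largest admissible set of inputs $u\in\mathcal{U}_{pc}$ for which there is a unique trajectory $x_\Sigma(\cdot;x_0,u):[0,T_u]\to X$ of $\Sigma$. $\Sigma$ is a local (Nash) realization of a response map $p:\widetilde{\mathcal{U}}_{pc}\to\mathbb{R}^r$ if $p(u)=h(x_\Sigma(T_u;x_0,u))$ for all $u\in\widetilde{\mathcal{U}}_{pc}\cap\widetilde{\mathcal{U}}_{pc}(\Sigma)$. It is minimal if it has the smallest dimension among all local realizations of that response map. **Reachability, observability, isomorphism.** $\mathcal{R}(x_0)=\{x_\Sigma(T_u;x_0,u)\mid u\in\widetilde{\mathcal{U}}_{pc}(\Sigma)\}$.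 $\Sigma$ is semi-algebraically reachable if every $g\in\mathcal{N}(X)$ vanishing on $\mathcal{R}(x_0)$ is zero. $A_{obs}(\Sigma)$ is the smallest subalgebra of $\mathcal{N}(X)$ containing the components of $h$ and closed under Lie derivatives along $f_\alpha$, $\alpha\in U$; $\Sigma$ is semi-algebraically observable if $\operatorname{trdeg}A_{obs}(\Sigma)=\operatorname{trdeg}\mathcal{N}(X)$. Nash systems $(V_1,f^1,h^1,x^1)$ and $(V_2,f^2,h^2,x^2)$ are isomorphic if there is a Nash diffeomorphism $\phi:V_1\to V_2$ with $f^2_\alpha(\phi(x))=D\phi(x)f^1_\alpha(x)$ for all $x\in V_1$, $\alpha\in U$, $h^2\circ\phi=h^1$ and $\phi(x^1)=x^2$. *)

(* Defs.v *)
From HB Require Import structures.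
From mathcomp Require Import all_boot all_order all_algebra.
From mathcomp Require Import all_classical all_reals all_analysis.
From mathcomp.multinomials Require Import -(notations) mpoly.

Set Implicit Arguments.
Unset Strict Implicit.
Unset Printing Implicit Defensive.

Import Order.TTheory GRing.Theory Num.Theory.
Import numFieldNormedType.Exports.

Local Open Scope classical_set_scope.
Local Open Scope ring_scope.

(* A map defined on a subset D of a type T is a total function on T of which
   only the values on D are ever used; two such maps are the same when they
   agree on D. *)

Section Analytic.
Variable R : realType.

(* The sum over 0 <= nu_i < N of c(nu) y^nu. *)
Definition psum k (c : ('I_k -> nat) -> R) (y : 'rV[R]_k) (N : nat) : R :=
  \sum_(nu : {ffun 'I_k -> 'I_N})
    c (fun i => nat_of_ord (nu i)) * \prod_(i < k) y 0 i ^+ nu i.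

(* S need not be open: around each point of S, g must agree on S with the sum
   of a power series converging absolutely on a full neighbourhood. *)
Definition analytic_on k (S : set 'rV[R]_k) (g : 'rV[R]_k -> R) : Prop :=
  forall a, S a -> exists c : ('I_k -> nat) -> R,
    \forall x \near a,
      cvgn (psum (fun nu => `|c nu|) (map_mx Num.norm (x - a))) /\
      (S x -> psum c (x - a) @ \oo --> g x).

Inductive semialgebraic n : set 'rV[R]_n -> Prop :=
| semialgebraic_pos (P : mpoly n R) :
    semialgebraic [set x : 'rV[R]_n | 0 < meval (fun i => x 0 i) P]
| semialgebraicU A B :
    semialgebraic A -> semialgebraic B -> semialgebraic (A `|` B)
| semialgebraicI A B :
    semialgebraic A -> semialgebraic B -> semialgebraic (A `&` B)
| semialgebraicC A : semialgebraic A -> semialgebraic (~` A).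

Definition semialgebraic_fun n (X : set 'rV[R]_n) (g : 'rV[R]_n -> R) : Prop :=
  semialgebraic [set z : 'rV[R]_(n + 1) |
    X (lsubmx z) /\ rsubmx z 0 0 = g (lsubmx z)].

Definition nash n (X : set 'rV[R]_n) : set ('rV[R]_n -> R) :=
  [set g | analytic_on X g /\ semialgebraic_fun X g].

Definition nash_map n k (X : set 'rV[R]_n) (g : 'rV[R]_n -> 'rV[R]_k) : Prop :=
  forall j, nash X (fun x => g x 0 j).

End Analytic.

Section TranscendenceDegree.
Variable R : realType.

Definition subalgebra T (A : set (T -> R)) : Prop :=
  [/\ forall c, A (cst c),
      forall f g, A f -> A g -> A (f \+ g) &
      forall f g, A f -> A g -> A (f \* g)].

(* F is the fraction field of the algebra of the restrictions to D of the
   members of A, and iota is the embedding; such F exists iff that algebra is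
   an integral domain. *)
Definition fraction_field T (D : set T) (A : set (T -> R))
    (F : fieldType) (iota : (T -> R) -> F) : Prop :=
  [/\ forall f g, A f -> A g ->
        (iota f = iota g <-> (forall x, D x -> f x = g x)),
      iota (cst 1) = 1,
      forall f g, A f -> A g -> iota (f \+ g) = iota f + iota g,
      forall f g, A f -> A g -> iota (f \* g) = iota f * iota g &
      forall z, exists f g, [/\ A f, A g, iota g != 0 & z = iota f / iota g]].

Definition alg_indep (F : fieldType) (j : R -> F) d (y : 'I_d -> F) : Prop :=
  forall P : mpoly d R, mmap j y P = 0 -> P = 0.

Definition extend_family (F : Type) d (y : 'I_d -> F) (z : F) : 'I_d.+1 -> F :=
  fun i => if unlift ord_max i is Some i' then y i' else z.

(* A transcendence basis is a maximal algebraically independent family. *)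
Definition transcendence_basis (F : fieldType) (j : R -> F) d (y : 'I_d -> F) :=
  alg_indep j y /\ forall z, ~ alg_indep j (extend_family y z).

(* trdeg D A d : the algebra of the restrictions to D of the members of A is
   an integral domain of transcendence degree d over R. *)
Definition trdeg T (D : set T) (A : set (T -> R)) (d : nat) : Prop :=
  exists (F : fieldType) (iota : (T -> R) -> F) (y : 'I_d -> F),
    fraction_field D A iota /\
    transcendence_basis (fun c => iota (cst c)) y.

End TranscendenceDegree.

Section Inputs.
Variables (R : realType) (m : nat).
Implicit Type U : set 'rV[R]_m.

(* The word [:: (alpha_1, t_1); ...; (alpha_k, t_k)]; durations are arbitrary
   reals, so that generalized inputs are words too. *)
Definition input := seq ('rV[R]_m * R).
Implicit Types (D : set input) (u v w : input) (al : 'rV[R]_m).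

Definition duration u : R := \sum_(a <- u) a.2.

Definition mkinput k (al : 'I_k -> 'rV[R]_m) (t : 'rV[R]_k) : input :=
  [seq (al i, t 0 i) | i <- enum 'I_k].

(* The restriction of u to [0, t], for 0 <= t <= duration u. *)
Fixpoint restrict_input u (t : R) : input :=
  if u is (al, s) :: w then
    if t <= s then [:: (al, t)] else (al, s) :: restrict_input w (t - s)
  else [::].

Definition pc_inputs U : set input :=
  [set u | forall a, a \in u -> U a.1 /\ 0 <= a.2].

Definition gen_inputs U : set input :=
  [set u | forall a, a \in u -> U a.1].

(* Several words represent the same piecewise-constant function.  A set of
   inputs is a set of words closed under the identifications
   u (al,0) v = u v and u (al,s) (al,t) v = u (al,s+t) v. *)
Definition saturated U D : Prop :=
  (forall u v al, U al -> (D (u ++ (al, 0) :: v) <-> D (u ++ v))) /\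
  (forall u v al s t, 0 <= s -> 0 <= t ->
    (D (u ++ (al, s) :: (al, t) :: v) <-> D (u ++ (al, s + t) :: v))).

Definition admissible U D : Prop :=
  [/\ D !=set0 /\ D `<=` pc_inputs U,
      saturated U D,
      forall u t, D u -> 0 <= t <= duration u -> D (restrict_input u t),
      forall u al, D u -> U al -> exists2 t, 0 < t & D (rcons u (al, t)) &
      forall k (al : 'I_k -> 'rV[R]_m) (t : 'rV[R]_k), D (mkinput al t) ->
        exists2 delta : R, 0 < delta &
          forall t' : 'rV[R]_k,
            (forall i, 0 <= t' 0 i <= t 0 i + delta) -> D (mkinput al t')].

(* I(0, a) *)
Definition seg0 (a : R) : set R := [set` if 0 <= a then `[0, a] else `[a, 0]].

Definition gen_admissible U D : Prop :=
  [/\ D !=set0 /\ D `<=` gen_inputs U,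
      forall v w al s t, D (v ++ (al, s) :: w) -> seg0 s t ->
        D (rcons v (al, t)),
      forall u al, D u -> U al -> exists2 delta : R, 0 < delta &
        forall t, - delta < t < delta -> D (rcons u (al, t)) &
      forall k (al : 'I_k -> 'rV[R]_m) (t : 'rV[R]_k), D (mkinput al t) ->
        exists2 delta : R, 0 < delta &
          forall t' : 'rV[R]_k,
            (forall i, seg0 (Num.sg (t 0 i) * (`|t 0 i| + delta)) (t' 0 i)) ->
            D (mkinput al t')].

Definition respects_identifications (V : Type) D (f : input -> V) : Prop :=
  (forall u v al, D (u ++ (al, 0) :: v) -> D (u ++ v) ->
    f (u ++ (al, 0) :: v) = f (u ++ v)) /\
  (forall u v al s t,
    D (u ++ (al, s) :: (al, t) :: v) -> D (u ++ (al, s + t) :: v) ->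
    f (u ++ (al, s) :: (al, t) :: v) = f (u ++ (al, s + t) :: v)).

(* The algebra A(D -> R).  The control values need not be restricted to U: if
   one of them is outside U then no mkinput al t is in D. *)
Definition analytic_maps D : set (input -> R) :=
  [set f | respects_identifications D f /\
    forall k (al : 'I_k -> 'rV[R]_m),
      analytic_on [set t | D (mkinput al t)] (fun t => f (mkinput al t))].

(* Used both for D admissible (response maps) and for D an admissible set of
   generalized inputs (generalized response maps). *)
Definition response_map r D (p : input -> 'rV[R]_r) : Prop :=
  forall j, analytic_maps D (fun u => p u 0 j).

(* D_al f (u), the derivative of t |-> f(u(al,t)) at 0+ *)
Definition input_deriv al (f : input -> R) : input -> R :=
  fun u => lim ((f (rcons u (al, t)) - f (rcons u (al, 0))) / t @[t --> 0^'+]).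

Definition obs_algebra_map r U D (p : input -> 'rV[R]_r) : set (input -> R) :=
  smallest
    [set A | [/\ subalgebra A, A `<=` analytic_maps D &
      forall al f, U al -> A f -> A (input_deriv al f)]]
    [set (fun u => p u 0 j) | j in setT].

Definition shift_dom D u : set input := [set v | D v /\ D (u ++ v)].

Definition shift_map (V : Type) (p : input -> V) u : input -> V :=
  fun v => p (u ++ v).

Definition has_negative_extension r U D (p : input -> 'rV[R]_r) : Prop :=
  exists (Dbar : set input) (pbar : input -> 'rV[R]_r),
    [/\ gen_admissible U Dbar, D `<=` Dbar, response_map Dbar pbar &
        forall u, D u -> pbar u = p u].

End Inputs.

Section NashSystems.
Variables (R : realType) (m r : nat).
Implicit Type U : set 'rV[R]_m.

(* State space X, dynamics f_al = dyn al on X for al in the input space,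
   output map h, initial state x_0.  As X is a nonempty open subset of R^n,
   the dimension of the system is n. *)
Record system (n : nat) := System {
  state_space : set 'rV[R]_n;
  dyn : 'rV[R]_m -> 'rV[R]_n -> 'rV[R]_n;
  output : 'rV[R]_n -> 'rV[R]_r;
  init : 'rV[R]_n }.

Definition nash_system U n (S : system n) : Prop :=
  [/\ [/\ open (state_space S), connected (state_space S) &
          semialgebraic (state_space S)],
      forall al, U al -> nash_map (state_space S) (dyn S al),
      nash_map (state_space S) (output S) &
      state_space S (init S)].

Definition trajectory n (S : system n) (u : input R m) (x : R -> 'rV[R]_n) :=
  [/\ x 0 = init S,
      {within `[0, duration u], continuous x},
      forall t, 0 <= t <= duration u -> state_space S (x t) &
      forall v al s w, u = v ++ (al, s) :: w ->
        forall t, duration v < t < duration v + s ->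
          is_derive t 1 x (dyn S al (x t))].

Definition unique_trajectory n (S : system n) (u : input R m) : Prop :=
  (exists x, trajectory S u x) /\
  (forall x y, trajectory S u x -> trajectory S u y ->
    forall t, 0 <= t <= duration u -> x t = y t).

(* A union of admissible sets of inputs is admissible, so the largest one with
   unique trajectories is the union of all of them. *)
Definition system_inputs U n (S : system n) : set (input R m) :=
  \bigcup_(D in [set D | admissible U D /\ D `<=` unique_trajectory S]) D.

(* x_S(T_u; x_0, u), meaningful when u has a unique trajectory *)
Definition end_state n (S : system n) (u : input R m) : 'rV[R]_n :=
  xget (init S) [set z | exists2 x, trajectory S u x & z = x (duration u)].

Definition local_realization U (D : set (input R m)) (p : input R m -> 'rV[R]_r)
    n (S : system n) : Prop :=
  nash_system U S /\
  forall u, D u -> system_inputs U S u -> p u = output S (end_state S u).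

Definition minimal_realization U (D : set (input R m))
    (p : input R m -> 'rV[R]_r) n (S : system n) : Prop :=
  local_realization U D p S /\
  forall n' (S' : system n'), local_realization U D p S' -> (n <= n')%N.

Definition reachable_set U n (S : system n) : set 'rV[R]_n :=
  end_state S @` system_inputs U S.

Definition semialg_reachable U n (S : system n) : Prop :=
  forall g, nash (state_space S) g ->
    (forall x, reachable_set U S x -> g x = 0) ->
    forall x, state_space S x -> g x = 0.

Definition lie_deriv n (f : 'rV[R]_n -> 'rV[R]_n) (g : 'rV[R]_n -> R) :
    'rV[R]_n -> R :=
  fun x => 'd g x (f x).

Definition obs_algebra_system U n (S : system n) : set ('rV[R]_n -> R) :=
  smallest
    [set A | [/\ subalgebra A, A `<=` nash (state_space S) &
      forall al g, U al -> A g -> A (lie_deriv (dyn S al) g)]]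
    [set (fun x => output S x 0 j) | j in setT].

Definition semialg_observable U n (S : system n) : Prop :=
  exists d, trdeg (state_space S) (obs_algebra_system U S) d /\
            trdeg (state_space S) (nash (state_space S)) d.

Definition isomorphic U n1 n2 (S1 : system n1) (S2 : system n2) : Prop :=
  exists (phi : 'rV[R]_n1 -> 'rV[R]_n2) (psi : 'rV[R]_n2 -> 'rV[R]_n1),
    [/\ [/\ nash_map (state_space S1) phi, nash_map (state_space S2) psi,
            forall x, state_space S1 x -> state_space S2 (phi x) /\
                                          psi (phi x) = x &
            forall y, state_space S2 y -> state_space S1 (psi y) /\
                                          phi (psi y) = y],
        forall x al, state_space S1 x -> U al ->
          dyn S2 al (phi x) = 'd phi x (dyn S1 al x),
        forall x, state_space S1 x -> output S2 (phi x) = output S1 x &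
        phi (init S1) = init S2].

(* The system (V, f|V, h|V, x_S(T_u; x_0, u)). *)
Definition restrict_system n (S : system n) (V : set 'rV[R]_n)
    (u : input R m) : system n :=
  System V (dyn S) (output S) (end_state S u).

End NashSystems.

(* Main.v *)
(* To a point of the state space, or to an input, attach the words of iterated
   derivatives (Lie derivatives along the f_al, respectively the operators
   D_al) of a function at that point.  Words of letters carry the shuffle
   product, for which they form an integral domain, and taking these jets is a
   ring homomorphism commuting with the derivations.  By quasi-analyticity
   along trajectories, a Nash system is a local realization of p_u exactly when
   the jets of its outputs at x_0 are the jets of p at u, and a function of
   A_obs(p) is zero as soon as its jet at one input is; so every statement
   becomes one on jets.
   Existence: choose d independent elements of A_obs(p) as coordinates; their
   derivatives and the p_j are algebraic over them, and the implicit function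
   theorem at a short generic input turns the relations into a Nash system with
   the right jets.
   Minimality: if the jet map of a realization is not injective, or if the
   observations have dependent differentials at x_0, then in suitable Nash
   coordinates one coordinate can be frozen without changing the output jets,
   which lowers the dimension.  Transcendence degrees are compared by counting
   monomials. *)

Require Import Defs.
From HB Require Import structures.
From mathcomp Require Import all_boot all_order all_algebra.
From mathcomp Require Import all_classical all_reals all_analysis.
From mathcomp Require Import lra.
From mathcomp.real_closed Require ordered_qelim qe_rcf.
From mathcomp.multinomials Require Import -(notations) mpoly.
Set Implicit Arguments.
Unset Strict Implicit.
Unset Printing Implicit Defensive.
Import Order.TTheory GRing.Theory Num.Theory.
Import numFieldNormedType.Exports.
Local Open Scope classical_set_scope.
Local Open Scope ring_scope.

(** Two obstacles shape the development. First, analyticity is used quantitatively: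
    quasi-analyticity along trajectories requires bounds of the form C^(k+1) k! on all iterated Lie
    derivatives, and inverses and compositions have to be analytic again. An analytic function on a
    polydisc is therefore treated as the limit of polynomials that form a Cauchy sequence in a
    weighted l1 norm of the coefficients, for which products, compositions and derivatives have
    elementary estimates. Second, comparing jets is circular: the jets of the coordinates of a
    system depend on those of its vector fields, which are functions of the coordinates. Jets are
    therefore compared on words of length at most N: agreement of the coordinates to order N gives
    agreement of the vector fields to order N, which is agreement of the coordinates to order N + 1.
    That series on words form a domain also supplies the fraction fields in which transcendence
    degrees are computed, with controls as letters for the observation algebra and partial
    derivatives as letters for Nash functions. *)

(** * A weighted l1 norm on polynomials *)

Section PolynomialNorm.
Variable R : realType.

(** The l1 norm of the coefficients at radius r. It bounds the values on the polydisc ([pnorm_eval])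
    and, unlike a supremum over real points, also bounds the coefficients and, at smaller radii, the
    derivatives. *)
Definition pnorm n (r : R) (P : mpoly n R) : R :=
  \sum_(m <- msupp P) `|mcoeff m P| * r ^+ mdeg m.

Definition polyvar n (i : 'I_n) : mpoly n R := mpolyX R (mnm1 i).

Section Fixed.
Variables (n : nat) (r : R).
Hypothesis r_ge0 : 0 <= r.
Implicit Types P Q : mpoly n R.

(** Summing over any list that contains the support lets polynomials with different supports be
    compared term by term. *)
Lemma pnormE P (s : seq (multinom n)) : uniq s -> {subset msupp P <= s} ->
  pnorm r P = \sum_(m <- s) `|mcoeff m P| * r ^+ mdeg m.
Proof.
move=> us sub; rewrite /pnorm [RHS](bigID (fun m => m \in msupp P)) /=.
rewrite [X in _ + X]big1 ?addr0; last first.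
  by move=> m /memN_msupp_eq0 ->; rewrite normr0 mul0r.
rewrite -[RHS]big_filter; apply: perm_big; apply: uniq_perm.
- exact: msupp_uniq.
- exact: filter_uniq.
- move=> m; rewrite mem_filter /=.
  by apply/idP/andP => [h|[]//]; split=> //; apply: sub.
Qed.

Lemma pnorm_ge0 P : 0 <= pnorm r P.
Proof. by apply: sumr_ge0 => m _; rewrite mulr_ge0 ?exprn_ge0. Qed.

Lemma pnorm0 : pnorm r (0 : mpoly n R) = 0.
Proof. by rewrite /pnorm msupp0 big_nil. Qed.

Lemma pnormN P : pnorm r (- P) = pnorm r P.
Proof.
rewrite (@pnormE (- P) (msupp P)) ?msupp_uniq //.
  by apply: eq_bigr => m _; rewrite mcoeffN normrN.
by move=> m; rewrite (perm_mem (msuppN P)).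
Qed.

Lemma pnormD P Q : pnorm r (P + Q) <= pnorm r P + pnorm r Q.
Proof.
set s := undup (msupp P ++ msupp Q).
have us : uniq s by apply: undup_uniq.
rewrite !(@pnormE _ s) //.
- rewrite -big_split /=; apply: ler_sum => m _.
  by rewrite -mulrDl ler_wpM2r ?exprn_ge0 // mcoeffD ler_normD.
- by move=> m h; rewrite mem_undup mem_cat h orbT.
- by move=> m h; rewrite mem_undup mem_cat h.
- by move=> m /msuppD_le; rewrite mem_undup.
Qed.

Lemma pnormB P Q : pnorm r (P - Q) <= pnorm r P + pnorm r Q.
Proof. by rewrite -(pnormN Q) pnormD. Qed.

Lemma pnorm_sum (I : Type) (s : seq I) (F : I -> mpoly n R) :
  pnorm r (\sum_(i <- s) F i) <= \sum_(i <- s) pnorm r (F i).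
Proof.
elim: s => [|i s ih]; first by rewrite !big_nil pnorm0.
by rewrite !big_cons (le_trans (pnormD _ _)) // lerD2l.
Qed.

Lemma pnormZX c m : pnorm r (c *: mpolyX R m : mpoly n R) = `|c| * r ^+ mdeg m.
Proof.
rewrite (@pnormE _ [:: m]) //; last by move=> k /msuppZ_le; rewrite msuppX.
by rewrite big_seq1 mcoeffZ mcoeffX eqxx mulr1.
Qed.

Lemma pnormX m : pnorm r (mpolyX R m : mpoly n R) = r ^+ mdeg m.
Proof. by rewrite -[mpolyX R m]scale1r pnormZX normr1 mul1r. Qed.

Lemma pnorm_var i : pnorm r (polyvar i : mpoly n R) = r.
Proof. by rewrite pnormX mdeg1 expr1. Qed.

Lemma pnormC c : pnorm r (mpolyC n c) = `|c|.
Proof.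
by rewrite -[mpolyC n c]mulr1 -mpolyX0 mul_mpolyC pnormZX mdeg0 mulr1.
Qed.

Lemma pnormZ c P : pnorm r (c *: P) = `|c| * pnorm r P.
Proof.
rewrite (@pnormE _ (msupp P)) ?msupp_uniq //; last exact: msuppZ_le.
by rewrite mulr_sumr; apply: eq_bigr => m _; rewrite mcoeffZ normrM mulrA.
Qed.

Lemma pnormM P Q : pnorm r (P * Q) <= pnorm r P * pnorm r Q.
Proof.
rewrite {1}(mpolyE P) mulr_suml; apply: (le_trans (pnorm_sum _ _)).
rewrite [X in _ <= X * _]/pnorm mulr_suml; apply: ler_sum => m _.
rewrite {1}(mpolyE Q) mulr_sumr; apply: (le_trans (pnorm_sum _ _)).
rewrite [X in _ <= _ * X]/pnorm mulr_sumr; apply: ler_sum => k _.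
rewrite -scalerAl -scalerAr scalerA -mpolyXD pnormZX mdegD exprD normrM.
by rewrite mulrACA.
Qed.

Lemma pnormXn P k : pnorm r (P ^+ k) <= pnorm r P ^+ k.
Proof.
elim: k => [|k ih]; first by rewrite !expr0 -mpolyC1 pnormC normr1.
by rewrite !exprS (le_trans (pnormM _ _)) // ler_wpM2l // pnorm_ge0.
Qed.

Lemma pnorm_prod (I : Type) (s : seq I) (F : I -> mpoly n R) (G : I -> R) :
  (forall i, pnorm r (F i) <= G i) ->
  pnorm r (\prod_(i <- s) F i) <= \prod_(i <- s) G i.
Proof.
move=> FG; elim: s => [|i s ih].
  by rewrite !big_nil -mpolyC1 pnormC normr1.
by rewrite !big_cons (le_trans (pnormM _ _)) // ler_pM // pnorm_ge0.
Qed.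

Lemma pnorm_coef P m : `|mcoeff m P| * r ^+ mdeg m <= pnorm r P.
Proof.
case: (boolP (m \in msupp P)) => [mP|/memN_msupp_eq0 ->]; last first.
  by rewrite normr0 mul0r pnorm_ge0.
rewrite /pnorm (bigD1_seq m) ?msupp_uniq //= lerDl sumr_ge0 // => k _.
by rewrite mulr_ge0 ?exprn_ge0.
Qed.

Lemma pnorm_eval P (x : 'I_n -> R) :
  (forall i, `|x i| <= r) -> `|meval x P| <= pnorm r P.
Proof.
move=> xr; rewrite mevalE (le_trans (ler_norm_sum _ _ _)) //.
apply: ler_sum => m _; rewrite normrM ler_wpM2l // normr_prod.
rewrite mdegE -prodrXr; apply: ler_prod => i _.
by rewrite normr_ge0 normrX lerXn2r ?nnegrE.
Qed.

End Fixed.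

Lemma pnorm_le n (s r : R) (P : mpoly n R) :
  0 <= s -> s <= r -> pnorm s P <= pnorm r P.
Proof.
move=> s0 sr; apply: ler_sum => m _; rewrite ler_wpM2l //.
by rewrite lerXn2r ?nnegrE // (le_trans s0).
Qed.

(** Majorant principle: polynomials of norm at most s may be substituted as if they were numbers of
    absolute value at most s. *)
Lemma pnorm_comp n k (r s : R) (P : mpoly n R) (xi : n.-tuple (mpoly k R)) :
  0 <= r -> 0 <= s -> (forall i, pnorm r (tnth xi i) <= s) ->
  pnorm r (comp_mpoly xi P) <= pnorm s P.
Proof.
move=> r0 s0 xs; rewrite comp_mpolyEX (le_trans (pnorm_sum _ _ _)) //.
apply: ler_sum => m _; rewrite pnormZ // comp_mpolyX ler_wpM2l //.
rewrite mdegE -prodrXr; apply: (pnorm_prod r0) => i.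
rewrite (le_trans (pnormXn _ _ _)) // lerXn2r ?nnegrE ?pnorm_ge0 //.
Qed.

(** Mean value inequality k s^(k-1) (r - s) <= r^k, the Cauchy estimate for one monomial. The factor
    d is a coefficient in [pnorm_deriv] and a distance in [pnorm_lipschitz]. *)
Lemma subrXX_bound (r s d : R) k : 0 <= s -> s < r ->
  `|d| *+ k * s ^+ k.-1 * (r - s) <= `|d| * r ^+ k.
Proof.
move=> s0 sr.
have rs : 0 <= r - s by rewrite subr_ge0 ltW.
rewrite -mulr_natl -!mulrA mulrCA ler_wpM2l //.
have r0 : 0 <= r by rewrite (le_trans s0) ?ltW.
elim: k => [|k ih]; first by rewrite !mul0r expr0.
case: k ih => [|k] ih.
  by rewrite /= expr0 expr1 !mul1r; lra.
move: ih => /= ih; rewrite [s ^+ k.+1]exprS (exprS r).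
have sk : s ^+ k.+1 <= r ^+ k.+1 by rewrite lerXn2r ?nnegrE // ltW.
have : s * ((k.+1%:R * (s ^+ k * (r - s)))) + (r - s) * s ^+ k.+1 <= r * r ^+ k.+1.
  have -> : r * r ^+ k.+1 = s * r ^+ k.+1 + (r - s) * r ^+ k.+1 by lra.
  by rewrite lerD // ler_wpM2l.
apply: le_trans; rewrite le_eqVlt; apply/orP; left; apply/eqP.
rewrite (exprS s) -[k.+2%:R]natr1; lra.
Qed.

Lemma pnorm_deriv n (r s : R) (P : mpoly n R) i : 0 <= s -> s < r ->
  pnorm s (mderiv i P) * (r - s) <= pnorm r P.
Proof.
move=> s0 sr; rewrite {1}(mpolyE P) raddf_sum /=.
have rs : 0 <= r - s by rewrite subr_ge0 ltW.
apply: le_trans (ler_wpM2r rs (pnorm_sum s0 _ _)) _.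
rewrite mulr_suml; apply: ler_sum => m _.
rewrite mderivZ mderivX scalerA pnormZX // normrM normr_nat.
case: (posnP (m i)) => [->|mi].
  by rewrite !(mulr0, mul0r) mulr_ge0 // exprn_ge0 // (le_trans s0) ?ltW.
apply: le_trans (subrXX_bound _ (mdeg m) s0 sr); rewrite ler_wpM2r //.
rewrite mulr_natr.
have -> : mdeg (mnm_sub m (mnm1 i)) = (mdeg m).-1.
  have e : m = mnm_add (mnm_sub m (mnm1 i)) (mnm1 i).
    by rewrite submK //; apply/mnm_lepP => j; rewrite mnm1E; case: eqP => [<-|].
  by rewrite [in RHS]e mdegD mdeg1 addn1.
rewrite ler_wpM2r ?exprn_ge0 // ler_wpMn2l //.
by rewrite mdegE (bigD1 i) //= leq_addr.
Qed.

(** Invariant for telescoping two products of k factors: when the factors have norm at most s and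
    differ pairwise by at most d, the products differ by at most k d s^(k-1). *)
Definition mono_close n (r s d : R) (f g : mpoly n R) (k : nat) :=
  [/\ pnorm r f <= s ^+ k, pnorm r g <= s ^+ k &
      pnorm r (f - g) <= d *+ k * s ^+ k.-1].

Lemma mono_closeM n (r s d : R) (f g f' g' : mpoly n R) a b :
  0 <= r -> 0 <= s -> 0 <= d ->
  mono_close r s d f g a -> mono_close r s d f' g' b ->
  mono_close r s d (f * f') (g * g') (a + b).
Proof.
move=> r0 s0 d0 [fs gs fg] [fs' gs' fg']; split.
- apply: (le_trans (pnormM r0 _ _)); rewrite exprD.
  by apply: ler_pM; rewrite ?pnorm_ge0.
- apply: (le_trans (pnormM r0 _ _)); rewrite exprD.
  by apply: ler_pM; rewrite ?pnorm_ge0.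
have -> : f * f' - g * g' = (f - g) * f' + g * (f' - g').
  by rewrite mulrBl mulrBr addrA subrK.
apply: (le_trans (pnormD r0 _ _)).
apply: (@le_trans _ _ (d *+ a * s ^+ a.-1 * s ^+ b + s ^+ a * (d *+ b * s ^+ b.-1))).
  by apply: lerD; (apply: (le_trans (pnormM r0 _ _)); apply: ler_pM; rewrite ?pnorm_ge0).
rewrite le_eqVlt; apply/orP; left; apply/eqP.
rewrite mulrnDr mulrDl -mulrA -exprD mulrCA -exprD; congr (_ + _).
  by case: a {fs gs fg} => [|a]; rewrite ?mulr0n ?mul0r.
by case: b {fs' gs' fg'} => [|b]; rewrite ?mulr0n ?mul0r ?addnS.
Qed.

Lemma mono_close1 n (r s d : R) : @mono_close n r s d 1 1 0.
Proof.
split; rewrite ?subrr ?pnorm0 ?mulr0n ?mul0r //.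
  by rewrite -mpolyC1 pnormC normr1 expr0.
by rewrite -mpolyC1 pnormC normr1 expr0.
Qed.

Lemma mono_closeXn n (r s d : R) (f g : mpoly n R) a :
  0 <= r -> 0 <= s -> 0 <= d ->
  mono_close r s d f g 1 -> mono_close r s d (f ^+ a) (g ^+ a) a.
Proof.
move=> r0 s0 d0 fg; elim: a => [|a ih]; first by rewrite !expr0; apply: mono_close1.
by rewrite !exprS -add1n; apply: mono_closeM.
Qed.

Lemma pnorm_lipschitz n k (r s s' d : R) (P : mpoly n R)
    (xi eta : n.-tuple (mpoly k R)) :
  0 <= r -> 0 <= s -> s < s' ->
  (forall i, pnorm r (tnth xi i) <= s) -> (forall i, pnorm r (tnth eta i) <= s) ->
  (forall i, pnorm r (tnth xi i - tnth eta i) <= d) -> 0 <= d ->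
  pnorm r (comp_mpoly xi P - comp_mpoly eta P) <= pnorm s' P * d / (s' - s).
Proof.
move=> r0 s0 ss xs es xe d0; have ds : 0 < s' - s by rewrite subr_gt0.
rewrite !comp_mpolyEX -sumrB (le_trans (pnorm_sum r0 _ _)) //.
rewrite [X in _ <= X * _ / _]/pnorm 2!mulr_suml; apply: ler_sum => m _.
rewrite -scalerBr pnormZ // -!mulrA ler_wpM2l // mulrA ler_pdivlMr //.
rewrite !comp_mpolyX.
have [_ _ H] : mono_close r s d (\prod_(i < n) tnth xi i ^+ m i)
    (\prod_(i < n) tnth eta i ^+ m i) (mdeg m).
  rewrite mdegE; elim/big_rec3: _ => [|i a f g _ ih]; first exact: mono_close1.
  apply: mono_closeM => //; apply: mono_closeXn => //.
  by split; rewrite ?expr1 // expr0 mulr1.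
apply: (@le_trans _ _ (d *+ mdeg m * s ^+ (mdeg m).-1 * (s' - s))).
  by rewrite ler_wpM2r // ltW.
have := @subrXX_bound s' s d (mdeg m) s0 ss.
by rewrite ger0_norm // [leRHS]mulrC.
Qed.

Lemma pnorm_eval_lipschitz n (s s' d : R) (P : mpoly n R) (x y : 'I_n -> R) :
  0 <= s -> s < s' -> (forall i, `|x i| <= s) -> (forall i, `|y i| <= s) ->
  (forall i, `|x i - y i| <= d) -> 0 <= d ->
  `|meval x P - meval y P| <= pnorm s' P * d / (s' - s).
Proof.
move=> s0 ss xs ys xy d0.
(* Points are tuples of polynomials in no variables, for which the norm is the absolute value and
   composition is evaluation. *)
pose c (z : 'I_n -> R) := [tuple mpolyC 0 (z i) | i < n].
have e z : comp_mpoly (c z) P = mpolyC 0 (meval z P).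
  rewrite /comp_mpoly /mmap mevalE raddf_sum /=; apply: eq_bigr => m _.
  rewrite mpolyCM rmorph_prod /mmap1; congr (_ * _); apply: eq_bigr => i _.
  by rewrite tnth_mktuple rmorphXn.
have := @pnorm_lipschitz n 0 0 s s' d P (c x) (c y) (lexx _) s0 ss.
rewrite !e -mpolyCB pnormC; apply => // i; rewrite !tnth_mktuple -?mpolyCB pnormC //.
Qed.

(** Every monomial but the constant one gains at least one factor s / r. *)
Lemma pnorm_shrink n (r s : R) (P : mpoly n R) : 0 < r -> 0 <= s -> s <= r ->
  mcoeff (@mnm0 n) P = 0 -> pnorm s P <= s / r * pnorm r P.
Proof.
move=> r0 s0 sr P0; rewrite mulr_sumr; apply: ler_sum => m _.
case: (eqVneq m (@mnm0 n)) => [->|].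
  by rewrite P0 normr0 !mul0r mulr0.
rewrite -mdeg_eq0 mulrCA => m0; rewrite ler_wpM2l //.
case: (mdeg m) m0 => // k _.
rewrite !exprS mulrA divfK ?gt_eqF // ler_wpM2l //.
by rewrite lerXn2r ?nnegrE // ltW.
Qed.

End PolynomialNorm.

(** * Functions analytic on a closed polydisc *)

Section AnalyticGerms.
Variable R : realType.

Definition box n (r : R) (a x : 'rV[R]_n) : Prop :=
  forall i, `|x 0 i - a 0 i| <= r.

Lemma rv_norm_coord n (x : 'rV[R]_n) i : `|x 0 i| <= `|x|.
Proof.
by rewrite [leRHS]/Num.Def.normr /= mx_normrE; apply/bigmax_geP; right => /=; exists (0, i).
Qed.

Lemma rv_norm_le n (x : 'rV[R]_n) d : 0 <= d -> (forall i, `|x 0 i| <= d) -> `|x| <= d.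
Proof.
move=> d0 xd; rewrite [leLHS]/Num.Def.normr /= mx_normrE; apply/bigmax_leP; split=> //.
by move=> [i j] _ /=; rewrite ord1.
Qed.

Lemma near_box n (a : 'rV[R]_n) (P : set 'rV[R]_n) :
  (\forall x \near a, P x) <-> exists2 r, 0 < r & forall x, box r a x -> P x.
Proof.
split=> [/nbhs_ballP[e /= e0 eP]|[r r0 rP]].
  exists (e / 2); first by rewrite divr_gt0.
  move=> x xa; apply: eP; rewrite mx_norm_ball /ball_ /=.
  apply: (@le_lt_trans _ _ (e / 2)); last by rewrite ltr_pdivrMr // ltr_pMr // ltr1n.
  apply: rv_norm_le => [|i]; first by rewrite divr_ge0 ?ltW.
  by rewrite !mxE distrC; apply: xa.
apply/nbhs_ballP; exists r => //= x; rewrite mx_norm_ball /ball_ /= => xa.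
apply: rP => i; rewrite distrC; apply: le_trans (ltW xa).
by have := rv_norm_coord (a - x) i; rewrite !mxE.
Qed.

Lemma box_refl n r (a : 'rV[R]_n) : 0 <= r -> box r a a.
Proof. by move=> r0 i; rewrite subrr normr0. Qed.

Lemma box_le n r s (a x : 'rV[R]_n) : r <= s -> box r a x -> box s a x.
Proof. by move=> rs xa i; apply: le_trans rs. Qed.

Lemma box_trans n r s (a b x : 'rV[R]_n) : box r a b -> box s b x -> box (r + s) a x.
Proof.
move=> ab bx i; have -> : x 0 i - a 0 i = (b 0 i - a 0 i) + (x 0 i - b 0 i) by lra.
by rewrite (le_trans (ler_normD _ _)) // lerD.
Qed.

Definition disp n (a x : 'rV[R]_n) : 'I_n -> R := fun i => x 0 i - a 0 i.

Definition pcauchy n (r : R) (Ps : nat -> mpoly n R) :=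
  forall e, 0 < e -> exists N, forall i j, (N <= i)%N -> (N <= j)%N ->
    pnorm r (Ps i - Ps j) <= e.

(* g is, on the closed polydisc of radius r around a, the sum of a power
   series whose coefficients c satisfy sum |c_m| r^|m| <= M; the series is
   replaced by any sequence of polynomials converging in this norm *)
Definition adisc n (r M : R) (a : 'rV[R]_n) (g : 'rV[R]_n -> R) :=
  exists Ps : nat -> mpoly n R,
    [/\ forall k, pnorm r (Ps k) <= M, pcauchy r Ps &
        forall x, box r a x -> (fun k => meval (disp a x) (Ps k)) @ \oo --> g x].

Lemma adisc_ext n r M a (f g : 'rV[R]_n -> R) :
  (forall x, box r a x -> f x = g x) -> adisc r M a f -> adisc r M a g.
Proof. by move=> fg [Ps [h1 h2 h3]]; exists Ps; split=> // x xa; rewrite -fg //; apply: h3. Qed.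

Lemma adisc_bound n r M a (g : 'rV[R]_n -> R) x : 0 <= r ->
  adisc r M a g -> box r a x -> `|g x| <= M.
Proof.
move=> r0 [Ps [PM _ Pg]] xa; apply: (cvgr_to_le (cvg_norm (Pg x xa))); near=> k.
by apply: le_trans (PM k); apply: pnorm_eval.
Unshelve. all: by end_near. Qed.

Lemma adisc_M0 n r M a (g : 'rV[R]_n -> R) : 0 <= r -> adisc r M a g -> 0 <= M.
Proof. by move=> r0 [Ps [PM _ _]]; apply: le_trans (PM 0%N); apply: pnorm_ge0. Qed.

Lemma adisc_le n r s M N a (g : 'rV[R]_n -> R) : 0 <= s -> s <= r -> M <= N ->
  adisc r M a g -> adisc s N a g.
Proof.
move=> s0 sr MN [Ps [PM Pc Pg]]; exists Ps; split.
- by move=> k; apply: le_trans (le_trans (PM k) MN); apply: pnorm_le.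
- move=> e /Pc[K h]; exists K => i j Ki Kj; apply: le_trans (h i j Ki Kj).
  exact: pnorm_le.
- by move=> x xa; apply: Pg; apply: box_le xa.
Qed.

Lemma pcauchy_cst n r (P : mpoly n R) : pcauchy r (fun=> P).
Proof. by move=> e e0; exists 0%N => i j _ _; rewrite subrr pnorm0 ltW. Qed.

Lemma adisc_poly n r a (P : mpoly n R) (g : 'rV[R]_n -> R) :
  (forall x, box r a x -> g x = meval (disp a x) P) -> adisc r (pnorm r P) a g.
Proof.
move=> gP; exists (fun=> P); split=> //; first exact: pcauchy_cst.
by move=> x xa; rewrite gP //; apply: cvg_cst.
Qed.

Lemma adisc_cst n r (a : 'rV[R]_n) c : adisc r `|c| a (fun=> c).
Proof. by rewrite -(@pnormC R n r c); apply: adisc_poly => x _; rewrite mevalC. Qed.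

Lemma adisc_coord n r (a : 'rV[R]_n) i : 0 <= r ->
  adisc r (`|a 0 i| + r) a (fun x => x 0 i).
Proof.
move=> r0; apply: (@adisc_le _ r r (pnorm r (mpolyC n (a 0 i) + polyvar R i))) => //.
  by apply: (le_trans (pnormD r0 _ _)); rewrite pnormC pnorm_var.
by apply: adisc_poly => x _; rewrite mevalD mevalC mevalXU /disp; lra.
Qed.

Lemma pcauchyD n r (P Q : nat -> mpoly n R) : 0 <= r ->
  pcauchy r P -> pcauchy r Q -> pcauchy r (fun k => P k + Q k).
Proof.
move=> r0 cP cQ e e0; have e2 : 0 < e / 2 by rewrite divr_gt0.
have [K1 h1] := cP _ e2; have [K2 h2] := cQ _ e2.
exists (maxn K1 K2) => i j; rewrite !geq_max => /andP[i1 i2] /andP[j1 j2].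
have -> : P i + Q i - (P j + Q j) = (P i - P j) + (Q i - Q j) by rewrite opprD addrACA.
by rewrite (le_trans (pnormD r0 _ _)) // [leRHS]splitr lerD ?h1 ?h2.
Qed.

Lemma adiscD n r M N a (f g : 'rV[R]_n -> R) : 0 <= r ->
  adisc r M a f -> adisc r N a g -> adisc r (M + N) a (fun x => f x + g x).
Proof.
move=> r0 [P [PM cP Pf]] [Q [QN cQ Qg]]; exists (fun k => P k + Q k); split.
- by move=> k; rewrite (le_trans (pnormD r0 _ _)) // lerD.
- exact: pcauchyD.
- move=> x xa; under eq_fun do rewrite mevalD.
  by apply: cvgD; [apply: Pf|apply: Qg].
Qed.

Lemma pcauchyM n r M N (P Q : nat -> mpoly n R) : 0 <= r ->
  (forall k, pnorm r (P k) <= M) -> (forall k, pnorm r (Q k) <= N) ->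
  pcauchy r P -> pcauchy r Q -> pcauchy r (fun k => P k * Q k).
Proof.
move=> r0 PM QN cP cQ e e0.
have M0 : 0 <= M by apply: le_trans (PM 0%N); apply: pnorm_ge0.
have N0 : 0 <= N by apply: le_trans (QN 0%N); apply: pnorm_ge0.
have e2 : 0 < e / (M + N + 1) by rewrite divr_gt0 //; lra.
have [K1 h1] := cP _ e2; have [K2 h2] := cQ _ e2.
exists (maxn K1 K2) => i j; rewrite !geq_max => /andP[i1 i2] /andP[j1 j2].
have -> : P i * Q i - P j * Q j = (P i - P j) * Q i + P j * (Q i - Q j).
  by rewrite mulrBl mulrBr addrA subrK.
apply: (le_trans (pnormD r0 _ _)).
apply: (@le_trans _ _ (e / (M + N + 1) * N + M * (e / (M + N + 1)))).
  by apply: lerD; (apply: (le_trans (pnormM r0 _ _)); apply: ler_pM; rewrite ?pnorm_ge0 ?h1 ?h2).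
rewrite (mulrC M) -mulrDr mulrAC ler_pdivrMr; last by lra.
by rewrite ler_wpM2l; lra.
Qed.

Lemma adiscM n r M N a (f g : 'rV[R]_n -> R) : 0 <= r ->
  adisc r M a f -> adisc r N a g -> adisc r (M * N) a (fun x => f x * g x).
Proof.
move=> r0 [P [PM cP Pf]] [Q [QN cQ Qg]]; exists (fun k => P k * Q k); split.
- by move=> k; rewrite (le_trans (pnormM r0 _ _)) // ler_pM ?pnorm_ge0.
- exact: pcauchyM cP cQ.
- move=> x xa; under eq_fun do rewrite mevalM.
  by apply: cvgM; [apply: Pf|apply: Qg].
Qed.

Lemma adiscN n r M a (f : 'rV[R]_n -> R) : 0 <= r ->
  adisc r M a f -> adisc r M a (fun x => - f x).
Proof.
move=> r0 af; apply: (@adisc_ext _ _ _ _ (fun x => -1 * f x)); first by move=> *; rewrite mulN1r.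
rewrite -[M]mul1r -[X in X * M](@normrN1 R).
by apply: adiscM => //; apply: adisc_cst.
Qed.

Lemma adisc_sum n r a (I : Type) (s : seq I) (M : I -> R) (f : I -> 'rV[R]_n -> R) :
  0 <= r -> (forall i, adisc r (M i) a (f i)) ->
  adisc r (\sum_(i <- s) M i) a (fun x => \sum_(i <- s) f i x).
Proof.
move=> r0 af; elim: s => [|i s ih].
  rewrite big_nil; apply: (@adisc_ext _ _ _ _ (fun=> 0)); first by move=> *; rewrite big_nil.
  by rewrite -[X in adisc _ X](@normr0 _ R); apply: adisc_cst.
rewrite big_cons; apply: (@adisc_ext _ _ _ _ (fun x => f i x + \sum_(i <- s) f i x)).
  by move=> *; rewrite big_cons.
exact: adiscD.
Qed.

(** The outer polynomials and the points of evaluation vary together; the values converge because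
    the outer polynomials are uniformly Lipschitz on the smaller cube. *)
Lemma comp_meval_cvg n k s M N (a x : 'rV[R]_k) (b y : 'rV[R]_n)
    (P : nat -> mpoly n R) (X : 'I_n -> nat -> mpoly k R) (gy : R) :
  0 <= s -> s < N -> (forall k, pnorm N (P k) <= M) ->
  (fun k => meval (disp b y) (P k)) @ \oo --> gy ->
  (forall i j, `|meval (disp a x) (X i j)| <= s) ->
  (forall i, `|y 0 i - b 0 i| <= s) ->
  (forall i, (fun j => meval (disp a x) (X i j)) @ \oo --> y 0 i - b 0 i) ->
  (fun j => meval (disp a x) (comp_mpoly [tuple X i j | i < n] (P j))) @ \oo --> gy.
Proof.
move=> s0 sN PM Pg XM ys Xl.
have M0 : 0 <= M by apply: le_trans (PM 0%N); apply: pnorm_ge0; rewrite (le_trans s0) ?ltW.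
under eq_fun do rewrite comp_mpoly_meval.
apply/cvgrPdist_le => e e0.
have e2 : 0 < e / 2 by rewrite divr_gt0.
(* [P j] has Lipschitz constant at most M / (N - s) on the cube of radius s, so a move of d changes
   its value by at most e / 2; the added 1 guards against M = 0. *)
pose d := e / 2 * (N - s) / (M + 1).
have d0 : 0 < d by rewrite /d !mulr_gt0 ?invr_gt0; lra.
have /cvgrPdist_le/(_ _ e2) := Pg.
have : \forall j \near \oo, forall i, `|y 0 i - b 0 i - meval (disp a x) (X i j)| <= d.
  apply: filter_forall => i; have /cvgrPdist_le := Xl i; exact.
move=> H1 H2; near=> j.
have H3 i : `|y 0 i - b 0 i - meval (disp a x) (X i j)| <= d.
  by move: i; near: j; exact: H1.
rewrite [leRHS]splitr.
have -> : gy - meval (fun i => meval (disp a x) (tnth [tuple X i j | i < n] i)) (P j) =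
  (gy - meval (disp b y) (P j)) + (meval (disp b y) (P j) -
    meval (fun i => meval (disp a x) (tnth [tuple X i j | i < n] i)) (P j)) by lra.
apply: (le_trans (ler_normD _ _)); apply: lerD; first by near: j; exact: H2.
have := @pnorm_eval_lipschitz R n s N d (P j) (disp b y)
  (fun i => meval (disp a x) (tnth [tuple X i j | i < n] i)) s0 sN.
move=> /(_ _ _ _ (ltW d0)) H; apply: le_trans (H _ _ _) _.
+ by move=> i; apply: ys.
+ by move=> i; rewrite tnth_mktuple; apply: XM.
+ by move=> i; rewrite tnth_mktuple; apply: H3.
rewrite ler_pdivrMr; last by lra.
apply: (@le_trans _ _ (M * d)); first by rewrite ler_wpM2r // ltW.
rewrite /d mulrA ler_pdivrMr; last by lra.
have : 0 <= e / 2 * (N - s) by rewrite mulr_ge0; lra.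
by nra.
Unshelve. all: by end_near. Qed.

(* composition: the inner polydisc has to be mapped, in norm, into the outer one *)
Lemma adisc_comp n k r s M N (a : 'rV[R]_k) (b : 'rV[R]_n)
    (g : 'rV[R]_n -> R) (th : 'rV[R]_k -> 'rV[R]_n) :
  0 <= r -> 0 <= s -> s < N -> adisc N M b g ->
  (forall i, adisc r s a (fun x => th x 0 i - b 0 i)) ->
  adisc r M a (fun x => g (th x)).
Proof.
move=> r0 s0 sN [P [PM cP Pg]] ath.
have N0 : 0 <= N by rewrite (le_trans s0) ?ltW.
have M0 : 0 <= M by apply: le_trans (PM 0%N); apply: pnorm_ge0.
pose X i := sval (cid (ath i)).
have XM i j : pnorm r (X i j) <= s by rewrite /X; case: cid => ? /= [].
have Xc i : pcauchy r (X i) by rewrite /X; case: cid => ? /= [].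
have Xl i x : box r a x -> (fun j => meval (disp a x) (X i j)) @ \oo --> th x 0 i - b 0 i.
  by rewrite /X; case: cid => ? /= [_ _]; apply.
pose xi j := [tuple X i j | i < n].
exists (fun j => comp_mpoly (xi j) (P j)); split.
- move=> j; apply: le_trans (PM j); apply: pnorm_comp => // i.
  by rewrite tnth_mktuple (le_trans (XM _ _)) ?ltW.
- move=> e e0; have e2 : 0 < e / 2 by rewrite divr_gt0.
  have [K1 h1] := cP _ e2.
  pose d := e / 2 * (N - s) / (M + 1).
  have d0 : 0 < d by rewrite /d !mulr_gt0 ?invr_gt0; lra.
  have [K2 h2] : exists K, forall i p q, (K <= p)%N -> (K <= q)%N ->
      pnorm r (X i p - X i q) <= d.
    pose K i := sval (cid (Xc i _ d0)).
    exists (\max_i K i)%N => i p q Kp Kq.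
    rewrite /K in Kp Kq.
    have := leq_bigmax i (F := K); rewrite /K; case: cid => k0 /= hk Ki.
    by apply: hk; [apply: leq_trans Kp|apply: leq_trans Kq].
  exists (maxn K1 K2) => p q; rewrite !geq_max => /andP[p1 p2] /andP[q1 q2].
  have -> : comp_mpoly (xi p) (P p) - comp_mpoly (xi q) (P q) =
      comp_mpoly (xi p) (P p - P q) + (comp_mpoly (xi p) (P q) - comp_mpoly (xi q) (P q)).
    by rewrite comp_mpolyB addrA subrK.
  apply: (le_trans (pnormD r0 _ _)); rewrite [leRHS]splitr; apply: lerD.
    apply: le_trans (h1 p q p1 q1); apply: pnorm_comp => // i.
    by rewrite tnth_mktuple (le_trans (XM _ _)) ?ltW.
  have := @pnorm_lipschitz R n k r s N d (P q) (xi p) (xi q) r0 s0 sN.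
  move=> /(_ _ _ _ (ltW d0)) H; apply: le_trans (H _ _ _) _.
  + by move=> i; rewrite tnth_mktuple.
  + by move=> i; rewrite tnth_mktuple.
  + by move=> i; rewrite !tnth_mktuple h2.
  rewrite ler_pdivrMr; last by lra.
  apply: (@le_trans _ _ (M * d)); first by rewrite ler_wpM2r // ltW.
  rewrite /d mulrA ler_pdivrMr; last by lra.
  have : 0 <= e / 2 * (N - s) by rewrite mulr_ge0; lra.
  by nra.
- move=> x xa.
  have thb : box N b (th x).
    move=> i; apply: (@le_trans _ _ s); last exact: ltW.
    exact: adisc_bound (ath i) xa.
  apply: (comp_meval_cvg s0 sN PM (Pg _ thb)) => i; last exact: Xl.
    by move=> j; apply: le_trans (XM i j); apply: pnorm_eval.
  exact: adisc_bound (ath i) xa.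
Unshelve. all: by end_near. Qed.

End AnalyticGerms.

(** * Differentiation of analytic functions *)

Section AnalyticDerivative.
Variable R : realType.

Definition pd n (i : 'I_n) (g : 'rV[R]_n -> R) : 'rV[R]_n -> R :=
  fun x => 'd g x (delta_mx 0 i).

Lemma rv_linear_continuous n (G : 'I_n -> R) :
  continuous (fun v : 'rV[R]_n => \sum_i v 0 i * G i).
Proof.
move=> v; elim: (index_enum _) => [|i s ih].
  rewrite (_ : (fun _ => _) = cst 0); first exact: cst_continuous.
  by apply/funext => w; rewrite big_nil.
rewrite (_ : (fun _ => _) = (fun w : 'rV_n => w 0 i * G i) \+
    (fun w : 'rV_n => \sum_(j <- s) w 0 j * G j)).
  by apply: continuousD => //; apply: continuousM; [apply: coord_continuous|apply: cst_continuous].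
by apply/funext => w; rewrite big_cons.
Qed.

(** The remainder is measured against any d that bounds the coordinates of h, which spares the norm
    of row vectors in later uses. *)
Lemma differentiable_rv n (f : 'rV[R]_n -> R) (x : 'rV[R]_n) (G : 'I_n -> R) :
  (forall e : R, 0 < e -> exists2 dl : R, 0 < dl & forall (h : 'rV[R]_n) (d : R), 0 <= d -> d <= dl ->
    (forall i, `|h 0 i| <= d) ->
    `|f (x + h) - f x - \sum_i h 0 i * G i| <= e * d) ->
  differentiable f x /\ forall v, 'd f x v = \sum_i v 0 i * G i.
Proof.
move=> H.
pose L (v : 'rV[R]_n) := \sum_i v 0 i * G i.
have Llin : linear L.
  move=> c u v; rewrite /L scaler_sumr -big_split /=; apply: eq_bigr => i _.
  by rewrite !mxE mulrDl [c *: _]mulrA.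
pose LM := GRing.isLinear.Build _ _ _ _ _ Llin.
pose Lf : {linear 'rV[R]_n -> R} := HB.pack L LM.
have Lc : continuous Lf by apply: rv_linear_continuous.
have Ee (e : R) : 0 < e -> \forall h \near (0 : 'rV[R]_n),
    `|(f \o shift x - (cst (f x) + L)) h| <= e * `|id h|.
  move=> e0; have [dl dl0 Hd] := H e e0.
  apply/near_box; exists dl => // h hd /=.
  have -> : (f \o shift x - (cst (f x) + L)) h = f (x + h) - f x - L h.
    rewrite [x + h]addrC -[in RHS]addrA -opprD; by [].
  apply: Hd; [exact: normr_ge0| |exact: rv_norm_coord].
  apply: rv_norm_le => [|i]; first exact: ltW.
  by have := hd i; rewrite mxE subr0.
have D : 'd f x = Lf :> ('rV[R]_n -> R).
  by apply: diff_unique => //; apply/eqaddoP.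
split; last by move=> v; rewrite D.
by apply/diff_locallyP; split; rewrite D //; apply/eqaddoP.
Qed.

Lemma diff_pdE n (f : 'rV[R]_n -> R) x v :
  'd f x v = \sum_i v 0 i * pd i f x.
Proof.
rewrite {1}[v]row_sum_delta linear_sum; apply: eq_bigr => i _.
by rewrite linearZ.
Qed.

Lemma diffDE n (f g : 'rV[R]_n -> R) (x v : 'rV[R]_n) :
  differentiable f x -> differentiable g x ->
  'd (fun y => f y + g y) x v = 'd f x v + 'd g x v.
Proof. by move=> df dg; have /(congr1 (@^~ v)) := diffD df dg. Qed.

Lemma diffME n (f g : 'rV[R]_n -> R) (x v : 'rV[R]_n) :
  differentiable f x -> differentiable g x ->
  'd (fun y => f y * g y) x v = f x * 'd g x v + g x * 'd f x v.
Proof. by move=> df dg; have /(congr1 (@^~ v)) := diffM df dg. Qed.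

Lemma diff_leibniz n (f g : 'rV[R]_n -> R) (x v : 'rV[R]_n) :
  differentiable f x -> differentiable g x ->
  'd (fun y => f y * g y) x v = 'd f x v * g x + f x * 'd g x v.
Proof.
move=> df dg.
have E : 'd (fun y => f y * g y) x v = f x * 'd g x v + g x * 'd f x v by apply: diffME.
apply: (eq_trans E).
have -> : g x * 'd f x v = 'd f x v * g x by apply: mulrC.
exact: addrC.
Qed.

(** Induction on ring generators instead of monomials: a statement compatible with sums and products
    is checked on constants and variables. *)
Lemma mpoly_ring_ind n (K : mpoly n R -> Prop) :
  (forall c, K (mpolyC n c)) -> (forall i, K (polyvar R i)) ->
  (forall P Q, K P -> K Q -> K (P + Q)) ->
  (forall P Q, K P -> K Q -> K (P * Q)) -> forall P, K P.
Proof.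
move=> KC KX KD KM; apply: mpolyind => [|c m P _ _ KP].
  by rewrite -mpolyC0.
apply: (KD) => //; rewrite -mul_mpolyC; apply: (KM) => //.
rewrite mpolyXE_id; apply: (big_ind K); [by rewrite -mpolyC1|exact: KM|].
move=> i _; elim: (m i) => [|k ih]; first by rewrite expr0 -mpolyC1.
by rewrite exprS; apply: KM => //; apply: KX.
Qed.

Lemma poly_differentiable n (P : mpoly n R) (a x : 'rV[R]_n) :
  differentiable (fun x : 'rV[R]_n => meval (disp a x) P) x /\
  forall v, 'd (fun x : 'rV[R]_n => meval (disp a x) P) x v =
    \sum_i v 0 i * meval (disp a x) (mderiv i P).
Proof.
elim/mpoly_ring_ind: P => [c|i|P Q [dP eP] [dQ eQ]|P Q [dP eP] [dQ eQ]].
- apply: differentiable_rv => e e0; exists 1 => // h d d0 _ hd.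
  rewrite !mevalC subrr sub0r normrN big1 ?normr0; first by rewrite mulr_ge0 // ltW.
  by move=> i _; rewrite mderivC meval0 mulr0.
- apply: differentiable_rv => e e0; exists 1 => // h d d0 _ hd.
  rewrite !mevalXU /disp !mxE (bigD1 i) //= big1 => [|j ji]; last first.
    rewrite mderivX mnm1E eq_sym (negbTE ji) scale0r meval0 mulr0 //.
  rewrite mderivX mnm1E eqxx scale1r -[X in mnm_sub X _]add0m addmK mpolyX0 meval1.
  have -> : x 0 i + h 0 i - a 0 i - (x 0 i - a 0 i) - (h 0 i * 1 + 0) = 0 by lra.
  by rewrite normr0 mulr_ge0 // ltW.
- have -> : (fun x : 'rV[R]_n => meval (disp a x) (P + Q)) =
      (fun x => meval (disp a x) P + meval (disp a x) Q).
    by apply/funext => y /=; rewrite mevalD.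
  split=> [|v]; first exact: differentiableD.
  rewrite diffDE // eP eQ -big_split /=; apply: eq_bigr => i _.
  by rewrite mderivD mevalD mulrDr.
- have -> : (fun x : 'rV[R]_n => meval (disp a x) (P * Q)) =
      (fun x => meval (disp a x) P * meval (disp a x) Q).
    by apply/funext => y /=; rewrite mevalM.
  split=> [|v]; first exact: differentiableM.
  rewrite diffME // eP eQ !mulr_sumr -big_split /=; apply: eq_bigr => i _.
  by rewrite mderivM mevalD !mevalM; lra.
Qed.

Lemma pcauchy_cvg n r (Ps : nat -> mpoly n R) (y : 'I_n -> R) : 0 <= r ->
  pcauchy r Ps -> (forall i, `|y i| <= r) -> cvgn (fun k => meval y (Ps k)).
Proof.
move=> r0 cP yr; apply: cauchy_cvg; apply/cauchy_exP => e e0.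
have e2 : 0 < e / 2 by rewrite divr_gt0.
have [K h] := cP _ e2; exists (meval y (Ps K)).
exists K => //= k Kk; rewrite -ball_normE /= -mevalB.
apply: le_lt_trans (_ : e / 2 < e); last by rewrite ltr_pdivrMr // ltr_pMr // ltr1n.
by apply: le_trans (h K k _ _) => //; apply: pnorm_eval.
Qed.

Lemma pcauchy_deriv n r s (Ps : nat -> mpoly n R) i : 0 <= s -> s < r ->
  pcauchy r Ps -> pcauchy s (fun k => mderiv i (Ps k)).
Proof.
move=> s0 sr cP e e0; have rs : 0 < r - s by lra.
have [K h] := cP (e * (r - s)) (mulr_gt0 e0 rs); exists K => p q Kp Kq.
rewrite -mderivB -(ler_pM2r rs); apply: le_trans (h p q Kp Kq).
exact: pnorm_deriv.
Qed.

(** The error left by the k-th polynomial is Lipschitz with constant e / (r - s), being a limit of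
    polynomials of norm at most e. This is what permits differentiating the limit. *)
Lemma limit_lipschitz n (r s : R) (e d : R) (Ps : nat -> mpoly n R) k (x y : 'I_n -> R) fx fy :
  0 <= s -> s < r -> (forall i, `|x i| <= s) -> (forall i, `|y i| <= s) ->
  (forall i, `|x i - y i| <= d) -> 0 <= d ->
  (forall l, (k <= l)%N -> pnorm r (Ps l - Ps k) <= e) ->
  (fun k => meval x (Ps k)) @ \oo --> fx -> (fun k => meval y (Ps k)) @ \oo --> fy ->
  `|(fx - meval x (Ps k)) - (fy - meval y (Ps k))| <= e * d / (r - s).
Proof.
move=> s0 sr xs ys xy d0 Pk Px Py.
have C : (fun l => (meval x (Ps l) - meval x (Ps k)) - (meval y (Ps l) - meval y (Ps k)))
   @ \oo --> (fx - meval x (Ps k)) - (fy - meval y (Ps k)).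
  by apply: cvgB; apply: cvgB => //; apply: cvg_cst.
apply: (cvgr_to_le (cvg_norm C)); exists k => //= l kl.
rewrite -!mevalB.
apply: le_trans (pnorm_eval_lipschitz (s' := r) (s := s) (d := d) _ s0 sr xs ys xy d0) _.
by rewrite ler_wpM2r ?invr_ge0 ?subr_ge0 ?(ltW sr) // ler_wpM2r // Pk.
Qed.

(** The Taylor remainder of g at x is split into three parts of size e / 3: the variation of g minus
    its k-th polynomial ([limit_lipschitz]), the remainder of that polynomial, and the difference of
    the two gradients. *)
Lemma adisc_differentiable n r M s a (g : 'rV[R]_n -> R) Ps x : 0 <= s -> s < r ->
  pcauchy r Ps -> (forall k, pnorm r (Ps k) <= M) ->
  (forall x, box r a x -> (fun k => meval (disp a x) (Ps k)) @ \oo --> g x) ->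
  box s a x ->
  differentiable g x /\ forall i,
    (fun k => meval (disp a x) (mderiv i (Ps k))) @ \oo --> pd i g x.
Proof.
move=> s0 sr cP PM Pg xa.
have r0 : 0 <= r by lra.
pose G i := lim ((fun k => meval (disp a x) (mderiv i (Ps k))) @ \oo).
have GP i : (fun k => meval (disp a x) (mderiv i (Ps k))) @ \oo --> G i.
  by apply: (pcauchy_cvg s0) => //; apply: pcauchy_deriv cP.
have [] := @differentiable_rv n g x G; last first.
  move=> dg E; split=> // i; suff -> : pd i g x = G i by apply: GP.
  rewrite /pd E (bigD1 i) //= big1 ?addr0; last first.
    by move=> j ji; rewrite !mxE eqxx /= (negbTE ji) mul0r.
  by rewrite !mxE !eqxx mul1r.
move=> e e0.
(* The points x + h may leave the cube of radius s, so the estimates are made on a cube of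
   intermediate radius. *)
pose t := (s + r) / 2.
have st : s < t by rewrite /t; lra.
have tr : t < r by rewrite /t; lra.
have t0 : 0 <= t by lra.
have rt : 0 < r - t by lra.
have rs : 0 < r - s by lra.
pose e1 := e / 3 * (r - t).
have e10 : 0 < e1 by rewrite mulr_gt0 // divr_gt0.
pose e2 := e / 3 * (r - s) / n.+1%:R.
have e20 : 0 < e2 by rewrite /e2 !mulr_gt0 ?invr_gt0 ?ltr0Sn //; lra.
have [K1 h1] := cP _ e10; have [K2 h2] := cP _ e20.
pose k := maxn K1 K2.
have [dP dE] := poly_differentiable (Ps k) a x.
have e3 : 0 < e / 3 by rewrite divr_gt0.
have /diff_locally/eqaddoP/(_ _ e3)/near_box[dl dl0 Hd] := dP.
exists (Num.min dl (t - s)); first by rewrite lt_min dl0 subr_gt0.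
move=> h d d0; rewrite le_min => /andP[ddl dts] hd.
have xha : box t a (x + h).
  have -> : t = s + (t - s) by lra.
  apply: box_trans xa _ => i; rewrite !mxE addrAC subrr add0r.
  exact: le_trans (hd i) dts.
have xta : box t a x by apply: box_le xa; lra.
have H1 := @limit_lipschitz n r t e1 d Ps k (disp a (x + h)) (disp a x)
  (g (x + h)) (g x) t0 tr xha xta.
have {}H1 : `|g (x + h) - meval (disp a (x + h)) (Ps k) -
    (g x - meval (disp a x) (Ps k))| <= e / 3 * d.
  have -> : e / 3 * d = e1 * d / (r - t).
    by rewrite /e1 [e / 3 * _ * d]mulrAC mulfK // gt_eqF.
  apply: H1 => //.
  - move=> i; rewrite /disp !mxE.
    by have -> : x 0 i + h 0 i - a 0 i - (x 0 i - a 0 i) = h 0 i by lra.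
  - by move=> l kl; apply: h1; rewrite ?(leq_trans _ kl) // leq_maxl.
  - by apply: Pg; apply: box_le xha; lra.
  - by apply: Pg; apply: box_le xta; lra.
have H2 i : `|G i - meval (disp a x) (mderiv i (Ps k))| <= e / 3 / n.+1%:R.
  have C : (fun l => meval (disp a x) (mderiv i (Ps l)) - meval (disp a x) (mderiv i (Ps k)))
     @ \oo --> G i - meval (disp a x) (mderiv i (Ps k)).
    by apply: cvgB => //; apply: cvg_cst.
  apply: (cvgr_to_le (cvg_norm C)); exists k => //= l kl.
  rewrite -mevalB -mderivB; apply: le_trans (pnorm_eval s0 _ xa) _.
  rewrite -(ler_pM2r rs); apply: le_trans (pnorm_deriv _ _ s0 sr) _.
  apply: le_trans (h2 l k _ _) _; rewrite ?(leq_trans _ kl) ?leq_maxr //.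
  by rewrite /e2 mulrAC.
have H3 : `|meval (disp a (x + h)) (Ps k) - meval (disp a x) (Ps k) -
    \sum_i h 0 i * meval (disp a x) (mderiv i (Ps k))| <= e / 3 * d.
  have hb : box dl 0 h by move=> i; rewrite mxE subr0; apply: le_trans (hd i) ddl.
  have H : `|meval (disp a (h + x)) (Ps k) - (meval (disp a x) (Ps k) +
    'd (fun y : 'rV[R]_n => meval (disp a y) (Ps k)) x h)| <= e / 3 * `|h| := Hd h hb.
  move: H; rewrite dE [h + x]addrC opprD addrA => H; apply: le_trans H _.
  by rewrite ler_wpM2l ?(ltW e3) // rv_norm_le.
have H4 : `|\sum_i h 0 i * meval (disp a x) (mderiv i (Ps k)) - \sum_i h 0 i * G i|
   <= e / 3 * d.
  rewrite -sumrB (le_trans (ler_norm_sum _ _ _)) //.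
  apply: (@le_trans _ _ (\sum_(i < n) d * (e / 3 / n.+1%:R))).
    apply: ler_sum => i _; rewrite -mulrBr normrM distrC.
    by apply: ler_pM.
  rewrite sumr_const card_ord -[leLHS]mulr_natr [leRHS]mulrC -mulrA ler_wpM2l //.
  rewrite -mulrA ler_piMr ?(ltW e3) // mulrC ler_pdivrMr ?ltr0Sn // mul1r ler_nat.
  exact: leqnSn.
have -> : g (x + h) - g x - \sum_i h 0 i * G i =
  (g (x + h) - meval (disp a (x + h)) (Ps k) - (g x - meval (disp a x) (Ps k))) +
  (meval (disp a (x + h)) (Ps k) - meval (disp a x) (Ps k) -
    \sum_i h 0 i * meval (disp a x) (mderiv i (Ps k))) +
  (\sum_i h 0 i * meval (disp a x) (mderiv i (Ps k)) - \sum_i h 0 i * G i) by lra.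
apply: (le_trans (ler_normD _ _)); apply: (@le_trans _ _ (e / 3 * d + e / 3 * d + e / 3 * d)).
  apply: lerD => //; apply: (le_trans (ler_normD _ _)); exact: lerD.
lra.
Qed.

Lemma adisc_diff n r M s a (g : 'rV[R]_n -> R) x : 0 <= s -> s < r ->
  adisc r M a g -> box s a x -> differentiable g x.
Proof.
by move=> s0 sr [Ps [PM cP Pg]] xa; have [] := adisc_differentiable s0 sr cP PM Pg xa.
Qed.

Lemma adisc_pd n r M s a (g : 'rV[R]_n -> R) i : 0 <= s -> s < r ->
  adisc r M a g -> adisc s (M / (r - s)) a (pd i g).
Proof.
move=> s0 sr [Ps [PM cP Pg]]; exists (fun k => mderiv i (Ps k)); split.
- move=> k; rewrite ler_pdivlMr ?subr_gt0 //.
  by apply: le_trans (PM k); apply: pnorm_deriv.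
- exact: pcauchy_deriv cP.
- by move=> x xa; have [_] := adisc_differentiable s0 sr cP PM Pg xa; apply.
Qed.

Lemma pd_comm n r M a (g : 'rV[R]_n -> R) i j x s : 0 <= s -> s < r ->
  adisc r M a g -> box s a x -> pd i (pd j g) x = pd j (pd i g) x.
Proof.
move=> s0 sr [Ps [PM cP Pg]] xa.
pose t := (s + r) / 2.
have st : s < t by rewrite /t; lra.
have tr : t < r by rewrite /t; lra.
have t0 : 0 <= t by lra.
have H k l : (fun p => meval (disp a x) (mderiv k (mderiv l (Ps p)))) @ \oo -->
    pd k (pd l g) x.
  have := @adisc_differentiable n t (M / (r - t)) s a (pd l g) (fun p => mderiv l (Ps p)) x s0 st.
  case=> //.
  - exact: pcauchy_deriv cP.
  - move=> p; rewrite ler_pdivlMr ?subr_gt0 //.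
    by apply: le_trans (PM p); apply: pnorm_deriv.
  - by move=> y ya; have [_] := adisc_differentiable t0 tr cP PM Pg ya; apply.
apply: cvg_unique (H i j) _ => //.
rewrite (_ : (fun _ => _) = (fun p => meval (disp a x) (mderiv j (mderiv i (Ps p))))); first exact: H.
by apply/funext => p; rewrite mderiv_comm.
Qed.

(** Translating the variables by b - a, at most s in each coordinate, sends radius r - s into radius
    r. *)
Lemma adisc_recenter n r M s (a b : 'rV[R]_n) (g : 'rV[R]_n -> R) : 0 <= s -> s <= r ->
  adisc r M a g -> box s a b -> adisc (r - s) M b g.
Proof.
move=> s0 sr [Ps [PM cP Pg]] ab.
have rs : 0 <= r - s by lra.
pose xi := [tuple polyvar R i + mpolyC n (b 0 i - a 0 i) | i < n].
have xiN i : pnorm (r - s) (tnth xi i) <= r.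
  rewrite tnth_mktuple (le_trans (pnormD _ _ _)) // pnorm_var // pnormC.
  by have := ab i; lra.
have xiE x : (fun i => meval (disp b x) (tnth xi i)) = disp a x.
  by apply/funext => i; rewrite tnth_mktuple mevalD mevalXU mevalC /disp; lra.
exists (fun k => comp_mpoly xi (Ps k)); split.
- by move=> k; apply: le_trans (PM k); apply: pnorm_comp => //; lra.
- move=> e /cP[K h]; exists K => p q Kp Kq; rewrite -comp_mpolyB.
  by apply: le_trans (h p q Kp Kq); apply: pnorm_comp => //; lra.
- move=> x xb; under eq_fun do rewrite comp_mpoly_meval xiE.
  by apply: Pg; have -> : r = s + (r - s) by [lra]; apply: box_trans ab xb.
Qed.

End AnalyticDerivative.

(** * Equivalence with absolutely convergent power series *)

Section PowerSeriesBridge.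
Variable R : realType.
Variable n : nat.

(** The summation range of [psum], listed as monomials so that its partial sums become
    polynomials. *)
Definition mnm_box (N : nat) : seq (multinom n) :=
  [seq Multinom [tuple nat_of_ord (nu i) | i < n] | nu : {ffun 'I_n -> 'I_N}].

Lemma mem_mnm_box N (m : multinom n) : (m \in mnm_box N) = [forall i, (m i < N)%N].
Proof.
apply/mapP/forallP => [[nu _ ->] i|H].
  by rewrite multinomE tnth_mktuple.
exists [ffun i => Ordinal (H i)]; first by rewrite mem_enum.
by apply/mnmP => i; rewrite multinomE tnth_mktuple ffunE.
Qed.

Lemma mnm_box_uniq N : uniq (mnm_box N).
Proof.
rewrite map_inj_uniq ?enum_uniq // => f g /mnmP H; apply/ffunP => i.
by apply: val_inj; have := H i; rewrite !multinomE !tnth_mktuple.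
Qed.

Lemma mnm_box_sub N1 N2 : (N1 <= N2)%N -> {subset mnm_box N1 <= mnm_box N2}.
Proof.
move=> N12 m; rewrite !mem_mnm_box => /forallP H; apply/forallP => i.
exact: leq_trans (H i) N12.
Qed.

Lemma big_mnm_box N (F : ('I_n -> nat) -> R) :
  \sum_(nu : {ffun 'I_n -> 'I_N}) F (fun i => nat_of_ord (nu i)) =
  \sum_(m <- mnm_box N) F (fun i => m i).
Proof.
rewrite big_image /=; apply: eq_bigr => nu _; congr F.
by apply/funext => i; rewrite multinomE tnth_mktuple.
Qed.

Lemma sum_mnm_box_sub N1 N2 (V : zmodType) (F : multinom n -> V) : (N1 <= N2)%N ->
  \sum_(m <- mnm_box N2) F m - \sum_(m <- mnm_box N1) F m =
  \sum_(m <- mnm_box N2 | m \notin mnm_box N1) F m.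
Proof.
move=> N12; rewrite (bigID (fun m => m \in mnm_box N1)) /= -[X in X + _ - _]big_filter.
rewrite (perm_big (mnm_box N1)); first by rewrite addrAC subrr add0r.
apply: uniq_perm; rewrite ?filter_uniq ?mnm_box_uniq // => m.
rewrite mem_filter; case: (boolP (m \in mnm_box N1)) => //= h.
exact: mnm_box_sub h.
Qed.

Lemma psum_mnm (c : ('I_n -> nat) -> R) (y : 'rV[R]_n) N :
  psum c y N = \sum_(m <- mnm_box N) c (fun i => m i) * \prod_(i < n) y 0 i ^+ m i.
Proof.
exact: (@big_mnm_box N (fun f => c f * \prod_(i < n) y 0 i ^+ f i)).
Qed.

Lemma prod_exp_const (r : R) (m : multinom n) : \prod_(i < n) r ^+ m i = r ^+ mdeg m.
Proof. by rewrite mdegE prodrXr. Qed.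

Definition box_poly (c : multinom n -> R) N : mpoly n R :=
  \sum_(m <- mnm_box N) c m *: mpolyX R m.

Lemma meval_box_poly c N (y : 'I_n -> R) :
  meval y (box_poly c N) = \sum_(m <- mnm_box N) c m * \prod_(i < n) y i ^+ m i.
Proof. by rewrite raddf_sum; apply: eq_bigr => m _; rewrite /= mevalZ mevalX. Qed.

Lemma mcoeff_box_poly c N m :
  mcoeff m (box_poly c N) = if m \in mnm_box N then c m else 0.
Proof.
rewrite /box_poly raddf_sum /=; under eq_bigr do rewrite mcoeffZ mcoeffX.
case: ifP => mN.
  rewrite (bigD1_seq m) ?mnm_box_uniq //= eqxx mulr1 big1 ?addr0 // => k km.
  by rewrite (negbTE km) mulr0.
rewrite big_seq big1 // => k kN; case: eqP => [e|]; last by rewrite mulr0.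
by rewrite -e kN in mN.
Qed.

Lemma poly_in_box (P : mpoly n R) : exists N, {subset msupp P <= mnm_box N}.
Proof.
exists (msize P) => m /msize_mdeg_lt mP; rewrite mem_mnm_box; apply/forallP => i.
by apply: leq_ltn_trans mP; rewrite mdegE (bigD1 i) //= leq_addr.
Qed.

Lemma analytic_on_adisc (S : set 'rV[R]_n) (g : 'rV[R]_n -> R) a :
  S a -> analytic_on S g ->
  exists r M G, [/\ 0 < r, adisc r M a G & forall x, S x -> box r a x -> g x = G x].
Proof.
move=> Sa /(_ a Sa)[c /near_box[r r0 H]].
(* Absolute convergence at this corner of the cube is the summability of |c_m| r^|m|, hence a norm
   bound valid on the whole cube. *)
have x0 : box r a (\row_i (a 0 i + r)).
  by move=> i; rewrite mxE addrAC subrr add0r gtr0_norm.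
have [cc _] := H _ x0.
pose Q N := \sum_(m <- mnm_box N) `|c (fun i => m i)| * r ^+ mdeg m.
have QE N : psum (fun nu => `|c nu|) (map_mx Num.norm (\row_i (a 0 i + r) - a)) N = Q N.
  rewrite psum_mnm; apply: eq_bigr => m _; rewrite -prod_exp_const; congr (_ * _).
  by apply: eq_bigr => i _; rewrite !mxE addrAC subrr add0r gtr0_norm.
have {}cc : cvgn Q by rewrite (_ : Q = psum (fun nu => `|c nu|)
  (map_mx Num.norm (\row_i (a 0 i + r) - a))) //; apply/funext => N; rewrite QE.
have Qnd : nondecreasing_seq Q.
  apply/nondecreasing_seqP => N; rewrite -subr_ge0 sum_mnm_box_sub //.
  by apply: sumr_ge0 => m _; rewrite mulr_ge0 // exprn_ge0 // ltW.
have QM N : Q N <= lim (Q @ \oo) by apply: nondecreasing_cvgn_le.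
pose c' (m : multinom n) := c (fun i => m i).
pose P := box_poly c'.
have PB i j : (i <= j)%N -> pnorm r (P j - P i) = Q j - Q i.
  move=> ij; rewrite [RHS](sum_mnm_box_sub _ ij).
  rewrite (@pnormE _ _ _ _ (mnm_box j)) ?mnm_box_uniq //.
    rewrite [RHS]big_mkcond /= big_seq [RHS]big_seq; apply: eq_bigr => m mj.
    rewrite mcoeffB !mcoeff_box_poly mj; case: ifP => //= _; last by rewrite subr0.
    by rewrite subrr normr0 mul0r.
  move=> m; apply: contraLR => mj; rewrite -mcoeff_eq0 mcoeffB !mcoeff_box_poly.
  rewrite (negbTE mj) ifF ?subrr //; apply: contraNF mj; exact: mnm_box_sub.
have cP : pcauchy r P.
  move=> e e0; have /cauchy_cvgP/cauchy_ballP/(_ _ e0)[[A B] /= [A1 B1] AB] := cc.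
  have [N1 _ h1] := A1; have [N2 _ h2] := B1.
  exists (maxn N1 N2) => i j; rewrite !geq_max => /andP[i1 i2] /andP[j1 j2].
  have Aij : `|Q i - Q j| < e by apply: (AB (Q i, Q j)); split; [apply: h1|apply: h2].
  case/orP: (leq_total i j) => ij; last by rewrite PB // (le_trans (ler_norm _)) // ltW.
  by rewrite -pnormN opprB PB // (le_trans (ler_norm _)) // distrC ltW.
have ev x N : meval (disp a x) (P N) = psum c (x - a) N.
  rewrite meval_box_poly psum_mnm; apply: eq_bigr => m _; congr (_ * _).
  by apply: eq_bigr => i _; rewrite !mxE.
exists r, (lim (Q @ \oo)), (fun x => lim ((fun k => meval (disp a x) (P k)) @ \oo)); split=> //.
  exists P; split=> //.
    move=> k; have <- : pnorm r (P k - P 0%N + P 0%N) = pnorm r (P k) by rewrite subrK.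
    apply: le_trans (QM k); rewrite (le_trans (pnormD _ _ _)) ?(ltW r0) // PB //.
    have /eqP : pnorm r (P 0%N) <= Q 0%N.
      apply: le_trans (pnorm_sum (ltW r0) _ _) _; apply: ler_sum => m _.
      by rewrite pnormZX.
    by move/eqP => ?; lra.
  by move=> x xa; apply: (pcauchy_cvg (ltW r0) cP).
move=> x Sx xa; have [_ /(_ Sx) h] := H x xa.
by apply/esym/cvg_lim => //; under eq_fun do rewrite ev.
Qed.

(** The polynomials approximating G are not the partial sums of a series. Their coefficients
    converge, each being controlled by the norm, and the limits are the coefficients sought. *)
Lemma adisc_psum r M (a : 'rV[R]_n) (G : 'rV[R]_n -> R) : 0 < r -> adisc r M a G ->
  exists c : ('I_n -> nat) -> R, forall x, box r a x ->
    cvgn (psum (fun nu => `|c nu|) (map_mx Num.norm (x - a))) /\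
    psum c (x - a) @ \oo --> G x.
Proof.
move=> r0 [P [PM cP PG]].
have coefc m : cvgn (fun k => mcoeff m (P k)).
  apply: cauchy_cvg; apply/cauchy_exP => e e0.
  have rm : 0 < r ^+ mdeg m by rewrite exprn_gt0.
  have [K h] := cP (e / 2 * r ^+ mdeg m) (mulr_gt0 (divr_gt0 e0 (ltr0Sn _ _)) rm).
  exists (mcoeff m (P K)); exists K => //= k Kk; rewrite -ball_normE /=.
  apply: (@le_lt_trans _ _ (e / 2)); last by rewrite ltr_pdivrMr // ltr_pMr // ltr1n.
  rewrite -(ler_pM2r rm) -mcoeffB; apply: le_trans (h K k _ _) => //.
  by apply: pnorm_coef; apply: ltW.
pose c' m := lim ((fun k => mcoeff m (P k)) @ \oo).
pose c (f : 'I_n -> nat) := c' (Multinom [tuple f i | i < n]).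
have cE (m : multinom n) : c (fun i => m i) = c' m.
  by rewrite /c; congr c'; apply/mnmP => i; rewrite multinomE tnth_mktuple.
have cvS N (Q : mpoly n R) : (fun k => \sum_(m <- mnm_box N) `|mcoeff m (P k) - mcoeff m Q| * r ^+ mdeg m)
    @ \oo --> \sum_(m <- mnm_box N) `|c' m - mcoeff m Q| * r ^+ mdeg m.
  elim: (mnm_box N) => [|m s ih].
    by rewrite big_nil; under eq_fun do rewrite big_nil; apply: cvg_cst.
  rewrite big_cons; under eq_fun do rewrite big_cons.
  apply: cvgD ih; apply: cvgMr_tmp; apply: cvg_norm; apply: cvgB; last exact: cvg_cst.
  exact: coefc.
(* A finite sum of coefficient distances is at most the norm, uniformly in k, and so stays bounded
   in the limit, as in Fatou's lemma. *)
have bnd N (Q : mpoly n R) e K : {subset msupp Q <= mnm_box N} ->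
    (forall k, (K <= k)%N -> pnorm r (P k - Q) <= e) ->
    \sum_(m <- mnm_box N) `|c' m - mcoeff m Q| * r ^+ mdeg m <= e.
  move=> QN h; apply: (cvgr_to_le (cvS N Q)); exists K => //= k Kk.
  apply: le_trans (h k Kk).
  have [N' hN'] := poly_in_box (P k - Q).
  rewrite (@pnormE _ _ _ _ (mnm_box (maxn N N'))) ?mnm_box_uniq //; last first.
    by move=> m /hN'; apply: mnm_box_sub; rewrite leq_maxr.
  rewrite -subr_ge0.
  under [X in _ - X]eq_bigr do rewrite -mcoeffB.
  rewrite sum_mnm_box_sub ?leq_maxl //; apply: sumr_ge0 => m _.
  by rewrite mulr_ge0 // exprn_ge0 // ltW.
have bM N : \sum_(m <- mnm_box N) `|c' m| * r ^+ mdeg m <= M.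
  have := bnd N 0 M 0%N; under eq_bigr do rewrite mcoeff0 subr0; apply.
    by rewrite msupp0.
  by move=> k _; rewrite subr0.
exists c => x xa; split.
  apply: nondecreasing_is_cvgn.
    apply/nondecreasing_seqP => N; rewrite -subr_ge0 !psum_mnm sum_mnm_box_sub //.
    apply: sumr_ge0 => m _; rewrite mulr_ge0 // prodr_ge0 // => i _.
    by rewrite exprn_ge0 // mxE.
  exists M => _ [N _ <-]; rewrite psum_mnm; apply: le_trans (bM N).
  apply: ler_sum => m _; rewrite cE ler_wpM2l // -prod_exp_const.
  apply: ler_prod => i _; rewrite !mxE exprn_ge0 //=.
  by rewrite lerXn2r ?nnegrE ?(ltW r0) //; apply: xa.
apply/cvgrPdist_le => e e0; have e2 : 0 < e / 2 by rewrite divr_gt0.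
have [K hK] := cP _ e2; have [N0 hN0] := poly_in_box (P K).
have G1 : `|G x - meval (disp a x) (P K)| <= e / 2.
  have C : (fun k => meval (disp a x) (P k) - meval (disp a x) (P K)) @ \oo
      --> G x - meval (disp a x) (P K) by apply: cvgB; [apply: PG|apply: cvg_cst].
  apply: (cvgr_to_le (cvg_norm C)); exists K => //= k Kk; rewrite -mevalB.
  apply: le_trans (hK k K Kk _) => //; apply: pnorm_eval; first exact: ltW.
  exact: xa.
exists N0 => //= N N0N.
(* From [N0] on the box of exponents contains the support of [P K], so the partial sum and [P K] can
   be compared coefficient by coefficient. *)
have PKN : {subset msupp (P K) <= mnm_box N} by move=> m /hN0; apply: mnm_box_sub.
have G2 : `|meval (disp a x) (P K) - psum c (x - a) N| <= e / 2.
  have -> : meval (disp a x) (P K) = \sum_(m <- mnm_box N) mcoeff m (P K) * \prod_(i < n) (x - a) 0 i ^+ m i.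
    rewrite mevalE.
    rewrite [RHS](bigID (fun m => m \in msupp (P K))) /= [X in _ = _ + X]big1 ?addr0; last first.
      by move=> m /memN_msupp_eq0 ->; rewrite mul0r.
    rewrite -[RHS]big_filter; under eq_bigr do under eq_bigr do rewrite /disp.
    under [RHS]eq_bigr do under eq_bigr do rewrite !mxE.
    apply: perm_big; apply: uniq_perm; rewrite ?filter_uniq ?msupp_uniq ?mnm_box_uniq // => m.
    by rewrite mem_filter; case: (boolP (m \in msupp _)) => //= /PKN.
  rewrite psum_mnm -sumrB (le_trans (ler_norm_sum _ _ _)) //.
  apply: le_trans (bnd N (P K) (e / 2) K PKN _); last by move=> k Kk; apply: hK.
  apply: ler_sum => m _; rewrite -mulrBl cE normrM distrC ler_wpM2l //.
  rewrite normr_prod -prod_exp_const; apply: ler_prod => i _.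
  rewrite normr_ge0 normrX lerXn2r ?nnegrE ?(ltW r0) // !mxE; exact: xa.
rewrite [leRHS]splitr; have -> : G x - psum c (x - a) N =
  (G x - meval (disp a x) (P K)) + (meval (disp a x) (P K) - psum c (x - a) N) by lra.
by apply: (le_trans (ler_normD _ _)); apply: lerD.
Qed.

Lemma analytic_onP (S : set 'rV[R]_n) (g : 'rV[R]_n -> R) :
  analytic_on S g <-> forall a, S a ->
  exists r M G, [/\ 0 < r, adisc r M a G & forall x, S x -> box r a x -> g x = G x].
Proof.
split=> [h a Sa|h a Sa]; first exact: analytic_on_adisc Sa h.
have [r [M [G [r0 aG gG]]]] := h a Sa; have [c hc] := adisc_psum r0 aG.
exists c; apply/near_box; exists r => // x xa; have [h1 h2] := hc x xa.
by split=> // Sx; rewrite gG.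
Qed.

Definition analytic_at (a : 'rV[R]_n) (g : 'rV[R]_n -> R) :=
  exists r M, 0 < r /\ adisc r M a g.

Lemma analytic_onE (X : set 'rV[R]_n) (g : 'rV[R]_n -> R) : open X ->
  analytic_on X g <-> forall a, X a -> analytic_at a g.
Proof.
move=> oX; split=> [/analytic_onP h a Xa|h].
  have [r [M [G [r0 aG gG]]]] := h a Xa.
  have : nbhs a X by apply: open_nbhs_nbhs.
  move=> /near_box[s s0 sX]; exists (Num.min r s), M; split.
    by rewrite lt_min r0.
  apply: (@adisc_ext _ _ _ _ _ G).
    move=> x xa; rewrite gG //.
      by apply: sX; apply: box_le xa; rewrite ge_min lexx orbT.
    by apply: box_le xa; rewrite ge_min lexx.
  by apply: adisc_le aG => //; rewrite ?ge_min ?lexx // le_min !ltW.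
apply/analytic_onP => a /h[r [M [r0 ag]]].
by exists r, M, g; split.
Qed.

End PowerSeriesBridge.

(** * Quasi-analyticity on an interval *)

Lemma within_comp_continuous (T S W : topologicalType) (A : set T) (B : set S)
    (phi : T -> S) (G : S -> W) :
  {within B, continuous G} -> {within A, continuous phi} ->
  (forall x, A x -> B (phi x)) -> {within A, continuous (G \o phi)}.
Proof.
move=> /subspace_continuousP cG /subspace_continuousP cp AB.
apply/subspace_continuousP => x Ax V /(cG _ (AB x Ax)) H.
have h : nbhs x [set z | A z -> B (phi z) -> V (G (phi z))] := cp x Ax _ H.
suff : nbhs x [set z | A z -> V (G (phi z))] by [].
by apply: filterS h => z /= h Az; apply: h => //; apply: AB.
Qed.

Section QuasiAnalytic.
Variable R : realType.

(** Taylor's formula when all derivatives vanish at 0. By induction on K, [G k] is compared through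
    the mean value theorem with the primitive P of the bound already known for [G k.+1]. *)
Lemma taylor_bound_right (h B : R) (G : nat -> R -> R) K k :
  (forall j, {within `[0, h], continuous (G j)}) ->
  (forall j (t : R), 0 < t < h -> is_derive t 1 (G j) (G j.+1 t)) ->
  (forall j, G j 0 = 0) ->
  (forall t, 0 <= t <= h -> `|G (k + K)%N t| <= B) ->
  forall t : R, 0 <= t <= h -> `|G k t| <= B * t ^+ K / K`!%:R.
Proof.
move=> Gc Gd G0; elim: K k => [|K ih] k HB t /andP[t0 th].
  by rewrite expr0 fact0 divr1 mulr1; have := HB t; rewrite addn0 t0 th; apply.
move: t0; rewrite le_eqVlt => /predU1P[<-|t0].
  by rewrite G0 normr0 exprS mul0r mulr0 mul0r.
have {}ih s : 0 <= s <= h -> `|G k.+1 s| <= B * s ^+ K / K`!%:R.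
  by apply: ih => u; rewrite addSnnS; apply: HB.
pose P s : R := B * s ^+ K.+1 / K.+1`!%:R.
have Pd (s : R) : is_derive s (1 : R) P (B * s ^+ K / K`!%:R).
  have -> : P = (B / K.+1`!%:R) \*: (id ^+ K.+1).
    by apply/funext => u; rewrite /P /= fctE /= mulrAC.
  apply: is_derive_eq.
  rewrite -[_ *: (_ *: _)]/(_ * (_ * _)) /= mulr1 factS natrM.
  have K0 : K.+1%:R != 0 :> R by rewrite pnatr_eq0.
  have F0 : K`!%:R != 0 :> R by rewrite pnatr_eq0 -lt0n fact_gt0.
  rewrite invfM. rewrite -!mulrA; congr (B * _).
  by rewrite mulrCA mulKf // mulrC.
have Pc : continuous P by move=> s; apply/differentiable_continuous/derivable1_diffP; case: (Pd s).
have sub : `[0, t] `<=` `[0, h].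
  by move=> u /=; rewrite !in_itv /= => /andP[-> ut]; apply: le_trans th.
have key (e : R) : `|e| = 1 -> e * G k t <= P t.
  move=> e1; pose u s := P s - e * G k s.
  have ud (s : R) : s \in `]0, t[ -> is_derive s 1 u (B * s ^+ K / K`!%:R - e * G k.+1 s).
    rewrite in_itv /= => /andP[s0 st].
    have D1 := Pd s; have D2 : is_derive s 1 (G k) (G k.+1 s).
      by apply: Gd; rewrite s0 (lt_le_trans st).
    have -> : u = P - e *: G k by apply/funext.
    by apply: is_derive_eq.
  have uc : {within `[0, t], continuous u}.
    move=> s; apply: continuousB; first by apply: continuous_subspaceT.
    apply: continuousM; first by apply: cst_continuous.
    by apply: (continuous_subspaceW sub (Gc k)).
  have [s] := MVT t0 ud uc; rewrite in_itv /= => /andP[s0 st].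
  rewrite subr0 => E.
  have : 0 <= u t - u 0.
    rewrite E mulr_ge0 ?(ltW t0) // subr_ge0; apply: le_trans (ih s _).
      by rewrite (le_trans (ler_norm _)) // normrM e1 mul1r.
    by rewrite (ltW s0) (le_trans (ltW st)).
  have P0 : P 0 = 0 by rewrite /P exprS mul0r mulr0 mul0r.
  by rewrite /u P0 G0 mulr0 !subr0 subr_ge0.
rewrite ler_norml -/(P t); apply/andP; split.
  by have := key (-1); rewrite normrN1 mulN1r lerNl => /(_ erefl); rewrite lerNl.
by have := key 1; rewrite normr1 mul1r; apply.
Qed.

(** The quotient of (a + b)! by a! b! is a binomial coefficient, at most 2^(a + b). *)
Lemma fact_ratio_le a b : ((a + b)`! <= 2 ^ (a + b) * a`! * b`!)%N.
Proof.
rewrite -mulnA -(@bin_fact (a + b) a) ?leq_addr // addKn leq_mul2r.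
apply/orP; right; rewrite -[2%N]/(1 + 1)%N expnDn.
have ab : (a < (a + b).+1)%N by rewrite ltnS leq_addr.
rewrite (bigD1 (Ordinal ab)) //= !exp1n !muln1; exact: leq_addr.
Qed.

(** By [taylor_bound_right] the derivatives are at most a constant times (2 C t)^K for every K, and
    2 C t <= 1/2. *)
Lemma quasi_analytic_right (h C : R) (G : nat -> R -> R) :
  (forall j, {within `[0, h], continuous (G j)}) ->
  (forall j (t : R), 0 < t < h -> is_derive t 1 (G j) (G j.+1 t)) ->
  (forall j, G j 0 = 0) -> 0 <= C ->
  (forall k t, 0 <= t <= h -> `|G k t| <= C ^+ k.+1 * k`!%:R) ->
  forall k t, 0 <= t <= h -> t * (4 * C) <= 1 -> G k t = 0.
Proof.
move=> Gc Gd G0 C0 GC k t /andP[t0 th] tC.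
have B K : `|G k t| <= C ^+ k.+1 * 2 ^+ k * k`!%:R * (2^-1) ^+ K.
  have := @taylor_bound_right h (C ^+ (k + K).+1 * (k + K)`!%:R) G K k Gc Gd G0.
  move=> /(_ _ t) H; apply: le_trans (H _ _) _; rewrite ?t0 //.
    by move=> s sh; apply: GC.
  rewrite ler_pdivrMr ?ltr0n ?fact_gt0 //.
  have F : (k + K)`!%:R <= 2 ^+ (k + K) * k`!%:R * K`!%:R :> R.
    by rewrite -natrX -!natrM ler_nat fact_ratio_le.
  apply: (@le_trans _ _ (C ^+ (k + K).+1 * (2 ^+ (k + K) * k`!%:R * K`!%:R) * t ^+ K)).
    by rewrite ler_wpM2r ?exprn_ge0 // ler_wpM2l // exprn_ge0.
  have -> : C ^+ (k + K).+1 * (2 ^+ (k + K) * k`!%:R * K`!%:R) * t ^+ K =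
    C ^+ k.+1 * 2 ^+ k * k`!%:R * K`!%:R * (2 * C * t) ^+ K.
    by rewrite -addSn !exprD !exprMn; lra.
  rewrite -[leRHS]mulrA [_ ^+ K * _]mulrC mulrA ler_wpM2l //.
    by rewrite !mulr_ge0 // ?exprn_ge0 ?mulr_ge0.
  by rewrite lerXn2r ?nnegrE ?mulr_ge0 ?invr_ge0 //; lra.
have L : (fun K => C ^+ k.+1 * 2 ^+ k * k`!%:R * (2^-1 : R) ^+ K) @ \oo --> (0 : R).
  rewrite -[X in _ --> X](mulr0 (C ^+ k.+1 * 2 ^+ k * k`!%:R)).
  apply: cvgM; [exact: cvg_cst|apply: cvg_expr]; rewrite ger0_norm ?invr_ge0 //.
  by rewrite invf_lt1 // ltr1n.
apply/eqP; rewrite -normr_le0.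
apply: (ler_cvg_to (cvg_cst `|G k t|) L).
by near=> K; apply: B.
Unshelve. all: by end_near. Qed.

(** The points where all [G k] vanish form a set that is closed by continuity and relatively open by
    [quasi_analytic_right], hence the whole interval; constants C depending on the point are
    enough. *)
Lemma quasi_analytic (c d t0 : R) (G : nat -> R -> R) :
  (forall j, {within `[c, d], continuous (G j)}) ->
  (forall j (t : R), c < t < d -> is_derive t 1 (G j) (G j.+1 t)) ->
  (forall t, c <= t <= d -> exists C dl : R, [/\ 0 <= C, 0 < dl & forall k (x : R), c <= x <= d ->
     `|x - t| < dl -> `|G k x| <= C ^+ k.+1 * k`!%:R]) ->
  c <= t0 <= d -> (forall k, G k t0 = 0) -> forall k t, c <= t <= d -> G k t = 0.
Proof.
move=> Gc Gd Gb t0cd G0.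
pose Z := [set t | c <= t <= d /\ forall k, G k t = 0].
have loc t : Z t -> exists2 e, 0 < e & forall x, c <= x <= d -> `|x - t| < e -> Z x.
  move=> [/andP[ct td] Gt].
  have [C [dl [C0 dl0 HC]]] := Gb t (introT andP (conj ct td)).
  pose e := Num.min (dl / 2) (4 * C + 1)^-1.
  have e0 : 0 < e by rewrite lt_min divr_gt0 //= invr_gt0; lra.
  have edl : e < dl.
    by apply: (@le_lt_trans _ _ (dl / 2)); [rewrite ge_min lexx|rewrite ltr_pdivrMr // ltr_pMr // ltr1n].
  have eC : e * (4 * C) <= 1.
    apply: (@le_trans _ _ ((4 * C + 1)^-1 * (4 * C))).
      by rewrite ler_wpM2r ?mulr_ge0 // ge_min lexx orbT.
    by rewrite mulrC ler_pdivrMr; lra.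
  exists e => // x /andP[cx xd] xt; split; first by rewrite cx.
  (* The sign s reduces points on the left of t to points on the right: s^k G k (t + s z) is again a
     family of successive derivatives in z. *)
  pose s : R := if t <= x then 1 else -1.
  have ss : s * s = 1 by rewrite /s; case: ifP; lra.
  have s1 : `|s| = 1 by rewrite /s; case: ifP => _; rewrite ?normrN1 ?normr1.
  pose h : R := `|x - t|.
  have xE : x = t + s * h.
    by rewrite /h /s; case: leP => tx; [rewrite ger0_norm|rewrite ltr0_norm]; lra.
  have h0 : 0 <= h := normr_ge0 _.
  have he : h < e := xt.
  have {}xE : x = t + s * h /\ (s = 1 \/ s = -1).
    by split=> //; rewrite /s; case: ifP; [left|right].
  clearbody h s; move: xE => [xE sE].
  pose H k z := s ^+ k * G k (t + s * z).
  have inI (z : R) : 0 <= z <= h -> c <= t + s * z <= d.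
    by move=> /andP[z0 zh]; case: sE xE => -> xE; lra.
  have inIo (z : R) : 0 < z < h -> c < t + s * z < d.
    by move=> /andP[z0 zh]; case: sE xE => -> xE; lra.
  move=> k.
  have := @quasi_analytic_right h C H _ _ _ C0 _ k h; rewrite lexx h0.
  have -> : H k h = s ^+ k * G k x by rewrite /H -xE.
  move=> HH; have {HH} : s ^+ k * G k x = 0.
    apply: HH => //.
    - move=> j; rewrite /H => z.
      apply: (@continuousM _ (subspace `[0, h]) (fun=> s ^+ j) (fun u => G j (t + s * u))).
        exact: cst_continuous.
      apply: (within_comp_continuous (Gc j)).
        apply: continuous_subspaceT => u.
        by apply: cvgD; [exact: cvg_cst|apply: cvgM; [exact: cvg_cst|exact: cvg_id]].
      by move=> u /=; rewrite !in_itv; apply: inI.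
    - move=> j z z0; have D := Gd j _ (inIo z z0).
      have D1 : is_derive z (1 : R) (fun u => t + s * u) s.
        have D0 := is_deriveD (is_derive_cst t z (1 : R)) (is_deriveZ s (is_derive_id z (1 : R))).
        have E0 : 0 + s *: (1 : R) = s by apply: (eq_trans (add0r _)); apply: mulr1.
        by rewrite E0 in D0.
      have D2 := @is_derive1_comp _ (G j) (fun u => t + s * u) z _ _ D D1.
      have -> : H j = s ^+ j *: (G j \o (fun u => t + s * u)) by apply/funext.
      by apply: is_derive_eq; rewrite -[_ *: _]/(_ * _) /H exprSr; lra.
    - by move=> j; rewrite /H mulr0 addr0 Gt mulr0.
    - move=> j z z0; rewrite /H normrM normrX s1 expr1n mul1r; apply: HC; first exact: inI.
      rewrite addrAC subrr add0r normrM s1 mul1r; case/andP: z0 => z0 zh.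
      by rewrite ger0_norm // (le_lt_trans zh) // (lt_trans he).
    - by apply: le_trans eC; rewrite ler_wpM2r ?mulr_ge0 // ltW.
  move/eqP; rewrite mulf_eq0 expf_eq0 => /orP[/andP[_ /eqP s0]|/eqP //].
  by move: s1; rewrite s0 normr0; lra.
suff : Z = `[c, d]%classic.
  by move=> E k t tcd; have [] : Z t by rewrite E /= in_itv.
apply: segment_connected.
- by exists t0.
- exists (\bigcup_(te in [set te : R * R | Z te.1 /\ forall x, c <= x <= d ->
     `|x - te.1| < te.2 -> Z x]) ball te.1 te.2).
    by apply: bigcup_open => -[t e] _; apply: ball_open.
  apply/seteqP; split=> [t Zt|t [/= + [[u e] /= [Zu He]]]].
    have [e e0 He] := loc t Zt; split; first by rewrite /= in_itv; case: Zt.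
    by exists (t, e) => //=; apply: ballxx.
  by rewrite in_itv /= => tcd; rewrite -ball_normE /= distrC; apply: He.
- exists (closure Z); first exact: closed_closure.
  apply/seteqP; split=> [t Zt|t [/= +]].
    split; last exact: subset_closure.
    by rewrite /= in_itv; case: Zt.
  rewrite in_itv /= => tcd Zt; split=> // k; apply/eqP; apply: contrapT => /negP Gt.
  have /subspace_continuousP/(_ t) := Gc k; rewrite /= in_itv /= => /(_ tcd).
  move=> /(cvgr_neq0 _)/(_ Gt) H; have [u [[ucd Gu] Hu]] := Zt _ H.
  have : G k u != 0 by apply: Hu; rewrite /= in_itv.
  by rewrite Gu eqxx.
Qed.
End QuasiAnalytic.

(** * Iterated Lie derivatives and the identity theorem *)

Section AnalyticCalculus.
Variable R : realType.
Implicit Types n k : nat.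

Lemma diff_near0 n (g : 'rV[R]_n -> R) (x v : 'rV[R]_n) :
  (\forall y \near x, g y = 0) -> differentiable g x /\ 'd g x v = 0.
Proof.
move=> /near_box[r r0 g0]; have [] := @differentiable_rv R n g x (fun=> 0).
  move=> e e0; exists r => // h d d0 dr hd.
  rewrite !g0; [|exact/box_refl/ltW|].
    rewrite subrr sub0r normrN big1 ?normr0 ?mulr_ge0 // ?ltW // => i _.
    by rewrite mulr0.
  by move=> i; rewrite mxE addrAC subrr add0r (le_trans (hd i)).
move=> dg ->; split=> //; by rewrite big1 // => i _; rewrite mulr0.
Qed.

Lemma diff_near n (f g : 'rV[R]_n -> R) (x v : 'rV[R]_n) :
  (\forall y \near x, f y = g y) -> differentiable f x ->
  differentiable g x /\ 'd g x v = 'd f x v.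
Proof.
move=> fg df; have [d0 e0] : differentiable (fun y => g y - f y) x /\
    'd (fun y => g y - f y) x v = 0.
  by apply: diff_near0; near=> y; apply/eqP; rewrite subr_eq0 eq_sym; apply/eqP; near: y.
have -> : g = (fun y => f y + (g y - f y)) by apply/funext => y; rewrite addrC subrK.
by split; [exact: differentiableD|rewrite diffDE // e0 addr0].
Unshelve. all: by end_near. Qed.

Lemma meval_center n (a : 'rV[R]_n) (P : mpoly n R) :
  meval (disp a a) P = mcoeff (@mnm0 n) P.
Proof.
rewrite mevalE.
have E (m : multinom n) : mcoeff m P * \prod_(i < n) disp a a i ^+ m i =
    if m == @mnm0 n then mcoeff m P else 0.
  case: eqP => [->|/eqP].
    by rewrite big1 ?mulr1 // => i _; rewrite mnm0E expr0.
  rewrite -mdeg_eq0 mdegE sum_nat_eq0 => /forallPn[i]; rewrite /= => mi.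
  by rewrite (bigD1 i) //= /disp subrr expr0n (negbTE mi) mul0r mulr0.
under eq_bigr do rewrite E.
rewrite -big_mkcond /=; case: (boolP (@mnm0 n \in msupp P)) => h.
  rewrite -big_filter (perm_big [:: @mnm0 n]) ?big_seq1 //.
  apply: uniq_perm; rewrite ?filter_uniq ?msupp_uniq // => m.
  by rewrite mem_filter inE; case: eqP => // ->.
rewrite (memN_msupp_eq0 h) big_seq_cond big1 // => m /andP[ms /eqP me].
by rewrite -me ms in h.
Qed.

(** Removing the constant terms, which tend to g a = 0, leaves approximations of norm at most M + M
    to which [pnorm_shrink] applies. *)
Lemma adisc_shrink n r M s a (g : 'rV[R]_n -> R) : 0 < r -> 0 <= s -> s <= r ->
  adisc r M a g -> g a = 0 -> adisc s (s / r * (M + M)) a g.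
Proof.
move=> r0 s0 sr [P [PM cP Pg]] ga.
have r0' := ltW r0.
pose Q k := P k - mpolyC n (mcoeff (@mnm0 n) (P k)).
have c0 k := meval_center a (P k).
have cM k : `|mcoeff (@mnm0 n) (P k)| <= M.
  by rewrite -c0; apply: le_trans (PM k); apply: pnorm_eval => // i; rewrite /disp subrr normr0.
exists Q; split.
- move=> k; apply: le_trans (pnorm_shrink r0 s0 sr _) _.
    by rewrite mcoeffB mcoeffC eqxx mulr1 subrr.
  rewrite ler_wpM2l ?divr_ge0 //; apply: le_trans (pnormB r0' _ _) _.
  by rewrite pnormC lerD.
- have cP0 : pcauchy r (fun k => mpolyC n (- mcoeff (@mnm0 n) (P k))).
    move=> e /cP[K h]; exists K => i j Ki Kj; rewrite -mpolyCB pnormC.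
    rewrite opprK addrC -mcoeffB.
    apply: le_trans (h j i Kj Ki); have := pnorm_coef r0' (P j - P i) (@mnm0 n).
    by rewrite mdeg0 expr0 mulr1.
  move=> e /(pcauchyD r0' cP cP0)[K h]; exists K => i j Ki Kj.
  apply: le_trans (h i j Ki Kj); rewrite !mpolyCN -![P _ + - _]/(Q _).
  exact: pnorm_le.
- move=> x xa; under eq_fun do rewrite mevalB mevalC -c0.
  rewrite -[g x]subr0 -ga; apply: cvgB; apply: Pg; first exact: box_le xa.
  exact: box_refl.
Qed.

(** Directional derivatives as Lie derivatives along a constant field, so that the bounds on
    iterated Lie derivatives also apply along lines. *)
Definition lie1 n (v : 'rV[R]_n) := lie_deriv (fun=> v).

Lemma lie_pdE n (f : 'rV[R]_n -> 'rV[R]_n) g x :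
  lie_deriv f g x = \sum_i f x 0 i * pd i g x.
Proof. exact: diff_pdE. Qed.

Lemma adisc_lie n r s M B a (f : 'rV[R]_n -> 'rV[R]_n) (g : 'rV[R]_n -> R) :
  0 <= s -> s < r -> adisc r M a g -> (forall i, adisc r B a (fun x => f x 0 i)) ->
  adisc s (n%:R * B * M / (r - s)) a (lie_deriv f g).
Proof.
move=> s0 sr ag af; have r0 : 0 <= r by lra.
apply: (@adisc_ext _ _ _ _ _ (fun x => \sum_(i < n) f x 0 i * pd i g x)).
  by move=> x _; rewrite lie_pdE.
have -> : n%:R * B * M / (r - s) = \sum_(i < n) B * (M / (r - s)).
  by rewrite sumr_const card_ord -[RHS]mulr_natl !mulrA.
apply: adisc_sum => // i; apply: adiscM => //; last exact: adisc_pd.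
by apply: adisc_le (af i) => //; apply: ltW.
Qed.

Lemma expR_pow_bound k : ((k.+2%:R / k.+1%:R) ^+ k : R) <= expR 1.
Proof.
have k0 : 0 < k.+1%:R :> R by rewrite ltr0Sn.
have -> : k.+2%:R / k.+1%:R = 1 + k.+1%:R^-1 :> R.
  by rewrite -[k.+2%:R]natr1 mulrDl divff ?gt_eqF // mul1r.
apply: (@le_trans _ _ (expR k.+1%:R^-1 ^+ k)).
  by rewrite lerXn2r ?nnegrE ?expR_ge0 ?addr_ge0 ?invr_ge0 // expR_ge1Dx.
rewrite -expRM_natl ler_expR ler_pdivrMr // mul1r ler_nat leqnSn //.
Qed.

(** Each Lie derivative costs some radius. Giving up the fraction 1 / (k + 2) of the gap r - s at
    step k multiplies the previous bound by ((k + 2) / (k + 1))^k <= exp 1, so that the growth stays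
    of type k! C^k. The factor 2 in C absorbs k + 2 <= 2 (k + 1). *)
Lemma adisc_iter_lie n r M B a (f : 'rV[R]_n -> 'rV[R]_n) (g : 'rV[R]_n -> R) :
  0 < r -> 0 <= B -> adisc r M a g -> (forall i, adisc r B a (fun x => f x 0 i)) ->
  forall k s, 0 <= s -> s < r ->
  adisc s (M * k`!%:R * ((2 * expR 1 * (n%:R * B)) / (r - s)) ^+ k) a
    (iter k (lie_deriv f) g).
Proof.
move=> r0 B0 ag af; have M0 : 0 <= M := adisc_M0 (ltW r0) ag.
set C := 2 * expR 1 * _.
have nB0 : 0 <= n%:R * B by rewrite mulr_ge0.
have C0 : 0 <= C by rewrite !mulr_ge0 // expR_ge0.
elim=> [|k ih] s s0 sr.
  by rewrite fact0 expr0 !mulr1 /=; apply: adisc_le ag => //; apply: ltW.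
pose t := s + (r - s) / k.+2%:R.
have k2 : 0 < k.+2%:R :> R by rewrite ltr0Sn.
have k1 : 0 < k.+1%:R :> R by rewrite ltr0Sn.
have rs : 0 < r - s by lra.
have st : s < t by rewrite /t ltrDl divr_gt0.
have rt : r - t = (r - s) * (k.+1%:R / k.+2%:R).
  have E : k.+1%:R / k.+2%:R = 1 - k.+2%:R^-1 :> R.
    rewrite -[k.+1%:R](addrK 1) natr1 mulrBl divff ?gt_eqF // mul1r //.
  by rewrite E /t; move: (k.+2%:R^-1) => q; lra.
have tr : t < r by rewrite -subr_gt0 rt mulr_gt0 // divr_gt0.
have t0 : 0 <= t by lra.
have := @adisc_lie n t s _ B a f _ s0 st (ih t t0 tr) _.
move=> H; apply: adisc_le (H _) => //; last first.
  by move=> i; apply: adisc_le (af i) => //; apply: ltW.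
have -> : t - s = (r - s) / k.+2%:R by rewrite /t addrAC subrr add0r.
rewrite rt !invfM !invrK exprS factS natrM.
have E : (C * ((r - s)^-1 * (k.+1%:R^-1 * k.+2%:R))) ^+ k =
   (C / (r - s)) ^+ k * (k.+2%:R / k.+1%:R) ^+ k.
  by rewrite -exprMn; congr (_ ^+ k); rewrite -!mulrA [k.+1%:R^-1 * _]mulrC.
rewrite E.
have F := expR_pow_bound k.
have -> : n%:R * B * (M * k`!%:R * ((C / (r - s)) ^+ k * (k.+2%:R / k.+1%:R) ^+ k)) *
   ((r - s)^-1 * k.+2%:R) =
   (M * k`!%:R * ((C / (r - s)) ^+ k) * (r - s)^-1 * (n%:R * B)) * ((k.+2%:R / k.+1%:R) ^+ k * k.+2%:R).
  set p := (C / (r - s)) ^+ k; set p' := (_ / _) ^+ k.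
  by move: p p' ((r - s)^-1) (k.+2%:R : R) => p p' q u; lra.
have -> : M * (k.+1%:R * k`!%:R) * (C / (r - s) * (C / (r - s)) ^+ k) =
  (M * k`!%:R * ((C / (r - s)) ^+ k) * (r - s)^-1 * (n%:R * B)) * (expR 1 * (2 * k.+1%:R)).
  set p := (C / (r - s)) ^+ k; rewrite {1}/C.
  by move: p ((r - s)^-1) (k.+1%:R : R) (expR 1) => p q u w; lra.
apply: ler_wpM2l.
  by rewrite !mulr_ge0 // ?invr_ge0 ?exprn_ge0 ?divr_ge0 // ltW.
apply: ler_pM; rewrite ?exprn_ge0 ?divr_ge0 //.
by rewrite -natrM ler_nat mul2n -addnn addSn !addnS !ltnS leq_addr.
Qed.

Lemma iter_lie_bound n r M B a s (f : 'rV[R]_n -> 'rV[R]_n) (g : 'rV[R]_n -> R) :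
  0 < r -> 0 <= B -> adisc r M a g -> (forall i, adisc r B a (fun x => f x 0 i)) ->
  0 <= s -> s < r ->
  exists2 C : R, 0 <= C & forall k x, box s a x -> `|iter k (lie_deriv f) g x| <= C ^+ k.+1 * k`!%:R.
Proof.
move=> r0 B0 ag af s0 sr; have M0 : 0 <= M := adisc_M0 (ltW r0) ag.
set D := (2 * expR 1 * (n%:R * B)) / (r - s).
have D0 : 0 <= D by rewrite /D divr_ge0 ?subr_ge0 ?(ltW sr) // !mulr_ge0 // expR_ge0.
exists (M + D) => [|k x xa]; first exact: addr_ge0.
have H := adisc_iter_lie r0 B0 ag af k s0 sr.
apply: le_trans (adisc_bound s0 H xa) _.
rewrite mulrAC ler_wpM2r // exprS ler_pM ?exprn_ge0 ?lerDl //.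
by rewrite lerXn2r ?nnegrE ?addr_ge0 // lerDr.
Qed.

Lemma chain_derive n (g : 'rV[R]_n -> R) (x : R -> 'rV[R]_n) (t : R) v :
  is_derive t (1 : R) x v -> differentiable g (x t) ->
  is_derive t (1 : R) (g \o x) ('d g (x t) v).
Proof.
move=> [dx xE] dg; have dx' : differentiable x t by apply/derivable1_diffP.
have dgx := differentiable_comp dx' dg.
apply: DeriveDef; first exact/derivable1_diffP.
have <- : 'd x t 1 = v by rewrite -deriveE.
by rewrite deriveE // diff_comp.
Qed.

Lemma box_convex n (s : R) (a y z : 'rV[R]_n) (t : R) : 0 <= t <= 1 ->
  box s a y -> box s a z -> box s a (z + t *: (y - z)).
Proof.
move=> /andP[t0 t1] ya za i; rewrite !mxE.
have -> : z 0 i + t * (y 0 i - z 0 i) - a 0 i = (1 - t) * (z 0 i - a 0 i) + t * (y 0 i - a 0 i) by lra.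
apply: (le_trans (ler_normD _ _)); rewrite !normrM (ger0_norm t0) ger0_norm ?subr_ge0 //.
have -> : s = (1 - t) * s + t * s by lra.
by apply: lerD; apply: ler_wpM2l; rewrite ?subr_ge0.
Qed.

Lemma line_derive n (z v : 'rV[R]_n) (t : R) :
  is_derive t (1 : R) (fun u : R => z + u *: v) v.
Proof.
have -> : (fun u : R => z + u *: v) = cst z + ( *:%R ^~ v) by apply/funext.
apply: DeriveDef.
  by apply: derivableD; [exact: derivable_cst|apply/derivable1_diffP].
rewrite deriveD; [|exact: derivable_cst|by apply/derivable1_diffP].
by rewrite derive_cst add0r deriveE // diff_val scale1r.
Qed.

(** Along the segment from z to y the iterated directional derivatives of g form a family to which
    [quasi_analytic] applies. *)
Lemma adisc_zero_line n r M a s (g : 'rV[R]_n -> R) z y : 0 <= s -> s < r ->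
  adisc r M a g -> box s a z -> box s a y ->
  (forall k, iter k (lie1 (y - z)) g z = 0) -> g y = 0.
Proof.
move=> s0 sr ag za ya g0.
have r0 : 0 < r by lra.
pose v := y - z.
pose B := \sum_(i < n) `|v 0 i|.
have B0 : 0 <= B by apply: sumr_ge0.
have av i : adisc r B a (fun=> v 0 i).
  apply: (@adisc_le _ _ r r `|v 0 i| B) => //; [exact: ltW| |exact: adisc_cst].
  by rewrite /B (bigD1 i) //= lerDl sumr_ge0.
have [C C0 HC] := iter_lie_bound r0 B0 ag av s0 sr.
pose G k (t : R) := iter k (lie1 v) g (z + t *: v).
have inb (t : R) : 0 <= t <= 1 -> box s a (z + t *: v) by move=> t01; apply: box_convex.
have dG k (t : R) : 0 <= t <= 1 -> differentiable (iter k (lie1 v) g) (z + t *: v).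
  move=> t01; pose s' := (s + r) / 2.
  have ss : s < s' by rewrite /s'; lra.
  have sr' : s' < r by rewrite /s'; lra.
  have s0' : 0 <= s' by lra.
  exact: (adisc_diff s0 ss (adisc_iter_lie r0 B0 ag av k s0' sr') (inb t t01)).
have DG k (t : R) : 0 <= t <= 1 -> is_derive t (1 : R) (G k) (G k.+1 t).
  by move=> t01; apply: chain_derive (line_derive z v t) (dG k t t01).
suff : G 0%N 1 = 0 by rewrite /G /= scale1r addrC subrK.
apply: (@quasi_analytic R 0 1 0 G) => //.
- move=> k; apply: derivable_within_continuous => t; rewrite in_itv /= => t01.
  by case: (DG k t t01).
- by move=> k t /andP[t0 t1]; apply: DG; rewrite !ltW.
- move=> t _; exists C, 1; split=> // k x x01 _.
  by apply: HC; apply: inb.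
- by rewrite lexx ler01.
- by move=> k; rewrite /G scale0r addr0 g0.
- by rewrite ler01 lexx.
Qed.

Lemma iter_lie_near0 n (f : 'rV[R]_n -> 'rV[R]_n) (g : 'rV[R]_n -> R) (z : 'rV[R]_n) k :
  (\forall x \near z, g x = 0) -> \forall x \near z, iter k (lie_deriv f) g x = 0.
Proof.
move=> gz; elim: k => [|k ih] //=.
move/near_box: ih => [r r0 H]; apply/near_box; exists (r / 2); first by rewrite divr_gt0.
move=> x xz; have [] // := @diff_near0 n (iter k (lie_deriv f) g) x (f x).
apply/near_box; exists (r / 2); first by rewrite divr_gt0.
by move=> y yx; apply: H; rewrite [r]splitr; apply: box_trans xz yx.
Qed.

Lemma adisc_identity n r M a s (g : 'rV[R]_n -> R) (z : 'rV[R]_n) : 0 <= s -> s < r ->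
  adisc r M a g -> box s a z -> (\forall x \near z, g x = 0) ->
  forall y, box s a y -> g y = 0.
Proof.
move=> s0 sr ag za gz y ya; apply: (adisc_zero_line s0 sr ag za ya) => k.
exact: (nbhs_singleton (@iter_lie_near0 n (fun=> y - z) g z k gz)).
Qed.

(** The set where g vanishes locally is open. It is closed in X because the half-size cube around a
    limit point meets it, and [adisc_identity] then covers that cube. *)
Lemma analytic_identity n (X : set 'rV[R]_n) (g : 'rV[R]_n -> R) (z : 'rV[R]_n) : connected X ->
  (forall a, X a -> analytic_at a g) -> X z -> (\forall x \near z, g x = 0) ->
  forall x, X x -> g x = 0.
Proof.
move=> cX ag Xz gz.
pose Z := [set x | X x /\ \forall y \near x, g y = 0].
suff ZX : Z = X by move=> x; rewrite -ZX => -[_ /nbhs_singleton].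
apply: cX.
- by exists z.
- exists (interior [set x | g x = 0]); first exact: open_interior.
  by apply/seteqP; split.
- exists (closure Z); first exact: closed_closure.
  apply/seteqP; split=> [x Zx|a [Xa cZ]].
    by split; [case: Zx|exact: subset_closure].
  split=> //; have [r [M [r0 agr]]] := ag a Xa.
  have r2 : 0 < r / 2 by rewrite divr_gt0.
  have rr : r / 2 < r by rewrite ltr_pdivrMr // ltr_pMr // ltr1n.
  have [x [[Xx gx] xa]] : (Z `&` box (r / 2) a) !=set0.
    by apply: cZ; apply/near_box; exists (r / 2).
  apply/near_box; exists (r / 2) => //.
  exact: (adisc_identity (ltW r2) rr agr xa gx).
Qed.

End AnalyticCalculus.

(** * Inverting a perturbation of the identity *)

Section InverseFunction.
Variable R : realType.

Lemma pnorm_coef_le n (r : R) (A B : mpoly n R) : 0 <= r ->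
  (forall m, `|mcoeff m A| <= `|mcoeff m B|) -> pnorm r A <= pnorm r B.
Proof.
move=> r0 AB; set s := undup (msupp A ++ msupp B).
have us : uniq s by apply: undup_uniq.
rewrite !(@pnormE _ _ _ _ s) //; first by apply: ler_sum => m _; rewrite ler_wpM2r // exprn_ge0.
  by move=> m h; rewrite mem_undup mem_cat h orbT.
by move=> m h; rewrite mem_undup mem_cat h.
Qed.

Lemma pnorm_shrink2 n (r s : R) (P : mpoly n R) : 0 < r -> 0 <= s -> s <= r ->
  (forall m, (mdeg m < 2)%N -> mcoeff m P = 0) -> pnorm s P <= (s / r) ^+ 2 * pnorm r P.
Proof.
move=> r0 s0 sr P0; rewrite mulr_sumr; apply: ler_sum => m _.
case: (ltnP (mdeg m) 2) => [/P0 ->|m2]; first by rewrite normr0 !mul0r mulr0.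
rewrite mulrCA ler_wpM2l // -(subnKC m2) !exprD mulrA -exprMn divfK ?gt_eqF //.
by rewrite ler_wpM2l ?exprn_ge0 // lerXn2r ?nnegrE // ltW.
Qed.

Definition drop_affine n (P : mpoly n R) : mpoly n R :=
  P - mpolyC n (mcoeff (@mnm0 n) P) - \sum_i mcoeff (mnm1 i) P *: polyvar R i.

Lemma mcoeff_drop_affine n (P : mpoly n R) m :
  mcoeff m (drop_affine P) = if (mdeg m < 2)%N then 0 else mcoeff m P.
Proof.
rewrite !mcoeffB mcoeffC raddf_sum /=.
have E i : mcoeff m (mcoeff (mnm1 i) P *: polyvar R i) = mcoeff (mnm1 i) P * (mnm1 i == m)%:R.
  by rewrite mcoeffZ mcoeffX.
under eq_bigr do rewrite E.
case: (ltnP (mdeg m) 2) => m2; last first.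
  have -> : (m == @mnm0 n) = false by apply/negbTE; rewrite -mdeg_eq0; case: (mdeg m) m2.
  rewrite mulr0 subr0 big1 ?subr0 // => i _.
  have -> : (mnm1 i == m) = false; last by rewrite mulr0.
  by apply/negbTE/eqP => e; move: m2; rewrite -e mdeg1.
case: (posnP (mdeg m)) => [/eqP|m0].
  rewrite mdeg_eq0 => /eqP ->; rewrite eqxx mulr1 subrr sub0r big1 ?oppr0 // => i _.
  have -> : (mnm1 i == @mnm0 n) = false; last by rewrite mulr0.
  by apply/negbTE; rewrite -mdeg_eq0 mdeg1.
have /mdeg1P[i /eqP ->] : mdeg m == 1%N by rewrite eqn_leq -ltnS m2.
have -> : (mnm1 i == @mnm0 n) = false by apply/negbTE; rewrite -mdeg_eq0 mdeg1.
rewrite mulr0 subr0 (bigD1 i) //= eqxx mulr1 big1 ?addr0 ?subrr // => j ji.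
by rewrite eq_mnm1 (negbTE ji) mulr0.
Qed.

Lemma drop_affineB n (P Q : mpoly n R) : drop_affine (P - Q) = drop_affine P - drop_affine Q.
Proof.
apply/mpolyP => m; rewrite mcoeffB !mcoeff_drop_affine mcoeffB.
by case: ifP => _ //; rewrite subrr.
Qed.

Lemma pnorm_drop_affine n (r : R) (P : mpoly n R) : 0 <= r ->
  pnorm r (drop_affine P) <= pnorm r P.
Proof.
move=> r0; apply: pnorm_coef_le => // m; rewrite mcoeff_drop_affine.
by case: ifP => _; rewrite ?normr0.
Qed.

Lemma adisc_order2 n r M (a : 'rV[R]_n) (g : 'rV[R]_n -> R) : 0 < r -> adisc r M a g ->
  g a = 0 -> (forall i, pd i g a = 0) ->
  exists Q : nat -> mpoly n R,
    [/\ forall k s, 0 <= s -> s <= r -> pnorm s (Q k) <= (s / r) ^+ 2 * M,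
        pcauchy r Q &
        forall x, box r a x -> (fun k => meval (disp a x) (Q k)) @ \oo --> g x].
Proof.
move=> r0 [P [PM cP Pg]] ga dga; exists (fun k => drop_affine (P k)); split.
- move=> k s s0 sr; apply: (le_trans (pnorm_shrink2 r0 s0 sr _)).
    by move=> m m2; rewrite mcoeff_drop_affine m2.
  rewrite ler_wpM2l ?exprn_ge0 ?divr_ge0 ?(ltW r0) //; apply: le_trans (PM k).
  exact/pnorm_drop_affine/ltW.
- move=> e /cP[K h]; exists K => i j Ki Kj; rewrite -drop_affineB.
  by apply: le_trans (h i j Ki Kj); apply/pnorm_drop_affine/ltW.
have c0 : (fun k => mcoeff (@mnm0 n) (P k)) @ \oo --> (0 : R).
  rewrite -ga; have := Pg a (box_refl a (ltW r0)).
  by under eq_fun do rewrite meval_center.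
have c1 i : (fun k => mcoeff (mnm1 i) (P k)) @ \oo --> (0 : R).
  rewrite -(dga i).
  have [_ /(_ i)] := adisc_differentiable (lexx 0) r0 cP PM Pg (box_refl a (lexx 0)).
  under eq_fun do rewrite meval_center mcoeff_deriv add0m mnm0E mulr1n.
  by [].
move=> x xa.
have E k : meval (disp a x) (drop_affine (P k)) = meval (disp a x) (P k) -
    mcoeff (@mnm0 n) (P k) - \sum_i mcoeff (mnm1 i) (P k) * disp a x i.
  rewrite /drop_affine !mevalB mevalC; congr (_ - _); rewrite raddf_sum /=.
  by apply: eq_bigr => i _; rewrite mevalZ mevalXU.
under eq_fun do rewrite E.
have -> : g x = g x - 0 - 0 by rewrite !subr0.
apply: cvgB.
  by apply: cvgB => //; apply: Pg.
elim: (index_enum _) => [|i s ih].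
  by under eq_fun do rewrite big_nil; apply: cvg_cst.
under eq_fun do rewrite big_cons.
have e0 : 0 = 0 * disp a x i + 0 by rewrite mul0r addr0.
rewrite {1}e0; apply: cvgD ih.
by apply: cvgM; [exact: c1|exact: cvg_cst].
Qed.

(** Iterates for the fixed point equation xi = id - rho(xi), carried out on polynomials: step k uses
    the k-th approximation of rho. *)
Fixpoint picard n (Q : 'I_n -> nat -> mpoly n R) (k : nat) : n.-tuple (mpoly n R) :=
  if k is k'.+1 then
    [tuple polyvar R i - comp_mpoly (picard Q k') (Q i k') | i < n]
  else [tuple 0 | i < n].

(** Since rho has order two at 0, it is a contraction near 0. The iteration runs on polynomials and
    converges in their norm, so that the limit is analytic by definition of [adisc]. *)
Lemma inverse_near_identity n (rho : 'rV[R]_n -> 'rV[R]_n) r M : 0 < r -> 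
  (forall i, adisc r M 0 (fun u => rho u 0 i)) -> rho 0 = 0 ->
  (forall i j, pd i (fun u => rho u 0 j) 0 = 0) ->
  exists s t (xi : 'rV[R]_n -> 'rV[R]_n),
    [/\ 0 < s /\ 0 < t, forall i, adisc t s 0 (fun y => xi y 0 i),
        forall y, box t 0 y -> box s 0 (xi y) /\ xi y + rho (xi y) = y &
        forall u v, box s 0 u -> box s 0 v -> u + rho u = v + rho v -> u = v].
Proof.
move=> r0 ar rho0 drho.
have rho00 i : rho 0 0 i = 0 by rewrite rho0 mxE.
have Hq i : exists Q : nat -> mpoly n R,
    [/\ forall k s, 0 <= s -> s <= r -> pnorm s (Q k) <= (s / r) ^+ 2 * M,
        pcauchy r Q & forall x, box r 0 x ->
        (fun k => meval (disp 0 x) (Q k)) @ \oo --> rho x 0 i].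
  exact: (adisc_order2 r0 (ar i) (rho00 i) (drho^~ i)).
pose Q i := sval (cid (Hq i)).
have QM i k s : 0 <= s -> s <= r -> pnorm s (Q i k) <= (s / r) ^+ 2 * M.
  by rewrite /Q; case: cid => ? /= [+ _ _]; apply.
have cQ i : pcauchy r (Q i) by rewrite /Q; case: cid => ? /= [].
have Ql i x : box r 0 x -> (fun k => meval (disp 0 x) (Q i k)) @ \oo --> rho x 0 i.
  by rewrite /Q; case: cid => ? /= [_ _]; apply.
pose M' := `|M| + 1.
have M'0 : 0 < M' by rewrite /M' ltr_wpDl.
have MM' : M <= M' by rewrite /M' (le_trans (ler_norm M)) // lerDl.
(* At this radius every approximation of rho has norm at most s' / 4, because (s' / r)^2 M' <= s' /
   4. *)
pose s' := Num.min r (r ^+ 2 / (4 * M')).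
have s'0 : 0 < s' by rewrite lt_min r0 /= divr_gt0 ?exprn_gt0 // mulr_gt0.
have s'r : s' <= r by rewrite ge_min lexx.
have QS i k : pnorm s' (Q i k) <= s' / 4.
  apply: (le_trans (QM i k s' (ltW s'0) s'r)).
  apply: (@le_trans _ _ ((s' / r) ^+ 2 * M')).
    by rewrite ler_wpM2l // exprn_ge0 // divr_ge0 // ltW.
  have : s' <= r ^+ 2 / (4 * M') by rewrite ge_min lexx orbT.
  rewrite ler_pdivlMr ?mulr_gt0 // => H.
  rewrite expr_div_n mulrAC ler_pdivrMr ?exprn_gt0 //.
  have := ler_wpM2l (ltW s'0) H; rewrite !expr2; lra.
(* The iterates keep norm at most s because t + s' / 4 = s, and there the approximations of rho have
   Lipschitz constant (s' / 4) / (s' - s) = 1/2. *)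
pose s := s' / 2; pose t := s / 2.
have s0 : 0 < s by rewrite divr_gt0.
have t0 : 0 < t by rewrite divr_gt0.
have ss' : s < s' by rewrite /s; lra.
pose X := picard Q.
have XS k i : pnorm t (tnth (X k) i) <= s.
  elim: k i => [|k ih] i; first by rewrite tnth_mktuple pnorm0 ltW.
  rewrite tnth_mktuple; apply: le_trans (pnormB (ltW t0) _ _) _.
  rewrite pnorm_var; have := @pnorm_comp R n n t s (Q i k) (X k) (ltW t0) (ltW s0) ih.
  have := pnorm_le (Q i k) (ltW s0) (ltW ss'); have := QS i k.
  by rewrite /t /s -/X; lra.
have Lip i k d (A B : n.-tuple (mpoly n R)) : 0 <= d ->
    (forall i, pnorm t (tnth A i) <= s) -> (forall i, pnorm t (tnth B i) <= s) ->
    (forall i, pnorm t (tnth A i - tnth B i) <= d) ->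
    pnorm t (comp_mpoly A (Q i k) - comp_mpoly B (Q i k)) <= d / 2.
  move=> d0 As Bs AB.
  apply: (le_trans (pnorm_lipschitz (Q i k) (ltW t0) (ltW s0) ss' As Bs AB d0)).
  rewrite ler_pdivrMr ?subr_gt0 //.
  have := ler_wpM2r d0 (QS i k); rewrite /s; lra.
have cX i : pcauchy t (fun k => tnth (X k) i).
  move=> e e0; have e4 : 0 < e / 4 by rewrite divr_gt0.
  have [N HN] : exists N, forall i p q, (N <= p)%N -> (N <= q)%N ->
      pnorm r (Q i p - Q i q) <= e / 4.
    pose K i := sval (cid (cQ i _ e4)).
    exists (\max_i K i)%N => l p q Kp Kq.
    have := leq_bigmax l (F := K); rewrite {1}/K; case: cid => k0 /= hk Kl.
    by apply: hk; [apply: leq_trans Kp|apply: leq_trans Kq].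
  (* Each step halves the bound, up to an error e / 4 from exchanging one approximation of rho for
     another; e / 2 is the fixed point of this recursion. *)
  have H m l p q : pnorm t (tnth (X (N + m + p)%N) l - tnth (X (N + m + q)%N) l) <=
      e / 2 + 2 * s * 2^-1 ^+ m.
    elim: m l p q => [|m ih] l p q.
      rewrite expr0 mulr1; apply: (le_trans (pnormB (ltW t0) _ _)).
      have := XS (N + 0 + p)%N l; have := XS (N + 0 + q)%N l; lra.
    rewrite !addnS !addSn /= !tnth_mktuple -/X.
    set u := (N + m + p)%N; set v := (N + m + q)%N.
    have -> : polyvar R l - comp_mpoly (X u) (Q l u) - (polyvar R l - comp_mpoly (X v) (Q l v))
      = (comp_mpoly (X v) (Q l v - Q l u)) - (comp_mpoly (X u) (Q l u) - comp_mpoly (X v) (Q l u)).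
      rewrite comp_mpolyB !opprB [RHS]addrA subrK [LHS]addrC [LHS]addrA.
      by rewrite subrK.
    apply: (le_trans (pnormB (ltW t0) _ _)).
    have H1 : pnorm t (comp_mpoly (X v) (Q l v - Q l u)) <= e / 4.
      apply: (le_trans (pnorm_comp _ (ltW t0) (ltW s0) (XS v))).
      apply: (@le_trans _ _ (pnorm r (Q l v - Q l u))).
        by apply: pnorm_le; rewrite ?(ltW s0) // ltW // (lt_le_trans ss').
      by apply: HN; rewrite /u /v -addnA leq_addr.
    have H2 : pnorm t (comp_mpoly (X u) (Q l u) - comp_mpoly (X v) (Q l u)) <=
        (e / 2 + 2 * s * 2^-1 ^+ m) / 2.
      apply: Lip; [|exact: XS|exact: XS|by move=> i'; exact: ih].
      by rewrite addr_ge0 ?divr_ge0 ?(ltW e0) // !mulr_ge0 ?exprn_ge0 ?invr_ge0 // ltW.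
    by rewrite exprS; lra.
  have [m Hm] : exists m, 2 * s * 2^-1 ^+ m <= e / 2.
    have L : (fun m => 2 * s * (2^-1 : R) ^+ m) @ \oo --> (0 : R).
      rewrite -[X in _ --> X](mulr0 (2 * s)).
      apply: cvgM; [exact: cvg_cst|apply: cvg_expr]; rewrite ger0_norm ?invr_ge0 //.
      by rewrite invf_lt1 // ltr1n.
    have e2 : 0 < e / 2 by rewrite divr_gt0.
    have /cvgrPdist_le/(_ _ e2)[m _ /(_ m (leqnn m))] := L.
    by rewrite sub0r normrN => h; exists m; apply: le_trans (ler_norm _) h.
  exists (N + m)%N => p q Np Nq; have := H m i (p - (N + m))%N (q - (N + m))%N.
  rewrite !subnKC // => h; apply: (le_trans h).
  by lra.
pose xi (y : 'rV[R]_n) : 'rV[R]_n :=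
  \row_i lim ((fun k => meval (disp 0 y) (tnth (X k) i)) @ \oo).
have xiP y i : box t 0 y ->
    (fun k => meval (disp 0 y) (tnth (X k) i)) @ \oo --> xi y 0 i.
  by move=> yt; rewrite mxE; apply: (pcauchy_cvg (ltW t0) (cX i)).
have axi i : adisc t s 0 (fun y => xi y 0 i).
  exists (fun k => tnth (X k) i); split=> // y yt; exact: xiP.
have xis y : box t 0 y -> box s 0 (xi y).
  by move=> yt i; rewrite [X in _ - X]mxE subr0; apply: (adisc_bound (ltW t0) (axi i) yt).
exists s, t, xi; split=> //.
  move=> y yt; split; first exact: xis.
  apply/rowP => i; rewrite mxE.
  have C1 : (fun k => meval (disp 0 y) (tnth (X k.+1) i)) @ \oo --> xi y 0 i.
    by have := xiP y i yt; rewrite -(cvg_shiftn 1); under eq_fun do rewrite addn1.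
  have C2 : (fun k => meval (disp 0 y) (tnth (X k.+1) i)) @ \oo --> y 0 i - rho (xi y) 0 i.
    have E k : X k = [tuple tnth (X k) i | i < n].
      by apply: eq_from_tnth => j; rewrite tnth_mktuple.
    have E2 k : meval (disp 0 y) (tnth (X k.+1) i) = y 0 i -
        meval (disp 0 y) (comp_mpoly [tuple tnth (X k) i | i < n] (Q i k)).
      by rewrite tnth_mktuple mevalB mevalXU /disp mxE subr0 -E.
    under eq_fun do rewrite E2.
    apply: cvgB; first exact: cvg_cst.
    have xr : box r 0 (xi y) by apply: box_le (xis y yt); rewrite (le_trans (ltW ss')).
    apply: (@comp_meval_cvg R n n s (s' / 4) s' 0 y 0 (xi y) (Q i) (fun i k => tnth (X k) i)) => //.
    - exact: ltW.
    - exact: Ql.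
    - move=> j k; apply: le_trans (XS k j); apply: pnorm_eval; first exact: ltW.
      exact: yt.
    - exact: xis.
    - by move=> j; rewrite [X in _ - X]mxE subr0; apply: xiP.
  have -> : xi y 0 i = y 0 i - rho (xi y) 0 i by apply: cvg_unique C1 C2.
  by rewrite subrK.
move=> u v us vs E.
pose d := `|u - v|.
have duv i : `|u 0 i - v 0 i| <= d by have := rv_norm_coord (u - v) i; rewrite !mxE.
have ur : box r 0 u by apply: box_le us; rewrite (le_trans (ltW ss')).
have vr : box r 0 v by apply: box_le vs; rewrite (le_trans (ltW ss')).
have H i : `|rho u 0 i - rho v 0 i| <= d / 2.
  have C : (fun k => meval (disp 0 u) (Q i k) - meval (disp 0 v) (Q i k)) @ \oo -->
    rho u 0 i - rho v 0 i by apply: cvgB; apply: Ql.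
  apply: (cvgr_to_le (cvg_norm C)); near=> k.
  apply: (le_trans (pnorm_eval_lipschitz (Q i k) (ltW s0) ss' us vs _ (normr_ge0 (u - v)))).
    by move=> j; have -> : disp 0 u j - disp 0 v j = u 0 j - v 0 j by [rewrite /disp; lra]; exact: duv.
  rewrite ler_pdivrMr ?subr_gt0 // -/d.
  have := ler_wpM2r (normr_ge0 (u - v)) (QS i k); rewrite -/d /s; lra.
have dd : d <= d / 2.
  apply: rv_norm_le => [|i]; first exact: divr_ge0 (normr_ge0 _) (ler0n _ _).
  rewrite !mxE; have -> : u 0 i - v 0 i = rho v 0 i - rho u 0 i.
    by have /rowP/(_ i) := E; rewrite !mxE; lra.
  by rewrite distrC.
have d0 : d <= 0 by lra.
by apply/eqP; rewrite -subr_eq0 -normr_le0.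
Unshelve. all: by end_near. Qed.

End InverseFunction.

(** * Germs of analytic functions and the inverse function theorem *)

Section AnalyticAt.
Variable R : realType.

Lemma analytic_at_family n k (g : 'I_k -> 'rV[R]_n -> R) (a : 'rV[R]_n) :
  (forall i, analytic_at a (g i)) ->
  exists r M, [/\ 0 < r, 0 <= M & forall i, adisc r M a (g i)].
Proof.
move=> ag; pose r i := sval (cid (ag i)).
have H i : exists M, 0 < r i /\ adisc (r i) M a (g i) by exact: (svalP (cid (ag i))).
pose M i := sval (cid (H i)).
have r0 i : 0 < r i by case: (H i) => N [].
have aM i : adisc (r i) (M i) a (g i) by have [] := svalP (cid (H i)).
(* The inverse of a sum of inverses lies below every radius, also when the family is empty. *)
pose S := 1 + \sum_i (r i)^-1.
have S1 : 1 <= S by rewrite lerDl sumr_ge0 // => i _; rewrite invr_ge0 ltW.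
have S0 : 0 < S by lra.
exists S^-1, (\sum_i `|M i|); split; [by rewrite invr_gt0|exact: sumr_ge0|move=> i].
apply: adisc_le (aM i); first by rewrite invr_ge0 ltW.
  rewrite -[r i]invrK lef_pV2 ?posrE ?invr_gt0 // /S (bigD1 i) //=.
  rewrite addrCA lerDl addr_ge0 // sumr_ge0 // => j _; by rewrite invr_ge0 ltW.
by rewrite (bigD1 i) //= (le_trans (ler_norm _)) // lerDl sumr_ge0.
Qed.

Lemma analytic_at_ext n (f g : 'rV[R]_n -> R) (a : 'rV[R]_n) :
  (\forall x \near a, f x = g x) -> analytic_at a f -> analytic_at a g.
Proof.
move=> /near_box[s s0 fg] [r [M [r0 af]]]; exists (Num.min r s), M.
have m0 : 0 < Num.min r s by rewrite lt_min r0.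
split=> //; apply: (@adisc_ext _ _ _ _ _ f).
  by move=> x xa; apply: fg; apply: box_le xa; rewrite ge_min lexx orbT.
by apply: adisc_le af => //; rewrite ?ge_min ?lexx // ltW.
Qed.

Lemma near_forall n k (a : 'rV[R]_n) (P : 'I_k -> set 'rV[R]_n) :
  (forall i, \forall x \near a, P i x) -> \forall x \near a, forall i, P i x.
Proof. by move=> H; apply: (@filter_forall _ _ P (nbhs a) (nbhs_filter a)). Qed.

Lemma analytic_at_close n k (a : 'rV[R]_n) (th : 'rV[R]_n -> 'rV[R]_k) (t : R) : 0 < t ->
  (forall i, analytic_at a (fun x => th x 0 i)) -> \forall x \near a, box t (th a) (th x).
Proof.
move=> t0 ath; apply: (@near_forall _ _ _ (fun i x => `|th x 0 i - th a 0 i| <= t)) => i.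
have [r [M [r0 ag]]] := ath i.
have := differentiable_continuous (adisc_diff (lexx 0) r0 ag (box_refl a (lexx 0))).
move=> /cvgrPdist_le/(_ _ t0) H.
by near=> x; rewrite distrC; near: x.
Unshelve. all: by end_near. Qed.

Lemma analytic_at_cst n (a : 'rV[R]_n) c : analytic_at a (fun=> c).
Proof. by exists 1, `|c|; split=> //; apply: adisc_cst. Qed.

Lemma analytic_at_coord n (a : 'rV[R]_n) i : analytic_at a (fun x => x 0 i).
Proof. by exists 1, (`|a 0 i| + 1); split=> //; apply: adisc_coord. Qed.

Lemma analytic_at_op2 n (a : 'rV[R]_n) (f g : 'rV[R]_n -> R) :
  analytic_at a f -> analytic_at a g ->
  exists r M, [/\ 0 < r, adisc r M a f & adisc r M a g].
Proof.
move=> af ag; have [|r [M [r0 M0 H]]] :=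
  @analytic_at_family n 2 (fun i => if i == ord0 then f else g) a.
  by move=> i; case: ifP.
by exists r, M; split; [|exact: (H ord0)|exact: (H ord_max)].
Qed.

Lemma analytic_atD n (a : 'rV[R]_n) f g : analytic_at a f -> analytic_at a g ->
  analytic_at a (fun x => f x + g x).
Proof.
move=> af ag; have [r [M [r0 f1 g1]]] := analytic_at_op2 af ag.
by exists r, (M + M); split=> //; apply: adiscD => //; apply: ltW.
Qed.

Lemma analytic_atM n (a : 'rV[R]_n) f g : analytic_at a f -> analytic_at a g ->
  analytic_at a (fun x => f x * g x).
Proof.
move=> af ag; have [r [M [r0 f1 g1]]] := analytic_at_op2 af ag.
by exists r, (M * M); split=> //; apply: adiscM => //; apply: ltW.
Qed.

Lemma analytic_atN n (a : 'rV[R]_n) f : analytic_at a f -> analytic_at a (fun x => - f x).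
Proof. by move=> [r [M [r0 h]]]; exists r, M; split=> //; apply: adiscN => //; apply: ltW. Qed.

Lemma analytic_atB n (a : 'rV[R]_n) f g : analytic_at a f -> analytic_at a g ->
  analytic_at a (fun x => f x - g x).
Proof. by move=> af ag; apply: analytic_atD => //; apply: analytic_atN. Qed.

Lemma analytic_at_sum n (a : 'rV[R]_n) (I : Type) (s : seq I) (f : I -> 'rV[R]_n -> R) :
  (forall i, analytic_at a (f i)) -> analytic_at a (fun x => \sum_(i <- s) f i x).
Proof.
move=> af; elim: s => [|i s ih].
  by under eq_fun do rewrite big_nil; apply: analytic_at_cst.
by under eq_fun do rewrite big_cons; apply: analytic_atD.
Qed.

Lemma analytic_at_meval n k (a : 'rV[R]_n) (P : mpoly k R) (f : 'I_k -> 'rV[R]_n -> R) :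
  (forall i, analytic_at a (f i)) -> analytic_at a (fun x => meval (fun i => f i x) P).
Proof.
move=> af; elim/mpoly_ring_ind: P => [c|i|P Q aP aQ|P Q aP aQ].
- by under eq_fun do rewrite mevalC; apply: analytic_at_cst.
- by under eq_fun do rewrite mevalXU.
- by under eq_fun do rewrite mevalD; apply: analytic_atD.
- by under eq_fun do rewrite mevalM; apply: analytic_atM.
Qed.

Lemma analytic_at_diff n (a : 'rV[R]_n) g : analytic_at a g -> differentiable g a.
Proof. by move=> [r [M [r0 ag]]]; apply: (adisc_diff (lexx 0) r0 ag); apply: box_refl. Qed.

Lemma analytic_at_cvg n (a : 'rV[R]_n) g : analytic_at a g -> {for a, continuous g}.
Proof. by move=> /analytic_at_diff/differentiable_continuous. Qed.

Lemma analytic_at_near n (a : 'rV[R]_n) g : analytic_at a g ->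
  \forall x \near a, analytic_at x g.
Proof.
move=> [r [M [r0 ag]]]; apply/near_box; exists (r / 2); first by rewrite divr_gt0.
move=> x xa; exists (r - r / 2), M; split; first by lra.
by apply: adisc_recenter ag xa; lra.
Qed.

Lemma analytic_at_pd n (a : 'rV[R]_n) i g : analytic_at a g -> analytic_at a (pd i g).
Proof.
move=> [r [M [r0 ag]]]; exists (r / 2), (M / (r - r / 2)); split; first by rewrite divr_gt0.
by apply: adisc_pd => //; lra.
Qed.

Lemma analytic_at_lie n (a : 'rV[R]_n) (f : 'rV[R]_n -> 'rV[R]_n) g : analytic_at a g ->
  (forall i, analytic_at a (fun x => f x 0 i)) -> analytic_at a (lie_deriv f g).
Proof.
move=> ag af; rewrite (_ : lie_deriv f g = fun x => \sum_i f x 0 i * pd i g x); last first.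
  by apply/funext => x; rewrite lie_pdE.
by apply: analytic_at_sum => i; apply: analytic_atM => //; apply: analytic_at_pd.
Qed.

Lemma analytic_at_comp n k (a : 'rV[R]_k) (th : 'rV[R]_k -> 'rV[R]_n) (g : 'rV[R]_n -> R) :
  (forall i, analytic_at a (fun x => th x 0 i)) -> analytic_at (th a) g ->
  analytic_at a (fun x => g (th x)).
Proof.
move=> ath [N [M [N0 ag]]].
have [|r [L [r0 L0 H]]] := @analytic_at_family k n (fun i x => th x 0 i - th a 0 i) a.
  by move=> i; apply: analytic_atB => //; apply: analytic_at_cst.
(* By [adisc_shrink] this radius keeps the displacement of th below N / 2, inside the polydisc of
   g. *)
pose q := Num.min r (r * N / (4 * (L + 1))).
have q0 : 0 < q.
  by rewrite lt_min r0 /= divr_gt0 // mulr_gt0 //; lra.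
have qr : q <= r by rewrite ge_min lexx.
have qL : q / r * (L + L) <= N / 2.
  have : q <= r * N / (4 * (L + 1)) by rewrite ge_min lexx orbT.
  rewrite ler_pdivlMr; last by lra.
  move=> h; rewrite mulrAC ler_pdivrMr //; nra.
exists q, M; split=> //.
apply: (@adisc_comp R n k q (N / 2) M N a (th a) g th) => //; try lra.
move=> i; apply: (@adisc_le _ _ q q _ (N / 2) _ _ (ltW q0) (lexx q) qL).
by apply: (adisc_shrink r0 (ltW q0) qr (H i)); rewrite subrr.
Qed.

(* the Jacobian acts on row vectors from the right *)
Definition jac n k (b : 'rV[R]_n -> 'rV[R]_k) (a : 'rV[R]_n) : 'M[R]_(n, k) :=
  \matrix_(i, j) pd i (fun x => b x 0 j) a.

Lemma pd_coord n (i j : 'I_n) (a : 'rV[R]_n) : pd i (fun x => x 0 j) a = (i == j)%:R.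
Proof.
have [_ E] : differentiable (fun x : 'rV[R]_n => x 0 j) a /\
    forall v, 'd (fun x : 'rV[R]_n => x 0 j) a v = \sum_k v 0 k * (k == j)%:R.
  apply: differentiable_rv => e e0; exists 1 => // h d d0 _ hd.
  rewrite (bigD1 j) //= eqxx mulr1 big1 => [|k kj]; last by rewrite (negbTE kj) mulr0.
  rewrite mxE (_ : _ - _ - _ = 0); last by lra.
  by rewrite normr0 mulr_ge0 // ltW.
rewrite /pd E (bigD1 i) //= big1 ?addr0 => [|k ki]; rewrite !mxE eqxx /=.
  by rewrite eqxx mul1r.
by rewrite (negbTE ki) mul0r.
Qed.

Lemma diff_cst0 n c (a v : 'rV[R]_n) : 'd (fun=> c : R) a v = 0.
Proof. by rewrite (_ : (fun=> c) = cst c) // diff_cst. Qed.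

Lemma diff_sumE n (I : Type) (s : seq I) (f : I -> 'rV[R]_n -> R) (a v : 'rV[R]_n) :
  (forall i, differentiable (f i) a) ->
  differentiable (fun x => \sum_(i <- s) f i x) a /\
  'd (fun x => \sum_(i <- s) f i x) a v = \sum_(i <- s) 'd (f i) a v.
Proof.
move=> df; elim: s => [|i s [ih1 ih2]].
  by under eq_fun do rewrite big_nil; rewrite big_nil diff_cst0; split=> //; apply: differentiable_cst.
under eq_fun do rewrite big_cons.
rewrite big_cons diffDE // ih2; split=> //; exact: differentiableD.
Qed.

Lemma diff_mulC n c (f : 'rV[R]_n -> R) (a v : 'rV[R]_n) : differentiable f a ->
  differentiable (fun x => f x * c) a /\ 'd (fun x => f x * c) a v = 'd f a v * c.
Proof.
move=> df; have dc : differentiable (fun _ : 'rV[R]_n => c) a by apply: differentiable_cst.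
by split; [exact: differentiableM|rewrite diffME // diff_cst0 mulr0 add0r mulrC].
Qed.

Lemma diff_rowE n k (b : 'rV[R]_n -> 'rV[R]_k) (a v : 'rV[R]_n) :
  (forall j, differentiable (fun x => b x 0 j) a) ->
  differentiable b a /\ 'd b a v = \row_j 'd (fun x => b x 0 j) a v.
Proof.
move=> db.
have E : b = (fun x => \sum_j b x 0 j *: delta_mx 0 j) by apply/funext => x; apply: row_sum_delta.
have D j : is_diff a (fun x => b x 0 j *: (delta_mx 0 j : 'rV[R]_k))
   (fun v => 'd (fun x => b x 0 j) a v *: (delta_mx 0 j : 'rV[R]_k)).
  have := is_diff_comp (differentiableP (db j)) (is_diff_scalel (b a 0 j) (delta_mx 0 j : 'rV[R]_k)).
  by [].
have {}D : is_diff a (\sum_j (fun x => b x 0 j *: (delta_mx 0 j : 'rV[R]_k)))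
   (\sum_j (fun v => 'd (fun x => b x 0 j) a v *: (delta_mx 0 j : 'rV[R]_k))).
  elim/big_ind2: _ => //; first exact: is_diff_cst.
  by move=> f1 f2 g1 g2 d1 d2; apply: is_diffD.
have E2 : b = \sum_j (fun x => b x 0 j *: (delta_mx 0 j : 'rV[R]_k)).
  by rewrite {1}E; apply/funext => x; rewrite fct_sumE.
split; first by rewrite E2; case: D.
rewrite {1}E2 diff_val fct_sumE [RHS]row_sum_delta; apply: eq_bigr => j _.
by rewrite mxE.
Qed.

Lemma diff_compE n k (b : 'rV[R]_n -> 'rV[R]_k) (g : 'rV[R]_k -> R) (a v : 'rV[R]_n) :
  (forall j, differentiable (fun x => b x 0 j) a) -> differentiable g (b a) ->
  differentiable (fun x => g (b x)) a /\
  'd (fun x => g (b x)) a v = 'd g (b a) (\row_j 'd (fun x => b x 0 j) a v).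
Proof.
move=> db dg; have [db' E] := diff_rowE v db.
split; first exact: (differentiable_comp db' dg).
by rewrite -E -[fun x => _]/(g \o b) diff_comp.
Qed.

Lemma adisc_shift n r M (a : 'rV[R]_n) g : adisc r M a g -> adisc r M 0 (fun u => g (a + u)).
Proof.
move=> [P [PM cP Pg]]; exists P; split=> // u u0.
have -> : disp 0 u = disp a (a + u) by apply/funext => i; rewrite /disp !mxE subr0 addrAC subrr add0r.
by apply: Pg => i; have := u0 i; rewrite !mxE subr0 addrAC subrr add0r.
Qed.

(** Translating by a and multiplying by the inverse Jacobian K normalises b to the identity plus a
    term rho of order two. *)
Theorem inverse_function n (b : 'rV[R]_n -> 'rV[R]_n) (a : 'rV[R]_n) :
  (forall i, analytic_at a (fun x => b x 0 i)) -> jac b a \in unitmx ->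
  exists psi : 'rV[R]_n -> 'rV[R]_n,
    [/\ forall i, analytic_at (b a) (fun y => psi y 0 i), psi (b a) = a,
        \forall y \near b a, b (psi y) = y & \forall x \near a, psi (b x) = x].
Proof.
move=> ab Ju; set J := jac b a; pose K := invmx J.
pose rho (u : 'rV[R]_n) := (b (a + u) - b a) *m K - u.
have bm i u : rho u 0 i = \sum_j (b (a + u) 0 j - b a 0 j) * K j i - u 0 i.
  by rewrite !mxE; congr (_ - _); apply: eq_bigr => j _; rewrite !mxE.
have ab0 j : analytic_at 0 (fun u => b (a + u) 0 j).
  by have [r [M [r0 /adisc_shift h]]] := ab j; exists r, M.
have arho i : analytic_at 0 (fun u => rho u 0 i).
  rewrite (_ : (fun u => rho u 0 i) = fun u => \sum_j (b (a + u) 0 j - b a 0 j) * K j i - u 0 i).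
    apply: analytic_atB; last exact: analytic_at_coord.
    apply: analytic_at_sum => j; apply: analytic_atM; last exact: analytic_at_cst.
    by apply: analytic_atB => //; apply: analytic_at_cst.
  by apply/funext => u; rewrite bm.
have [r [M [r0 M0 ar]]] := analytic_at_family arho.
have rho0 : rho 0 = 0 by rewrite /rho addr0 subrr mul0mx subr0.
have pdb i j : pd i (fun u => b (a + u) 0 j) 0 = J i j.
  have [] := @diff_compE n n (fun u => a + u) (fun x => b x 0 j) 0 (delta_mx 0 i).
  - move=> k; under eq_fun do rewrite mxE.
    apply: differentiableD; first exact: differentiable_cst.
    exact: differentiable_coord.
  - by rewrite addr0; apply: analytic_at_diff.
  move=> _; rewrite {1}/pd => ->; rewrite addr0 mxE /pd; congr ('d _ a _).
  apply/rowP => k; rewrite mxE.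
  under eq_fun do rewrite mxE.
  rewrite diffDE; [|exact: differentiable_cst|exact: differentiable_coord].
  by rewrite diff_cst0 add0r -[LHS]/(pd i (fun x => x 0 k) 0) pd_coord !mxE eqxx eq_sym.
have drho i j : pd i (fun u => rho u 0 j) 0 = 0.
  have db k : differentiable (fun u : 'rV_n => b (a + u) 0 k) 0 by apply: analytic_at_diff.
  have dc c : differentiable (fun _ : 'rV[R]_n => c : R) 0 by apply: differentiable_cst.
  have T k : differentiable (fun u => (b (a + u) 0 k - b a 0 k) * K k j) 0 /\
     'd (fun u => (b (a + u) 0 k - b a 0 k) * K k j) 0 (delta_mx 0 i) = J i k * K k j.
    have [|d1 e1] := @diff_mulC n (K k j) (fun u => b (a + u) 0 k - b a 0 k) 0 (delta_mx 0 i).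
      exact: (differentiableB (db k) (dc _)).
    split=> //; rewrite e1 diffDE //.
    by rewrite diff_cst0 addr0 -pdb.
  have [dS eS] := @diff_sumE n _ (index_enum 'I_n)
    (fun k u => (b (a + u) 0 k - b a 0 k) * K k j) 0 (delta_mx 0 i) (fun k => (T k).1).
  rewrite /pd; under eq_fun do rewrite bm.
  have dco := differentiable_coord (0 : 'rV[R]_n) 0 j.
  have dN : differentiable (fun u : 'rV[R]_n => - u 0 j) 0 by apply: differentiableN.
  rewrite diffDE // eS (eq_bigr (fun k => J i k * K k j)); last by move=> k _; case: (T k).
  have -> : (fun u : 'rV[R]_n => - u 0 j) = (fun u => u 0 j * -1).
    by apply/funext => u; rewrite mulrN1.
  have [_ ->] := @diff_mulC n (-1) (fun u => u 0 j) 0 (delta_mx 0 i) dco.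
  have := pd_coord i j (0 : 'rV[R]_n); rewrite /pd => ->.
  have : (J *m K) i j = (i == j)%:R by rewrite mulmxV // mxE.
  by rewrite mxE => ->; rewrite mulrN1 subrr.
have [s [t [xi [[s0 t0] axi xiP inj]]]] := inverse_near_identity r0 ar rho0 drho.
pose eta (y : 'rV[R]_n) := (y - b a) *m K.
have etaE y i : eta y 0 i = \sum_j (y 0 j - b a 0 j) * K j i.
  by rewrite !mxE; apply: eq_bigr => j _; rewrite !mxE.
have aeta i : analytic_at (b a) (fun y => eta y 0 i).
  under eq_fun do rewrite etaE.
  apply: analytic_at_sum => j; apply: analytic_atM; last exact: analytic_at_cst.
  by apply: analytic_atB; [exact: analytic_at_coord|exact: analytic_at_cst].
have eta0 : eta (b a) = 0 by rewrite /eta subrr mul0mx.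
have box0 : box t 0 (0 : 'rV[R]_n) by apply: box_refl; apply: ltW.
have xi0 : xi 0 = 0.
  have [xs xe] := xiP 0 box0.
  by apply: inj => //; [apply: box_refl; apply: ltW|rewrite xe rho0 addr0].
exists (fun y => a + xi (eta y)); split.
- move=> i; under eq_fun do rewrite mxE.
  apply: analytic_atD; first exact: analytic_at_cst.
  apply: (@analytic_at_comp n n (b a) eta (fun y => xi y 0 i)) => //.
  by rewrite eta0; exists t, s.
- by rewrite eta0 xi0 addr0.
- have := @analytic_at_close n n (b a) eta t t0 aeta; rewrite eta0.
  apply: filterS => y yt.
  have [xs] := xiP _ yt; rewrite /rho addrCA subrr addr0 => E.
  have : (b (a + xi (eta y)) - b a) *m K *m J = eta y *m J by rewrite E.
  by rewrite /eta !mulmxKV // => /addIr.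
- have := @analytic_at_close n n a (fun x => eta (b x)) t t0; rewrite eta0 => H.
  have {}H := H (fun i => @analytic_at_comp n n a b (fun y => eta y 0 i) ab (aeta i)).
  have bs : \forall x \near a, box s a x by apply/near_box; exists s.
  apply: filterS2 bs H => x xs yt.
  have [xis xe] := xiP _ yt.
  have xa0 : box s 0 (x - a) by move=> i; rewrite !mxE subr0; apply: xs.
  rewrite (inj _ (x - a) xis xa0); first by rewrite addrC subrK.
  by rewrite xe /rho [a + _]addrC subrK addrCA subrr addr0.
Qed.

End AnalyticAt.

(** * Semialgebraic sets and quantifier elimination *)

Section TarskiSeidenberg.
Variable R : realType.
Import ordered_qelim.

(** The valuation of the first n variables of a formula by the coordinates of x. *)
Definition rv_seq n (x : 'rV[R]_n) : seq R := [seq x 0 i | i <- enum 'I_n].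

Lemma size_rv_seq n (x : 'rV[R]_n) : size (rv_seq x) = n.
Proof. by rewrite size_map size_enum_ord. Qed.

Lemma nth_rv_seq n (x : 'rV[R]_n) (i : 'I_n) : (rv_seq x)`_i = x 0 i.
Proof. by rewrite (nth_map i) ?size_enum_ord // nth_ord_enum. Qed.

Lemma rv_seq_row_mx n k (x : 'rV[R]_n) (y : 'rV[R]_k) :
  rv_seq (row_mx x y) = rv_seq x ++ rv_seq y.
Proof.
apply: (@eq_from_nth _ 0) => [|j]; rewrite size_rv_seq ?size_cat ?size_rv_seq // => jnk.
rewrite -[j]/(nat_of_ord (Ordinal jnk)) nth_rv_seq nth_cat size_rv_seq /= mxE.
case: splitP => i /= ->; first by rewrite ltn_ord nth_rv_seq.
by rewrite ltnNge leq_addr /= addKn nth_rv_seq.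
Qed.

Lemma rv_seq_surj n (s : seq R) : size s = n -> exists x : 'rV[R]_n, rv_seq x = s.
Proof.
move=> sn; exists (\row_i s`_i); apply: (@eq_from_nth _ 0); rewrite size_rv_seq // => j jn.
by rewrite -[j in LHS]/(nat_of_ord (Ordinal jn)) nth_rv_seq mxE.
Qed.

Lemma rterm_mpoly n (t : GRing.term R) : GRing.rterm t ->
  exists P : mpoly n R, forall x : 'rV[R]_n,
    GRing.eval (rv_seq x) t = meval (fun i => x 0 i) P.
Proof.
elim: t => //=.
- move=> k _; case: (ltnP k n) => kn.
    exists (polyvar R (Ordinal kn)) => x; rewrite mevalXU.
    by rewrite -[k]/(nat_of_ord (Ordinal kn)) nth_rv_seq.
  by exists 0 => x; rewrite meval0 nth_default // size_rv_seq.
- by move=> c _; exists (mpolyC n c) => x; rewrite mevalC.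
- by move=> k _; exists (mpolyC n k%:R) => x; rewrite mevalC.
- move=> t1 ih1 t2 ih2 /andP[/ih1[P1 h1] /ih2[P2 h2]].
  by exists (P1 + P2) => x; rewrite mevalD h1 h2.
- by move=> t1 ih1 /ih1[P1 h1]; exists (- P1) => x; rewrite mevalN h1.
- by move=> t1 ih1 k /ih1[P1 h1]; exists (P1 *+ k) => x; rewrite mevalMn h1.
- move=> t1 ih1 t2 ih2 /andP[/ih1[P1 h1] /ih2[P2 h2]].
  by exists (P1 * P2) => x; rewrite mevalM h1 h2.
- by move=> t1 ih1 k /ih1[P1 h1]; exists (P1 ^+ k) => x; rewrite rmorphXn h1.
Qed.

(** The tail s makes room for later variables, which quantifiers append to the valuation. *)
Lemma mpoly_rterm n (P : mpoly n R) : exists t : GRing.term R,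
  forall x : 'rV[R]_n, forall s, GRing.eval (rv_seq x ++ s) t = meval (fun i => x 0 i) P.
Proof.
elim/mpoly_ring_ind: P => [c|i|P Q [t1 h1] [t2 h2]|P Q [t1 h1] [t2 h2]].
- by exists (GRing.Const c) => x s; rewrite mevalC.
- exists (GRing.Var _ i) => x s; rewrite mevalXU /= nth_cat size_rv_seq ltn_ord.
  exact: nth_rv_seq.
- by exists (GRing.Add t1 t2) => x s; rewrite mevalD /= h1 h2.
- by exists (GRing.Mul t1 t2) => x s; rewrite mevalM /= h1 h2.
Qed.

Lemma sa_eq0 n (P : mpoly n R) :
  semialgebraic [set x : 'rV[R]_n | meval (fun i => x 0 i) P = 0].
Proof.
rewrite (_ : [set x | _] = ~` ([set x : 'rV[R]_n | 0 < meval (fun i => x 0 i) P] `|`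
    [set x : 'rV[R]_n | 0 < meval (fun i => x 0 i) (- P)])).
  by apply/semialgebraicC/semialgebraicU; apply: semialgebraic_pos.
apply/seteqP; split=> x /=.
  by move=> P0; rewrite mevalN P0 oppr0 ltxx => -[].
rewrite mevalN oppr_gt0 => H; apply/eqP; rewrite eq_le !leNgt.
by apply/andP; split; apply/negP => h; apply: H; [left|right].
Qed.

Lemma saT n : semialgebraic [set: 'rV[R]_n].
Proof.
rewrite (_ : setT = [set x : 'rV[R]_n | meval (fun i => x 0 i) (0 : mpoly n R) = 0]).
  exact: sa_eq0.
by apply/seteqP; split=> x //= _; rewrite meval0.
Qed.

Lemma sa0 n : semialgebraic (@set0 'rV[R]_n).
Proof. by rewrite -setCT; apply/semialgebraicC/saT. Qed.

Lemma qf_semialgebraic n (f : ord.formula R) : ord.qf_form f -> ord.rformula f ->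
  semialgebraic [set x : 'rV[R]_n | ord.qf_eval (rv_seq x) f].
Proof.
elim: f => //=.
- by case=> _ _; [rewrite (_ : [set _ | _] = setT); first exact: saT; apply/seteqP; split
    |rewrite (_ : [set _ | _] = set0); first exact: sa0; apply/seteqP; split].
- move=> t1 t2 _ /andP[/(rterm_mpoly n)[P1 h1] /(rterm_mpoly n)[P2 h2]].
  rewrite (_ : [set _ | _] = [set x : 'rV[R]_n | meval (fun i => x 0 i) (P1 - P2) = 0]).
    exact: sa_eq0.
  apply/seteqP; split=> x /=; rewrite mevalB h1 h2.
    by move=> /eqP ->; rewrite subrr.
  by move=> /eqP; rewrite subr_eq0.
- move=> t1 t2 _ /andP[/(rterm_mpoly n)[P1 h1] /(rterm_mpoly n)[P2 h2]].
  rewrite (_ : [set _ | _] = [set x : 'rV[R]_n | 0 < meval (fun i => x 0 i) (P2 - P1)]).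
    exact: semialgebraic_pos.
  by apply/seteqP; split=> x /=; rewrite mevalB h1 h2 subr_gt0.
- move=> t1 t2 _ /andP[/(rterm_mpoly n)[P1 h1] /(rterm_mpoly n)[P2 h2]].
  rewrite (_ : [set _ | _] = ~` [set x : 'rV[R]_n | 0 < meval (fun i => x 0 i) (P1 - P2)]).
    exact/semialgebraicC/semialgebraic_pos.
  by apply/seteqP; split=> x /=; rewrite mevalB h1 h2 subr_gt0 leNgt => /negP.
- move=> f1 ih1 f2 ih2 /andP[q1 q2] /andP[r1 r2].
  rewrite (_ : [set _ | _] = [set x : 'rV[R]_n | ord.qf_eval (rv_seq x) f1] `&`
     [set x : 'rV[R]_n | ord.qf_eval (rv_seq x) f2]).
    by apply: semialgebraicI; auto.
  by apply/seteqP; split=> x /= /andP.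
- move=> f1 ih1 f2 ih2 /andP[q1 q2] /andP[r1 r2].
  rewrite (_ : [set _ | _] = [set x : 'rV[R]_n | ord.qf_eval (rv_seq x) f1] `|`
     [set x : 'rV[R]_n | ord.qf_eval (rv_seq x) f2]).
    by apply: semialgebraicU; auto.
  by apply/seteqP; split=> x /= /orP.
- move=> f1 ih1 f2 ih2 /andP[q1 q2] /andP[r1 r2].
  rewrite (_ : [set _ | _] = ~` [set x : 'rV[R]_n | ord.qf_eval (rv_seq x) f1] `|`
     [set x : 'rV[R]_n | ord.qf_eval (rv_seq x) f2]).
    by apply: semialgebraicU; [apply: semialgebraicC|]; auto.
  apply/seteqP; split=> x /=; first by case: (ord.qf_eval _ f1) => /=; [right|left].
  by case: (ord.qf_eval _ f1) => //= -[].
- move=> f1 ih1 q1 r1.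
  rewrite (_ : [set _ | _] = ~` [set x : 'rV[R]_n | ord.qf_eval (rv_seq x) f1]).
    by apply: semialgebraicC; auto.
  by apply/seteqP; split=> x /= /negP.
Qed.

(** Quantifier elimination over real closed fields leaves a quantifier-free formula, which
    [qf_semialgebraic] reads as a set. *)
Lemma formula_semialgebraic n (f : ord.formula R) :
  semialgebraic [set x : 'rV[R]_n | ord.holds (rv_seq x) f].
Proof.
pose w k s := qe_rcf.qfr_to_formula (@qe_rcf.wproj R k s).
pose g := ord.quantifier_elim w (ord.to_rform f).
have [qg rg] : ord.qf_form g /\ ord.rformula g.
  apply/andP; apply: (@ord.quantifier_elim_wf R w) => //.
    exact: (@qe_rcf.wf_QE_wproj R).
  exact: ord.to_rform_rformula.
rewrite (_ : [set x | _] = [set x : 'rV[R]_n | ord.qf_eval (rv_seq x) g]).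
  exact: qf_semialgebraic.
by apply/seteqP; split=> x /= /(@qe_rcf.rcf_satP R).
Qed.

Lemma semialgebraic_formula n (A : set 'rV[R]_n) : semialgebraic A ->
  exists f : ord.formula R, forall x s, ord.holds (rv_seq x ++ s) f <-> A x.
Proof.
elim=> [P|B C _ [f1 h1] _ [f2 h2]|B C _ [f1 h1] _ [f2 h2]|B _ [f1 h1]].
- have [t ht] := mpoly_rterm P; exists (ord.Lt (GRing.NatConst _ 0) t) => x s /=.
  by rewrite ht.
- by exists (ord.Or f1 f2) => x s /=; rewrite h1 h2.
- by exists (ord.And f1 f2) => x s /=; rewrite h1 h2.
- by exists (ord.Not f1) => x s /=; rewrite h1.
Qed.

Definition ex_block (n k : nat) (f : ord.formula R) : ord.formula R :=
  foldr (fun i g => ord.Exists i g) f (iota n k).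

Lemma holds_ex_block n k f (e : seq R) : size e = n ->
  ord.holds e (ex_block n k f) <-> exists2 s, size s = k & ord.holds (e ++ s) f.
Proof.
elim: k n e => [|k ih] n e en.
  split=> [h|[s /size0nil ->]]; last by rewrite cats0.
  by exists [::]; rewrite ?cats0.
rewrite /ex_block /=.
(* The valuation has length exactly n, so quantifying variable n appends a value at its end; this is
   why the block starts at n. *)
have E v : set_nth 0 e n v = rcons e v.
  apply: (@eq_from_nth _ 0).
    by rewrite size_set_nth size_rcons en; apply/maxn_idPl.
  move=> i _; rewrite nth_set_nth /= nth_rcons en.
  case: ltngtP => // ni; rewrite ?nth_default ?en ?(ltnW ni) //.
split.
  move=> [v]; rewrite E => /(ih n.+1)[]; first by rewrite size_rcons en.
  by move=> s sk; rewrite cat_rcons => h; exists (v :: s); rewrite //= sk.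
move=> [[//|v s] /= [sk] h]; exists v; rewrite E; apply/(ih n.+1).
  by rewrite size_rcons en.
by exists s => //; rewrite cat_rcons.
Qed.

Lemma sa_ex n k (A : set 'rV[R]_(n + k)) : semialgebraic A ->
  semialgebraic [set x : 'rV[R]_n | exists y : 'rV[R]_k, A (row_mx x y)].
Proof.
move=> /semialgebraic_formula[f hf].
rewrite (_ : [set x | _] = [set x : 'rV[R]_n | ord.holds (rv_seq x) (ex_block n k f)]).
  exact: formula_semialgebraic.
apply/seteqP; split=> x /=.
  move=> [y Ay]; apply/holds_ex_block; first exact: size_rv_seq.
  exists (rv_seq y); first exact: size_rv_seq.
  by rewrite -rv_seq_row_mx -[rv_seq _]cats0; apply/hf.
move/holds_ex_block => /(_ (size_rv_seq x))[s /rv_seq_surj[y <-]].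
by rewrite -rv_seq_row_mx -[rv_seq _]cats0 => /hf; exists y.
Qed.

Definition polyfun n (f : 'rV[R]_n -> R) :=
  exists P : mpoly n R, forall x, f x = meval (fun i => x 0 i) P.

Lemma polyfun_coord n (i : 'I_n) : polyfun (fun x : 'rV[R]_n => x 0 i).
Proof. by exists (polyvar R i) => x; rewrite mevalXU. Qed.

Lemma polyfun_cst n c : polyfun (fun _ : 'rV[R]_n => c).
Proof. by exists (mpolyC n c) => x; rewrite mevalC. Qed.

Lemma polyfunD n (f g : 'rV[R]_n -> R) : polyfun f -> polyfun g -> polyfun (fun x => f x + g x).
Proof. by move=> [P hP] [Q hQ]; exists (P + Q) => x; rewrite mevalD hP hQ. Qed.

Lemma polyfunM n (f g : 'rV[R]_n -> R) : polyfun f -> polyfun g -> polyfun (fun x => f x * g x).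
Proof. by move=> [P hP] [Q hQ]; exists (P * Q) => x; rewrite mevalM hP hQ. Qed.

Lemma polyfunN n (f : 'rV[R]_n -> R) : polyfun f -> polyfun (fun x => - f x).
Proof. by move=> [P hP]; exists (- P) => x; rewrite mevalN hP. Qed.

Lemma polyfunB n (f g : 'rV[R]_n -> R) : polyfun f -> polyfun g -> polyfun (fun x => f x - g x).
Proof. by move=> pf pg; apply: polyfunD => //; apply: polyfunN. Qed.

Lemma sa_lt n (f g : 'rV[R]_n -> R) : polyfun f -> polyfun g ->
  semialgebraic [set x | f x < g x].
Proof.
move=> pf pg; have [P hP] := polyfunB pg pf.
rewrite (_ : [set x | _] = [set x : 'rV[R]_n | 0 < meval (fun i => x 0 i) P]).
  exact: semialgebraic_pos.
by apply/seteqP; split=> x /=; rewrite -hP subr_gt0.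
Qed.

Lemma sa_le n (f g : 'rV[R]_n -> R) : polyfun f -> polyfun g ->
  semialgebraic [set x | f x <= g x].
Proof.
move=> pf pg; rewrite (_ : [set x | _] = ~` [set x | g x < f x]).
  exact/semialgebraicC/sa_lt.
by apply/seteqP; split=> x /=; rewrite leNgt => /negP.
Qed.

Lemma sa_eq n (f g : 'rV[R]_n -> R) : polyfun f -> polyfun g ->
  semialgebraic [set x | f x = g x].
Proof.
move=> pf pg; rewrite (_ : [set x | _] = [set x | g x <= f x] `&` [set x | f x <= g x]).
  by apply: semialgebraicI; apply: sa_le.
apply/seteqP; split=> x /=; first by move=> ->.
by move=> [h1 h2]; apply/eqP; rewrite eq_le h1 h2.
Qed.

Lemma sa_preim n k (A : set 'rV[R]_k) (l : 'rV[R]_n -> 'rV[R]_k) :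
  semialgebraic A -> (forall i, polyfun (fun x => l x 0 i)) ->
  semialgebraic (l @^-1` A).
Proof.
move=> sA pl; pose p i := sval (cid (pl i)).
have pE i x : l x 0 i = meval (fun j => x 0 j) (p i) by exact: (svalP (cid (pl i))).
elim: sA => [P|B C _ h1 _ h2|B C _ h1 _ h2|B _ h1].
- rewrite (_ : _ @^-1` _ = [set x : 'rV[R]_n | 0 < meval (fun j => x 0 j) (comp_mpoly [tuple p i | i < k] P)]).
    exact: semialgebraic_pos.
  have E (x : 'rV[R]_n) : meval (fun j => x 0 j) (comp_mpoly [tuple p i | i < k] P) = meval (fun i => l x 0 i) P.
    by rewrite comp_mpoly_meval; apply: meval_eq => i; rewrite tnth_mktuple pE.
  by apply/seteqP; split=> x /=; rewrite E.
- exact: semialgebraicU h1 h2.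
- exact: semialgebraicI h1 h2.
- exact: semialgebraicC h1.
Qed.

Lemma sa_bigcap n (I : finType) (A : I -> set 'rV[R]_n) : (forall i, semialgebraic (A i)) ->
  semialgebraic [set x | forall i, A i x].
Proof.
move=> sA; have H (s : seq I) : semialgebraic [set x | forall i, i \in s -> A i x].
  elim: s => [|j s ih].
    by rewrite (_ : [set x | _] = setT); [exact: saT|apply/seteqP; split].
  rewrite (_ : [set x | _] = A j `&` [set x | forall i, i \in s -> A i x]).
    exact: semialgebraicI.
  apply/seteqP; split=> x /=.
    by move=> h; split=> [|i si]; apply: h; rewrite inE ?eqxx // si orbT.
  by move=> [h1 h2] i; rewrite inE => /predU1P[->//|]; apply: h2.
rewrite (_ : [set x | _] = [set x | forall i, i \in enum I -> A i x]); first exact: H.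
by apply/seteqP; split=> x /= h i => [_|]; apply: h; rewrite ?mem_enum.
Qed.

End TarskiSeidenberg.

(** * Semialgebraic functions and their partial derivatives *)

Section SemialgebraicFunctions.
Variable R : realType.

Lemma polyfun_row_mx n k1 k2 (p : 'rV[R]_n -> 'rV[R]_k1) (q : 'rV[R]_n -> 'rV[R]_k2) :
  (forall i, polyfun (fun z => p z 0 i)) -> (forall i, polyfun (fun z => q z 0 i)) ->
  forall i, polyfun (fun z => row_mx (p z) (q z) 0 i).
Proof.
move=> pp pq i; case: (split_ordP i) => j ->.
  by under eq_fun do rewrite row_mxEl.
by under eq_fun do rewrite row_mxEr.
Qed.

Lemma polyfun_lsub n k1 k2 (p : 'rV[R]_n -> 'rV[R]_(k1 + k2)) :
  (forall i, polyfun (fun z => p z 0 i)) -> forall i, polyfun (fun z => lsubmx (p z) 0 i).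
Proof. by move=> pp i; under eq_fun do rewrite mxE. Qed.

Lemma polyfun_rsub n k1 k2 (p : 'rV[R]_n -> 'rV[R]_(k1 + k2)) :
  (forall i, polyfun (fun z => p z 0 i)) -> forall i, polyfun (fun z => rsubmx (p z) 0 i).
Proof. by move=> pp i; under eq_fun do rewrite mxE. Qed.

Lemma polyfun_scal n (p : 'rV[R]_n -> R) :
  polyfun p -> forall i : 'I_1, polyfun (fun z => ((p z)%:M : 'rV[R]_1) 0 i).
Proof.
move=> pp i; rewrite ord1.
by under eq_fun do rewrite mxE eqxx mulr1n.
Qed.

Lemma polyfun_id n i : polyfun (fun z : 'rV[R]_n => z 0 i).
Proof. exact: polyfun_coord. Qed.

Definition graph n (X : set 'rV[R]_n) (f : 'rV[R]_n -> R) : set 'rV[R]_(n + 1) :=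
  [set z | X (lsubmx z) /\ rsubmx z 0 0 = f (lsubmx z)].

Lemma graphP n (X : set 'rV[R]_n) f x (c : R) :
  graph X f (row_mx x c%:M) <-> X x /\ c = f x.
Proof. by rewrite /graph /= row_mxKl row_mxKr mxE eqxx mulr1n. Qed.

Lemma rv1_scalar (y : 'rV[R]_1) : y = (y 0 0)%:M.
Proof. by rewrite [LHS]mx11_scalar. Qed.

Lemma saf_dom n (X : set 'rV[R]_n) f : semialgebraic_fun X f -> semialgebraic X.
Proof.
move=> /sa_ex H; rewrite (_ : X = [set x | exists y : 'rV[R]_1, graph X f (row_mx x y)]) //.
apply/seteqP; split=> x /=.
  by move=> Xx; exists (f x)%:M; apply/graphP.
by move=> [y]; rewrite (rv1_scalar y) => /graphP[].
Qed.

(** The set B has to describe the graph over points of X only; what it contains elsewhere is cut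
    away. *)
Lemma saf_intro n (X : set 'rV[R]_n) f (B : set 'rV[R]_(n + 1)) :
  semialgebraic X -> semialgebraic B ->
  (forall x c, X x -> (B (row_mx x c%:M) <-> c = f x)) -> semialgebraic_fun X f.
Proof.
move=> sX sB H; rewrite /semialgebraic_fun.
rewrite (_ : [set z | _] = (lsubmx @^-1` X) `&` B).
  apply: semialgebraicI => //; apply: sa_preim => //.
  exact/polyfun_lsub/polyfun_id.
have zE (z : 'rV[R]_(n + 1)) : exists x c, z = row_mx x (c : R)%:M.
  by exists (lsubmx z), (rsubmx z 0 0); rewrite -rv1_scalar hsubmxK.
apply/seteqP; split=> z; have [x [c ->]] := zE z.
  by move/graphP => -[Xx E]; split=> /=; [rewrite row_mxKl|apply/H].
move=> [/=]; rewrite row_mxKl => Xx /(H _ _ Xx) E; split=> //.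
by rewrite row_mxKr mxE eqxx mulr1n.
Qed.

Lemma polyfun_saf n (f : 'rV[R]_n -> R) (X : set 'rV[R]_n) :
  semialgebraic X -> polyfun f -> semialgebraic_fun X f.
Proof.
move=> sX [P hP]; apply: (@saf_intro n X f [set z | rsubmx z 0 0 = f (lsubmx z)]) => //.
  apply: sa_eq; first by apply: polyfun_rsub; apply: polyfun_id.
  exists (comp_mpoly [tuple polyvar R (lshift 1 i) | i < n] P) => z.
  rewrite hP comp_mpoly_meval; apply: meval_eq => i.
  by rewrite tnth_mktuple mevalXU mxE.
by move=> x c Xx /=; rewrite row_mxKl row_mxKr mxE eqxx mulr1n.
Qed.

Lemma saf_subset n (X V : set 'rV[R]_n) f :
  semialgebraic V -> V `<=` X -> semialgebraic_fun X f -> semialgebraic_fun V f.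
Proof.
move=> sV VX sf; apply: (saf_intro sV sf) => x c Vx.
by rewrite [X in X <-> _]graphP; split=> [[]|->] //; split=> //; apply: VX.
Qed.

Lemma saf_comp n k (X : set 'rV[R]_n) (Y : set 'rV[R]_k) (th : 'rV[R]_n -> 'rV[R]_k) g :
  semialgebraic X -> (forall i, semialgebraic_fun X (fun x => th x 0 i)) ->
  semialgebraic_fun Y g -> (forall x, X x -> Y (th x)) ->
  semialgebraic_fun X (fun x => g (th x)).
Proof.
move=> sX sth sg XY.
(* The ambient point is (x, c, y): [C1] says that y is th x, [C2] that c is g y, and y is then
   projected away. *)
pose C1 i := [set w : 'rV[R]_(n + 1 + k) |
  graph X (fun x => th x 0 i) (row_mx (lsubmx (lsubmx w)) (rsubmx w 0 i)%:M)].
pose C2 := [set w : 'rV[R]_(n + 1 + k) | graph Y g (row_mx (rsubmx w) (rsubmx (lsubmx w)))].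
have sC1 i : semialgebraic (C1 i).
  apply: (sa_preim (sth i)); apply: polyfun_row_mx.
    by apply: polyfun_lsub; apply: polyfun_lsub; apply: polyfun_id.
  by apply: polyfun_scal; apply: polyfun_rsub; apply: polyfun_id.
have sC2 : semialgebraic C2.
  apply: (sa_preim sg); apply: polyfun_row_mx.
    by apply: polyfun_rsub; apply: polyfun_id.
  by apply: polyfun_rsub; apply: polyfun_lsub; apply: polyfun_id.
apply: (saf_intro sX (sa_ex (semialgebraicI (sa_bigcap sC1) sC2))) => x c Xx /=; split.
  move=> [y [h1 h2]]; have : graph Y g (row_mx y c%:M).
    by move: h2; rewrite /C2 /= row_mxKl !row_mxKr.
  move=> /graphP[_ ->]; congr g; apply/rowP => i.
  have : graph X (fun x => th x 0 i) (row_mx x (y 0 i)%:M).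
    by have := h1 i; rewrite /C1 /= row_mxKl row_mxKr row_mxKl.
  by move=> /graphP[].
move=> ->; exists (th x); split.
  move=> i; suff : graph X (fun x => th x 0 i) (row_mx x (th x 0 i)%:M).
    by rewrite /C1 /= row_mxKl row_mxKr row_mxKl.
  exact/graphP.
suff : graph Y g (row_mx (th x) (g (th x))%:M) by rewrite /C2 /= row_mxKl !row_mxKr.
by apply/graphP; split=> //; apply: XY.
Qed.

Lemma saf_op2 n (X : set 'rV[R]_n) f g (op : 'rV[R]_2 -> R) : polyfun op ->
  semialgebraic_fun X f -> semialgebraic_fun X g ->
  semialgebraic_fun X (fun x => op (\row_i (if i == ord0 then f x else g x))).
Proof.
move=> pop sf sg; apply: (@saf_comp n 2 X setT) => //.
- exact: saf_dom sf.
- by move=> i; under eq_fun do rewrite mxE; case: (i == ord0).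
- exact: polyfun_saf (saT _ _) pop.
Qed.

Lemma safD n (X : set 'rV[R]_n) f g :
  semialgebraic_fun X f -> semialgebraic_fun X g -> semialgebraic_fun X (fun x => f x + g x).
Proof.
move=> sf sg; rewrite (_ : (fun x => f x + g x) = (fun x =>
    (fun w : 'rV[R]_2 => w 0 ord0 + w 0 ord_max) (\row_i (if i == ord0 then f x else g x)))).
  apply: (@saf_op2 n X f g (fun w => w 0 ord0 + w 0 ord_max)) => //.
  by apply: polyfunD; apply: polyfun_coord.
by apply/funext => x; rewrite !mxE.
Qed.

Lemma safM n (X : set 'rV[R]_n) f g :
  semialgebraic_fun X f -> semialgebraic_fun X g -> semialgebraic_fun X (fun x => f x * g x).
Proof.
move=> sf sg; rewrite (_ : (fun x => f x * g x) = (fun x =>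
    (fun w : 'rV[R]_2 => w 0 ord0 * w 0 ord_max) (\row_i (if i == ord0 then f x else g x)))).
  apply: (@saf_op2 n X f g (fun w => w 0 ord0 * w 0 ord_max)) => //.
  by apply: polyfunM; apply: polyfun_coord.
by apply/funext => x; rewrite !mxE.
Qed.

Lemma pd_limit n i (g : 'rV[R]_n -> R) (x : 'rV[R]_n) (e : R) : differentiable g x -> 0 < e ->
  exists2 dl : R, 0 < dl & forall h : R, `|h| <= dl ->
    `|g (x + h *: delta_mx 0 i) - g x - h * pd i g x| <= e * `|h|.
Proof.
move=> dg e0; have /diff_locally/eqaddoP/(_ _ e0)/near_box[dl dl0 Hd] := dg.
exists dl => // h hd.
have hb j : `|(h *: (delta_mx 0 i : 'rV[R]_n)) 0 j| <= `|h|.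
  rewrite !mxE eqxx /= normrM; case: (_ == _); rewrite ?normr1 ?normr0 ?mulr1 ?mulr0 //.
have := Hd (h *: delta_mx 0 i) _; rewrite /=.
have b : box dl 0 (h *: (delta_mx 0 i : 'rV[R]_n)).
  by move=> j; rewrite [X in _ - X]mxE subr0; apply: le_trans (hb j) hd.
move=> /(_ b) H.
have {}H : `|g (h *: delta_mx 0 i + x) - (g x + 'd g x (h *: delta_mx 0 i))| <=
   e * `|h *: (delta_mx 0 i : 'rV[R]_n)| := H.
have -> : g (x + h *: delta_mx 0 i) - g x - h * pd i g x =
    g (h *: delta_mx 0 i + x) - (g x + 'd g x (h *: delta_mx 0 i)).
  have -> : 'd g x (h *: delta_mx 0 i) = h * pd i g x by rewrite linearZ.
  by rewrite [x + _]addrC opprD addrA.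
by apply: le_trans H _; rewrite ler_wpM2l ?(ltW e0) // rv_norm_le.
Qed.

(** The limit that defines a partial derivative as a first-order condition. Squares replace absolute
    values so that only polynomial inequalities in h, d and values of g occur. *)
Lemma pd_charact n i (X : set 'rV[R]_n) (g : 'rV[R]_n -> R) (x : 'rV[R]_n) (d : R) :
  open X -> X x -> differentiable g x ->
  d = pd i g x <->
  (forall e : R, 0 < e -> exists2 dl : R, 0 < dl & forall h : R, h * h < dl * dl ->
    X (x + h *: delta_mx 0 i) ->
    (g (x + h *: delta_mx 0 i) - g x - h * d) ^+ 2 <= e * e * (h * h)).
Proof.
move=> oX Xx dg; split.
  move=> -> e e0; have [dl dl0 H] := pd_limit i dg e0; exists dl => // h hd _.
  have hdl : `|h| <= dl.
    have hh : `|h| * `|h| = h * h by rewrite -normrM ger0_norm // -expr2 sqr_ge0.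
    rewrite leNgt; apply/negP => h1; move: hd; rewrite -hh.
    by move: (`|h|) h1 => u h1 h2; nra.
  have := H h hdl; set u := (_ - _ - _) => Hu.
  have -> : e * e * (h * h) = (e * `|h|) ^+ 2.
    by rewrite exprMn real_normK ?num_real // !expr2.
  by rewrite -real_normK ?num_real // lerXn2r ?nnegrE // mulr_ge0 // ltW.
move=> H; apply/eqP; rewrite -subr_eq0 -normr_le0; apply/ler_addgt0Pr => e e0; rewrite add0r.
have e2 : 0 < e / 2 by rewrite divr_gt0.
have [d1 d10 H1] := H _ e2; have [d2 d20 H2] := pd_limit i dg e2.
have [r r0 rX] : exists2 r, 0 < r & forall y, box r x y -> X y.
  by apply/near_box; apply: open_nbhs_nbhs.
pose h := Num.min (d1 / 2) (Num.min d2 r).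
have h0 : 0 < h by rewrite !lt_min divr_gt0 // d20.
have hd1 : h < d1 by apply: (@le_lt_trans _ _ (d1 / 2)); [rewrite ge_min lexx|lra].
have hd2 : `|h| <= d2 by rewrite gtr0_norm // !ge_min lexx orbT.
have hr : h <= r by rewrite !ge_min lexx !orbT.
have Xh : X (x + h *: delta_mx 0 i).
  apply: rX => j; rewrite !mxE eqxx /= addrAC subrr add0r normrM (gtr0_norm h0).
  by case: (_ == _); rewrite ?normr1 ?normr0 ?mulr1 ?mulr0 // ltW.
have A1 : `|g (x + h *: delta_mx 0 i) - g x - h * d| <= e / 2 * h.
  have hh : h * h < d1 * d1 by nra.
  have := H1 h hh Xh.
  have -> : e / 2 * (e / 2) * (h * h) = (e / 2 * h) ^+ 2 by rewrite exprMn !expr2.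
  by rewrite -[X in X <= _]real_normK ?num_real // ler_pXn2r // ?nnegrE ?mulr_ge0 // ltW.
have A2 := H2 h hd2.
have A3 : `|h * (d - pd i g x)| <= e * h.
  have -> : h * (d - pd i g x) = (g (x + h *: delta_mx 0 i) - g x - h * pd i g x) -
     (g (x + h *: delta_mx 0 i) - g x - h * d) by lra.
  apply: le_trans (ler_normB _ _) _; rewrite (gtr0_norm h0) in A2; lra.
move: A3; rewrite normrM (gtr0_norm h0) mulrC ler_pM2r //.
Qed.

(** The condition of [pd_charact] reads: for all e there is t such that for all h. Each quantifier
    becomes a projection or the complement of one. *)
Lemma saf_pd n i (X : set 'rV[R]_n) (g : 'rV[R]_n -> R) : open X ->
  (forall x, X x -> differentiable g x) -> semialgebraic_fun X g ->
  semialgebraic_fun X (pd i g).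
Proof.
move=> oX dg sg; have sX := saf_dom sg.
(* The blocks of a point w are x, the candidate d, then e, t, h, and the two values y0 = g (x + h)
   and y1 = g x. *)
pose N := (n + 1 + 1 + 1 + 1)%N.
pose xx (w : 'rV[R]_(N + 2)) : 'rV[R]_n := lsubmx (lsubmx (lsubmx (lsubmx (lsubmx w)))).
pose dd (w : 'rV[R]_(N + 2)) : R := rsubmx (lsubmx (lsubmx (lsubmx (lsubmx w)))) 0 0.
pose ee (w : 'rV[R]_(N + 2)) : R := rsubmx (lsubmx (lsubmx (lsubmx w))) 0 0.
pose tt (w : 'rV[R]_(N + 2)) : R := rsubmx (lsubmx (lsubmx w)) 0 0.
pose hh (w : 'rV[R]_(N + 2)) : R := rsubmx (lsubmx w) 0 0.
pose y0 (w : 'rV[R]_(N + 2)) : R := rsubmx w 0 ord0.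
pose y1 (w : 'rV[R]_(N + 2)) : R := rsubmx w 0 ord_max.
have px j : polyfun (fun w => xx w 0 j) by do 5 apply: polyfun_lsub; apply: polyfun_id.
have pdd : polyfun dd by apply: polyfun_rsub; do 4 apply: polyfun_lsub; apply: polyfun_id.
have pee : polyfun ee by apply: polyfun_rsub; do 3 apply: polyfun_lsub; apply: polyfun_id.
have ptt : polyfun tt by apply: polyfun_rsub; do 2 apply: polyfun_lsub; apply: polyfun_id.
have phh : polyfun hh by apply: polyfun_rsub; apply: polyfun_lsub; apply: polyfun_id.
have py0 : polyfun y0 by apply: polyfun_rsub; apply: polyfun_id.
have py1 : polyfun y1 by apply: polyfun_rsub; apply: polyfun_id.
(* [A0] holds the violations. [A1] says that some h violates the estimate, [B1] that t is positive
   and has no violation, [A2] that e has such a t, [B2] that e is positive and has none. The graph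
   sought is the complement of the projection of [B2]. *)
pose A0 : set 'rV[R]_(N + 2) :=
  (fun w => row_mx (xx w + hh w *: delta_mx 0 i) (y0 w)%:M) @^-1` graph X g `&`
  ((fun w => row_mx (xx w) (y1 w)%:M) @^-1` graph X g `&`
  ([set w | hh w * hh w < tt w * tt w] `&`
   [set w | ee w * ee w * (hh w * hh w) < (y0 w - y1 w - hh w * dd w) * (y0 w - y1 w - hh w * dd w)])).
have sA0 : semialgebraic A0.
  have pu : polyfun (fun w => y0 w - y1 w - hh w * dd w).
    by apply: polyfunB; [apply: polyfunB|apply: polyfunM].
  apply: semialgebraicI; last apply: semialgebraicI; last apply: semialgebraicI.
  - apply: sa_preim => //; apply: polyfun_row_mx; last exact: polyfun_scal.
    move=> j; under eq_fun do rewrite !mxE.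
    apply: polyfunD; last by apply: polyfunM => //; apply: polyfun_cst.
    by have := px j; under eq_fun do rewrite !mxE.
  - by apply: sa_preim => //; apply: polyfun_row_mx; last exact: polyfun_scal.
  - by apply: sa_lt; apply: polyfunM.
  - by apply: sa_lt; apply: polyfunM => //; apply: polyfunM.
have sA1 := sa_ex (sa_ex sA0 : @semialgebraic R (n + 1 + 1 + 1 + 1) _).
set A1 := [set x | _] in sA1.
pose B1 : set 'rV[R]_(n + 1 + 1 + 1) := ~` A1 `&` [set w | 0 < rsubmx w 0 0].
have sB1 : semialgebraic B1.
  apply: semialgebraicI; first exact: semialgebraicC.
  by apply: sa_lt; [exact: polyfun_cst|apply: polyfun_rsub; apply: polyfun_id].
have sA2 := sa_ex (sB1 : @semialgebraic R (n + 1 + 1 + 1) _).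
set A2 := [set x | _] in sA2.
pose B2 : set 'rV[R]_(n + 1 + 1) := ~` A2 `&` [set w | 0 < rsubmx w 0 0].
have sB2 : semialgebraic B2.
  apply: semialgebraicI; first exact: semialgebraicC.
  by apply: sa_lt; [exact: polyfun_cst|apply: polyfun_rsub; apply: polyfun_id].
have sB3 := semialgebraicC (sa_ex (sB2 : @semialgebraic R (n + 1 + 1) _)).
apply: (saf_intro sX sB3) => x d Xx.
have A0E (e t h : R) (y : 'rV[R]_2) :
   A0 (row_mx (row_mx (row_mx (row_mx (row_mx x d%:M) e%:M) t%:M) h%:M) y) <->
   [/\ X (x + h *: delta_mx 0 i), y 0 ord0 = g (x + h *: delta_mx 0 i), y 0 ord_max = g x,
    h * h < t * t &
    e * e * (h * h) < (y 0 ord0 - y 0 ord_max - h * d) * (y 0 ord0 - y 0 ord_max - h * d)].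
  rewrite /A0 /= /xx /hh /tt /ee /dd /y0 /y1 !(row_mxKl, row_mxKr) ![_%:M 0 0]mxE eqxx !mulr1n.
  split; first by move=> [/graphP[h1 h2] [/graphP[_ h3] []]].
  by move=> [h1 h2 h3 h4 h5]; split; [apply/graphP|split; [apply/graphP|]].
rewrite (pd_charact i d oX Xx (dg x Xx)) /= ; split.
  move=> H e e0; apply: contrapT => /forall2NP K; apply: H; exists e%:M; split; last first.
    by rewrite /= row_mxKr mxE eqxx mulr1n.
  move=> [t]; rewrite (rv1_scalar t); move: (t 0 0) => {}t [/= K1].
  rewrite row_mxKr mxE eqxx mulr1n => t0.
  have [//|] := K t; apply=> h ht Xh; rewrite leNgt; apply/negP => L; apply: K1.
  exists h%:M, (\row_j (if j == ord0 then g (x + h *: delta_mx 0 i) else g x)).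
  by apply/A0E; rewrite !mxE /=; split=> //; rewrite -expr2.
move=> H [e]; rewrite (rv1_scalar e); move: (e 0 0) => {}e [/= K].
rewrite row_mxKr mxE eqxx mulr1n => e0; apply: K.
have [t t0 Ht] := H e e0; exists t%:M; split; last by rewrite /= row_mxKr mxE eqxx mulr1n.
move=> [h] [y]; rewrite (rv1_scalar h); move: (h 0 0) => {}h /A0E[Xh -> -> ht].
by apply/negP; rewrite -leNgt -expr2; apply: Ht.
Qed.

End SemialgebraicFunctions.

(** * Nash functions *)

Section NashFunctions.
Variable R : realType.

(** Open cubes are at once open, connected and semialgebraic, which makes them suitable state spaces
    for the local models built below. *)
Definition obox n (r : R) (a : 'rV[R]_n) : set 'rV[R]_n :=
  [set x | forall i, `|x 0 i - a 0 i| < r].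

Lemma obox_center n r (a : 'rV[R]_n) : 0 < r -> obox r a a.
Proof. by move=> r0 i; rewrite subrr normr0. Qed.

Lemma obox_box n r (a x : 'rV[R]_n) : obox r a x -> box r a x.
Proof. by move=> xa i; apply: ltW. Qed.

Lemma obox_open n r (a : 'rV[R]_n) : open (obox r a).
Proof.
rewrite openE => x xa; apply/near_box.
pose s := \big[Num.min/1]_i (r - `|x 0 i - a 0 i|).
have s0 : 0 < s by apply/bigmin_gtP; split=> // i _; rewrite subr_gt0.
exists (s / 2); first by rewrite divr_gt0.
move=> y yx i; have -> : y 0 i - a 0 i = (x 0 i - a 0 i) + (y 0 i - x 0 i) by lra.
apply: le_lt_trans (ler_normD _ _) _.
have : s <= r - `|x 0 i - a 0 i| by apply: bigmin_le_cond.
have := yx i; lra.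
Qed.

Lemma obox_nbhs n r (a : 'rV[R]_n) : 0 < r -> nbhs a (obox r a).
Proof. by move=> r0; apply: open_nbhs_nbhs; split; [exact: obox_open|exact: obox_center]. Qed.

Lemma near_obox n (a : 'rV[R]_n) (P : set 'rV[R]_n) :
  (\forall x \near a, P x) -> exists2 r, 0 < r & obox r a `<=` P.
Proof. by move=> /near_box[r r0 rP]; exists r => // x /obox_box; apply: rP. Qed.

Lemma obox_semialg n r (a : 'rV[R]_n) : semialgebraic (obox r a).
Proof.
rewrite (_ : obox r a = [set x | forall i, ([set x | x 0 i < a 0 i + r] `&`
   [set x | a 0 i - r < x 0 i]) x]).
  apply: sa_bigcap => i; apply: semialgebraicI; apply: sa_lt;
    (exact: polyfun_coord || exact: polyfun_cst).
apply/seteqP; split=> x /= H i; have := H i; rewrite ltr_norml.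
  by move=> /andP[h1 h2]; split; lra.
by move=> [h1 h2]; apply/andP; split; lra.
Qed.

Lemma obox_connected n r (a : 'rV[R]_n) : connected (obox r a).
Proof.
(* For r <= 0 the cube is empty, except that it is a single point when n = 0. *)
have [r0|r0] := ltP 0 r; last first.
  move: n a => [|n] a.
    rewrite (_ : obox r a = [set a]); first exact: connected1.
    by apply/seteqP; split=> x /=; [rewrite [x]thinmx0 [a]thinmx0|move=> _ []].
  rewrite (_ : obox r a = set0); first exact: connected0.
  by apply/seteqP; split=> x //= /(_ ord0); rewrite ltNge (le_trans r0).
have seg x : obox r a x -> connected ((fun t : R => a + t *: (x - a)) @` `[0, 1]).
  move=> xa; apply: connected_continuous_connected; first exact: segment_connected.
  apply: continuous_subspaceT => t; have [dt _] := line_derive a (x - a) t.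
  exact/differentiable_continuous/derivable1_diffP.
rewrite (_ : obox r a = \bigcup_(x in obox r a) ((fun t : R => a + t *: (x - a)) @` `[0, 1])).
  apply: bigcup_connected; last by move=> x; apply: seg.
  exists a => x xa; exists 0; first by rewrite /= in_itv /= lexx ler01.
  by rewrite scale0r addr0.
apply/seteqP; split=> [x xa|y [x xa [t /=]]].
  exists x => //; exists 1; first by rewrite /= in_itv /= lexx ler01.
  by rewrite scale1r addrC subrK.
rewrite in_itv /= => /andP[t0 t1] <- i; rewrite !mxE addrAC subrr add0r normrM.
apply: le_lt_trans (xa i); rewrite ger0_norm // ler_piMl //.
Qed.

Lemma nash_at n (X : set 'rV[R]_n) g a : open X -> nash X g -> X a -> analytic_at a g.
Proof. by move=> oX [/(analytic_onE g oX) h _]; apply: h. Qed.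

Lemma nash_saf n (X : set 'rV[R]_n) g : nash X g -> semialgebraic_fun X g.
Proof. by case. Qed.

Lemma nash_intro n (X : set 'rV[R]_n) g : open X ->
  (forall a, X a -> analytic_at a g) -> semialgebraic_fun X g -> nash X g.
Proof. by move=> oX h sg; split=> //; apply/analytic_onE. Qed.

Lemma nash_ext n (X : set 'rV[R]_n) f g : open X -> (forall x, X x -> f x = g x) ->
  nash X f -> nash X g.
Proof.
move=> oX fg nf; apply: nash_intro => // [a Xa|].
  apply: (@analytic_at_ext _ _ f); last exact: nash_at nf Xa.
  have : nbhs a X by apply: open_nbhs_nbhs.
  by apply: filterS => x; apply: fg.
apply: (saf_intro (saf_dom (nash_saf nf)) (nash_saf nf)) => x c Xx.
by rewrite -[X in X <-> _]/(graph X f _) graphP -fg //; split=> [[]|].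
Qed.

Lemma nash_subset n (X V : set 'rV[R]_n) g : open X -> open V -> semialgebraic V ->
  V `<=` X -> nash X g -> nash V g.
Proof.
move=> oX oV sV VX ng; apply: nash_intro => //; last exact: saf_subset (nash_saf ng).
by move=> a Va; apply: nash_at ng _ => //; apply: VX.
Qed.

Lemma nash_cst n (X : set 'rV[R]_n) c : open X -> semialgebraic X -> nash X (fun=> c).
Proof.
move=> oX sX; apply: nash_intro => // [a _|]; first exact: analytic_at_cst.
by apply: polyfun_saf => //; apply: polyfun_cst.
Qed.

Lemma nash_coord n (X : set 'rV[R]_n) i : open X -> semialgebraic X -> nash X (fun x => x 0 i).
Proof.
move=> oX sX; apply: nash_intro => // [a _|]; first exact: analytic_at_coord.
by apply: polyfun_saf => //; apply: polyfun_coord.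
Qed.

Lemma nashD n (X : set 'rV[R]_n) f g : open X -> nash X f -> nash X g ->
  nash X (fun x => f x + g x).
Proof.
move=> oX nf ng; apply: nash_intro => // [a Xa|]; last exact: safD (nash_saf nf) (nash_saf ng).
by apply: analytic_atD; [exact: nash_at nf Xa|exact: nash_at ng Xa].
Qed.

Lemma nashM n (X : set 'rV[R]_n) f g : open X -> nash X f -> nash X g ->
  nash X (fun x => f x * g x).
Proof.
move=> oX nf ng; apply: nash_intro => // [a Xa|]; last exact: safM (nash_saf nf) (nash_saf ng).
by apply: analytic_atM; [exact: nash_at nf Xa|exact: nash_at ng Xa].
Qed.

Lemma nash_dom n (X : set 'rV[R]_n) f : nash X f -> semialgebraic X.
Proof. by move=> /nash_saf/saf_dom. Qed.

Lemma nashB n (X : set 'rV[R]_n) f g : open X -> nash X f -> nash X g ->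
  nash X (fun x => f x - g x).
Proof.
move=> oX nf ng; apply: (@nash_ext _ _ (fun x => f x + -1 * g x)) => //.
  by move=> x _; rewrite mulN1r.
by apply: nashD => //; apply: nashM => //; apply: nash_cst => //; apply: nash_dom nf.
Qed.

Lemma nash_sum n (X : set 'rV[R]_n) (I : Type) (s : seq I) (f : I -> 'rV[R]_n -> R) :
  open X -> semialgebraic X -> (forall i, nash X (f i)) -> nash X (fun x => \sum_(i <- s) f i x).
Proof.
move=> oX sX nf; elim: s => [|i s ih].
  by under eq_fun do rewrite big_nil; apply: nash_cst.
by under eq_fun do rewrite big_cons; apply: nashD.
Qed.

Lemma nash_meval n k (X : set 'rV[R]_n) (P : mpoly k R) (f : 'I_k -> 'rV[R]_n -> R) :
  open X -> semialgebraic X -> (forall i, nash X (f i)) ->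
  nash X (fun x => meval (fun i => f i x) P).
Proof.
move=> oX sX nf; elim/mpoly_ring_ind: P => [c|i|P Q aP aQ|P Q aP aQ].
- by under eq_fun do rewrite mevalC; apply: nash_cst.
- by under eq_fun do rewrite mevalXU.
- by under eq_fun do rewrite mevalD; apply: nashD.
- by under eq_fun do rewrite mevalM; apply: nashM.
Qed.

Lemma nash_pd n (X : set 'rV[R]_n) i g : open X -> nash X g -> nash X (pd i g).
Proof.
move=> oX ng; apply: nash_intro => // [a Xa|].
  by apply: analytic_at_pd; apply: nash_at ng Xa.
apply: saf_pd => //; last exact: nash_saf.
by move=> x Xx; apply: analytic_at_diff; apply: nash_at ng Xx.
Qed.

Lemma nash_lie n (X : set 'rV[R]_n) f g : open X -> nash_map X f -> nash X g ->
  nash X (lie_deriv f g).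
Proof.
move=> oX nf ng; rewrite (_ : lie_deriv f g = fun x => \sum_i f x 0 i * pd i g x); last first.
  by apply/funext => x; rewrite lie_pdE.
apply: nash_sum => //; first exact: nash_dom ng.
by move=> i; apply: nashM => //; apply: nash_pd.
Qed.

Lemma nash_comp n k (X : set 'rV[R]_n) (Y : set 'rV[R]_k) th g : open X -> open Y ->
  semialgebraic X -> nash_map X th -> nash Y g -> (forall x, X x -> Y (th x)) ->
  nash X (fun x => g (th x)).
Proof.
move=> oX oY sX nt ng XY; apply: nash_intro => // [a Xa|].
  apply: analytic_at_comp => [i|]; first exact: nash_at (nt i) Xa.
  by apply: nash_at ng _ => //; apply: XY.
by apply: (saf_comp sX _ (nash_saf ng)) => // i; apply: nash_saf.
Qed.

Lemma near_all_at n k (a : 'rV[R]_n) (f : 'I_k -> 'rV[R]_n -> R) :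
  (forall i, analytic_at a (f i)) -> \forall x \near a, forall i, analytic_at x (f i).
Proof. by move=> af; apply: near_forall => i; apply: analytic_at_near. Qed.

(** The graph of the inverse is the graph of b read backwards. Restricted to the cube [obox r1 a],
    where psi inverts b, it has one point over each y, which makes psi semialgebraic. *)
Theorem nash_inverse n (X : set 'rV[R]_n) (b : 'rV[R]_n -> 'rV[R]_n) (a : 'rV[R]_n) :
  open X -> nash_map X b -> X a -> jac b a \in unitmx ->
  exists psi r s, [/\ 0 < r /\ 0 < s,
    nash_map (obox s (b a)) psi, psi (b a) = a,
    forall y, obox s (b a) y -> X (psi y) /\ b (psi y) = y &
    obox r a `<=` X /\ forall x, obox r a x -> obox s (b a) (b x) /\ psi (b x) = x].
Proof.
move=> oX nb Xa Ju.
have ab i : analytic_at a (fun x => b x 0 i) by apply: nash_at (nb i) Xa.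
have [psi [apsi psia bpsi psib]] := inverse_function ab Ju.
have nX : \forall x \near a, X x by apply: open_nbhs_nbhs.
have [r1 r10 H1] := near_obox (filterI nX psib).
have apsi' : \forall y \near b a, obox r1 a (psi y).
  have := analytic_at_close (divr_gt0 r10 (ltr0Sn R 1)) apsi; rewrite psia.
  apply: filterS => y yb i; apply: le_lt_trans (yb i) _.
  by rewrite ltr_pdivrMr // ltr_pMr // ltr1n.
have [s s0 H2] := near_obox (filterI (near_all_at apsi) (filterI bpsi apsi')).
have nbs : \forall x \near a, obox s (b a) (b x).
  have := analytic_at_close (divr_gt0 s0 (ltr0Sn R 1)) ab.
  apply: filterS => y yb i; apply: le_lt_trans (yb i) _.
  by rewrite ltr_pdivrMr // ltr_pMr // ltr1n.
have [r r0 H3] := near_obox (filterI nbs (@obox_nbhs _ r1 a r10)).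
exists psi, r, s; split=> //.
- move=> i; apply: nash_intro; first exact: obox_open.
    by move=> y /H2[/(_ i)].
  have V1 : semialgebraic (obox r1 a) by apply: obox_semialg.
  pose C j := [set w : 'rV[R]_(n + 1 + n) |
    graph X (fun x => b x 0 j) (row_mx (rsubmx w) (lsubmx (lsubmx w) 0 j)%:M)].
  pose E := [set w : 'rV[R]_(n + 1 + n) | rsubmx w 0 i = rsubmx (lsubmx w) 0 0].
  have sC j : semialgebraic (C j).
    apply: (sa_preim (nash_saf (nb j))); apply: polyfun_row_mx.
      by apply: polyfun_rsub; apply: polyfun_id.
    by apply: polyfun_scal; do 2 apply: polyfun_lsub; apply: polyfun_id.
  have sE : semialgebraic E.
    by apply: sa_eq; [apply: polyfun_rsub|apply: polyfun_rsub; apply: polyfun_lsub]; apply: polyfun_id.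
  have sV : semialgebraic (rsubmx @^-1` obox r1 a : set 'rV[R]_(n + 1 + n)).
    by apply: sa_preim => //; apply: polyfun_rsub; apply: polyfun_id.
  apply: (saf_intro (obox_semialg _ _) (sa_ex (semialgebraicI (sa_bigcap sC) (semialgebraicI sE sV)))).
  move=> y c ys; split.
    move=> [x [Cx [Ex Vx]]]; move: Ex Vx; rewrite /E /= row_mxKl !row_mxKr mxE eqxx mulr1n => <- Vx.
    have bx : b x = y.
      apply/rowP => j; have := Cx j; rewrite /C /= row_mxKr !row_mxKl.
      by move=> /graphP[_ ->].
    by have [_ <-] := H1 x Vx; rewrite bx.
  move=> ->; have [_ [bp Vp]] := H2 y ys; have [Xp _] := H1 _ Vp.
  exists (psi y); split.
    move=> j; suff : graph X (fun x => b x 0 j) (row_mx (psi y) (y 0 j)%:M).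
      by rewrite /C /= row_mxKr !row_mxKl.
    by apply/graphP; rewrite bp.
  by split; rewrite /E /= ?row_mxKl !row_mxKr ?mxE ?eqxx ?mulr1n.
- by move=> y ys; have [_ [bp Vp]] := H2 y ys; have [Xp _] := H1 _ Vp.
- split; first by move=> x /H3[_ /H1[]].
  by move=> x /H3[h1 /H1[]].
Qed.

Lemma meval_continuous n (P : mpoly n R) : continuous (fun x : 'rV[R]_n => meval (fun i => x 0 i) P).
Proof.
move=> x; apply: analytic_at_cvg.
exact: (@analytic_at_meval _ n n x P (fun i x => x 0 i) (fun i => analytic_at_coord _ _)).
Qed.

(** Take the product of the nonzero polynomials that describe A: where it does not vanish, all their
    signs are locally constant. *)
Lemma semialgebraic_generic n (A : set 'rV[R]_n) : semialgebraic A ->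
  exists2 P : mpoly n R, P != 0 &
    forall z : 'rV[R]_n, meval (fun i => z 0 i) P != 0 -> nbhs z A \/ nbhs z (~` A).
Proof.
elim=> [P|B C _ [P P0 hP] _ [Q Q0 hQ]|B C _ [P P0 hP] _ [Q Q0 hQ]|B _ [P P0 hP]].
- case: (eqVneq P 0) => [->|P0].
    exists 1; first exact: oner_neq0.
    move=> z _; right; rewrite (_ : ~` _ = setT); first exact: filterT.
    by apply/seteqP; split=> x //= _; rewrite meval0 ltxx.
  exists P => // z; have := @meval_continuous n P z; rewrite neq_lt => H /orP[Pz|Pz].
    right; have h : \forall y \near z, meval (fun i => (y : 'rV[R]_n) 0 i) P < 0 by exact: (cvgr_lt _ H).
    by apply: filterS h => x /= h; apply/negP; rewrite -leNgt ltW.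
  by left; apply: (cvgr_gt _ H).
- exists (P * Q); first by rewrite mulf_neq0.
  move=> z; rewrite mevalM mulf_eq0 negb_or => /andP[/hP h1 /hQ h2].
  case: h1 => h1; first by left; apply: filterS h1 => x; left.
  case: h2 => h2; first by left; apply: filterS h2 => x; right.
  by right; apply: filterS2 h1 h2 => x h1 h2 [].
- exists (P * Q); first by rewrite mulf_neq0.
  move=> z; rewrite mevalM mulf_eq0 negb_or => /andP[/hP h1 /hQ h2].
  case: h1 => h1; last by right; apply: filterS h1 => x h [].
  case: h2 => h2; last by right; apply: filterS h2 => x h [].
  by left; apply: filterS2 h1 h2.
- exists P => // z /hP[h|h]; last by left.
  by right; rewrite setCK.
Qed.

(** Near one of its points a graph is neither everything nor empty, so the polynomial of
    [semialgebraic_generic] vanishes there. *)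
Lemma saf_algebraic n (X : set 'rV[R]_n) g : semialgebraic_fun X g ->
  exists2 P : mpoly (n + 1) R, P != 0 &
    forall x, X x -> meval (fun i => row_mx x (g x)%:M 0 i) P = 0.
Proof.
move=> /semialgebraic_generic[P P0 hP]; exists P => // x Xx.
apply/eqP; apply: contrapT => /negP/hP.
have gx : graph X g (row_mx x (g x)%:M) by apply/graphP.
case=> [|/nbhs_singleton] //; move=> /near_box[r r0 H].
have : graph X g (row_mx x (g x + r)%:M).
  apply: H => i; case: (split_ordP i) => j ->.
    by rewrite !row_mxEl subrr normr0 ltW.
  by rewrite !row_mxEr !mxE ord1 eqxx !mulr1n addrAC subrr add0r gtr0_norm.
move=> /graphP[_ /eqP]; rewrite -subr_eq0 addrAC subrr add0r gt_eqF //.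
Qed.

(** Induction on a bound for the degree: the derivatives also vanish on X and are zero by induction,
    so the polynomial is constant. *)
Lemma mpoly_zero_on_open n (P : mpoly n R) (X : set 'rV[R]_n) a : open X -> X a ->
  (forall x, X x -> meval (fun i => x 0 i) P = 0) -> P = 0.
Proof.
move=> oX Xa.
have E (Q : mpoly n R) : (fun x : 'rV[R]_n => meval (fun i => x 0 i) Q) =
    (fun x => meval (disp 0 x) Q).
  by apply/funext => x; congr meval; apply/funext => i; rewrite /disp mxE subr0.
suff H N : forall Q : mpoly n R, (forall m, (N <= mdeg m)%N -> mcoeff m Q = 0) ->
    (forall x, X x -> meval (fun i => x 0 i) Q = 0) -> Q = 0.
  by apply: (H (msize P)) => m /msize_mdeg_ge/memN_msupp_eq0.
elim: N => [|N ih] Q QN Q0; first by apply/mpolyP => m; rewrite mcoeff0 QN.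
have dQ i : mderiv i Q = 0.
  apply: ih => [m Nm|x Xx].
    by rewrite mcoeff_deriv QN ?mul0rn // mdegD mdeg1 addn1.
  have [_ /(_ (delta_mx 0 i))] := poly_differentiable Q 0 x.
  have [|_] := @diff_near0 R n (fun y => meval (disp 0 y) Q) x (delta_mx 0 i).
    have : nbhs x X by apply: open_nbhs_nbhs.
    by apply: filterS => y Xy; have := Q0 y Xy; rewrite -[meval _ _]/((fun x : 'rV[R]_n => meval (fun i => x 0 i) Q) y) E.
  move=> ->; rewrite (bigD1 i) //= big1 => [|j ji]; rewrite !mxE eqxx /=; last by rewrite (negbTE ji) mul0r.
  by rewrite eqxx mul1r addr0 -[meval (disp 0 x) _]/((fun x => meval (disp 0 x) (mderiv i Q)) x) -E.
have QC : Q = mpolyC n (mcoeff (@mnm0 n) Q).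
  apply/mpolyP => m; rewrite mcoeffC eq_sym; case: eqP => [<-|]; first by rewrite mulr1.
  move/eqP; rewrite mulr0 eq_sym -mdeg_eq0 mdegE sum_nat_eq0 => /forallPn[i]; rewrite /= => mi.
  have := mcoeff_deriv i (mnm_sub m (mnm1 i)) Q.
  have -> : mnm_add (mnm_sub m (mnm1 i)) (mnm1 i) = m.
    rewrite submK //; apply/mnm_lepP => j; rewrite mnm1E; case: eqP => [<-|//].
    by rewrite lt0n.
  rewrite dQ mcoeff0 => /esym/eqP; rewrite -mulr_natl mulf_eq0 pnatr_eq0 /= => /eqP //.
by rewrite QC -[mcoeff _ _](mevalC (fun i => a 0 i)) -QC Q0 // mpolyC0.
Qed.

End NashFunctions.

(** * The shuffle algebra of series on words *)

(** A name of its own keeps the shuffle product apart from the pointwise product of functions. *)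
Definition wseries (R : realType) (A : Type) := seq A -> R.

Section SeriesRing.
Variables (R : realType) (A : Type).
Local Notation series := (wseries R A).

HB.instance Definition _ := gen_eqMixin series.
HB.instance Definition _ := gen_choiceMixin series.

Definition sshift (a : A) (f : series) : series := fun w => f (a :: w).

(** The shuffle product, defined through the Leibniz rule for the derivations [sshift a]; this is
    the rule by which jets multiply. *)
Fixpoint smul_at (w : seq A) (f g : series) : R :=
  if w is a :: v then smul_at v (sshift a f) g + smul_at v f (sshift a g)
  else f [::] * g [::].

Definition sadd (f g : series) : series := fun w => f w + g w.
Definition sopp (f : series) : series := fun w => - f w.
Definition szero : series := fun=> 0.
Definition smul (f g : series) : series := fun w => smul_at w f g.
Definition scst (c : R) : series := fun w => if w is [::] then c else 0.

Lemma saddA : associative sadd.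
Proof. by move=> f g h; apply/funext => w; rewrite /sadd addrA. Qed.
Lemma saddC : commutative sadd.
Proof. by move=> f g; apply/funext => w; rewrite /sadd addrC. Qed.
Lemma sadd0 : left_id szero sadd.
Proof. by move=> f; apply/funext => w; rewrite /sadd add0r. Qed.
Lemma saddN : left_inverse szero sopp sadd.
Proof. by move=> f; apply/funext => w; rewrite /sadd addNr. Qed.

HB.instance Definition _ := GRing.isZmodule.Build series saddA saddC sadd0 saddN.

Lemma wsD (f g : series) w : (f + g) w = f w + g w. Proof. by []. Qed.
Lemma wsN (f : series) w : (- f) w = - f w. Proof. by []. Qed.
Lemma wsMn (f : series) k w : (f *+ k) w = f w *+ k.
Proof. by elim: k => [|k ih]; rewrite ?mulr0n // !mulrS wsD ih. Qed.

Lemma sshiftD a (f g : series) : sshift a (f + g) = sshift a f + sshift a g.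
Proof. by []. Qed.
Lemma sshift_smul a f g : sshift a (smul f g) = smul (sshift a f) g + smul f (sshift a g).
Proof. by []. Qed.

Lemma smul_atDl w f g h : smul_at w (f + g) h = smul_at w f h + smul_at w g h.
Proof.
elim: w f g h => [|a w ih] f g h /=; first by rewrite wsD mulrDl.
by rewrite sshiftD !ih addrACA.
Qed.

Lemma smulC : commutative smul.
Proof.
move=> f g; apply/funext => w; rewrite /smul.
by elim: w f g => [|a w ih] f g /=; rewrite ?(mulrC (f _)) // ih addrC; congr (_ + _).
Qed.

Lemma smulDl : left_distributive smul +%R.
Proof. by move=> f g h; apply/funext => w; apply: smul_atDl. Qed.

Lemma smulDr : right_distributive smul +%R.
Proof. by move=> f g h; rewrite smulC smulDl !(smulC _ f). Qed.

Lemma smulA : associative smul.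
Proof.
move=> f g h; apply/funext => w; rewrite /smul.
elim: w f g h => [|a w ih] f g h /=; first by rewrite mulrA.
rewrite -[fun v => smul_at v g h]/(smul g h) -[fun v => smul_at v f g]/(smul f g).
rewrite !sshift_smul -[smul_at w f _]/(smul f _ w) smulDr wsD smul_atDl.
by rewrite -[smul f _ w]/(smul_at w f _) -[smul f (smul g _) w]/(smul_at w f _) !ih addrA.
Qed.

Lemma smul1 : left_id (scst 1) smul.
Proof.
move=> f; apply/funext => w; rewrite /smul.
elim: w f => [|a w ih] f /=; first by rewrite mul1r.
rewrite ih (_ : sshift a (scst 1) = 0) //.
rewrite (_ : smul_at w 0 f = 0) ?add0r //.
have := smul_atDl w 0 0 f; rewrite addr0 => /esym/eqP.
by rewrite -subr_eq0 addrK => /eqP.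
Qed.

Lemma scst1_neq0 : scst 1 != 0.
Proof. by apply/eqP => /(congr1 (fun f : series => f [::]))/eqP; rewrite /= oner_eq0. Qed.

HB.instance Definition _ :=
  GRing.Zmodule_isComNzRing.Build series smulA smulC smul1 smulDl scst1_neq0.

Lemma wsM0 (f g : series) : (f * g) [::] = f [::] * g [::]. Proof. by []. Qed.
Lemma sshiftM a (f g : series) : sshift a (f * g) = sshift a f * g + f * sshift a g.
Proof. by []. Qed.

Lemma sshift_cst a c : sshift a (scst c) = 0. Proof. by []. Qed.

Lemma sshiftMn a (f : series) k : sshift a (f *+ k) = sshift a f *+ k.
Proof. by apply/funext => w; rewrite /sshift !wsMn. Qed.

Lemma scst_is_zmod : zmod_morphism scst.
Proof. by move=> a b; apply/funext => -[|c w] //; rewrite wsD wsN /= subrr. Qed.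

Lemma scst_is_monoid : monoid_morphism scst.
Proof.
split=> // a b; apply/funext => -[|c w] //.
by rewrite -[RHS]/(sshift c (scst a * scst b) w) sshiftM !sshift_cst mulr0 mul0r addr0.
Qed.

HB.instance Definition _ := GRing.isZmodMorphism.Build R series scst scst_is_zmod.
HB.instance Definition _ := GRing.isMonoidMorphism.Build R series scst scst_is_monoid.

(* [vanish s f]: f is zero on all words obtained from s by repeating each
   letter an arbitrary number of times. *)
Fixpoint vanish (s : seq A) (f : series) : Prop :=
  if s is a :: s' then forall k, vanish s' (iter k (sshift a) f) else f [::] = 0.

Lemma iter_shiftD k a (f g : series) : iter k (sshift a) (f + g) =
  iter k (sshift a) f + iter k (sshift a) g.
Proof. by elim: k => //= k ->. Qed.

Lemma iter_shiftN k a (f : series) : iter k (sshift a) (- f) = - iter k (sshift a) f.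
Proof. by elim: k => //= k ->. Qed.

Lemma iter_shiftMn k a (f : series) q : iter k (sshift a) (f *+ q) =
  iter k (sshift a) f *+ q.
Proof. by elim: k => //= k ->; rewrite sshiftMn. Qed.

Lemma vanishD s f g : vanish s f -> vanish s g -> vanish s (f + g).
Proof.
elim: s f g => [|a s ih] f g /=; first by rewrite wsD => -> ->; rewrite addr0.
by move=> hf hg k; rewrite iter_shiftD; apply: ih.
Qed.

Lemma vanishN s f : vanish s f -> vanish s (- f).
Proof.
elim: s f => [|a s ih] f /=; first by rewrite wsN => ->; rewrite oppr0.
by move=> hf k; rewrite iter_shiftN; apply: ih.
Qed.

Lemma vanishMn s f q : (0 < q)%N -> vanish s (f *+ q) -> vanish s f.
Proof.
move=> q0; elim: s f => [|a s ih] f /=.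
  by rewrite wsMn => /eqP; rewrite mulrn_eq0 eqn0Ngt q0 /= => /eqP.
by move=> hf k; apply: ih; rewrite -iter_shiftMn.
Qed.

Lemma vanishM s f g : vanish s f -> vanish s (f * g).
Proof.
elim: s f g => [|a s ih] f g /=; first by rewrite wsM0 => ->; rewrite mul0r.
move=> hf k; elim: k f g hf => [|k ihk] f g hf; first exact: ih (hf 0%N).
rewrite iterSr sshiftM iter_shiftD; apply: vanishD; apply: ihk => // i.
by rewrite -iterSr.
Qed.

Lemma vanish0 s : vanish s 0.
Proof. by rewrite -(subrr 0) oppr0 addr0; elim: s => //= a s ih k; rewrite (_ : iter _ _ _ = 0) //; elim: k => //= k ->. Qed.

(** Leibniz rule: fewer than i + j derivatives cannot put i of them on f or j of them on g only when
    each term leaves one factor short of its order, and that factor vanishes. *)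
Lemma vanish_low s a n : forall i j (f g : series),
  (forall k, (k < i)%N -> vanish s (iter k (sshift a) f)) ->
  (forall k, (k < j)%N -> vanish s (iter k (sshift a) g)) ->
  (n < i + j)%N -> vanish s (iter n (sshift a) (f * g)).
Proof.
have shiftP i (f : series) : (forall k, (k < i)%N -> vanish s (iter k (sshift a) f)) ->
    forall k, (k < i.-1)%N -> vanish s (iter k (sshift a) (sshift a f)).
  by move=> h k ki; rewrite -iterSr; apply: h; case: (i) ki.
elim: n => [|n ih] i j f g hf hg nij.
  case: i nij hf => [|i] nij hf; last by apply: vanishM; apply: (hf 0%N).
  by rewrite mulrC /=; apply: vanishM; apply: (hg 0%N); case: (j) nij.
rewrite iterSr sshiftM iter_shiftD; apply: vanishD.
  by apply: (ih i.-1 j) => //; [exact: shiftP|case: (i) nij => [|k]; rewrite ?add0n => // /ltnW].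
by apply: (ih i j.-1) => //; [exact: shiftP|case: (j) nij => [|k]; rewrite ?addn0 ?addnS => // /ltnW].
Qed.

(** Leading terms multiply up to a positive integer q, a binomial coefficient that never has to be
    identified: for positive i and j it is the sum of those for (i - 1, j) and (i, j - 1). *)
Lemma vanish_lead s a n : forall i j (f g : series), (i + j = n)%N ->
  (forall k, (k < i)%N -> vanish s (iter k (sshift a) f)) ->
  (forall k, (k < j)%N -> vanish s (iter k (sshift a) g)) ->
  exists2 q, (0 < q)%N & vanish s (iter n (sshift a) (f * g)
    - (iter i (sshift a) f * iter j (sshift a) g) *+ q).
Proof.
have shiftP i (f : series) : (forall k, (k < i.+1)%N -> vanish s (iter k (sshift a) f)) ->
    forall k, (k < i)%N -> vanish s (iter k (sshift a) (sshift a f)).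
  by move=> h k ki; rewrite -iterSr; apply: h.
elim: n => [|n ih] i j f g.
  move=> /eqP; rewrite addn_eq0 => /andP[/eqP-> /eqP->] _ _.
  by exists 1%N => //=; rewrite mulr1n subrr; apply: vanish0.
have zero_case j' (f' g' : series) : j' = n.+1 ->
    (forall k, (k < j')%N -> vanish s (iter k (sshift a) g')) ->
    exists2 q, (0 < q)%N & vanish s (iter n.+1 (sshift a) (f' * g')
      - (f' * iter j' (sshift a) g') *+ q).
  move=> -> hg; have [//|q q0 hq] := ih 0%N n f' (sshift a g') erefl _ (shiftP _ _ hg).
  exists q => //; rewrite iterSr sshiftM iter_shiftD -addrA; apply: vanishD.
    by apply: (@vanish_low _ _ _ 0%N n.+1) => //; rewrite add0n.
  by rewrite iterSr.
move=> ij hf hg; case: i ij hf => [|i] ij hf; first exact: zero_case.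
case: j ij hg => [|j] ij hg.
  have [||q q0 hq] := zero_case i.+1 g f => //; first by rewrite -ij addn0.
  by exists q => //; rewrite (mulrC f) [X in _ - X *+ _]mulrC.
have [|q q0 hq] := ih i j.+1 (sshift a f) g _ (shiftP _ _ hf) hg.
  by apply/eqP; rewrite -eqSS -ij addSn.
have [|q' q0' hq'] := ih i.+1 j f (sshift a g) _ hf (shiftP _ _ hg).
  by apply/eqP; rewrite -eqSS -ij addnS.
exists (q + q')%N; first by rewrite addn_gt0 q0.
rewrite iterSr sshiftM iter_shiftD mulrnDr opprD addrACA.
by apply: vanishD; [rewrite [iter i.+1 _ f]iterSr|rewrite [iter j.+1 _ g]iterSr].
Qed.

(** If neither f nor g vanishes, take their leading terms with respect to the first letter. By
    induction on s the product of these does not vanish, and the factor q does no harm in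
    characteristic zero. *)
Lemma vanish_prime s f g : vanish s (f * g) -> vanish s f \/ vanish s g.
Proof.
elim: s f g => [|a s ih] f g.
  by rewrite /= wsM0 => /eqP; rewrite mulf_eq0 => /orP[/eqP|/eqP]; [left|right].
move=> hfg; apply: contrapT => /not_orP[nf ng].
have first (h : series) : ~ vanish (a :: s) h -> exists2 i, ~ vanish s (iter i (sshift a) h) &
    forall k, (k < i)%N -> vanish s (iter k (sshift a) h).
  move=> /existsNP[k hk].
  have ex : exists k, `[< ~ vanish s (iter k (sshift a) h) >] by exists k; apply/asboolP.
  case: (ex_minnP ex) => i /asboolP hi mi; exists i => // l li; apply: contrapT => hl.
  by have := mi l; rewrite leqNgt li => /(_ _)/negP; apply; [apply/asboolP|].
have [i hi li] := first f nf; have [j hj lj] := first g ng.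
have [q q0 hq] := vanish_lead erefl li lj.
have [] // := ih (iter i (sshift a) f) (iter j (sshift a) g).
apply: (vanishMn q0); have := vanishD (hfg (i + j)%N) (vanishN hq).
by rewrite opprB addrC subrK.
Qed.

Lemma vanish_value w f : vanish w f -> f w = 0.
Proof. by elim: w f => [|a w ih] f //= h; apply: (ih (sshift a f)); apply: (h 1%N). Qed.

Lemma vanish_catl s1 s2 f : vanish (s1 ++ s2) f -> vanish s1 f.
Proof.
elim: s1 f => [|a s1 ih] f /=; last by move=> h k; apply: ih.
by elim: s2 f => //= a s2 ih f h; apply: ih; apply: (h 0%N).
Qed.

Lemma vanish_catr s1 s2 f : vanish (s1 ++ s2) f -> vanish s2 f.
Proof. by elim: s1 f => //= a s1 ih f h; apply: ih; apply: (h 0%N). Qed.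

(** If f is nonzero at w1 and g at w2, then both are nonzero on the words obtained from w1 ++ w2 by
    repeating letters, since zero repetitions are allowed. *)
Lemma series_integral (f g : series) : f * g = 0 -> f = 0 \/ g = 0.
Proof.
move=> fg0; apply: contrapT => /not_orP[nf ng].
have ex (h : series) : h <> 0 -> exists w, h w <> 0.
  move=> hn; apply: contrapT => /forallNP hw; apply: hn; apply/funext => w.
  by apply: contrapT; apply: hw.
have [w1 hf] := ex f nf; have [w2 hg] := ex g ng.
have [] := @vanish_prime (w1 ++ w2) f g; first by rewrite fg0; apply: vanish0.
  by move=> /vanish_catl/vanish_value.
by move=> /vanish_catr/vanish_value.
Qed.

Definition series_unit : {pred series} := [pred f | `[< exists g : series, g * f = 1 >]].
Definition series_inv (f : series) : series :=
  if pselect (exists g : series, g * f = 1) is left h then sval (cid h) else f.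

Lemma series_mulVr : {in series_unit, left_inverse 1 series_inv *%R}.
Proof.
move=> f /asboolP h; rewrite /series_inv; case: pselect => // h'; exact: (svalP (cid h')).
Qed.

Lemma series_unitP (f g : series) : g * f = 1 -> series_unit f.
Proof. by move=> h; apply/asboolP; exists g. Qed.

Lemma series_inv_out : {in [predC series_unit], series_inv =1 id}.
Proof. by move=> f /asboolPn h; rewrite /series_inv; case: pselect. Qed.

HB.instance Definition _ := GRing.ComNzRing_hasMulInverse.Build series
  series_mulVr series_unitP series_inv_out.

Lemma series_idomain : GRing.integral_domain_axiom series.
Proof.
by move=> f g /series_integral[->|->]; rewrite eqxx ?orbT.
Qed.

HB.instance Definition _ := GRing.ComUnitRing_isIntegral.Build series series_idomain.

Definition jet0 (N : nat) (f : series) : Prop := forall w, (size w <= N)%N -> f w = 0.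

Lemma jet0S N f : jet0 N.+1 f <-> f [::] = 0 /\ forall a, jet0 N (sshift a f).
Proof.
split=> [h|[h0 hs] [|a w] // sw]; first by split=> [|a w sw]; apply: h.
exact: hs.
Qed.

Lemma jet0_le N M f : (M <= N)%N -> jet0 N f -> jet0 M f.
Proof. by move=> MN h w sw; apply: h; apply: leq_trans MN. Qed.

Lemma jet0_0 f : jet0 0 f <-> f [::] = 0.
Proof. by split=> [h|h []] //; apply: h. Qed.

Lemma jet0D N f g : jet0 N f -> jet0 N g -> jet0 N (f + g).
Proof. by move=> hf hg w sw; rewrite wsD hf ?hg ?addr0. Qed.

Lemma jet0N N f : jet0 N f -> jet0 N (- f).
Proof. by move=> hf w sw; rewrite wsN hf ?oppr0. Qed.

Lemma jet0_zero N : jet0 N 0. Proof. by []. Qed.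

Lemma jet0_sum N (I : Type) (s : seq I) (F : I -> series) :
  (forall i, jet0 N (F i)) -> jet0 N (\sum_(i <- s) F i).
Proof.
move=> h; elim: s => [|i s ih]; first by rewrite big_nil; apply: jet0_zero.
by rewrite big_cons; apply: jet0D.
Qed.

Lemma jet0Ml N f g : jet0 N f -> jet0 N (f * g).
Proof.
elim: N f g => [|N ih] f g; first by rewrite !jet0_0 wsM0 => ->; rewrite mul0r.
move=> hf; have [h0 hs] := (jet0S N f).1 hf.
apply/jet0S; rewrite wsM0 h0 mul0r; split=> // a; rewrite sshiftM.
by apply: jet0D; apply: ih => //; apply: jet0_le hf.
Qed.

Lemma jet0Mr N f g : jet0 N f -> jet0 N (g * f).
Proof. by rewrite mulrC; apply: jet0Ml. Qed.

(** A series with nonzero constant term is invertible to every order; the induction on N cancels it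
    without building the inverse. *)
Lemma jet0_cancel N (f u : series) : u [::] != 0 -> jet0 N (f * u) -> jet0 N f.
Proof.
move=> u0; elim: N f => [|N ih] f.
  by rewrite !jet0_0 wsM0 => /eqP; rewrite mulf_eq0 (negbTE u0) orbF => /eqP.
move=> h; have fN : jet0 N f by apply: ih; apply: jet0_le h.
have [] := (jet0S N _).1 h; rewrite wsM0 => /eqP; rewrite mulf_eq0 (negbTE u0) orbF => /eqP f0 hs.
apply/jet0S; split=> // a; apply: ih; have := hs a; rewrite sshiftM => h1.
rewrite -[X in jet0 _ X](addrK (f * sshift a u)).
by apply: jet0D => //; apply: jet0N; apply: jet0Ml.
Qed.

Lemma jet0_all f : (forall N, jet0 N f) -> f = 0.
Proof. by move=> h; apply/funext => w; apply: (h (size w)). Qed.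

Lemma mmap_head k (P : mpoly k R) (x : 'I_k -> series) :
  (mmap scst x P) [::] = meval (fun i => x i [::]) P.
Proof.
elim/mpoly_ring_ind: P => [c|i|P Q h1 h2|P Q h1 h2].
- by rewrite mmapC mevalC.
- by rewrite mmapX mmap1U mevalXU.
- by rewrite rmorphD mevalD wsD -h1 -h2.
- by rewrite rmorphM mevalM wsM0 -h1 -h2.
Qed.

(** Division of P(x) - P(y) by the differences x_i - y_i. Since x and y have the same constant
    terms, those of the cofactors are the partial derivatives of P. *)
Lemma mmap_difference k (P : mpoly k R) (x y : 'I_k -> series) :
  (forall i, x i [::] = y i [::]) ->
  exists2 E : 'I_k -> series, mmap scst x P - mmap scst y P = \sum_i E i * (x i - y i) &
    forall i, E i [::] = meval (fun i => y i [::]) (mderiv i P).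
Proof.
move=> xy; elim/mpoly_ring_ind: P => [c|i|P Q [E1 h1 e1] [E2 h2 e2]|P Q [E1 h1 e1] [E2 h2 e2]].
- exists (fun=> 0) => [|i]; last by rewrite mderivC meval0.
  by rewrite !mmapC subrr big1 // => i _; rewrite mul0r.
- exists (fun j => (j == i)%:R) => [|j].
    by rewrite !mmapX !mmap1U (bigD1 i) //= eqxx mul1r big1 ?addr0 // => j /negbTE->; rewrite mul0r.
  rewrite mderivX mnm1E eq_sym; case: eqP => [->|_] /=; last by rewrite scale0r meval0.
  by rewrite scale1r -[X in mnm_sub X _]add0m addmK mpolyX0 meval1.
- exists (fun i => E1 i + E2 i) => [|i]; last by rewrite wsD e1 e2 mderivD mevalD.
  rewrite !rmorphD opprD addrACA h1 h2 -big_split /=.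
  by apply: eq_bigr => i _; rewrite mulrDl.
- exists (fun i => E1 i * mmap scst x Q + mmap scst y P * E2 i) => [|i].
    transitivity ((mmap scst x P - mmap scst y P) * mmap scst x Q +
        mmap scst y P * (mmap scst x Q - mmap scst y Q)).
      by rewrite !rmorphM mulrBl mulrBr addrA subrK.
    rewrite h1 h2 mulr_suml mulr_sumr -big_split /=.
    by apply: eq_bigr => i _; rewrite mulrDl -!mulrA (mulrC (x i - y i)).
  rewrite wsD !wsM0 e1 e2 !mmap_head mderivM mevalD !mevalM.
  by congr (_ * _ + _); congr meval; apply/funext => j; rewrite xy.
Qed.

End SeriesRing.

(** * Polynomials with a distinguished last variable *)

Section Univariate.
Variables (R : realType) (d : nat).

Lemma extend_family_lift (T : Type) (y : 'I_d -> T) z i :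
  extend_family y z (lift ord_max i) = y i.
Proof. by rewrite /extend_family liftK. Qed.

Lemma extend_family_max (T : Type) (y : 'I_d -> T) z : extend_family y z ord_max = z.
Proof. by rewrite /extend_family unlift_none. Qed.

Lemma extend_familyE (T : Type) (h : 'I_d.+1 -> T) :
  extend_family (fun i => h (lift ord_max i)) (h ord_max) = h.
Proof.
by apply/funext => i; case: (unliftP ord_max i) => [j|] ->;
  rewrite ?extend_family_lift ?extend_family_max.
Qed.

Definition uni : mpoly d.+1 R -> {poly (mpoly d R)} :=
  mmap (polyC \o @mpolyC d R) (extend_family (fun i => (polyvar R i)%:P) 'X).

Lemma uni_eval (S : comNzRingType) (jm : {rmorphism R -> S}) (y : 'I_d -> S) z P :
  mmap jm (extend_family y z) P = (map_poly (mmap jm y) (uni P)).[z].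
Proof.
elim/mpoly_ring_ind: P => [c|i|P Q h1 h2|P Q h1 h2].
- by rewrite /uni !mmapC /= map_polyC /= hornerC mmapC.
- rewrite /uni !mmapX !mmap1U; case: (unliftP ord_max i) => [j|] ->.
    by rewrite !extend_family_lift map_polyC /= hornerC mmapX mmap1U.
  by rewrite !extend_family_max map_polyX hornerX.
- by rewrite /uni !rmorphD hornerD; congr (_ + _); [exact: h1|exact: h2].
- by rewrite /uni !rmorphM hornerM; congr (_ * _); [exact: h1|exact: h2].
Qed.

Lemma mmap_id k (P : mpoly k R) : mmap (@mpolyC k R) (fun i => polyvar R i) P = P.
Proof.
elim/mpoly_ring_ind: P => [c|i|P Q h1 h2|P Q h1 h2].
- by rewrite mmapC.
- by rewrite mmapX mmap1U.
- by rewrite rmorphD; congr (_ + _); [exact: h1|exact: h2].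
- by rewrite rmorphM; congr (_ * _); [exact: h1|exact: h2].
Qed.

Lemma uni_neq0 P : P != 0 -> uni P != 0.
Proof.
apply: contraNneq => P0.
have := @uni_eval _ (@mpolyC d.+1 R) (fun i => polyvar R (lift ord_max i)) (polyvar R ord_max) P.
by rewrite (@extend_familyE _ (fun i => polyvar R i)) mmap_id P0 map_poly0 horner0 => ->.
Qed.

End Univariate.

Lemma nontrivial_kernel (R : fieldType) (I J : finType) (c : I -> J -> R) : (#|J| < #|I|)%N ->
  exists2 l : I -> R, (exists i, l i != 0) & forall j, \sum_i l i * c i j = 0.
Proof.
move=> JI; pose M := \matrix_(i < #|I|, j < #|J|) c (enum_val i) (enum_val j).
have : kermx M != 0.
  rewrite -mxrank_eq0 mxrank_ker -lt0n subn_gt0.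
  by apply: leq_ltn_trans JI; rewrite rank_leq_col.
move=> /rowV0Pn[v /sub_kermxP vM v0].
exists (fun i => v 0 (enum_rank i)).
  by have /rV0Pn[i vi] := v0; exists (enum_val i); rewrite enum_valK.
pose h : 'I_#|I| -> I := fun k => enum_val k.
move=> j; transitivity ((v *m M) 0 (enum_rank j)); last by rewrite vM mxE.
rewrite mxE (reindex h) /=; last first.
  by exists enum_rank => i _; rewrite /h ?enum_rankK ?enum_valK.
by apply: eq_bigr => i _; rewrite enum_valK mxE enum_rankK.
Qed.

Section Counting.
Variables (R : realType) (F : fieldType) (jm : {rmorphism R -> F}) (e M D : nat).
Variables (y : 'I_e -> F) (x : 'I_M -> F).
Local Notation ev := (mmap jm y).

Definition xmon (b : {ffun 'I_M -> 'I_D}) : F := \prod_m x m ^+ b m.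

(** Elements in reduced form: powers of the x below D, with coefficients polynomial in y. The bound
    k on the size of the coefficients is what is finally counted. *)
Definition polyspan (k : nat) (v : F) : Prop :=
  exists2 P : {ffun 'I_M -> 'I_D} -> mpoly e R,
    forall b, (msize (P b) <= k)%N & v = \sum_b ev (P b) * xmon b.

Lemma msizeD_leq (P Q : mpoly e R) k : (msize P <= k)%N -> (msize Q <= k)%N ->
  (msize (P + Q) <= k)%N.
Proof.
move=> h1 h2; apply: leq_trans (@mmeasureD_le _ _ mdeg P Q) _.
by rewrite geq_max h1.
Qed.

Lemma polyspanD k v w : polyspan k v -> polyspan k w -> polyspan k (v + w).
Proof.
move=> [P hP ->] [Q hQ ->]; exists (fun b => P b + Q b).
  by move=> b; apply: msizeD_leq.
by rewrite -big_split /=; apply: eq_bigr => b _; rewrite rmorphD mulrDl.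
Qed.

Lemma polyspan0 k : polyspan k 0.
Proof.
exists (fun=> 0) => [b|]; first by rewrite msize0.
by rewrite big1 // => b _; rewrite rmorph0 mul0r.
Qed.

Lemma polyspan_sum k (I : Type) (s : seq I) (v : I -> F) :
  (forall i, polyspan k (v i)) -> polyspan k (\sum_(i <- s) v i).
Proof.
move=> h; elim: s => [|i s ih]; first by rewrite big_nil; apply: polyspan0.
by rewrite big_cons; apply: polyspanD.
Qed.

Lemma polyspan_term k P b : (msize P <= k)%N -> polyspan k (ev P * xmon b).
Proof.
move=> hP; exists (fun b' => if b' == b then P else 0).
  by move=> b'; case: ifP => //; rewrite msize0.
rewrite (bigD1 b) //= eqxx big1 ?addr0 // => b' /negbTE->.
by rewrite rmorph0 mul0r.
Qed.

Definition upd_exp (b : {ffun 'I_M -> 'I_D}) m i : {ffun 'I_M -> 'I_D} :=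
  [ffun m' => if m' == m then i else b m'].

Lemma xmon_upd b m i : xmon (upd_exp b m i) = x m ^+ i * \prod_(m' | m' != m) x m' ^+ b m'.
Proof.
rewrite /xmon (bigD1 m) //= ffunE eqxx; congr (_ * _).
by apply: eq_bigr => m' /negbTE h; rewrite ffunE h.
Qed.

Lemma upd_id b m : upd_exp b m (b m) = b.
Proof. by apply/ffunP => m'; rewrite ffunE; case: eqP => [->|]. Qed.

Lemma xmon_split b m : xmon b = x m ^+ b m * \prod_(m' | m' != m) x m' ^+ b m'.
Proof. by rewrite -{1}(upd_id b m) xmon_upd. Qed.

Variables (q : mpoly e R) (A : 'I_M -> 'I_D -> mpoly e R) (dl : nat).
Hypothesis q_dl : (msize q <= dl)%N.
Hypothesis A_dl : forall m i, (msize (A m i) <= dl)%N.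
Hypothesis relA : forall m, ev q * x m ^+ D = \sum_(i < D) ev (A m i) * x m ^+ i.

Lemma msizeM_leq (P Q : mpoly e R) a b : (msize P <= a)%N -> (msize Q <= b)%N ->
  (msize (P * Q) <= b + a)%N.
Proof.
move=> h1 h2; have [->|P0] := eqVneq P 0; first by rewrite mul0r msize0.
have [->|Q0] := eqVneq Q 0; first by rewrite mulr0 msize0.
by rewrite msizeM // addnC (leq_trans (leq_pred _)) // leq_add.
Qed.

(** Multiplying by q x_m either raises an exponent or, when it reaches D, uses the relation [relA];
    in both cases the coefficients grow by dl only. *)
Lemma polyspan_step m k v : polyspan k v -> polyspan (k + dl) (ev q * x m * v).
Proof.
move=> [P hP ->]; rewrite mulr_sumr; apply: polyspan_sum => b.
have [h|h] := ltnP (b m).+1 D.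
  have -> : ev q * x m * (ev (P b) * xmon b) = ev (q * P b) * xmon (upd_exp b m (Ordinal h)).
    by rewrite xmon_upd (xmon_split b m) rmorphM /= exprS mulrACA !mulrA.
  by apply: polyspan_term; apply: msizeM_leq.
have bD : (b m).+1 = D by apply/eqP; rewrite eqn_leq h ltn_ord.
have -> : ev q * x m * (ev (P b) * xmon b) = \sum_(i < D) ev (A m i * P b) * xmon (upd_exp b m i).
  rewrite (xmon_split b m); set w := \prod_(_ | _) _.
  transitivity ((ev q * x m ^+ (b m).+1) * (ev (P b) * w)).
    by rewrite exprS !mulrA; congr (_ * w); rewrite -!mulrA (mulrC (ev (P b))).
  rewrite bD relA mulr_suml; apply: eq_bigr => i _.
  by rewrite xmon_upd -/w rmorphM mulrACA.
by apply: polyspan_sum => i; apply: polyspan_term; apply: msizeM_leq.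
Qed.

Lemma polyspan_pow m n k v : polyspan k v -> polyspan (k + dl * n) ((ev q * x m) ^+ n * v).
Proof.
elim: n k v => [|n ih] k v h; first by rewrite muln0 addn0 expr0 mul1r.
rewrite exprS -mulrA mulnS addnC -addnA addnC; apply: polyspan_step.
by rewrite addnC; apply: ih.
Qed.

Lemma polyspan1 : (0 < D)%N -> polyspan 1 1.
Proof.
move=> D0; have := @polyspan_term 1 1 [ffun=> Ordinal D0] _; rewrite msize1 => /(_ isT).
by rewrite rmorph1 mul1r /xmon big1 // => m _; rewrite ffunE expr0.
Qed.

(** These are the monomials of degree at most N in each quotient of x (a i) by x (b i), cleared of
    denominators; their reduced coefficients have size linear in N. *)
Lemma monomial_span N k (a b : 'I_k -> 'I_M) (al : {ffun 'I_k -> 'I_N.+1}) : (0 < D)%N ->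
  polyspan (1 + dl * (N * k)) (\prod_i (ev q ^+ N * (x (a i) ^+ al i * x (b i) ^+ (N - al i)))).
Proof.
move=> D0; rewrite -[X in (_ * (_ * X))%N](size_enum_ord k).
rewrite -(big_enum _ _ predT) /=.
elim: (enum 'I_k) => [|i s ih] /=; first by rewrite big_nil muln0 muln0 addn0; apply: polyspan1.
rewrite big_cons.
have -> : ev q ^+ N * (x (a i) ^+ al i * x (b i) ^+ (N - al i)) =
    (ev q * x (a i)) ^+ al i * (ev q * x (b i)) ^+ (N - al i).
  by rewrite !exprMn mulrACA -exprD subnKC // -ltnS.
rewrite -mulrA mulnS mulnDr addnA addnAC.
have -> : (1 + dl * (N * size s) + dl * N = 1 + dl * (N * size s) + dl * (N - al i) + dl * al i)%N.
  by rewrite -[RHS]addnA -mulnDr subnK // -ltnS.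
by do 2 apply: polyspan_pow.
Qed.

Lemma polyspan_coef k v : polyspan k v ->
  exists c : {ffun 'I_M -> 'I_D} * {ffun 'I_e -> 'I_k} -> R,
    v = \sum_t jm (c t) * (xmon t.1 * \prod_i y i ^+ t.2 i).
Proof.
move=> [P hP ->].
exists (fun t : {ffun 'I_M -> 'I_D} * {ffun 'I_e -> 'I_k} =>
  mcoeff (Multinom [tuple nat_of_ord (t.2 i) | i < e]) (P t.1)).
rewrite -(pair_bigA _ (fun (b : {ffun 'I_M -> 'I_D}) (nu : {ffun 'I_e -> 'I_k}) => jm (mcoeff (Multinom [tuple nat_of_ord (nu i) | i < e]) (P b))
  * (xmon b * \prod_i y i ^+ nu i))) /=.
apply: eq_bigr => b _; transitivity ((\sum_(m <- mnm_box e k) jm (mcoeff m (P b)) * mmap1 y m) * xmon b).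
  congr (_ * _); rewrite [RHS](bigID (fun m => m \in msupp (P b))) /=.
  rewrite [X in _ = _ + X]big1 ?addr0 => [|m /memN_msupp_eq0->]; last by rewrite rmorph0 mul0r.
  rewrite -[RHS]big_filter /mmap; apply: perm_big; apply: uniq_perm.
  - exact: msupp_uniq.
  - by rewrite filter_uniq // mnm_box_uniq.
  move=> m; rewrite mem_filter; case: (boolP (m \in msupp (P b))) => //= hm.
  rewrite mem_mnm_box; apply/esym/forallP => i.
  apply: leq_trans (leq_trans (msize_mdeg_lt hm) (hP b)).
  by rewrite ltnS mdegE (bigD1 i) //= leq_addr.
rewrite /mnm_box big_image /= mulr_suml; apply: eq_bigr => nu _.
rewrite -mulrA [_ * xmon b]mulrC; congr (_ * (_ * _)).
by rewrite /mmap1; apply: eq_bigr => i _; rewrite multinomE tnth_mktuple.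
Qed.

(** The (N + 1)^(e + 1) monomials in the e + 1 quotients lie in a space of dimension at most D^M K^e
    with K linear in N, so for large N they are linearly dependent. *)
Lemma quotients_dependent (z : 'I_e.+1 -> F) (a b : 'I_e.+1 -> 'I_M) : (0 < D)%N -> ev q != 0 ->
  (forall i, x (b i) != 0 /\ z i = x (a i) / x (b i)) ->
  exists2 P : mpoly e.+1 R, P != 0 & mmap jm z P = 0.
Proof.
move=> D0 q0 hz.
(* The constant [c0] gives K <= c0 (N + 1), and N is chosen so that D^M c0^e < N + 1. *)
pose c0 := (1 + dl * e.+1)%N; pose N := (D ^ M * c0 ^ e)%N.
pose K := (1 + dl * (N * e.+1))%N.
pose I := {ffun 'I_e.+1 -> 'I_N.+1}; pose J := ({ffun 'I_M -> 'I_D} * {ffun 'I_e -> 'I_K})%type.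
have JI : (#|{: J}| < #|{: I}|)%N.
  rewrite card_prod !card_ffun !card_ord.
  have KN : (K <= c0 * N.+1)%N.
    by rewrite /K /c0 mulnDl mul1n -mulnA leq_add // leq_mul // mulnC leq_mul2l leqnSn orbT.
  apply: (@leq_ltn_trans (D ^ M * (c0 * N.+1) ^ e)%N); first rewrite leq_mul //.
    by elim: (e) => // k ih; rewrite !expnS leq_mul.
  by rewrite expnMn mulnA -/N expnS ltn_mul2r ltnSn expn_gt0.
have hs (al : I) := polyspan_coef (@monomial_span N e.+1 a b al D0).
have [l [al l0] hl] := nontrivial_kernel (fun (al : I) (t : J) => sval (cid (hs al)) t) JI.
pose mm (al : I) := Multinom [tuple nat_of_ord (al i) | i < e.+1].
have mm_inj : injective mm.
  move=> f g /mnmP H; apply/ffunP => i; apply: val_inj; have := H i.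
  by rewrite !multinomE !tnth_mktuple.
exists (\sum_(al : I) l al *: mpolyX R (mm al)).
  apply: contraNneq l0 => /(congr1 (mcoeff (mm al))).
  rewrite mcoeff0 raddf_sum /= (bigD1 al) //= big1 => [|al' ne]; rewrite mcoeffZ mcoeffX.
    by rewrite eqxx mulr1 addr0 => ->.
  by rewrite (inj_eq mm_inj) (negbTE ne) mulr0.
pose W := \prod_(i < e.+1) (ev q ^+ N * x (b i) ^+ N).
have W0 : W != 0.
  by apply/prodf_neq0 => i _; rewrite mulf_neq0 // expf_neq0 // (hz i).1.
apply: (mulfI W0); rewrite mulr0 raddf_sum /= mulr_sumr.
transitivity (\sum_(al : I) jm (l al) * \sum_(t : J) jm (sval (cid (hs al)) t) *
    (xmon t.1 * \prod_i y i ^+ t.2 i)).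
  apply: eq_bigr => al' _; rewrite -(svalP (cid (hs al'))) mmapZ mulrCA; congr (_ * _).
  rewrite mmapX /mmap1 -big_split /=; apply: eq_bigr => i _.
  rewrite multinomE tnth_mktuple; have [xb ->] := hz i.
  rewrite -mulrA expr_div_n; congr (_ * _).
  rewrite mulrCA; congr (_ * _); rewrite expfB_cond //.
  by rewrite (negbTE xb) add0n -ltnS.
under eq_bigr do rewrite mulr_sumr.
rewrite exchange_big /= big1 // => t _.
transitivity (jm (\sum_al l al * sval (cid (hs al)) t) * (xmon t.1 * \prod_i y i ^+ t.2 i));
  last by rewrite hl rmorph0 mul0r.
rewrite rmorph_sum mulr_suml.
by apply: eq_bigr => al' _; rewrite rmorphM mulrA.
Qed.

End Counting.

(** The exchange property of transcendence bases, in the form used below: for fractions of elements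
    algebraic over e independent ones. *)
Lemma indep_quotients_dependent (R : realType) (F : fieldType) (jm : {rmorphism R -> F})
    e (y : 'I_e -> F) (f g : 'I_e.+1 -> F) : alg_indep jm y ->
  (forall x, (exists i, x = f i) \/ (exists i, x = g i) ->
     exists2 P : mpoly e.+1 R, P != 0 & mmap jm (extend_family y x) P = 0) ->
  (forall i, g i != 0) ->
  exists2 P : mpoly e.+1 R, P != 0 & mmap jm (fun i => f i / g i) P = 0.
Proof.
move=> iy hx g0; pose M := (e.+1 + e.+1)%N.
pose x (m : 'I_M) := match fintype.split m with inl i => f i | inr i => g i end.
have hP m : exists2 P : mpoly e.+1 R, P != 0 & mmap jm (extend_family y (x m)) P = 0.
  by apply: hx; rewrite /x; case: (fintype.split m) => i; [left|right]; exists i.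
pose p m := uni (s2val (cid2 (hP m))).
have p0 m : p m != 0 by apply: uni_neq0; exact: (s2valP (cid2 (hP m))).
have px m : (map_poly (mmap jm y) (p m)).[x m] = 0.
  by rewrite /p -uni_eval; exact: (s2valP' (cid2 (hP m))).
(* All relations are brought to one degree D > 0 and one leading coefficient q, by multiplying with
   a power of the variable and with the other leading coefficients. Independence of y keeps q
   nonzero. *)
pose s m := (size (p m)).-1; pose D := (\max_m s m).+1.
pose qm m := \prod_(m' | m' != m) lead_coef (p m'); pose q := \prod_m lead_coef (p m).
pose p' m := qm m *: ('X^(D - s m) * p m).
have sD m : (s m <= D)%N by rewrite ltnW // ltnS (leq_bigmax m).
have sp' m : (size (p' m) <= D.+1)%N.
  apply: leq_trans (size_scale_leq _ _) _; apply: leq_trans (size_polyMleq _ _) _.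
  by rewrite size_polyXn addSn /= -[X in (_ + X <= _)%N]prednK ?size_poly_gt0 // addnS subnK.
have p'D m : (p' m)`_D = q.
  rewrite coefZ coefXnM ltnNge leq_subr /= subKn // -/(lead_coef (p m)).
  by rewrite /q (bigD1 m) //= mulrC.
have p'x m : (map_poly (mmap jm y) (p' m)).[x m] = 0.
  by rewrite map_polyZ rmorphM /= hornerZ hornerM px !mulr0.
pose A m (i : 'I_D) := - (p' m)`_i.
pose dl := maxn (msize q) (\max_m \max_i msize (A m i)).
have relA m : mmap jm y q * x m ^+ D = \sum_(i < D) mmap jm y (A m i) * x m ^+ i.
  have := p'x m; rewrite (@horner_coef_wide _ D.+1); last first.
    by apply: leq_trans (sp' m); apply: size_poly.
  rewrite big_ord_recr /= coef_map /= p'D addrC => /eqP; rewrite addr_eq0 => /eqP->.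
  by rewrite -sumrN; apply: eq_bigr => i _; rewrite coef_map /A rmorphN mulNr.
have q0 : mmap jm y q != 0.
  apply/eqP => /iy/eqP; apply/negP; apply/prodf_neq0 => m _.
  by rewrite lead_coef_eq0.
have xE i : x (lshift _ i) = f i /\ x (rshift _ i) = g i.
  by rewrite /x; split; [rewrite (unsplitK (inl _ i))|rewrite (unsplitK (inr _ i))].
have q_dl : (msize q <= dl)%N by rewrite leq_maxl.
have A_dl m i : (msize (A m i) <= dl)%N.
  apply: leq_trans (leq_maxr _ _).
  by apply: leq_trans (leq_bigmax m); apply: (@leq_bigmax _ (fun i => msize (A m i)) i).
apply: (quotients_dependent q_dl A_dl relA (a := @lshift e.+1 e.+1) (b := @rshift e.+1 e.+1)) => //.
  by move=> i; have [-> ->] := xE i.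
Qed.

Lemma mmap_comp (R : realType) (S : comNzRingType) (jm : {rmorphism R -> S}) k d
    (P : mpoly k R) (v : 'I_k -> mpoly d R) (y : 'I_d -> S) :
  mmap jm y (mmap (@mpolyC d R) v P) = mmap jm (fun i => mmap jm y (v i)) P.
Proof.
elim/mpoly_ring_ind: P => [c|i|P Q h1 h2|P Q h1 h2].
- by rewrite !mmapC.
- by rewrite !mmapX !mmap1U.
- by rewrite !rmorphD; congr (_ + _); [exact: h1|exact: h2].
- by rewrite !rmorphM; congr (_ * _); [exact: h1|exact: h2].
Qed.

Lemma mmap_rename_inj (R : realType) k d (s : 'I_k -> 'I_d) (P : mpoly k R) : injective s ->
  mmap (@mpolyC d R) (fun i => polyvar R (s i)) P = 0 -> P = 0.
Proof.
move=> si P0; pose t i : mpoly k R := if [pick j | s j == i] is Some j then polyvar R j else 0.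
have := mmap_comp (@mpolyC k R) P (fun i => polyvar R (s i)) t; rewrite P0 rmorph0.
rewrite (_ : (fun i => _) = (fun i => polyvar R i)) ?mmap_id => [<-//|].
apply/funext => i; rewrite mmapX mmap1U /t; case: pickP => [j /eqP/si->//|/(_ i)].
by rewrite eqxx.
Qed.

Lemma widen_ord_injective k n (h : (k <= n)%N) : injective (widen_ord h).
Proof. by move=> i j /(congr1 val) /= /val_inj. Qed.

Lemma alg_indep_sub (R : realType) (F : fieldType) (jm : {rmorphism R -> F}) k d
    (y : 'I_d -> F) (s : 'I_k -> 'I_d) : injective s -> alg_indep jm y ->
  alg_indep jm (fun i => y (s i)).
Proof.
move=> si iy P P0; apply: (mmap_rename_inj si); apply: iy; rewrite mmap_comp -P0.
by congr mmap; apply/funext => i; rewrite mmapX mmap1U.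
Qed.

(** * Transcendence degree of algebras of functions *)

Section FunctionalDependence.
Variables (R : realType) (T : Type) (D : set T).
Implicit Types A : set (T -> R).

Definition fdep k (y : 'I_k -> T -> R) :=
  exists2 P : mpoly k R, P != 0 & forall u, D u -> meval (fun i => y i u) P = 0.

(** Transcendence degree without a field: it counts independent members of A itself, tested as
    functions on D. The comparison with [trdeg] is made in [trdeg_tdeg] and [tdeg_trdeg]. *)
Definition tdeg A d := (exists2 y : 'I_d -> T -> R, (forall i, A (y i)) & ~ fdep y) /\
  forall z : 'I_d.+1 -> T -> R, (forall i, A (z i)) -> fdep z.

Lemma meval_mmap k (P : mpoly k R) (v : 'I_k -> R) : meval v P = mmap (@idfun R) v P.
Proof. by []. Qed.

Lemma fdep_sub k d (y : 'I_d -> T -> R) (s : 'I_k -> 'I_d) : injective s ->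
  fdep (fun i => y (s i)) -> fdep y.
Proof.
move=> si [P P0 hP]; exists (mmap (@mpolyC d R) (fun i => polyvar R (s i)) P).
  by apply: contraNneq P0 => /mmap_rename_inj->.
move=> u Du; rewrite meval_mmap mmap_comp -(hP u Du).
by congr mmap; apply/funext => i; rewrite mmapX mmap1U.
Qed.

Lemma fdep_more A n k (z : 'I_k -> T -> R) : (n < k)%N ->
  (forall z : 'I_n.+1 -> T -> R, (forall i, A (z i)) -> fdep z) ->
  (forall i, A (z i)) -> fdep z.
Proof.
move=> nk h Az; apply: (@fdep_sub _ _ z (widen_ord nk)); first exact: widen_ord_injective.
by apply: h => i; apply: Az.
Qed.

Lemma tdeg_le A d d' : tdeg A d ->
  (forall z : 'I_d'.+1 -> T -> R, (forall i, A (z i)) -> fdep z) -> (d <= d')%N.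
Proof.
move=> [[y Ay ny] _] h; rewrite leqNgt; apply/negP => dd'.
by apply: ny; apply: (fdep_more dd' h).
Qed.

Lemma tdeg_unique A d d' : tdeg A d -> tdeg A d' -> d = d'.
Proof.
move=> h h'; apply/eqP; rewrite eqn_leq (tdeg_le h h'.2).
exact: tdeg_le h' h.2.
Qed.

Lemma tdeg_exists A n : (exists u, D u) ->
  (forall z : 'I_n.+1 -> T -> R, (forall i, A (z i)) -> fdep z) ->
  exists2 d, (d <= n)%N & tdeg A d.
Proof.
move=> [u Du]; elim: n => [|n ih] h.
  exists 0%N => //; split=> //; exists (fun _ _ => 0) => [[]//|[P P0 hP]].
  have [c cP] : exists c, P = mpolyC 0 c.
    exists (mcoeff (@mnm0 0) P); apply/mpolyP => m; rewrite mcoeffC.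
    by rewrite (_ : m = mnm0) ?eqxx ?mulr1 //; apply/mnmP => -[].
  by move: P0 (hP u Du); rewrite cP mevalC => /eqP P0 c0; apply: P0; rewrite c0 mpolyC0.
have [h'|] := pselect (forall z : 'I_n.+1 -> T -> R, (forall i, A (z i)) -> fdep z).
  by have [d dn hd] := ih h'; exists d => //; apply: leqW.
move=> /existsNP[y /not_implyP[Ay ny]]; exists n.+1 => //; split=> //.
by exists y.
Qed.

Lemma subalg_meval A k (P : mpoly k R) (z : 'I_k -> T -> R) : subalgebra A ->
  (forall i, A (z i)) -> A (fun u => meval (fun i => z i u) P).
Proof.
move=> [Ac Ad Am] Az; elim/mpoly_ring_ind: P => [c|i|P Q h1 h2|P Q h1 h2].
- by under eq_fun do rewrite mevalC; apply: Ac.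
- by under eq_fun do rewrite mevalXU; apply: Az.
- by under eq_fun do rewrite mevalD; apply: Ad.
- by under eq_fun do rewrite mevalM; apply: Am.
Qed.

Lemma hom_meval A (B : comNzRingType) (sc : {rmorphism R -> B}) (tau : (T -> R) -> B) :
  subalgebra A -> (forall c, tau (cst c) = sc c) ->
  (forall f g, A f -> A g -> tau (f \+ g) = tau f + tau g) ->
  (forall f g, A f -> A g -> tau (f \* g) = tau f * tau g) ->
  forall k (P : mpoly k R) (z : 'I_k -> T -> R), (forall i, A (z i)) ->
  tau (fun u => meval (fun i => z i u) P) = mmap sc (fun i => tau (z i)) P.
Proof.
move=> sA tc td tm k P z Az; elim/mpoly_ring_ind: P => [c|i|P Q h1 h2|P Q h1 h2].
- rewrite mmapC; transitivity (tau (cst c)); last exact: tc.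
  by congr tau; apply/funext => u; rewrite mevalC.
- by rewrite mmapX mmap1U; congr tau; apply/funext => u; rewrite mevalXU.
- rewrite rmorphD -[X in _ = X + _]h1 -[X in _ = _ + X]h2 -td; try exact: subalg_meval.
  by congr tau; apply/funext => u; rewrite mevalD.
- rewrite rmorphM -[X in _ = X * _]h1 -[X in _ = _ * X]h2 -tm; try exact: subalg_meval.
  by congr tau; apply/funext => u; rewrite mevalM.
Qed.

Section Embedding.
Variables (A : set (T -> R)) (B : comNzRingType) (sc : {rmorphism R -> B}) (tau : (T -> R) -> B).
Hypothesis sA : subalgebra A.
Hypothesis tc : forall c, tau (cst c) = sc c.
Hypothesis td : forall f g, A f -> A g -> tau (f \+ g) = tau f + tau g.
Hypothesis tm : forall f g, A f -> A g -> tau (f \* g) = tau f * tau g.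
Hypothesis te : forall f g, A f -> A g -> (tau f = tau g <-> forall x, D x -> f x = g x).

Lemma embed_dep k (z : 'I_k -> T -> R) (P : mpoly k R) : (forall i, A (z i)) ->
  (mmap sc (fun i => tau (z i)) P = 0 <-> forall u, D u -> meval (fun i => z i u) P = 0).
Proof.
move=> Az; rewrite -(hom_meval sA tc td tm) // -(rmorph0 sc) -tc.
by have [Ac _ _] := sA; rewrite te; [|exact: subalg_meval|exact: Ac].
Qed.

End Embedding.

(** The members of a transcendence basis are fractions and need not lie in A. If A had only e < d
    independent members, e + 1 of these fractions would be dependent. *)
Lemma trdeg_tdeg A d : subalgebra A -> trdeg D A d -> tdeg A d.
Proof.
move=> sA [F [iota [y [[te i1 td tm fr] [iy my]]]]].
have [Ac Ad Am] := sA.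
(* [iota] is a bare map that respects the operations on members of A; on constants it is a ring
   morphism and is packed as one. *)
have cstD a b : iota (cst (a + b)) = iota (cst a) + iota (cst b) by rewrite -td.
have iN a b : iota (cst (a - b)) = iota (cst a) - iota (cst b).
  by apply/eqP; rewrite eq_sym subr_eq -cstD subrK.
have iM : monoid_morphism (fun c => iota (cst c)) by split=> // a b; rewrite -tm.
pose j0 : R -> F := fun c => iota (cst c).
pose ja := GRing.isZmodMorphism.Build R F j0 iN.
pose jb := GRing.isMonoidMorphism.Build R F j0 iM.
pose jm : {rmorphism R -> F} := HB.pack j0 ja jb.
have tc c : iota (cst c) = jm c by [].
have dep k (z : 'I_k -> T -> R) P : (forall i, A (z i)) ->
    (mmap jm (fun i => iota (z i)) P = 0 <-> forall u, D u -> meval (fun i => z i u) P = 0).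
  by apply: embed_dep.
have alg z : exists2 P : mpoly d.+1 R, P != 0 & mmap jm (extend_family y z) P = 0.
  have /existsNP[P /not_implyP[h1 h2]] := my z; exists P => //; exact/eqP.
have all_dep (z : 'I_d.+1 -> F) : exists2 P : mpoly d.+1 R, P != 0 & mmap jm z P = 0.
  have [//|_|P P0 hP] := @indep_quotients_dependent R F jm d y z (fun=> 1) iy.
    exact: oner_neq0.
  exists P => //; rewrite -hP; congr mmap.
  by apply/funext => i; rewrite divr1.
have all_fdep (z : 'I_d.+1 -> T -> R) : (forall i, A (z i)) -> fdep z.
  move=> Az; have [P P0 hP] := all_dep (fun i => iota (z i)).
  by exists P => //; apply/(dep _ z).
have neD : exists u, D u.
  apply: contrapT => nD; have : iota (cst 1) = iota (cst 0).
    by apply/te => // x Dx; case: nD; exists x.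
  by rewrite i1 [RHS](rmorph0 jm) => /eqP; rewrite oner_eq0.
have [e ed he] := tdeg_exists neD all_fdep.
have [<-//|ned] := eqVneq e d; have {ned} ed : (e < d)%N by rewrite ltn_neqAle ned.
have [[v Av nv] hv] := he.
have iv : alg_indep jm (fun i => iota (v i)).
  move=> P hP; apply: contrapT => /eqP P0; apply: nv; exists P => //.
  by apply/(dep _ v).
have algv f : A f -> exists2 P : mpoly e.+1 R, P != 0 &
    mmap jm (extend_family (fun i => iota (v i)) (iota f)) P = 0.
  move=> Af; pose w := extend_family v f.
  have Aw i : A (w i).
    by rewrite /w; case: (unliftP ord_max i) => [j|] ->; rewrite ?extend_family_lift ?extend_family_max.
  have [P P0 /dep hP] := hv w Aw; exists P => //; rewrite -hP //; congr mmap.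
  apply/funext => i; rewrite /w; case: (unliftP ord_max i) => [j|] ->.
    by rewrite !extend_family_lift.
  by rewrite !extend_family_max.
pose s := widen_ord ed.
have hfr i : exists fg, [/\ A fg.1, A fg.2, iota fg.2 != 0 & y (s i) = iota fg.1 / iota fg.2].
  by have [f [g h]] := fr (y (s i)); exists (f, g).
pose fg i := sval (cid (hfr i)).
have fgP i := svalP (cid (hfr i)).
have [||P P0 hP] := @indep_quotients_dependent R F jm e _ (fun i => iota (fg i).1)
    (fun i => iota (fg i).2) iv.
- by move=> x [[i ->]|[i ->]]; apply: algv; have [] := fgP i.
- by move=> i; have [] := fgP i.
case/eqP: P0; apply: (@alg_indep_sub _ _ jm _ _ y s) => //; first exact: widen_ord_injective.
by rewrite -hP; congr mmap; apply/funext => i; have [] := fgP i.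
Qed.

End FunctionalDependence.

(** * Fraction fields cut out of a given field *)

Section SubfieldType.
Variables (F : fieldType) (S : divringClosed F).

Record subfield_of := SubfieldOf { subfield_val : F; _ : subfield_val \in S }.
HB.instance Definition _ := [isSub for subfield_val].
HB.instance Definition _ := [Choice of subfield_of by <:].
HB.instance Definition _ := [SubChoice_isSubIntegralDomain of subfield_of by <:].

Lemma subfield_unit (x : subfield_of) : x != 0 -> x \is a GRing.unit.
Proof.
move=> x0; have Sx : (val x)^-1 \in S by rewrite rpredVr // (valP x).
apply/unitrP; exists (SubfieldOf Sx); have vx0 : val x != 0 by apply: contraNneq x0 => h; apply/eqP/val_inj.
by split; apply: val_inj; rewrite rmorphM rmorph1 /= ?mulVf ?mulfV.
Qed.

(* A bare alias: declaring the field structure on the subtype itself makes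
   instance inference for the joined subtype structures explode. *)
Definition subfield_type : Type := subfield_of.
HB.instance Definition _ := GRing.IntegralDomain.copy subfield_type subfield_of.
HB.instance Definition _ := GRing.UnitRing_isField.Build subfield_type subfield_unit.

End SubfieldType.

Section FractionSubfield.
Variables (R : realType) (T : Type) (D : set T).
Variables (A : set (T -> R)) (B : fieldType) (sc : {rmorphism R -> B}) (tau : (T -> R) -> B).
Hypothesis sA : subalgebra A.
Hypothesis tc : forall c, tau (cst c) = sc c.
Hypothesis td : forall f g, A f -> A g -> tau (f \+ g) = tau f + tau g.
Hypothesis tm : forall f g, A f -> A g -> tau (f \* g) = tau f * tau g.
Hypothesis te : forall f g, A f -> A g -> (tau f = tau g <-> forall x, D x -> f x = g x).

(** [fraction_field] asks that every element be a fraction of members of A, so the field has to be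
    cut out of B. *)
Definition frac_pred : {pred B} := fun z =>
  `[< exists f g, [/\ A f, A g, tau g != 0 & z = tau f / tau g] >].

Lemma frac_predP z : z \in frac_pred ->
  exists f g, [/\ A f, A g, tau g != 0 & z = tau f / tau g].
Proof. by move=> /asboolP. Qed.

Lemma frac_pred_divring : divring_closed frac_pred.
Proof.
have [Ac Ad Am] := sA.
have Aopp f : A f -> A (cst (-1) \* f) by move=> Af; apply: Am.
have toppE f : A f -> tau (cst (-1) \* f) = - tau f.
  by move=> Af; rewrite tm // tc rmorphN1 mulN1r.
have t1 : tau (cst 1) = 1 by rewrite tc rmorph1.
split.
- apply/asboolP; exists (cst 1), (cst 1); split=> //; rewrite t1 ?oner_neq0 //.
  by rewrite divr1.
- move=> u v /frac_predP[f [g [Af Ag g0 ->]]] /frac_predP[f' [g' [Af' Ag' g0' ->]]].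
  apply/asboolP; exists ((f \* g') \+ (cst (-1) \* (f' \* g))), (g \* g').
  have A1 := Am _ _ Af Ag'; have A2 := Am _ _ Af' Ag.
  split; [by apply: Ad => //; apply: Aopp|exact: Am|by rewrite tm // mulf_neq0|].
  rewrite -mulNr addf_div // td ?toppE //; last exact: Aopp.
  by rewrite !tm // mulNr.
- move=> u v /frac_predP[f [g [Af Ag g0 ->]]] /frac_predP[f' [g' [Af' Ag' g0' ->]]].
  apply/asboolP; have [f0|f0] := eqVneq (tau f') 0.
    exists (cst 0), (cst 1); split=> //; first by rewrite t1 oner_neq0.
    by rewrite tc rmorph0 f0 !mul0r invr0 mulr0.
  exists (f \* g'), (g \* f'); split; [exact: Am|exact: Am|by rewrite tm // mulf_neq0|].
  by rewrite !tm // invf_div mulf_div.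
Qed.

HB.instance Definition _ := GRing.isDivringClosed.Build B frac_pred frac_pred_divring.

Definition frac_closed : divringClosed B := GRing.DivringClosed.clone _ frac_pred _.
Notation frac_sub := (subfield_type frac_closed).

Definition fval (x : frac_sub) : B := subfield_val x.

Lemma fvalI : injective fval.
Proof. exact: val_inj. Qed.
Lemma fvalD (x y : frac_sub) : fval (x + y) = fval x + fval y.
Proof. exact: (rmorphD (val : subfield_of frac_closed -> _)). Qed.
Lemma fvalM (x y : frac_sub) : fval (x * y) = fval x * fval y.
Proof. exact: (rmorphM (val : subfield_of frac_closed -> _)). Qed.
Lemma fval1 : fval 1 = 1.
Proof. exact: (rmorph1 (val : subfield_of frac_closed -> _)). Qed.
Lemma fval0 : fval 0 = 0.
Proof. exact: (rmorph0 (val : subfield_of frac_closed -> _)). Qed.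
Lemma fval_div (x y : frac_sub) : y != 0 -> fval (x / y) = fval x / fval y.
Proof.
move=> y0; have vy0 : fval y != 0.
  by apply: contraNneq y0 => h; apply/eqP/fvalI; rewrite h fval0.
by apply: (mulIf vy0); rewrite -fvalM !divfK.
Qed.

Definition frac_iota (f : T -> R) : frac_sub := insubd (0 : subfield_of frac_closed) (tau f).

Lemma frac_iotaE f : A f -> fval (frac_iota f) = tau f.
Proof.
have [Ac Ad Am] := sA; have t1 : tau (cst 1) = 1 by rewrite tc rmorph1.
move=> Af; rewrite /fval insubdK //; apply/asboolP; exists f, (cst 1); split=> //.
  by rewrite t1 oner_neq0.
by rewrite t1 divr1.
Qed.

(** A maximal independent family of A remains maximal in the fraction field, since any new element
    is a fraction of two elements algebraic over the family. *)
Lemma tdeg_trdeg d : tdeg D A d -> trdeg D A d.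
Proof.
have [Ac Ad Am] := sA; have t1 : tau (cst 1) = 1 by rewrite tc rmorph1.
move=> [[y Ay ny] hy]; pose F : fieldType := frac_sub.
exists F, frac_iota, (fun i => frac_iota (y i)).
have iE f g : A f -> A g -> (frac_iota f = frac_iota g <-> tau f = tau g).
  move=> Af Ag; split=> [/(congr1 fval)|h]; last by apply: fvalI; rewrite !frac_iotaE // h.
  by rewrite !frac_iotaE.
have i0 g : A g -> (frac_iota g != 0) = (tau g != 0).
  by move=> Ag; rewrite -(inj_eq fvalI) frac_iotaE // fval0.
have ff : fraction_field D A frac_iota.
  split.
  - by move=> f g Af Ag; rewrite iE // te.
  - by apply: fvalI; rewrite frac_iotaE // t1 fval1.
  - by move=> f g Af Ag; apply: fvalI; rewrite fvalD !frac_iotaE ?td //; apply: Ad.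
  - by move=> f g Af Ag; apply: fvalI; rewrite fvalM !frac_iotaE ?tm //; apply: Am.
  move=> z; have [f [g [Af Ag g0 hz]]] := frac_predP (valP z).
  exists f, g; split=> //; first by rewrite i0.
  by apply: fvalI; rewrite fval_div ?i0 // !frac_iotaE.
split=> //; have [_ j1 jd jmm frz] := ff.
have cstD a b : frac_iota (cst (a + b)) = frac_iota (cst a) + frac_iota (cst b) by rewrite -jd.
have iN a b : frac_iota (cst (a - b)) = frac_iota (cst a) - frac_iota (cst b).
  by apply/eqP; rewrite eq_sym subr_eq -cstD subrK.
have iM : monoid_morphism (fun c => frac_iota (cst c)) by split=> // a b; rewrite -jmm.
pose j0 : R -> F := fun c => frac_iota (cst c).
pose ja := GRing.isZmodMorphism.Build R F j0 iN.
pose jb := GRing.isMonoidMorphism.Build R F j0 iM.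
pose jm : {rmorphism R -> F} := HB.pack j0 ja jb.
have dep k (z : 'I_k -> T -> R) P : (forall i, A (z i)) ->
    (mmap jm (fun i => frac_iota (z i)) P = 0 <-> forall u, D u -> meval (fun i => z i u) P = 0).
  by apply: embed_dep => // f g Af Ag; rewrite iE // te.
have iy : alg_indep jm (fun i => frac_iota (y i)).
  move=> P hP; apply: contrapT => /eqP P0; apply: ny; exists P => //.
  by apply/(dep _ y).
have algy f : A f -> exists2 P : mpoly d.+1 R, P != 0 &
    mmap jm (extend_family (fun i => frac_iota (y i)) (frac_iota f)) P = 0.
  move=> Af; pose w := extend_family y f.
  have Aw i : A (w i).
    by rewrite /w; case: (unliftP ord_max i) => [j|] ->; rewrite ?extend_family_lift ?extend_family_max.
  have [P P0 /dep hP] := hy w Aw; exists P => //; rewrite -hP //; congr mmap.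
  apply/funext => i; rewrite /w; case: (unliftP ord_max i) => [j|] ->.
    by rewrite !extend_family_lift.
  by rewrite !extend_family_max.
split=> // z iz; have [f [g [Af Ag g0 hz]]] := frz z.
(* The family and the new element z are all written as fractions: y_i over 1, and f over g. *)
pose ff' := extend_family (fun i => frac_iota (y i)) (frac_iota f).
pose gg' := extend_family (fun=> 1) (frac_iota g) : 'I_d.+1 -> F.
have [|i|P P0 hP] := @indep_quotients_dependent R F jm d _ ff' gg' iy.
- move=> x [[i ->]|[i ->]]; case: (unliftP ord_max i) => [j|] ->;
    rewrite ?/ff' ?/gg' ?extend_family_lift ?extend_family_max; try exact: algy.
  by rewrite -j1; apply: algy.
- case: (unliftP ord_max i) => [j|] ->; rewrite /gg' ?extend_family_lift ?extend_family_max //.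
  exact: oner_neq0.
case/eqP: P0; apply: iz; rewrite -hP; congr mmap; apply/funext => i.
case: (unliftP ord_max i) => [j|] ->; rewrite /ff' /gg' ?extend_family_lift ?extend_family_max //.
by rewrite divr1.
Qed.

End FractionSubfield.

Lemma tdeg_trdeg_domain (R : realType) (T : Type) (D : set T) (A : set (T -> R))
    (B : idomainType) (sc : {rmorphism R -> B}) (tau : (T -> R) -> B) d :
  subalgebra A -> (forall c, tau (cst c) = sc c) ->
  (forall f g, A f -> A g -> tau (f \+ g) = tau f + tau g) ->
  (forall f g, A f -> A g -> tau (f \* g) = tau f * tau g) ->
  (forall f g, A f -> A g -> (tau f = tau g <-> forall x, D x -> f x = g x)) ->
  tdeg D A d -> trdeg D A d.
Proof.
move=> sA tc td tm te.
apply: (@tdeg_trdeg R T D A _ (@FracField.tofrac B \o sc) (fun f => @FracField.tofrac B (tau f)) sA).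
- by move=> c; rewrite tc.
- by move=> f g Af Ag; rewrite td // tofracD.
- by move=> f g Af Ag; rewrite tm // tofracM.
- move=> f g Af Ag; rewrite -te //; split=> [/eqP|->//].
  by rewrite tofrac_eq => /eqP.
Qed.

(** * Jets with respect to a family of derivations *)

Section Jets.
Variables (R : realType) (A : Type).

(** The first letter is differentiated first, so that the shift by a of the jet of f is the jet of
    [dl a f] by computation. *)
Definition jetser (X : Type) (dl : A -> (X -> R) -> X -> R) (x : X) (f : X -> R) : wseries R A :=
  fun w => foldl (fun g a => dl a g) f w x.

(** What Lie derivatives of analytic functions and the operators [input_deriv] on analytic maps have
    in common. The laws are required at points of P, outside which the total functions have
    arbitrary values. *)
Record frame (X : Type) (P : set X) (C : set (X -> R)) (dl : A -> (X -> R) -> X -> R) : Prop := Frame {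
  frame_alg : subalgebra C;
  frame_dl : forall a f, C f -> C (dl a f);
  frame_cst : forall a c x, P x -> dl a (cst c) x = 0;
  frameD : forall a f g x, C f -> C g -> P x -> dl a (f \+ g) x = dl a f x + dl a g x;
  frameM : forall a f g x, C f -> C g -> P x -> dl a (f \* g) x = dl a f x * g x + f x * dl a g x;
  frame_ext : forall a f g, C f -> C g -> (forall x, P x -> f x = g x) ->
    forall x, P x -> dl a f x = dl a g x }.

Section FrameTheory.
Variables (X : Type) (P : set X) (C : set (X -> R)) (dl : A -> (X -> R) -> X -> R).
Hypothesis fr : frame P C dl.

Lemma jet_ext f g x : C f -> C g -> (forall x, P x -> f x = g x) -> P x ->
  jetser dl x f = jetser dl x g.
Proof.
move=> Cf Cg fg Px; apply/funext => w; elim: w f g Cf Cg fg => [|a w ih] f g Cf Cg fg.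
  exact: fg.
apply: ih; [exact: (frame_dl fr)|exact: (frame_dl fr)|exact: (frame_ext fr)].
Qed.

Lemma jet_cst c x : P x -> jetser dl x (cst c) = @scst R A c.
Proof.
move=> Px; have [Cc _ _] := frame_alg fr; apply/funext => -[|a w] //.
rewrite -[LHS]/(jetser dl x (dl a (cst c)) w) (@jet_ext _ (cst 0)) //; last 2 first.
- exact: (frame_dl fr).
- by move=> y; apply: (frame_cst fr).
elim: w => [//|b w ih].
rewrite -[LHS]/(jetser dl x (dl b (cst 0)) w) (@jet_ext _ (cst 0)) //.
  exact: (frame_dl fr).
by move=> y; apply: (frame_cst fr).
Qed.

Lemma jetD f g x : C f -> C g -> P x -> jetser dl x (f \+ g) = jetser dl x f + jetser dl x g.
Proof.
have [_ Cd _] := frame_alg fr.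
move=> Cf Cg Px; apply/funext => w; elim: w f g Cf Cg => [//|a w ih] f g Cf Cg.
rewrite -[LHS]/(jetser dl x (dl a (f \+ g)) w) -[RHS]/((jetser dl x (dl a f) + jetser dl x (dl a g)) w).
have [Df Dg] := (frame_dl fr a Cf, frame_dl fr a Cg).
rewrite -(ih _ _ Df Dg) (@jet_ext _ (dl a f \+ dl a g)) //.
- by apply: (frame_dl fr); apply: Cd.
- exact: Cd.
- by move=> y Py; rewrite (frameD fr).
Qed.

Lemma jetM f g x : C f -> C g -> P x -> jetser dl x (f \* g) = jetser dl x f * jetser dl x g.
Proof.
have [_ Cd Cm] := frame_alg fr.
move=> Cf Cg Px; apply/funext => w; elim: w f g Cf Cg => [//|a w ih] f g Cf Cg.
rewrite -[LHS]/(jetser dl x (dl a (f \* g)) w).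
rewrite -[RHS]/((jetser dl x (dl a f) * jetser dl x g) w + (jetser dl x f * jetser dl x (dl a g)) w).
have [Df Dg] := (frame_dl fr a Cf, frame_dl fr a Cg).
rewrite -(ih _ _ Df Cg) -(ih _ _ Cf Dg) (@jet_ext _ ((dl a f \* g) \+ (f \* dl a g))) //.
- by rewrite jetD //; apply: Cm.
- by apply: (frame_dl fr); apply: Cm.
- by apply: Cd; apply: Cm.
- by move=> y Py; rewrite (frameM fr).
Qed.

Lemma jet_meval k (Q : mpoly k R) (z : 'I_k -> X -> R) x : (forall i, C (z i)) -> P x ->
  jetser dl x (fun u => meval (fun i => z i u) Q) = mmap (@scst R A) (fun i => jetser dl x (z i)) Q.
Proof.
move=> Cz Px; apply: (hom_meval (A := C) (frame_alg fr)) => //.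
- by move=> c; apply: jet_cst.
- by move=> f g Cf Cg; apply: jetD.
- by move=> f g Cf Cg; apply: jetM.
Qed.

End FrameTheory.

Definition ljet n (v : A -> 'rV[R]_n -> 'rV[R]_n) (x : 'rV[R]_n) : ('rV[R]_n -> R) -> wseries R A :=
  jetser (fun a => lie_deriv (v a)) x.

Lemma ljet_shift n (v : A -> 'rV[R]_n -> 'rV[R]_n) x g a :
  sshift a (ljet v x g) = ljet v x (lie_deriv (v a) g).
Proof. by []. Qed.

Lemma lie_near_ext n (f : 'rV[R]_n -> 'rV[R]_n) g1 g2 (x : 'rV[R]_n) :
  differentiable g1 x -> (\forall y \near x, g1 y = g2 y) -> lie_deriv f g1 x = lie_deriv f g2 x.
Proof. by move=> dg fg; rewrite /lie_deriv; have [_ ->] := diff_near (f x) fg dg. Qed.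

Definition analytic_vf n (V : set 'rV[R]_n) (v : A -> 'rV[R]_n -> 'rV[R]_n) :=
  forall x, V x -> forall a i, analytic_at x (fun y => v a y 0 i).

Lemma lie_frame n (V : set 'rV[R]_n) (v : A -> 'rV[R]_n -> 'rV[R]_n) : open V -> analytic_vf V v ->
  frame V [set f | forall x, V x -> analytic_at x f] (fun a => lie_deriv (v a)).
Proof.
move=> oV av; split.
- split=> [c x _|f g af ag x Vx|f g af ag x Vx]; first exact: analytic_at_cst.
    by apply: analytic_atD; [exact: af|exact: ag].
  by apply: analytic_atM; [exact: af|exact: ag].
- by move=> a f af x Vx; apply: analytic_at_lie; [exact: af|exact: av].
- by move=> a c x _; apply: diff_cst0.
- move=> a f g x af ag Vx; rewrite /lie_deriv.
  have [df dg] := (analytic_at_diff (af x Vx), analytic_at_diff (ag x Vx)).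
  exact: diffDE.
- move=> a f g x af ag Vx; rewrite /lie_deriv.
  have [df dg] := (analytic_at_diff (af x Vx), analytic_at_diff (ag x Vx)).
  exact: diff_leibniz.
- move=> a f g af ag fg x Vx; apply: lie_near_ext; first exact: analytic_at_diff (af x Vx).
  have : nbhs x V by apply: open_nbhs_nbhs.
  by apply: filterS => y; apply: fg.
Qed.

(** One neighbourhood serves all letters, since a word may use any of them. *)
Definition vfnear n (v : A -> 'rV[R]_n -> 'rV[R]_n) (x : 'rV[R]_n) :=
  \forall y \near x, forall a i, analytic_at y (fun z => v a z 0 i).

Lemma analytic_vfnear n (V : set 'rV[R]_n) v x : open V -> analytic_vf V v -> V x -> vfnear v x.
Proof.
move=> oV av Vx; have : nbhs x V by apply: open_nbhs_nbhs.
by apply: filterS => y; apply: av.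
Qed.

Lemma frame_at n (v : A -> 'rV[R]_n -> 'rV[R]_n) (x : 'rV[R]_n) (S : set 'rV[R]_n) :
  vfnear v x -> nbhs x S -> exists V, [/\ V x, V `<=` S, open V & analytic_vf V v].
Proof.
move=> vx Sx; exists (interior ([set y | forall a i, analytic_at y (fun z => v a z 0 i)] `&` S)).
split; [exact: filterI|by move=> y /interior_subset[]|exact: open_interior|].
by move=> y /interior_subset[].
Qed.

Section AtPoint.
Variables (n : nat) (v : A -> 'rV[R]_n -> 'rV[R]_n) (x : 'rV[R]_n).
Hypothesis vx : vfnear v x.

Lemma ljet_ext f g : analytic_at x f -> (\forall y \near x, f y = g y) -> ljet v x f = ljet v x g.
Proof.
move=> af fg; have ag := analytic_at_ext fg af.
have [V [Vx VS oV av]] := frame_at vx (filterI fg (filterI (analytic_at_near af) (analytic_at_near ag))).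
apply: (jet_ext (lie_frame oV av)) => //.
- by move=> y /VS[_ []].
- by move=> y /VS[_ []].
- by move=> y /VS[].
Qed.

Lemma ljetC c : ljet v x (fun=> c) = @scst R A c.
Proof.
have [V [Vx VS oV av]] := frame_at vx (@filterT _ (nbhs x) _).
exact: (jet_cst (lie_frame oV av)).
Qed.

Lemma ljetD f g : analytic_at x f -> analytic_at x g ->
  ljet v x (fun y => f y + g y) = ljet v x f + ljet v x g.
Proof.
move=> af ag.
have [V [Vx VS oV av]] := frame_at vx (filterI (analytic_at_near af) (analytic_at_near ag)).
by apply: (jetD (lie_frame oV av)) => // y /VS[].
Qed.

Lemma ljetM f g : analytic_at x f -> analytic_at x g ->
  ljet v x (fun y => f y * g y) = ljet v x f * ljet v x g.
Proof.
move=> af ag.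
have [V [Vx VS oV av]] := frame_at vx (filterI (analytic_at_near af) (analytic_at_near ag)).
by apply: (jetM (lie_frame oV av)) => // y /VS[].
Qed.

Lemma ljetB f g : analytic_at x f -> analytic_at x g ->
  ljet v x (fun y => f y - g y) = ljet v x f - ljet v x g.
Proof.
move=> af ag; apply/eqP; rewrite eq_sym subr_eq -ljetD //; last exact: analytic_atB.
by apply/eqP; congr ljet; apply/funext => y; rewrite subrK.
Qed.

Lemma ljet_sum (I : Type) (s : seq I) (f : I -> 'rV[R]_n -> R) : (forall i, analytic_at x (f i)) ->
  ljet v x (fun y => \sum_(i <- s) f i y) = \sum_(i <- s) ljet v x (f i).
Proof.
move=> af; elim: s => [|i s ih].
  rewrite big_nil; under eq_fun do rewrite big_nil.
  by rewrite ljetC rmorph0.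
rewrite big_cons; under eq_fun do rewrite big_cons.
by rewrite ljetD // ?ih //; apply: analytic_at_sum.
Qed.

Lemma ljet_meval k (Q : mpoly k R) (z : 'I_k -> 'rV[R]_n -> R) : (forall i, analytic_at x (z i)) ->
  ljet v x (fun u => meval (fun i => z i u) Q) = mmap (@scst R A) (fun i => ljet v x (z i)) Q.
Proof.
move=> az; have [V [Vx VS oV av]] := frame_at vx (near_all_at az).
by apply: (jet_meval (lie_frame oV av)) => // i y /VS; apply.
Qed.

Lemma vfnear_at a i : analytic_at x (fun y => v a y 0 i).
Proof. exact: (nbhs_singleton vx). Qed.

End AtPoint.

(* Two systems in which the coordinates of a map have the same jets give the
   same jet to every analytic function of these coordinates; this transports
   identities between a system and its models. *)
Lemma ljet_comp_mod n1 n2 k (v1 : A -> 'rV[R]_n1 -> 'rV[R]_n1) (v2 : A -> 'rV[R]_n2 -> 'rV[R]_n2)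
    x1 x2 (y1 : 'rV[R]_n1 -> 'rV[R]_k) (y2 : 'rV[R]_n2 -> 'rV[R]_k) N :
  vfnear v1 x1 -> vfnear v2 x2 ->
  (forall i, analytic_at x1 (fun x => y1 x 0 i)) -> (forall i, analytic_at x2 (fun x => y2 x 0 i)) ->
  (forall i, jet0 N (ljet v1 x1 (fun x => y1 x 0 i) - ljet v2 x2 (fun x => y2 x 0 i))) ->
  forall G, analytic_at (y1 x1) G ->
  jet0 N (ljet v1 x1 (fun x => G (y1 x)) - ljet v2 x2 (fun x => G (y2 x))).
Proof.
move=> h1 h2 a1 a2 hy.
have yE : y1 x1 = y2 x2.
  apply/rowP => i; have := hy i [::] (leq0n _); rewrite wsD wsN => /eqP.
  by rewrite subr_eq0 => /eqP.
(* Chain rule on jets. The factors pd j G (y) are again compositions with y, so the induction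
   hypothesis at order N covers them. *)
have step n (v : A -> 'rV[R]_n -> 'rV[R]_n) x (y : 'rV[R]_n -> 'rV[R]_k) G a : vfnear v x ->
    (forall i, analytic_at x (fun x => y x 0 i)) -> analytic_at (y x) G ->
    sshift a (ljet v x (fun x => G (y x))) =
    \sum_j ljet v x (fun x => pd j G (y x)) * sshift a (ljet v x (fun x => y x 0 j)).
  move=> hv ay aG; rewrite ljet_shift.
  have aGy : analytic_at x (fun x => G (y x)) by apply: analytic_at_comp.
  have apG j : analytic_at x (fun x => pd j G (y x)).
    by apply: analytic_at_comp => //; apply: analytic_at_pd.
  have alie j : analytic_at x (lie_deriv (v a) (fun x => y x 0 j)).
    by apply: analytic_at_lie => // i; apply: vfnear_at.
  rewrite (@ljet_ext _ _ _ hv _ (fun x => \sum_j pd j G (y x) * lie_deriv (v a) (fun x => y x 0 j) x)).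
  - rewrite ljet_sum //; last by move=> j; apply: analytic_atM.
    by apply: eq_bigr => j _; rewrite ljetM.
  - by apply: analytic_at_lie => // i; apply: vfnear_at.
  have aGn : \forall z \near x, analytic_at (y z) G.
    have /near_box[r r0 hr] := analytic_at_near aG.
    by have := analytic_at_close r0 ay; apply: filterS => z; apply: hr.
  apply: filterS2 (near_all_at ay) aGn => z az aGz.
  rewrite /lie_deriv; have [||_ ->] := @diff_compE _ _ _ y G z (v a z).
  - by move=> j; apply: analytic_at_diff.
  - exact: analytic_at_diff.
  rewrite -/(lie_deriv (fun=> \row_j 'd (fun x => y x 0 j) z (v a z)) G (y z)) lie_pdE.
  by apply: eq_bigr => j _; rewrite mxE mulrC.
elim: N hy => [|N ih] hy G aG.
  by apply/jet0_0; rewrite wsD wsN -[X in X - _]/(G (y1 x1)) yE subrr.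
apply/jet0S; split; first by rewrite wsD wsN -[X in X - _]/(G (y1 x1)) yE subrr.
move=> a; rewrite -[sshift _ _]/(sshift a (ljet v1 x1 (fun x => G (y1 x))) -
  sshift a (ljet v2 x2 (fun x => G (y2 x)))).
rewrite step // step -?yE // -sumrB; apply: jet0_sum => j.
set a0 := ljet v1 _ _; set b0 := sshift a _; set a0' := ljet v2 _ _; set b0' := sshift a _.
have -> : a0 * b0 - a0' * b0' = (a0 - a0') * b0 + a0' * (b0 - b0').
  by rewrite mulrBl mulrBr addrA subrK.
apply: jet0D.
  apply: jet0Ml; apply: ih; last exact: analytic_at_pd.
  by move=> i; apply: jet0_le (hy i).
by apply: jet0Mr; have [_] := (jet0S _ _).1 (hy j); apply.
Qed.

Lemma ljet_comp n1 n2 k (v1 : A -> 'rV[R]_n1 -> 'rV[R]_n1) (v2 : A -> 'rV[R]_n2 -> 'rV[R]_n2)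
    x1 x2 (y1 : 'rV[R]_n1 -> 'rV[R]_k) (y2 : 'rV[R]_n2 -> 'rV[R]_k) :
  vfnear v1 x1 -> vfnear v2 x2 ->
  (forall i, analytic_at x1 (fun x => y1 x 0 i)) -> (forall i, analytic_at x2 (fun x => y2 x 0 i)) ->
  (forall i, ljet v1 x1 (fun x => y1 x 0 i) = ljet v2 x2 (fun x => y2 x 0 i)) ->
  forall G, analytic_at (y1 x1) G ->
  ljet v1 x1 (fun x => G (y1 x)) = ljet v2 x2 (fun x => G (y2 x)).
Proof.
move=> h1 h2 a1 a2 hy G aG; apply/eqP; rewrite -subr_eq0; apply/eqP; apply: jet0_all => N.
by apply: ljet_comp_mod => // i; rewrite hy subrr; apply: jet0_zero.
Qed.

End Jets.

(** * Jets of partial derivatives *)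

Section CoordinateJets.
Variables (R : realType) (n : nat).

Definition partials (i : 'I_n) : 'rV[R]_n -> 'rV[R]_n := fun=> delta_mx 0 i.

Lemma partials_near (x : 'rV[R]_n) : vfnear partials x.
Proof. by apply: filterE => y a i; apply: analytic_at_cst. Qed.

Lemma partialsE i g : lie_deriv (partials i) g = pd i g. Proof. by []. Qed.

Lemma partials_iter_lie0 g (x w : 'rV[R]_n) : analytic_at x g -> ljet partials x g = 0 ->
  forall k, iter k (lie1 w) g x = 0.
Proof.
move=> ag g0 k; elim: k g ag g0 => [|k ih] g ag g0; first exact: (congr1 (fun f => f [::]) g0).
rewrite iterSr; apply: ih; first by apply: analytic_at_lie => // i; apply: analytic_at_cst.
rewrite (_ : lie1 w g = fun y => \sum_i w 0 i * pd i g y); last first.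
  by apply/funext => y; rewrite /lie1 lie_pdE.
have apd i : analytic_at x (pd i g) by apply: analytic_at_pd.
rewrite (ljet_sum (partials_near x)) => [|i]; last by apply: analytic_atM => //; apply: analytic_at_cst.
rewrite big1 // => i _; rewrite (ljetM (partials_near x)) //; last exact: analytic_at_cst.
by rewrite -[X in _ * X]/(sshift i (ljet partials x g)) g0 [X in _ * X](_ : _ = 0) ?mulr0.
Qed.

(** On a connected X the jet at one point determines an analytic function; this embeds the analytic
    functions on X in an integral domain. *)
Lemma partials_jet_inj (X : set 'rV[R]_n) (x : 'rV[R]_n) g : connected X ->
  (forall y, X y -> analytic_at y g) -> X x -> ljet partials x g = 0 -> forall y, X y -> g y = 0.
Proof.
move=> cX ag Xx g0; apply: (analytic_identity cX ag Xx).
have [r [M [r0 ar]]] := ag x Xx; apply/near_box; exists (r / 2); first by rewrite divr_gt0.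
move=> y xy; apply: (@adisc_zero_line _ _ r M x (r / 2) g x) => //.
- by rewrite divr_ge0 // ltW.
- by rewrite ltr_pdivrMr // ltr_pMr // ltr1n.
- by apply: box_refl; rewrite divr_ge0 // ltW.
- by apply: partials_iter_lie0 => //; apply: ag.
Qed.

End CoordinateJets.

(** * Words with a varying last duration *)

Section InputWords.
Variables (R : realType) (m : nat).

Lemma analytic_onA k (S : set 'rV[R]_k) (g : 'rV[R]_k -> R) :
  analytic_on S g <-> forall a, S a ->
    exists2 G, analytic_at a G & \forall x \near a, S x -> g x = G x.
Proof.
rewrite analytic_onP; split=> H a Sa; have := H a Sa.
  move=> [r [M [G [r0 aG gG]]]]; exists G; first by exists r, M.
  by apply/near_box; exists r => // x xa Sx; apply: gG.
move=> [G [r [M [r0 aG]]] /near_box[s s0 gG]].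
exists (Num.min r s), M, G; split; first by rewrite lt_min r0.
  by apply: adisc_le aG => //; [rewrite le_min !ltW|rewrite ge_min lexx].
by move=> x Sx xa; apply: gG => //; apply: box_le xa; rewrite ge_min lexx orbT.
Qed.

Lemma mkinput_word (u : input R m) : exists k (al : 'I_k -> 'rV[R]_m) (t : 'rV[R]_k), u = mkinput al t.
Proof.
exists (size u), (fun i => (nth (0, 0) u i).1), (\row_i (nth (0, 0) u i).2).
rewrite /mkinput -[LHS](mkseq_nth (0, 0)) /mkseq -val_enum_ord -map_comp.
by apply: eq_map => i /=; rewrite mxE -surjective_pairing.
Qed.

Definition ext_row k (t : 'rV[R]_k) (s : R) : 'rV[R]_k.+1 := \row_i extend_family (fun j => t 0 j) s i.

Lemma ext_row_lift k (t : 'rV[R]_k) s i : ext_row t s 0 (lift ord_max i) = t 0 i.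
Proof. by rewrite mxE extend_family_lift. Qed.

Lemma ext_row_max k (t : 'rV[R]_k) s : ext_row t s 0 ord_max = s.
Proof. by rewrite mxE extend_family_max. Qed.

Lemma mkinput_rcons k (al : 'I_k -> 'rV[R]_m) be (t : 'rV[R]_k) s :
  mkinput (extend_family al be) (ext_row t s) = rcons (mkinput al t) (be, s).
Proof.
rewrite /mkinput enum_ordSr map_rcons ext_row_max extend_family_max -map_comp; congr rcons.
apply: eq_map => i /=; have -> : widen_ord (leqnSn k) i = lift ord_max i.
  by apply: val_inj; rewrite /= /bump leqNgt ltn_ord.
by rewrite extend_family_lift ext_row_lift.
Qed.

(** The time axis as row vectors of length one, so that the analytic calculus applies to functions
    of time. *)
Definition tm (s : R) : 'rV[R]_1 := s%:M.

Lemma tmE s : tm s 0 0 = s. Proof. by rewrite mxE eqxx mulr1n. Qed.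

Lemma near_tm (P : set 'rV[R]_1) s0 : (\forall z \near tm s0, P z) ->
  exists2 r : R, 0 < r & forall s, `|s - s0| <= r -> P (tm s).
Proof.
move=> /near_box[r r0 h]; exists r => // s sr; apply: h => i.
by rewrite ord1 !tmE.
Qed.

Lemma right_deriv (F : R -> R) (G : 'rV[R]_1 -> R) (s r : R) : 0 < r -> differentiable G (tm s) ->
  (forall h, 0 <= h <= r -> F h = G (tm (s + h))) ->
  lim ((F h - F 0) / h @[h --> 0^'+]) = pd ord0 G (tm s).
Proof.
move=> r0 dG FG; pose v : 'rV[R]_1 := delta_mx 0 ord0.
have dv := @diff_derivable _ _ _ G (tm s) v dG.
have E : 'D_v G (tm s) = pd ord0 G (tm s) by rewrite deriveE.
have H : (fun h : R => h^-1 *: ((G \o shift (tm s)) (h *: v) - G (tm s))) @ 0^' --> pd ord0 G (tm s).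
  by rewrite -E; exact: dv.
have H' := cvg_dnbhs_at_right H.
apply: cvg_lim => //; apply: cvg_trans H'; apply: near_eq_cvg.
near=> h; have h0 : 0 < h by near: h; apply: nbhs_right_gt.
have hr : h < r by near: h; apply: nbhs_right_lt.
rewrite !FG ?lexx ?ltW // addr0 /= mulrC; congr (_ * (G _ - _)).
by apply/rowP => i; rewrite !mxE ord1 !eqxx !mulr1n mulr1 addrC.
Unshelve. all: by end_near. Qed.

Lemma lim_near_eq (F G : R -> R) : (\forall h \near 0^'+, F h = G h) ->
  lim (F h @[h --> (0 : R)^'+]) = lim (G h @[h --> (0 : R)^'+]).
Proof.
move=> FG; congr lim; apply/funext => S; apply/propext; split.
  by move=> FS; apply: filterS2 FG FS => h /= ->.
by move=> FS; apply: filterS2 FG FS => h /= ->.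
Qed.

End InputWords.

(** * Analytic maps on inputs and their derivatives *)

Section InputSide.
Variables (R : realType) (m : nat) (U : set 'rV[R]_m) (D : set (input R m)).
Hypothesis D_adm : admissible U D.
Local Notation letter := {al : 'rV[R]_m | U al}.
Implicit Types (u v : input R m) (al be : 'rV[R]_m).

Lemma DU u a : D u -> a \in u -> U a.1 /\ 0 <= a.2.
Proof. by have [[_ H] _ _ _ _] := D_adm => /H; apply. Qed.

Lemma DUr u al s : D (rcons u (al, s)) -> U al /\ 0 <= s.
Proof. by move=> Du; apply: (DU (a := (al, s)) Du); rewrite mem_rcons mem_head. Qed.

Lemma Dzero u al : U al -> (D (rcons u (al, 0)) <-> D u).
Proof.
move=> Ua; have [_ [H _] _ _ _] := D_adm.
by have := H u [::] al Ua; rewrite cats1 cats0.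
Qed.

Lemma Dmerge u al s h : 0 <= s -> 0 <= h ->
  (D (rcons (rcons u (al, s)) (al, h)) <-> D (rcons u (al, s + h))).
Proof.
move=> s0 h0; have [_ [_ H] _ _ _] := D_adm.
by have := H u [::] al s h s0 h0; rewrite -cat_rcons !cats1.
Qed.

(** Condition (iii) of admissibility for the whole word, applied with the durations of u kept
    fixed. *)
Lemma Dline u al T : D (rcons u (al, T)) -> exists2 dl : R, 0 < dl &
  forall t, 0 <= t <= T + dl -> D (rcons u (al, t)).
Proof.
move=> DT; have [k [be [a uE]]] := mkinput_word u; have [_ _ _ _ H] := D_adm.
have := H _ (extend_family be al) (ext_row a T); rewrite mkinput_rcons -uE => /(_ DT)[dl dl0 h].
exists dl => // t t0; have := h (ext_row a t); rewrite mkinput_rcons -uE; apply=> i.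
case: (unliftP ord_max i) => [j|] ->; rewrite ?ext_row_lift ?ext_row_max //.
have [] // := @DU u (be j, a 0 j) _ _; last by move=> _ /= ->; rewrite lerDl ltW.
  have [_ T0] := DUr DT; have [Ua _] := DUr DT; apply/(Dzero u Ua).
  have := h (ext_row a 0); rewrite mkinput_rcons -uE; apply=> i'.
  case: (unliftP ord_max i') => [j'|] ->; rewrite ?ext_row_lift ?ext_row_max.
    have [] // := @DU (rcons u (al, T)) (be j', a 0 j') DT.
      by rewrite mem_rcons in_cons uE (map_f (fun i => (be i, a 0 i))) ?orbT // mem_enum.
    by move=> _ /= ->; rewrite lerDl ltW.
  by rewrite lexx addr_ge0 // ltW.
by rewrite uE (map_f (fun i => (be i, a 0 i))) // mem_enum.
Qed.

(** The last duration is shrunk to 0 and the letter deleted. *)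
Lemma Dpre u a : D (rcons u a) -> D u.
Proof.
case: a => al T DT; have [Ua T0] := DUr DT; have [dl dl0 h] := Dline DT.
by apply/(Dzero u Ua); apply: h; rewrite lexx addr_ge0 // ltW.
Qed.

Lemma Dnil : D [::].
Proof. by have [[[u Du] _] _ _ _ _] := D_adm; elim/last_ind: u Du => // u a ih /Dpre. Qed.

Lemma Dext u al : D u -> U al -> exists2 dl : R, 0 < dl & forall t, 0 <= t <= dl -> D (rcons u (al, t)).
Proof.
move=> Du Ua; have [|dl dl0 h] := @Dline u al 0; first exact/Dzero.
by exists dl => // t; rewrite -[dl in X in X -> _]add0r; apply: h.
Qed.

(** Durations are nonnegative, but on them f agrees with a germ G defined on both sides of s0, to
    which calculus applies. *)
Lemma line_local f u al T s0 : analytic_maps D f -> D (rcons u (al, T)) -> 0 <= s0 <= T ->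
  exists2 G, analytic_at (tm s0) G & exists2 r : R, 0 < r & forall s, 0 <= s -> `|s - s0| <= r ->
    D (rcons u (al, s)) /\ f (rcons u (al, s)) = G (tm s).
Proof.
move=> [_ fA] DT /andP[s00 s0T]; have [k [be [a uE]]] := mkinput_word u.
have [dl dl0 hdl] := Dline DT.
have Ds0 : D (mkinput (extend_family be al) (ext_row a s0)).
  by rewrite mkinput_rcons -uE; apply: hdl; rewrite s00 (le_trans s0T) // lerDl ltW.
have := (analytic_onA _ _).1 (fA _ (extend_family be al)) _ Ds0 => -[G0 aG0 hG0].
pose th (z : 'rV[R]_1) := ext_row a (z 0 0).
have ath i : analytic_at (tm s0) (fun z => th z 0 i).
  case: (unliftP ord_max i) => [j|] ->.
    by under eq_fun do rewrite /th ext_row_lift; apply: analytic_at_cst.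
  by under eq_fun do rewrite /th ext_row_max; apply: analytic_at_coord.
have thE s : th (tm s) = ext_row a s by rewrite /th tmE.
exists (fun z => G0 (th z)); first by apply: analytic_at_comp => //; rewrite thE.
have /near_box[r1 r10 hr1] := hG0.
have [r2 r20 hr2] := near_tm (analytic_at_close r10 ath).
exists (Num.min r2 dl); first by rewrite lt_min r20.
move=> s s_ge0; rewrite le_min => /andP[sr2 sdl].
have Ds : D (rcons u (al, s)).
  apply: hdl; rewrite s_ge0 /= -lerBlDl; move: sdl; rewrite ler_norml => /andP[_].
  by move=> h; apply: le_trans h; rewrite lerD2l lerN2.
split=> //; rewrite thE; have := hr2 s sr2; rewrite !thE => /hr1 /=.
by rewrite mkinput_rcons -uE => ->.
Qed.

(** By the identification of (al, s)(al, h) with (al, s + h), the operator is the ordinary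
    derivative along the line. *)
Lemma deriv_line f u al s r G : analytic_maps D f -> 0 < r -> 0 <= s -> differentiable G (tm s) ->
  (forall h, 0 <= h <= r -> D (rcons u (al, s + h)) /\ f (rcons u (al, s + h)) = G (tm (s + h))) ->
  input_deriv al f (rcons u (al, s)) = pd ord0 G (tm s).
Proof.
move=> [[_ fm] _] r0 s0 dG H; apply: (right_deriv r0 dG) => h hr.
have [Dh fh] := H h hr; have h0 : 0 <= h by case/andP: hr.
rewrite -fh; have := fm u [::] al s h; rewrite -cat_rcons !cats1; apply=> //.
exact/Dmerge.
Qed.

Lemma deriv_at f u al r G : analytic_maps D f -> 0 < r -> differentiable G (tm 0) ->
  (forall h, 0 <= h <= r -> f (rcons u (al, h)) = G (tm h)) ->
  input_deriv al f u = pd ord0 G (tm 0).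
Proof. by move=> _ r0 dG H; apply: (right_deriv r0 dG) => h hr; rewrite H // add0r. Qed.

Lemma local_at f u al : analytic_maps D f -> D u -> U al ->
  exists2 G, analytic_at (tm 0) G & exists2 r : R, 0 < r & forall h, 0 <= h <= r ->
    D (rcons u (al, h)) /\ f (rcons u (al, h)) = G (tm h).
Proof.
move=> fA Du Ua; have [||G aG [r r0 H]] := @line_local f u al 0 0 fA; first exact/Dzero.
  by rewrite lexx.
exists G => //; exists r => // h /andP[h0 hr]; apply: H => //.
by rewrite subr0 ger0_norm.
Qed.

Lemma input_deriv_eq f w1 w2 be : U be -> D w1 -> D w2 ->
  (forall h, 0 <= h -> D (rcons w1 (be, h)) -> D (rcons w2 (be, h)) ->
     f (rcons w1 (be, h)) = f (rcons w2 (be, h))) ->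
  input_deriv be f w1 = input_deriv be f w2.
Proof.
move=> Ub D1 D2 H; have [d1 d10 h1] := Dext D1 Ub; have [d2 d20 h2] := Dext D2 Ub.
have E0 : f (rcons w1 (be, 0)) = f (rcons w2 (be, 0)).
  by apply: H => //; [apply: h1|apply: h2]; rewrite lexx ltW.
apply: lim_near_eq; near=> h.
have h0 : 0 < h by near: h; apply: nbhs_right_gt.
have hd1 : h < d1 by near: h; apply: nbhs_right_lt.
have hd2 : h < d2 by near: h; apply: nbhs_right_lt.
by rewrite E0 (H h) ?ltW //; [apply: h1|apply: h2]; rewrite !ltW.
Unshelve. all: by end_near. Qed.

(** As a function of the durations, [input_deriv be f] is a partial derivative of the germ of f in
    one more duration, taken at 0. *)
Lemma input_deriv_analytic f be : U be -> analytic_maps D f -> analytic_maps D (input_deriv be f).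
Proof.
move=> Ub fA; have [[f0 fm] fan] := fA; split.
  split=> [u v al D1 D2|u v al s t D1 D2].
    by apply: input_deriv_eq => // h h0 E1 E2; rewrite !rcons_cat /= f0 // -?rcons_cat -?rcons_cons -?rcons_cat.
  by apply: input_deriv_eq => // h h0 E1 E2; rewrite !rcons_cat /= fm // -?rcons_cat -?rcons_cons -?rcons_cat.
move=> k al; apply/analytic_onA => a Da.
have Da0 : D (mkinput (extend_family al be) (ext_row a 0)) by rewrite mkinput_rcons; apply/Dzero.
have [G aG hG] := (analytic_onA _ _).1 (fan _ (extend_family al be)) _ Da0.
exists (fun t => pd ord_max G (ext_row t 0)).
  apply: (@analytic_at_comp _ _ _ a (fun t => ext_row t 0)) => [i|]; last exact: analytic_at_pd.
  case: (unliftP ord_max i) => [j|] ->.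
    by under eq_fun do rewrite ext_row_lift; apply: analytic_at_coord.
  by under eq_fun do rewrite ext_row_max; apply: analytic_at_cst.
have [r r0 hr] := (near_box _ _).1 (filterI hG (analytic_at_near aG)).
apply/near_box; exists r => // t ta Dt.
have bx h : 0 <= h <= r -> box r (ext_row a 0) (ext_row t h).
  move=> /andP[h0 hr'] i; case: (unliftP ord_max i) => [j|] ->.
    by rewrite !ext_row_lift; apply: ta.
  by rewrite !ext_row_max subr0 ger0_norm.
have [dl dl0 hdl] := Dext Dt Ub.
pose th (z : 'rV[R]_1) := ext_row t (z 0 0).
have thE s : th (tm s) = ext_row t s by rewrite /th tmE.
have dth i : differentiable (fun z => th z 0 i) (tm 0 : 'rV[R]_1).
  apply: analytic_at_diff; case: (unliftP ord_max i) => [j|] ->.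
    by under eq_fun do rewrite /th ext_row_lift; apply: analytic_at_cst.
  by under eq_fun do rewrite /th ext_row_max; apply: analytic_at_coord.
have dG : differentiable G (th (tm 0)).
  by rewrite thE; apply: analytic_at_diff; apply: (hr _ (bx 0 _)).2; rewrite lexx ltW.
have [dGt dE] := @diff_compE _ _ _ th G (tm 0) (delta_mx 0 ord0) dth dG.
have m0 : 0 < Num.min r dl by rewrite lt_min r0.
rewrite (@deriv_at f _ be (Num.min r dl) (fun z => G (th z)) fA m0 dGt).
  rewrite /pd dE thE; congr ('d G _ _); apply/rowP => i; rewrite !mxE.
  case: (unliftP ord_max i) => [j|] ->.
    under eq_fun do rewrite /th ext_row_lift.
    by rewrite diff_cst0 (eq_sym (lift _ _)) (negbTE (neq_lift _ _)) andbF.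
  under eq_fun do rewrite /th ext_row_max.
  by rewrite -[LHS]/(pd ord0 (fun z => z 0 0) (tm 0)) pd_coord !eqxx.
move=> h /andP[h0]; rewrite le_min => /andP[hr' hdl'].
rewrite thE -mkinput_rcons; apply: (hr _ (bx h _)).1; first by rewrite h0.
by rewrite /= mkinput_rcons; apply: hdl; rewrite h0.
Qed.

Definition input_ops (a : letter) (f : input R m -> R) : input R m -> R := input_deriv (sval a) f.

Lemma analytic_maps_alg : subalgebra (analytic_maps D).
Proof.
split.
- by move=> c; split=> // k al; apply/analytic_onA => a _; exists (fun=> c);
    [exact: analytic_at_cst|by apply: filterE].
- move=> f g [[f0 fm] fan] [[g0 gm] gan]; split.
    by split=> *; rewrite /= ?f0 ?g0 ?fm ?gm.
  move=> k al; apply/analytic_onA => a Da.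
  have [F aF hF] := (analytic_onA _ _).1 (fan _ al) _ Da.
  have [G aG hG] := (analytic_onA _ _).1 (gan _ al) _ Da.
  exists (fun x => F x + G x); first exact: analytic_atD.
  by apply: filterS2 hF hG => x h1 h2 Dx; rewrite /= h1 ?h2.
- move=> f g [[f0 fm] fan] [[g0 gm] gan]; split.
    by split=> *; rewrite /= ?f0 ?g0 ?fm ?gm.
  move=> k al; apply/analytic_onA => a Da.
  have [F aF hF] := (analytic_onA _ _).1 (fan _ al) _ Da.
  have [G aG hG] := (analytic_onA _ _).1 (gan _ al) _ Da.
  exists (fun x => F x * G x); first exact: analytic_atM.
  by apply: filterS2 hF hG => x h1 h2 Dx; rewrite /= h1 ?h2.
Qed.

(** The sum and product laws are checked on germs in one extra duration: [local_at] turns the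
    operator at u into the derivative of a germ at 0. *)
Lemma input_frame : frame D (analytic_maps D) input_ops.
Proof.
have r2 (r s : R) : 0 < r -> 0 < s -> [/\ 0 < Num.min r s, forall h, 0 <= h <= Num.min r s -> 0 <= h <= r
    & forall h, 0 <= h <= Num.min r s -> 0 <= h <= s].
  move=> r0 s0; split; first by rewrite lt_min r0.
    by move=> h /andP[->]; rewrite le_min => /andP[->].
  by move=> h /andP[->]; rewrite le_min => /andP[_ ->].
split; first exact: analytic_maps_alg.
- by move=> [al Ua] f; apply: input_deriv_analytic.
- move=> [al Ua] c u Du; have [Ac _ _] := analytic_maps_alg.
  have dc : differentiable (fun=> c : R) (tm 0 : 'rV[R]_1) by apply: analytic_at_diff; apply: analytic_at_cst.
  rewrite /input_ops (@deriv_at (cst c) u al 1 (fun=> c)) //.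
  by rewrite /pd diff_cst0.
- move=> [al Ua] f g u fA gA Du.
  have [F aF [r r0 hF]] := local_at fA Du Ua; have [G aG [s s0 hG]] := local_at gA Du Ua.
  have [m0 hr hs] := r2 r s r0 s0; have [_ Ad _] := analytic_maps_alg.
  have [dF dG] := (analytic_at_diff aF, analytic_at_diff aG).
  rewrite /input_ops /= (@deriv_at _ u al _ F fA r0 dF); last by move=> h /hF[].
  rewrite (@deriv_at _ u al _ G gA s0 dG); last by move=> h /hG[].
  rewrite (@deriv_at _ u al _ (fun x => F x + G x) (Ad _ _ fA gA) m0).
  + exact: diffDE.
  + exact: analytic_at_diff (analytic_atD aF aG).
  + by move=> h hm; rewrite /= (hF h (hr h hm)).2 (hG h (hs h hm)).2.
- move=> [al Ua] f g u fA gA Du.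
  have [F aF [r r0 hF]] := local_at fA Du Ua; have [G aG [s s0 hG]] := local_at gA Du Ua.
  have [m0 hr hs] := r2 r s r0 s0; have [_ _ Am] := analytic_maps_alg.
  have [dF dG] := (analytic_at_diff aF, analytic_at_diff aG).
  have [[f0 _] _] := fA; have [[g0 _] _] := gA.
  have Du0 : D (rcons u (al, 0)) by apply/Dzero.
  have fu : f u = F (tm 0).
    rewrite -(hF 0 _).2 ?lexx ?ltW //; have := f0 u [::] al.
    by rewrite cats1 cats0 => ->.
  have gu : g u = G (tm 0).
    rewrite -(hG 0 _).2 ?lexx ?ltW //; have := g0 u [::] al.
    by rewrite cats1 cats0 => ->.
  rewrite /input_ops /= (@deriv_at _ u al _ F fA r0 dF); last by move=> h /hF[].
  rewrite (@deriv_at _ u al _ G gA s0 dG); last by move=> h /hG[].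
  rewrite (@deriv_at _ u al _ (fun x => F x * G x) (Am _ _ fA gA) m0).
  + by rewrite fu gu /pd; apply: diff_leibniz.
  + exact: analytic_at_diff (analytic_atM aF aG).
  + by move=> h hm; rewrite /= (hF h (hr h hm)).2 (hG h (hs h hm)).2.
- move=> [al Ua] f g fA gA fg u Du; have [dl dl0 H] := Dext Du Ua.
  apply: lim_near_eq; near=> h.
  have h0 : 0 < h by near: h; apply: nbhs_right_gt.
  have hd : h < dl by near: h; apply: nbhs_right_lt.
  by rewrite !fg //; apply: H; rewrite ?lexx !ltW.
Unshelve. all: by end_near. Qed.

End InputSide.

(** * Quasi-analytic families on a time interval *)

Section QuasiAnalytic.
Variable R : realType.

(* The families of successive derivatives to which quasi-analyticity applies. *)
Definition qa_family (T : R) (g : nat -> R -> R) :=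
  [/\ forall k, {within `[0, T], continuous (g k)},
      forall k (t : R), 0 < t < T -> is_derive t (1 : R) (g k) (g k.+1 t) &
      forall t, 0 <= t <= T -> exists C dl : R, [/\ 0 <= C, 0 < dl & forall k (x : R), 0 <= x <= T ->
        `|x - t| < dl -> `|g k x| <= C ^+ k.+1 * k`!%:R]].

Lemma qa_zero T g t0 : qa_family T g -> 0 <= t0 <= T -> (forall k, g k t0 = 0) ->
  forall k t, 0 <= t <= T -> g k t = 0.
Proof. by move=> [h1 h2 h3] t0T g0; apply: (quasi_analytic h1 h2 h3 t0T). Qed.

(** Makes a sum of two bounds of type C^(k+1) k! again one of that type. *)
Lemma expr_superadd (C D : R) k : 0 <= C -> 0 <= D -> C ^+ k.+1 + D ^+ k.+1 <= (C + D) ^+ k.+1.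
Proof.
move=> C0 D0; elim: k => [//|k ih].
rewrite [leRHS]exprS; apply: (@le_trans _ _ ((C + D) * (C ^+ k.+1 + D ^+ k.+1))).
  rewrite mulrDl !mulrDr -!exprS addrA -addrA lerD //; first by rewrite lerDl mulr_ge0 // exprn_ge0.
  by rewrite lerDr mulr_ge0 // exprn_ge0.
by apply: ler_wpM2l => //; apply: addr_ge0.
Qed.

Lemma qa_sub T g g' : qa_family T g -> qa_family T g' -> qa_family T (fun k t => g k t - g' k t).
Proof.
move=> [h1 h2 h3] [h1' h2' h3']; split.
- by move=> k x; apply: cvgB; [exact: h1|exact: h1'].
- by move=> k t tT; apply: is_deriveB; [exact: h2|exact: h2'].
move=> t tT; have [C [d [C0 d0 hC]]] := h3 t tT; have [C' [d' [C0' d0' hC']]] := h3' t tT.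
exists (C + C'), (Num.min d d'); split; [exact: addr_ge0|by rewrite lt_min d0|].
move=> k x xT; rewrite lt_min => /andP[xd xd'].
apply: le_trans (ler_normB _ _) _; apply: (@le_trans _ _ ((C ^+ k.+1 + C' ^+ k.+1) * k`!%:R)).
  by rewrite mulrDl lerD // ?hC ?hC'.
by apply: ler_wpM2r => //; apply: expr_superadd.
Qed.

Lemma tm_derive (t : R) : is_derive t (1 : R) (@tm R) (delta_mx 0 ord0).
Proof.
have -> : @tm R = fun u => 0 + u *: delta_mx 0 ord0.
  by apply/funext => s; apply/rowP => i; rewrite !mxE ord1 !eqxx mulr1n mulr1 add0r.
exact: line_derive.
Qed.

Lemma pd_iter_bound (G : 'rV[R]_1 -> R) s0 : analytic_at (tm s0) G ->
  exists C dl : R, [/\ 0 <= C, 0 < dl & forall k x, `|x - s0| <= dl ->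
    analytic_at (tm x) (iter k (pd ord0) G) /\ `|iter k (pd ord0) G (tm x)| <= C ^+ k.+1 * k`!%:R].
Proof.
move=> aG; have [r [M [r0 hG]]] := aG.
have av i : adisc r 1 (tm s0) (fun=> (delta_mx 0 ord0 : 'rV[R]_1) 0 i).
  have d1 : `|(delta_mx 0 ord0 : 'rV[R]_1) 0 i| <= 1.
    by rewrite mxE normr_nat; case: (_ && _); rewrite ?ler01 ?lexx.
  by apply: (adisc_le (ltW r0) (lexx r) d1); apply: adisc_cst.
have r2 : r / 2 < r by rewrite ltr_pdivrMr // ltr_pMr // ltr1n.
have r20 : 0 <= r / 2 by rewrite divr_ge0 // ltW.
have [C C0 HC] := iter_lie_bound r0 ler01 hG av r20 r2.
have [e e0 he] := near_tm (analytic_at_near aG).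
exists C, (Num.min (r / 2) e); split=> //; first by rewrite lt_min e0 divr_gt0.
move=> k x; rewrite le_min => /andP[xr xe]; split.
  by elim: k => [|k ih]; [exact: he|exact: analytic_at_pd].
by apply: (HC k); move=> i; rewrite ord1 !tmE.
Qed.

(** It is enough that near each time the family consists of the derivatives of one germ; at the ends
    of the interval the germ extends beyond it. *)
Lemma qa_local T (g : nat -> R -> R) :
  (forall s0, 0 <= s0 <= T -> exists2 G, analytic_at (tm s0) G & exists2 r : R, 0 < r &
     forall k s, 0 <= s <= T -> `|s - s0| < r -> g k s = iter k (pd ord0) G (tm s)) ->
  qa_family T g.
Proof.
move=> H; split.
- move=> k; apply/subspace_continuousP => s0; rewrite /= in_itv /= => s0T.
  have [G aG [r r0 hG]] := H s0 s0T; have [C [dl [C0 dl0 hC]]] := pd_iter_bound aG.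
  have [|aGk _] := hC k s0; first by rewrite subrr normr0 ltW.
  have cG : {for s0, continuous (iter k (pd ord0) G \o @tm R)}.
    apply: continuous_comp; last by apply: analytic_at_cvg; apply: aGk.
    have [d _] := tm_derive s0; exact/differentiable_continuous/derivable1_diffP.
  have E : iter k (pd ord0) G (tm s0) = g k s0 by rewrite hG ?subrr ?normr0.
  move: cG; rewrite /prop_for /continuous_at /= E => cG.
  suff: g k s @[s --> within `[0, T]%classic (nbhs s0)] --> g k s0 by [].
  have H2 : \forall s \near s0, `|s - s0| < r.
    by apply/nbhs_normP; exists r => //= y; rewrite /ball_ /= distrC.
  apply/cvgrPdist_lt => e e0; rewrite near_withinE; have /cvgrPdist_lt/(_ _ e0) H1 := cG.
  apply: filterS2 H1 H2 => s h1 h2; rewrite /= in_itv /= => sT.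
  by rewrite (hG k s).
- move=> k t /andP[t0 tT]; have tT' : 0 <= t <= T by rewrite !ltW.
  have [G aG [r r0 hG]] := H t tT'; have [C [dl [C0 dl0 hC]]] := pd_iter_bound aG.
  have [|aGk _] := hC k t; first by rewrite subrr normr0 ltW.
  rewrite (hG k.+1 t) ?subrr ?normr0 //.
  apply: (@near_eq_is_derive _ _ _ (iter k (pd ord0) G \o @tm R)); last first.
    exact: chain_derive (tm_derive t) (analytic_at_diff aGk).
  apply/nbhs_normP; exists (Num.min r (Num.min t (T - t))).
    by rewrite /= !lt_min r0 t0 subr_gt0 tT.
  move=> y; rewrite /ball_ /= !lt_min => /and3P[y1 y2 y3]; rewrite -hG //; last by rewrite distrC.
  by move: y2 y3; rewrite !ltr_norml => /andP[h1 h2] /andP[h3 h4]; apply/andP; split; lra.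
- move=> t tT; have [G aG [r r0 hG]] := H t tT; have [C [dl [C0 dl0 hC]]] := pd_iter_bound aG.
  exists C, (Num.min r dl); split=> //; first by rewrite lt_min r0.
  move=> k x xT; rewrite lt_min => /andP[xr xd]; rewrite hG //.
  by apply: (hC k x _).2; apply: ltW.
Qed.

End QuasiAnalytic.

(** * Propagation of zero jets along inputs *)

Section InputJets.
Variables (R : realType) (m : nat) (U : set 'rV[R]_m) (D : set (input R m)).
Hypothesis D_adm : admissible U D.
Local Notation letter := {al : 'rV[R]_m | U al}.
Local Notation ops := (@input_ops R m U).
Implicit Types (u v : input R m) (al be : 'rV[R]_m).

Lemma iter_input_analytic f al k : U al -> analytic_maps D f ->
  analytic_maps D (iter k (input_deriv al) f).
Proof. by move=> Ua fA; elim: k => //= k ih; apply: input_deriv_analytic D_adm _ _ _ _. Qed.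

Lemma line_qa f u al T : analytic_maps D f -> D (rcons u (al, T)) ->
  qa_family T (fun k t => iter k (input_deriv al) f (rcons u (al, t))).
Proof.
move=> fA DT; have [Ua T0] := DUr D_adm DT.
apply: qa_local => s0 s0T; have [G aG [r r0 hr]] := line_local D_adm fA DT s0T.
have [e e0 he] := near_tm (analytic_at_near aG).
pose rho := Num.min r e; have rho0 : 0 < rho by rewrite lt_min r0.
exists G => //; exists rho => //.
suff H k : forall s, 0 <= s -> `|s - s0| < rho ->
    iter k (input_deriv al) f (rcons u (al, s)) = iter k (pd ord0) G (tm s).
  by move=> k s /andP[h _]; apply: H.
elim: k => [|k ih] s h0 hs.
  by apply: (hr s h0 _).2; apply: ltW; move: hs; rewrite lt_min => /andP[].
(* A margin that keeps s + h in the range where f is given by the germ G. *)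
pose d := (rho - `|s - s0|) / 2; have d0 : 0 < d by rewrite /d divr_gt0 ?subr_gt0.
have dist h : 0 <= h <= d -> 0 <= s + h /\ `|s + h - s0| < rho.
  move=> /andP[h1 h2]; split; first exact: addr_ge0.
  rewrite addrAC; apply: le_lt_trans (ler_normD _ _) _; rewrite (ger0_norm h1).
  by move: h2 hs; rewrite /d; lra.
have ak : analytic_at (tm s) (iter k (pd ord0) G).
  have : analytic_at (tm s) G by apply: he; apply: ltW; move: hs; rewrite lt_min => /andP[].
  by elim: (k) => [|j jh] aGs //; apply: analytic_at_pd; apply: jh.
apply: (deriv_line D_adm (iter_input_analytic k Ua fA) d0 h0 (analytic_at_diff ak)).
move=> h hd; have [h1 h2] := dist h hd; split; last exact: ih.
by apply: (hr _ h1 _).1; apply: ltW; move: h2; rewrite lt_min => /andP[].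
Qed.

Lemma jetser_iter (a : letter) f u : jetser ops u f = 0 ->
  forall k, iter k (input_deriv (sval a)) f u = 0.
Proof.
move=> f0 k; elim: k f f0 => [|k ih] f f0; first exact: (congr1 (fun F => F [::]) f0).
by rewrite iterSr; apply: ih; rewrite -[LHS]/(sshift a (jetser ops u f)) f0.
Qed.

(** A zero jet at t0 kills, for each word w, the derivative of f along w together with all its
    further derivatives in direction al; these form a quasi-analytic family on the segment. *)
Lemma jet_line_zero f u al T t0 t : analytic_maps D f -> D (rcons u (al, T)) ->
  0 <= t0 <= T -> 0 <= t <= T ->
  jetser ops (rcons u (al, t0)) f = 0 -> jetser ops (rcons u (al, t)) f = 0.
Proof.
move=> fA DT t0T tT f0; have [Ua T0] := DUr D_adm DT.
apply/funext => w; elim: w f fA f0 => [|a w ih] f fA f0.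
  apply: (@qa_zero _ T _ t0 (line_qa fA DT) t0T _ 0%N t tT) => k.
  exact: (jetser_iter (exist _ al Ua) f0).
apply: (ih (ops a f)); first by case: a f0 => be Ub _; apply: input_deriv_analytic D_adm _ _ _ _.
by rewrite -[LHS]/(sshift a (jetser ops (rcons u (al, t0)) f)) f0.
Qed.

Lemma jet_rcons0 f u al : U al -> analytic_maps D f -> D u ->
  jetser ops (rcons u (al, 0)) f = jetser ops u f.
Proof.
move=> Ua fA Du; apply/funext => w; elim: w f fA => [|a w ih] f fA.
  have [[f0 _] _] := fA; have := f0 u [::] al; rewrite cats1 cats0; apply=> //.
  exact/(Dzero D_adm).
by apply: (ih (ops a f)); case: a => be Ub; apply: input_deriv_analytic D_adm _ _ _ _.
Qed.

(** Each letter of u is a segment along which [jet_line_zero] transports a zero jet in both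
    directions. *)
Lemma jet_zero_nil f u : analytic_maps D f -> D u ->
  (jetser ops u f = 0 <-> jetser ops [::] f = 0).
Proof.
move=> fA; elim/last_ind: u => [//|u [al T] ih] DT.
have Du := Dpre D_adm DT; have [Ua T0] := DUr D_adm DT.
rewrite -(ih Du) -(jet_rcons0 Ua fA Du).
by split; apply: (jet_line_zero fA DT); rewrite ?lexx ?T0.
Qed.

Lemma jet_zeroP f u : analytic_maps D f -> D u ->
  (jetser ops u f = 0 <-> forall v, D v -> f v = 0).
Proof.
move=> fA Du; split=> [/(jet_zero_nil fA Du) f0 v Dv|f0].
  by have /(congr1 (fun F => F [::])) := (jet_zero_nil fA Dv).2 f0.
have fr := input_frame D_adm; have [Ac _ _] := frame_alg fr.
rewrite (@jet_ext _ _ _ _ _ _ fr f (cst 0) u) // (jet_cst fr) // rmorph0 //.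
Qed.

Lemma duration_rcons u al t : duration (rcons u (al, t)) = duration u + t.
Proof. by rewrite /duration -cats1 big_cat big_seq1. Qed.

(** If f vanished on all short inputs so would all its derivatives there, and then f itself by
    [jet_zeroP]. *)
Lemma generic_short f eps : analytic_maps D f -> (exists2 v, D v & f v != 0) -> 0 < eps ->
  exists u, [/\ D u, duration u < eps & f u != 0].
Proof.
move=> fA [v Dv fv] eps0; apply: contrapT => H.
have f0 u : D u -> duration u < eps -> f u = 0.
  by move=> Du du; apply: contrapT => /eqP fu; apply: H; exists u.
case/eqP: fv; apply: (jet_zeroP fA (Dnil D_adm)).1 => //; apply/funext => w.
(* The induction on w needs all short inputs at once, since a derivative at u looks at slightly
   longer inputs. *)
have : forall u, D u -> duration u < eps -> jetser ops u f w = 0; last first.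
  by apply; [exact: (Dnil D_adm)|rewrite /duration big_nil].
elim: w f fA f0 {H} => [|[be Ub] w ih] f fA f0; first exact: f0.
apply: (ih (ops (exist _ be Ub) f)); first exact: input_deriv_analytic D_adm _ _ _ _.
move=> u Du du; have [dl dl0 hdl] := Dext D_adm Du Ub.
rewrite /ops /input_ops /= (@deriv_at _ _ _ f u be (Num.min dl ((eps - duration u) / 2)) (fun=> 0) fA).
- by rewrite /pd diff_cst0.
- by rewrite lt_min dl0 divr_gt0 // subr_gt0.
- by apply: analytic_at_diff; apply: analytic_at_cst.
move=> h /andP[h0]; rewrite le_min => /andP[hd he]; apply: f0; first by apply: hdl; rewrite h0.
by rewrite duration_rcons; move: he du; lra.
Qed.

End InputJets.

(** * Analytic functions with prescribed Taylor coefficients *)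

Section TaylorSeries.
Variable R : realType.

Definition mono1 (k : nat) : multinom 1 := Multinom [tuple k | i < 1].

Lemma mono1E k i : mono1 k i = k. Proof. by rewrite multinomE tnth_mktuple. Qed.

Lemma mdeg_mono1 k : mdeg (mono1 k) = k.
Proof. by rewrite mdegE big_ord1 mono1E. Qed.

Definition tpoly (e : nat -> R) N : mpoly 1 R := \sum_(k < N) (e k / k`!%:R) *: mpolyX R (mono1 k).

Lemma meval_tpoly e N (y : 'I_1 -> R) : meval y (tpoly e N) = \sum_(k < N) e k / k`!%:R * y ord0 ^+ k.
Proof.
rewrite raddf_sum; apply: eq_bigr => k _.
by rewrite /= mevalZ mevalX big_ord1 mono1E.
Qed.

Lemma mderiv_tpoly e N : mderiv ord0 (tpoly e N.+1) = tpoly (fun k => e k.+1) N.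
Proof.
rewrite raddf_sum big_ord_recl /= mderivZ mderivX mono1E scale0r scaler0 add0r.
apply: eq_bigr => k _; rewrite /= mderivZ mderivX mono1E scalerA.
have -> : mnm_sub (mono1 (bump 0 k)) (mnm1 ord0) = mono1 k.
  apply/mnmP => i; rewrite mnmBE !mono1E; have -> : (mnm1 ord0 : multinom 1) i = 1%N by rewrite mnm1E; case: i => -[].
  by rewrite /bump add1n subn1.
congr (_ *: _); rewrite /bump add1n factS natrM invfM -!mulrA; congr (_ * _).
by rewrite mulrA mulrAC mulVf ?mul1r // pnatr_eq0.
Qed.

Section Sum.
Variables (e : nat -> R) (B C : R).
Hypothesis B0 : 0 <= B.
Hypothesis C0 : 0 < C.
Hypothesis eB : forall k, `|e k| <= B * C ^+ k * k`!%:R.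
Local Notation q := ((2 * C)^-1).

Lemma q_gt0 : 0 < q. Proof. by rewrite invr_gt0 mulr_gt0. Qed.

(** At radius 1 / (2 C) the k-th term has norm at most B / 2^k, and the geometric bounds
    telescope. *)
Lemma tpoly_tail i j : (i <= j)%N -> pnorm q (tpoly e j - tpoly e i) <= 2 * B * (2^-1 ^+ i - 2^-1 ^+ j).
Proof.
have q0 := ltW q_gt0; move=> /subnKC <-; elim: (j - i)%N => [|d ih].
  by rewrite addn0 !subrr mulr0 pnorm0.
rewrite addnS {1}/tpoly big_ord_recr /= -/(tpoly e (i + d)) addrAC.
apply: le_trans (pnormD q0 _ _) _; rewrite pnormZX // mdeg_mono1.
apply: (@le_trans _ _ (2 * B * (2^-1 ^+ i - 2^-1 ^+ (i + d)) + B * 2^-1 ^+ (i + d))).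
  apply: lerD => //; set k := (i + d)%N; rewrite normrM normfV normr_nat.
  have f0 : (0 : R) < k`!%:R by rewrite ltr0n fact_gt0.
  apply: (@le_trans _ _ (B * C ^+ k * q ^+ k)).
    by rewrite ler_wpM2r ?exprn_ge0 // ler_pdivrMr.
  by rewrite -mulrA -exprMn invfM mulrCA mulfV ?mulr1 // gt_eqF.
rewrite exprS; move: (2^-1 ^+ (i + d)) (2^-1 ^+ i) => a b.
have -> : 2 * B * (b - 2^-1 * a) = 2 * B * (b - a) + B * a by lra.
by [].
Qed.

Lemma tpoly_bound N : pnorm q (tpoly e N) <= 2 * B.
Proof.
have := tpoly_tail (leq0n N); rewrite {2}/tpoly big_ord0 subr0 => /le_trans; apply.
by rewrite expr0 ler_piMr ?mulr_ge0 // lerBlDr lerDl exprn_ge0 // invr_ge0.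
Qed.

Lemma tpoly_cauchy : pcauchy q (tpoly e).
Proof.
move=> d d0; pose N := Num.bound (2 * B / d).
have hN : 2 * B * 2^-1 ^+ N <= d.
  rewrite exprVn ler_pdivrMr ?exprn_gt0 // [d * _]mulrC -ler_pdivrMr //.
  have h : 2 * B / d < N%:R by apply: archi_boundP; rewrite divr_ge0 ?mulr_ge0 ?(ltW d0).
  have h2 : (N%:R : R) <= 2 ^+ N by rewrite -natrX ler_nat ltnW // ltn_expl.
  exact: le_trans (ltW h) h2.
have H i j : (N <= i)%N -> (i <= j)%N -> pnorm q (tpoly e j - tpoly e i) <= d.
  move=> Ni ij; apply: le_trans (tpoly_tail ij) _; apply: le_trans hN.
  apply: ler_wpM2l; first by rewrite mulr_ge0.
  apply: (@le_trans _ _ (2^-1 ^+ i)); first by rewrite lerBlDr lerDl exprn_ge0 // invr_ge0.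
  by apply: ler_wiXn2l => //; rewrite ?invr_ge0 // invf_le1 // ler1n.
exists N => i j Ni Nj; case: (leqP i j) => ij; last exact: H (ltnW ij).
by rewrite -opprB pnormN; apply: H.
Qed.

Definition tsum (z : 'rV[R]_1) : R := lim (meval (disp 0 z) (tpoly e N) @[N --> \oo]).

Lemma tsum_cvg z : box q 0 z -> (fun N => meval (disp 0 z) (tpoly e N)) @ \oo --> tsum z.
Proof. by move=> zq; apply: (@pcauchy_cvg _ _ _ _ _ (ltW q_gt0) tpoly_cauchy). Qed.

Lemma tsum_adisc : adisc q (2 * B) 0 tsum.
Proof. by exists (tpoly e); split; [exact: tpoly_bound|exact: tpoly_cauchy|exact: tsum_cvg]. Qed.

Lemma tsum_analytic : analytic_at 0 tsum.
Proof. by exists q, (2 * B); split; [exact: q_gt0|exact: tsum_adisc]. Qed.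

Lemma tsum0 : tsum 0 = e 0%N.
Proof.
apply: cvg_lim => //; rewrite -cvg_shiftS; apply: cvg_near_cst; apply: filterE => N /=.
rewrite meval_tpoly big_ord_recl /= expr0 mulr1 divr1 big1 ?addr0 // => k _.
by rewrite /disp mxE subr0 expr0n /= mulr0.
Qed.

End Sum.

(** Termwise differentiation. The shifted coefficients obey a bound of the same kind with constants
    B C and 2 C, because k + 1 <= 2^k. *)
Lemma tsum_pd e B C : 0 <= B -> 0 < C -> (forall k, `|e k| <= B * C ^+ k * k`!%:R) ->
  \forall z \near (0 : 'rV[R]_1), pd ord0 (tsum e) z = tsum (fun k => e k.+1) z.
Proof.
move=> B0 C0 eB; pose e' k := e k.+1.
have eB' k : `|e' k| <= (B * C) * (2 * C) ^+ k * k`!%:R.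
  apply: le_trans (eB k.+1) _; rewrite factS natrM exprS exprMn.
  have h : (k.+1%:R : R) <= 2 ^+ k by rewrite -natrX ler_nat ltn_expl.
  have -> : B * (C * C ^+ k) * (k.+1%:R * k`!%:R) = k.+1%:R * (B * C * C ^+ k * k`!%:R).
    by rewrite mulrCA !mulrA.
  have -> : B * C * (2 ^+ k * C ^+ k) * k`!%:R = 2 ^+ k * (B * C * C ^+ k * k`!%:R).
    by rewrite mulrCA !mulrA.
  by apply: ler_wpM2r => //; rewrite !mulr_ge0 ?exprn_ge0 ?(ltW C0).
have q0 := q_gt0 C0; have q0' : 0 < (2 * (2 * C))^-1 by rewrite q_gt0 // mulr_gt0.
pose q := (2 * C)^-1; pose s := Num.min (q / 2) (2 * (2 * C))^-1.
have s0 : 0 < s by rewrite lt_min q0' divr_gt0.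
have sq : s < q by rewrite gt_min ltr_pdivrMr // ltr_pMr // ltr1n.
apply/near_box; exists s => // z zs.
have [_ H] := adisc_differentiable (ltW s0) sq (tpoly_cauchy B0 C0 eB) (tpoly_bound B0 C0 eB)
  (tsum_cvg B0 C0 eB) zs.
have H1 := H ord0; rewrite -cvg_shiftS /= in H1.
have C0' : 0 < 2 * C by rewrite mulr_gt0.
have H2 := tsum_cvg (mulr_ge0 B0 (ltW C0)) C0' eB' (box_le _ zs).
apply/esym; apply: cvg_lim => //; move: H1; under eq_fun do rewrite mderiv_tpoly; exact.
Qed.

(** The constants are quantified inside the induction, as each derivative replaces B by B C and C by
    2 C. *)
Lemma tsum_jet (w : seq 'I_1) : forall e B C, 0 <= B -> 0 < C ->
  (forall k, `|e k| <= B * C ^+ k * k`!%:R) -> ljet (@partials R 1) 0 (tsum e) w = e (size w).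
Proof.
elim: w => [|a w ih] e B C B0 C0 eB; first exact: tsum0.
rewrite -[LHS]/(sshift a (ljet (@partials R 1) 0 (tsum e)) w) ljet_shift partialsE ord1.
have h k : `|e k.+1| <= (B * C) * (2 * C) ^+ k * k`!%:R.
  apply: le_trans (eB k.+1) _; rewrite factS natrM exprS exprMn.
  have h : (k.+1%:R : R) <= 2 ^+ k by rewrite -natrX ler_nat ltn_expl.
  have -> : B * (C * C ^+ k) * (k.+1%:R * k`!%:R) = k.+1%:R * (B * C * C ^+ k * k`!%:R).
    by rewrite mulrCA !mulrA.
  have -> : B * C * (2 ^+ k * C ^+ k) * k`!%:R = 2 ^+ k * (B * C * C ^+ k * k`!%:R).
    by rewrite mulrCA !mulrA.
  by apply: ler_wpM2r => //; rewrite !mulr_ge0 ?exprn_ge0 ?(ltW C0).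
rewrite (ljet_ext (partials_near _) _ (tsum_pd B0 C0 eB)).
  by apply: (ih (fun k => e k.+1) (B * C) (2 * C)) => //; [rewrite mulr_ge0 // ltW|rewrite mulr_gt0].
by apply: analytic_at_pd; apply: tsum_analytic B0 C0 eB.
Qed.

End TaylorSeries.

(** * Flows of analytic vector fields *)

Section Flows.
Variable R : realType.

Lemma chain_derive_vec n k (b : 'rV[R]_n -> 'rV[R]_k) (x : R -> 'rV[R]_n) (t : R) v :
  is_derive t (1 : R) x v -> differentiable b (x t) ->
  is_derive t (1 : R) (b \o x) ('d b (x t) v).
Proof.
move=> [dx xE] dg; have dx' : differentiable x t by apply/derivable1_diffP.
have dgx := differentiable_comp dx' dg.
apply: DeriveDef; first exact/derivable1_diffP.
have <- : 'd x t 1 = v by rewrite -deriveE.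
by rewrite deriveE // diff_comp.
Qed.

Lemma tm0 : @tm R 0 = 0. Proof. by rewrite /tm raddf0. Qed.

(* The flow of an analytic vector field is the sum of its Lie series. *)
Lemma local_flow n (f : 'rV[R]_n -> 'rV[R]_n) (a : 'rV[R]_n) :
  (forall i, analytic_at a (fun x => f x 0 i)) ->
  exists r T K : R, [/\ 0 < r, 0 < T, 0 <= K & forall y, box r a y ->
    exists x : R -> 'rV[R]_n, [/\ x 0 = y,
      forall t, `|t| < T -> is_derive t (1 : R) x (f (x t)) &
      forall t, `|t| < T -> forall i, `|x t 0 i - y 0 i| <= K * `|t| ]].
Proof.
move=> af; have [r2 r20 hr2] := (near_box _ _).1 (near_all_at af).
have [r1 [M1 [r10 M10 hf]]] := analytic_at_family af.
have hs : 0 <= r1 / 2 by rewrite divr_ge0 // ltW.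
have sr1 : r1 / 2 < r1 by rewrite ltr_pdivrMr // ltr_pMr // ltr1n.
pose Ci i := s2val (cid2 (iter_lie_bound r10 M10 (adisc_coord a i (ltW r10)) hf hs sr1)).
have Ci0 i : 0 <= Ci i := s2valP (cid2 (iter_lie_bound r10 M10 (adisc_coord a i (ltW r10)) hf hs sr1)).
have CiP i := s2valP' (cid2 (iter_lie_bound r10 M10 (adisc_coord a i (ltW r10)) hf hs sr1)).
pose C := 1 + \sum_i Ci i; have C1 : 1 <= C by rewrite lerDl sumr_ge0.
have C0 : 0 < C := lt_le_trans ltr01 C1.
have CiC i : Ci i <= C by rewrite /C (bigD1 i) //= addrCA lerDl addr_ge0 // sumr_ge0.
pose e y i k := iter k (lie_deriv f) (fun x => x 0 i) y.
have eB y i k : box (r1 / 2) a y -> `|e y i k| <= C * C ^+ k * k`!%:R.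
  move=> ya; apply: le_trans (CiP i k y ya) _; rewrite -exprS.
  by apply: ler_wpM2r => //; rewrite ler_pXn2r ?nnegrE ?Ci0 ?(ltW C0) ?CiC.
pose q := (2 * C)^-1; have q0 : 0 < q by apply: q_gt0.
(* The displacement X - y has norm at most 3 C and vanishes at time 0, so [adisc_shrink] bounds it
   by (6 C / q) times the time. *)
pose K := 6 * C / q; have K0 : 0 <= K by rewrite divr_ge0 ?mulr_ge0 ?(ltW C0) ?(ltW q0).
pose r := Num.min (r1 / 2) (r2 / 2).
(* Before time T the series converges and the curve moves by at most K T <= r2 / 2, hence stays
   where f is analytic. *)
pose T := Num.min (q / 2) (r2 / 2 / (K + 1)).
have r0 : 0 < r by rewrite lt_min !divr_gt0.
have K1 : 0 < K + 1 by rewrite ltr_wpDl.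
have T0 : 0 < T by rewrite lt_min !divr_gt0.
exists r, T, K; split=> // y ya.
have ya1 : box (r1 / 2) a y by apply: box_le ya; rewrite ge_min lexx.
have ya2 : box (r2 / 2) a y by apply: box_le ya; rewrite ge_min lexx orbT.
pose X (z : 'rV[R]_1) : 'rV[R]_n := \row_i tsum (e y i) z.
have Xa i : adisc q (2 * C) 0 (tsum (e y i)) by apply: (@tsum_adisc _ _ C C (ltW C0) C0) => k; apply: eB.
have X0 : X 0 = y by apply/rowP => i; rewrite mxE tsum0.
have XK z : box q 0 z -> forall i, `|X z 0 i - y 0 i| <= K * `|z 0 0|.
  move=> zq i; have z0 : `|z 0 0| <= q by have := zq 0; rewrite mxE subr0.
  have yC : `|y 0 i| <= C by have := eB y i 0%N ya1; rewrite expr0 !mulr1.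
  have hd : adisc q (3 * C) 0 (fun z => tsum (e y i) z - y 0 i).
    apply: (@adisc_le _ _ q q (2 * C + `|y 0 i|)) => //; [exact: ltW|lra|].
    by apply: adiscD (ltW q0) (Xa i) _; rewrite -normrN; apply: adisc_cst.
  have h0 : tsum (e y i) 0 - y 0 i = 0 by have /rowP/(_ i) := X0; rewrite mxE => ->; rewrite subrr.
  have := adisc_bound (normr_ge0 (z 0 0)) (adisc_shrink q0 (normr_ge0 (z 0 0)) z0 hd h0) (x := z).
  rewrite mxE => /(_ _)/le_trans; apply; first by move=> j; rewrite ord1 mxE subr0.
  have -> : 3 * C + 3 * C = 6 * C by lra.
  by rewrite /K mulrC mulrA mulrAC.
have Tq : T <= q / 2 by rewrite ge_min lexx.
have TK : K * T <= r2 / 2.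
  apply: (@le_trans _ _ ((K + 1) * (r2 / 2 / (K + 1)))).
    by apply: ler_pM => //; [exact: ltW|rewrite lerDl|rewrite ge_min lexx orbT].
  by rewrite mulrC divfK // gt_eqF.
have zT z : obox T (0 : 'rV[R]_1) z -> [/\ box (q / 2) 0 z, box q 0 z & `|z 0 0| < T].
  move=> zT0; have z0 : `|z 0 0| < T by have := zT0 0; rewrite mxE subr0.
  by split=> // i; rewrite ord1 mxE subr0; apply: ltW; apply: (lt_le_trans z0); lra.
have Xan z j : obox T (0 : 'rV[R]_1) z -> analytic_at z (fun z => X z 0 j).
  move=> /zT[z1 z2 z3]; rewrite (_ : (fun z => X z 0 j) = tsum (e y j)); last first.
    by apply/funext => z'; rewrite mxE.
  exists (q - q / 2), (2 * C); split; first by lra.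
  by apply: adisc_recenter (Xa j) z1; lra.
have fan z j : obox T (0 : 'rV[R]_1) z -> analytic_at (X z) (fun x => f x 0 j).
  move=> /zT[z1 z2 z3]; apply: hr2 => i.
  have -> : X z 0 i - a 0 i = (X z 0 i - y 0 i) + (y 0 i - a 0 i) by lra.
  apply: le_trans (ler_normD _ _) _; have h1 := XK z z2 i; have h2 := ya2 i.
  have h3 : K * `|z 0 0| <= K * T by apply: ler_wpM2l => //; exact: ltW.
  lra.
have vy : vfnear (fun _ : 'I_1 => f) y.
  apply/near_box; exists (r2 / 2); first by rewrite divr_gt0.
  move=> z zy _ i; apply: hr2; rewrite (_ : r2 = r2 / 2 + r2 / 2); last by lra.
  exact: box_trans ya2 zy.
have lie_coord j : lie_deriv f (fun x => x 0 j) = fun x => f x 0 j.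
  apply/funext => x; rewrite lie_pdE (bigD1 j) //= pd_coord eqxx mulr1 big1 ?addr0 // => i ij.
  by rewrite pd_coord (negbTE ij) mulr0.
have jetE (w : seq 'I_1) : forall g, ljet (fun _ : 'I_1 => f) y g w = iter (size w) (lie_deriv f) g y.
  elim: w => [//|b w ih] g; rewrite -[LHS]/(ljet (fun _ : 'I_1 => f) y (lie_deriv f g) w) ih.
  by rewrite /= -iterSr.
have O0 : obox T (0 : 'rV[R]_1) 0 by apply: obox_center.
(* By construction the series X has, at time 0, the jet of the coordinates along f at y. *)
have jX j : ljet (fun _ : 'I_1 => f) y (fun x => x 0 j) = ljet (@partials R 1) 0 (fun z => X z 0 j).
  apply/funext => w; rewrite jetE (_ : (fun z => X z 0 j) = tsum (e y j)); last first.
    by apply/funext => z'; rewrite mxE.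
  by rewrite (@tsum_jet _ w _ C C) //; [exact: ltW|move=> k; apply: eB].
(* The differential equation holds because both sides are analytic in time and have the same jet at
   0. *)
have X' z : obox T (0 : 'rV[R]_1) z -> forall j, pd ord0 (fun z => X z 0 j) z = f (X z) 0 j.
  move=> zz j; apply/eqP; rewrite -subr_eq0; apply/eqP.
  apply: (@partials_jet_inj _ _ (obox T 0) 0 (fun z => pd ord0 (fun z => X z 0 j) z - f (X z) 0 j)) => //.
  - exact: obox_connected.
  - move=> z' zz'; apply: analytic_atB; first by apply: analytic_at_pd; apply: Xan.
    by apply: (analytic_at_comp (g := fun x => f x 0 j)) => [i|]; [exact: Xan|exact: fan].
  - rewrite (ljetB (partials_near _)); last 2 first.
    + by apply: analytic_at_pd; apply: Xan.
    + by apply: (analytic_at_comp (g := fun x => f x 0 j)) => [i|]; [exact: Xan|exact: fan].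
  rewrite -[X in X - _]/(sshift ord0 (ljet (@partials R 1) 0 (fun z => X z 0 j))) -jX ljet_shift lie_coord.
  rewrite (@ljet_comp _ _ _ _ _ _ _ y 0 id X vy (partials_near _) _ _ jX (fun x => f x 0 j)) ?subrr //.
  + by move=> i; apply: analytic_at_coord.
  + by move=> i; apply: Xan.
  + by rewrite /= -X0; apply: fan.
exists (fun t => X (tm t)); split.
- by rewrite tm0.
- move=> t tT; have zt : obox T (0 : 'rV[R]_1) (tm t) by move=> i; rewrite ord1 tmE mxE subr0.
  have [dX dE] := @diff_rowE _ _ _ X (tm t) (delta_mx 0 ord0) (fun j => analytic_at_diff (Xan _ j zt)).
  have -> : f (X (tm t)) = 'd X (tm t) (delta_mx 0 ord0).
    by rewrite dE; apply/rowP => j; rewrite mxE -X'.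
  exact: chain_derive_vec (tm_derive t) dX.
- move=> t tT i; have zt : obox T (0 : 'rV[R]_1) (tm t) by move=> i'; rewrite ord1 tmE mxE subr0.
  by have [_ h _] := zT _ zt; have := XK _ h i; rewrite tmE.
Qed.

(** Finitely many fields share one radius, one life time and one speed, so that trajectories of all
    short inputs can be built with the same constants. *)
Lemma uniform_flow (I : eqType) n (s : seq I) (f : I -> 'rV[R]_n -> 'rV[R]_n) (a : 'rV[R]_n) :
  (forall al, al \in s -> forall i, analytic_at a (fun x => f al x 0 i)) ->
  exists r T K : R, [/\ 0 < r, 0 < T, 0 <= K & forall al, al \in s -> forall y, box r a y ->
    exists x : R -> 'rV[R]_n, [/\ x 0 = y,
      forall t, `|t| < T -> is_derive t (1 : R) x (f al (x t)) &
      forall t, `|t| < T -> forall i, `|x t 0 i - y 0 i| <= K * `|t| ]].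
Proof.
elim: s => [|al s ih] af; first by exists 1, 1, 0; split.
have [|r [T [K [r0 T0 K0 H]]]] := ih; first by move=> be bs; apply: af; rewrite in_cons bs orbT.
have [|r' [T' [K' [r0' T0' K0' H']]]] := @local_flow n (f al) a; first by apply: af; rewrite mem_head.
exists (Num.min r r'), (Num.min T T'), (K + K'); split; rewrite ?lt_min ?r0 ?T0 ?addr_ge0 //.
move=> be; rewrite in_cons => /orP[/eqP->|bs] y ya.
  have [|x [x0 dx Kx]] := H' y; first by apply: box_le ya; rewrite ge_min lexx orbT.
  exists x; split=> // t; rewrite lt_min => /andP[_ tT]; first exact: dx.
  by move=> i; apply: le_trans (Kx t tT i) _; rewrite ler_wpM2r // lerDr.
have [|x [x0 dx Kx]] := H be bs y; first by apply: box_le ya; rewrite ge_min lexx.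
exists x; split=> // t; rewrite lt_min => /andP[tT _]; first exact: dx.
by move=> i; apply: le_trans (Kx t tT i) _; rewrite ler_wpM2r // lerDl.
Qed.

End Flows.

(** * Trajectories of a system *)

Section Systems.
Variables (R : realType) (m r n : nat) (U : set 'rV[R]_m) (S : system R m r n).
Local Notation letter := {al : 'rV[R]_m | U al}.
Local Notation X := (state_space S).
Implicit Types (u v : input R m) (al be : 'rV[R]_m) (x y : R -> 'rV[R]_n).

Definition sv (a : letter) : 'rV[R]_n -> 'rV[R]_n := dyn S (sval a).

Hypothesis U_fin : finite_set U.
Hypothesis oX : open X.
Hypothesis va : forall al, U al -> forall z, X z -> forall i, analytic_at z (fun z => dyn S al z 0 i).
Hypothesis X0 : X (init S).

Lemma sv_vf : analytic_vf X sv.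
Proof. by move=> z Xz [al Ua] i; apply: va. Qed.

Lemma sv_near z : X z -> vfnear sv z.
Proof. exact: analytic_vfnear oX sv_vf. Qed.

Lemma duration_ge0 u : (forall a, a \in u -> 0 <= a.2) -> 0 <= duration u.
Proof.
elim: u => [|a u ih] h; first by rewrite /duration big_nil.
rewrite /duration big_cons addr_ge0 ?h ?mem_head // ih // => b bu.
by apply: h; rewrite in_cons bu orbT.
Qed.

Lemma duration_cat u v : duration (u ++ v) = duration u + duration v.
Proof. by rewrite /duration big_cat. Qed.

Lemma duration_cons a u : duration (a :: u) = a.2 + duration u.
Proof. by rewrite /duration big_cons. Qed.

Lemma pc_rcons v a : pc_inputs U (rcons v a) -> pc_inputs U v /\ U a.1 /\ 0 <= a.2.
Proof.
move=> h; split; last by apply: h; rewrite mem_rcons mem_head.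
by move=> b bv; apply: h; rewrite mem_rcons in_cons bv orbT.
Qed.

Lemma pc_ge0 v : pc_inputs U v -> 0 <= duration v.
Proof. by move=> h; apply: duration_ge0 => a /h[]. Qed.

Lemma traj_pre v a x : 0 <= a.2 -> trajectory S (rcons v a) x -> trajectory S v x.
Proof.
case: a => al s /= s0 [x0 xc xX xd]; rewrite duration_rcons in xc xX.
split=> //.
- apply: continuous_subspaceW xc => t; rewrite /= !in_itv /= => /andP[-> h] /=.
  by apply: le_trans h _; rewrite lerDl.
- by move=> t /andP[h1 h2]; apply: xX; rewrite h1 (le_trans h2) // lerDl.
- move=> w be s' w' vE t tt; apply: (xd w be s' (rcons w' (al, s))) => //.
  by rewrite vE rcons_cat.
Qed.

Lemma shift_derive (x : R -> 'rV[R]_n) (c t : R) (d : 'rV[R]_n) :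
  is_derive t (1 : R) x d -> is_derive (c + t) (1 : R) (fun u : R => x (u - c)) d.
Proof.
have E : (fun h : R => h^-1 *: (((fun u : R => x (u - c)) \o shift (c + t)) (h *: (1 : R)) - x (c + t - c))) =
    (fun h : R => h^-1 *: ((x \o shift t) (h *: (1 : R)) - x t)).
  apply/funext => h /=; congr (_ *: (x _ - x _)); lra.
by move=> [dx <-]; split; [rewrite /derivable E|rewrite /derive E].
Qed.

(** On a piece with constant control the time derivatives of g are its iterated Lie derivatives, for
    which [iter_lie_bound] gives the required growth. *)
Lemma traj_qa v al s x g : pc_inputs U (rcons v (al, s)) -> trajectory S (rcons v (al, s)) x ->
  (forall z, X z -> analytic_at z g) ->
  qa_family s (fun k t => iter k (lie_deriv (dyn S al)) g (x (duration v + t))).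
Proof.
move=> pcv [x0 xc xX xd] ag; have [pcv' [/= Ua s0]] := pc_rcons pcv.
have dv := pc_ge0 pcv'; rewrite duration_rcons in xc xX.
have inX t : 0 <= t <= s -> X (x (duration v + t)).
  by move=> /andP[h1 h2]; apply: xX; rewrite addr_ge0 // lerD2l.
have ak k z : X z -> analytic_at z (iter k (lie_deriv (dyn S al)) g).
  by move=> Xz; elim: k => [|k ih] /=; [exact: ag|apply: analytic_at_lie => // i; apply: va].
have cx : {within `[0, s], continuous (fun t => x (duration v + t))}.
  apply: (within_comp_continuous xc).
    by apply: continuous_subspaceT => t; apply: cvgD; [exact: cvg_cst|exact: cvg_id].
  by move=> t; rewrite /= !in_itv /= => /andP[h1 h2]; rewrite addr_ge0 // lerD2l.
split.
- move=> k; apply: (@within_comp_continuous _ _ _ _ X _ _ _ cx) => [|t].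
    by apply: continuous_in_subspaceT => z; rewrite inE => Xz; apply: analytic_at_cvg; apply: ak.
  by rewrite /= in_itv /=; apply: inX.
- move=> k t /andP[t0 ts].
  have dx : is_derive (duration v + t) (1 : R) x (dyn S al (x (duration v + t))).
    by apply: (xd v al s [::]); rewrite ?cats1 // ltrDl t0 ltrD2l.
  have dx' : is_derive t (1 : R) (fun t => x (duration v + t)) (dyn S al (x (duration v + t))).
    have := @shift_derive x (- duration v) (duration v + t) _ dx; rewrite addKr.
    by rewrite (_ : (fun u : R => x (u - - duration v)) = fun t => x (duration v + t)) //;
      apply/funext => u; rewrite opprK addrC.
  apply: (chain_derive dx'); apply: analytic_at_diff; apply: ak.
  by apply: inX; rewrite !ltW.
move=> t ts; have Xt := inX t ts; pose a := x (duration v + t).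
have [r1 [M1 [r10 M10 hf]]] := analytic_at_family (fun i => va Ua Xt i).
have [r2 [M2 [r20 hg]]] := ag _ Xt.
pose q := Num.min r1 r2; have q0 : 0 < q by rewrite lt_min r10.
have hs : 0 <= q / 2 by rewrite divr_ge0 // ltW.
have sq : q / 2 < q by rewrite ltr_pdivrMr // ltr_pMr // ltr1n.
have hg' : adisc q M2 a g by apply: adisc_le hg; rewrite ?(ltW q0) // ge_min lexx orbT.
have hf' i : adisc q M1 a (fun z => dyn S al z 0 i).
  by apply: adisc_le (hf i); rewrite ?(ltW q0) // ge_min lexx.
have [C C0 HC] := iter_lie_bound q0 M10 hg' hf' hs sq.
have nb : nbhs a (box (q / 2) a) by apply/near_box; exists (q / 2) => //; rewrite divr_gt0.
have tI : `[0, s]%classic t by rewrite /= in_itv.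
have := (subspace_continuousP _ _).1 cx t tI _ nb; rewrite /= => /nbhs_normP[d d0 hd].
exists C, d; split=> // k z zs zt; apply: HC; apply: hd; last by rewrite /= in_itv.
by rewrite /ball_ /= distrC.
Qed.

(** Uniqueness by quasi-analyticity: on each piece the coordinates along both trajectories are
    quasi-analytic families that agree, with all derivatives, at the switching time. *)
Lemma traj_unique u x y : pc_inputs U u -> trajectory S u x -> trajectory S u y ->
  forall t, 0 <= t <= duration u -> x t = y t.
Proof.
elim/last_ind: u => [|v [al s] ih] pcu tx ty t.
  rewrite /duration big_nil -eq_le => /eqP<-.
  by have [-> _ _ _] := tx; have [-> _ _ _] := ty.
have [pcv [Ua /= s0]] := pc_rcons pcu; have dv := pc_ge0 pcv.
have IH := ih pcv (@traj_pre v (al, s) x s0 tx) (@traj_pre v (al, s) y s0 ty).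
have [tv|tv] := leP t (duration v); first by move=> /andP[t0 _]; apply: IH; rewrite t0.
rewrite duration_rcons => /andP[t0 ts]; apply/rowP => i.
have ac z : X z -> analytic_at z (fun z => z 0 i) by move=> _; apply: analytic_at_coord.
have h00 : (0 : R) <= 0 <= s by rewrite lexx.
have hk k : iter k (lie_deriv (dyn S al)) (fun z => z 0 i) (x (duration v + 0)) -
    iter k (lie_deriv (dyn S al)) (fun z => z 0 i) (y (duration v + 0)) = 0.
  by rewrite addr0 IH ?subrr // dv lexx.
have ht : 0 <= t - duration v <= s by rewrite subr_ge0 ltW //= lerBlDl.
have := qa_zero (qa_sub (traj_qa pcu tx ac) (traj_qa pcu ty ac)) h00 hk 0%N ht.
have tE : duration v + (t - duration v) = t by rewrite addrCA subrr addr0.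
by rewrite /= tE => /eqP; rewrite subr_eq0 => /eqP.
Qed.

Lemma end_stateE u x : pc_inputs U u -> trajectory S u x -> end_state S u = x (duration u).
Proof.
move=> pcu tx; rewrite /end_state; case: xgetP => [z -> [y ty ->]|/(_ (x (duration u)))].
  by apply: (traj_unique pcu ty tx); rewrite pc_ge0 ?lexx.
by move=> []; exists x.
Qed.

Lemma traj_nil : trajectory S [::] (fun=> init S).
Proof.
split=> //; first by apply: continuous_subspaceT => t; apply: cvg_cst.
by move=> [|? ?] ? ? ?.
Qed.

Lemma traj_rcons v al h x phi T : pc_inputs U v -> 0 <= h -> h < T -> trajectory S v x ->
  phi 0 = x (duration v) -> (forall t, `|t| < T -> is_derive t (1 : R) phi (dyn S al (phi t))) ->
  (forall t, 0 <= t <= h -> X (phi t)) ->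
  exists2 y, trajectory S (rcons v (al, h)) y & y (duration v + h) = phi h /\
    forall t, t <= duration v -> y t = x t.
Proof.
move=> pcv h0 hT [x0 xc xX xd] phi0 dphi phiX; have dv := pc_ge0 pcv.
pose y t := if t <= duration v then x t else phi (t - duration v).
have yphi t : duration v <= t -> y t = phi (t - duration v).
  rewrite /y le_eqVlt => /orP[/eqP<-|h1]; first by rewrite lexx subrr phi0.
  by rewrite leNgt h1.
have yx t : t <= duration v -> y t = x t by rewrite /y => ->.
have inT t : duration v <= t <= duration v + h -> `|t - duration v| < T.
  move=> /andP[h1 h2]; rewrite ger0_norm ?subr_ge0 //; apply: le_lt_trans hT.
  by rewrite lerBlDl.
have dpsi t : duration v <= t <= duration v + h ->
    is_derive t (1 : R) (fun u : R => phi (u - duration v)) (dyn S al (phi (t - duration v))).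
  move=> /inT/dphi/(@shift_derive phi (duration v)).
  by rewrite addrCA subrr addr0.
exists y; last by rewrite yphi ?lerDl // addrAC subrr add0r; split.
split.
- by rewrite yx.
- rewrite duration_rcons (_ : `[0, duration v + h]%classic = `[0, duration v] `|` `[duration v, duration v + h]); last first.
    apply/seteqP; split=> t; rewrite /= !in_itv /=.
      move=> /andP[t0 th]; have [tv|tv] := leP t (duration v); [left|right]; first by rewrite t0.
      by rewrite ltW.
    by move=> [/andP[t0 tv]|/andP[tv th]]; rewrite ?t0 ?th ?(le_trans dv tv) // (le_trans tv) // lerDl.
  apply: withinU_continuous; [exact: interval_closed|exact: interval_closed| |].
    apply: (subspace_eq_continuous _ xc) => t; rewrite inE /= in_itv /= => /andP[_ tv].
    by rewrite /from_subspace /= yx.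
  apply: (@subspace_eq_continuous _ _ _ (fun u : R => phi (u - duration v))) => [t|].
    by rewrite inE /= in_itv /= => /andP[tv _]; rewrite /from_subspace /= yphi.
  apply: derivable_within_continuous => t; rewrite in_itv /= => /dpsi[d _]; exact: d.
- move=> t; rewrite duration_rcons => /andP[t0 th]; have [tv|tv] := leP t (duration v).
    by rewrite yx //; apply: xX; rewrite t0.
  by rewrite yphi ?(ltW tv) //; apply: phiX; rewrite subr_ge0 ltW //= lerBlDl.
move=> w be s w'; elim/last_ind: w' => [|w' a _] E t tt.
  move: E; rewrite cats1 => /rcons_inj[vE aE sE]; subst w be s.
  have tt' : duration v <= t <= duration v + h by case/andP: tt => h1 h2; rewrite !ltW.
  rewrite yphi; last by case/andP: tt' .
  apply: near_eq_is_derive (dpsi t tt'); case/andP: tt => h1 h2.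
  apply/nbhs_normP; exists (t - duration v); first by rewrite /= subr_gt0.
  move=> z; rewrite /ball_ /= ltr_norml => /andP[h3 h4]; rewrite yphi //; lra.
move: E; rewrite -rcons_cons -rcons_cat => /rcons_inj[vE aE].
have tv : t < duration v.
  case/andP: tt => h1 h2; apply: (lt_le_trans h2); rewrite vE duration_cat lerD2l.
  rewrite /duration big_cons lerDl; apply: duration_ge0 => b bw.
  by have [] := pcv b; rewrite ?vE ?mem_cat ?in_cons ?bw ?orbT.
rewrite yx ?(ltW tv) //; apply: near_eq_is_derive (xd w be s w' vE t tt).
apply/nbhs_normP; exists (duration v - t); first by rewrite /= subr_gt0.
by move=> z; rewrite /ball_ /= ltr_norml => /andP[h3 h4]; rewrite yx //; lra.
Qed.

Lemma right_deriv_R (F psi : R -> R) c e : 0 < e -> is_derive (0 : R) (1 : R) psi c ->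
  (forall h, 0 <= h <= e -> F h = psi h) -> lim ((F h - F 0) / h @[h --> 0^'+]) = c.
Proof.
move=> e0 [d dE] H; have H1 : (fun h : R => h^-1 *: ((psi \o shift 0) (h *: (1 : R)) - psi 0)) @ 0^' --> c.
  by rewrite -dE; exact: d.
have H' := cvg_dnbhs_at_right H1; apply: cvg_lim => //; apply: cvg_trans H'; apply: near_eq_cvg.
near=> h; have h0 : 0 < h by near: h; apply: nbhs_right_gt.
have hr : h < e by near: h; apply: nbhs_right_lt.
by rewrite !H ?lexx ?ltW //= addr0 mulrC; congr (_ * (psi _ - _)); rewrite -[h%:A]/(h * 1) mulr1.
Unshelve. all: by end_near. Qed.

Lemma short_traj : exists2 tau : R, 0 < tau & forall u, pc_inputs U u -> duration u < tau ->
  exists x, trajectory S u x.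
Proof.
have [s sE] := (finite_seqP _).1 U_fin.
have [|q [T [K [q0 T0 K0 H]]]] := @uniform_flow R _ n s (fun al => dyn S al) (init S).
  by move=> al als i; apply: va => //; rewrite sE.
have [e e0 he] : exists2 e : R, 0 < e & box e (init S) `<=` X.
  by apply/near_box; apply: open_nbhs_nbhs.
pose b := Num.min q e; have b0 : 0 < b by rewrite lt_min q0.
have K1 : 0 < K + 1 by rewrite ltr_wpDl.
(* A trajectory moves by at most K times its duration, so before tau it stays in X and in the cube
   where the flows are uniform. *)
pose tau := Num.min T (b / (K + 1)); exists tau; first by rewrite lt_min T0 divr_gt0.
have Kb t : 0 <= t -> t < tau -> K * t <= b.
  move=> t0; rewrite lt_min => /andP[_ tb]; apply: (@le_trans _ _ ((K + 1) * t)).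
    by rewrite ler_wpM2r // lerDl.
  by rewrite mulrC -ler_pdivlMr // ltW.
suff G u : pc_inputs U u -> duration u < tau -> exists2 x, trajectory S u x &
    box (K * duration u) (init S) (x (duration u)).
  by move=> u pcu du; have [x tx _] := G u pcu du; exists x.
elim/last_ind: u => [|v [al h] ih] pcu du.
  by exists (fun=> init S); [exact: traj_nil|rewrite /duration big_nil mulr0; apply: box_refl].
have [pcv [/= Ua h0]] := pc_rcons pcu; have dv := pc_ge0 pcv; rewrite duration_rcons in du *.
have dvt : duration v < tau by apply: le_lt_trans du; rewrite lerDl.
have [x tx bx] := ih pcv dvt.
have [||phi [phi0 dphi Kphi]] := H al _ (x (duration v)).
- by have : U al by []; rewrite sE.
- by apply: box_le bx; apply: le_trans (Kb _ dv dvt) _; rewrite ge_min lexx.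
have hT : h < T by apply: (@le_lt_trans _ _ (duration v + h)); rewrite ?lerDr //; move: du; rewrite lt_min => /andP[].
have bphi t : 0 <= t <= h -> box (K * (duration v + t)) (init S) (phi t).
  move=> /andP[t0 th]; rewrite mulrDr; apply: box_trans bx _ => i.
  apply: le_trans (Kphi t _ i) _; rewrite ger0_norm //.
  exact: le_lt_trans th hT.
have [|y ty [yE _]] := traj_rcons pcv h0 hT tx phi0 dphi.
  move=> t th; apply: he; apply: box_le (bphi t th); case/andP: th => t0 th.
  apply: le_trans (Kb _ _ _) _; first exact: addr_ge0.
    by apply: le_lt_trans du; rewrite lerD2l.
  by rewrite ge_min lexx orbT.
by exists y => //; rewrite yE; apply: bphi; rewrite h0 lexx.
Qed.

Definition short_inputs (tau : R) : set (input R m) := [set u | pc_inputs U u /\ duration u < tau].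

Lemma short_admissible tau : 0 < tau -> admissible U (short_inputs tau).
Proof.
move=> tau0; split.
- split; last by move=> u [].
  by exists [::]; split=> //; rewrite /duration big_nil.
- split=> [u v al Ual|u v al s t s0 t0]; rewrite /short_inputs /= !duration_cat.
    rewrite duration_cons /= add0r; split=> -[h1 h2]; split=> // a.
      move=> ain; apply: h1; move: ain; rewrite !mem_cat in_cons => /orP[->//|->].
      by rewrite !orbT.
    by rewrite mem_cat in_cons => /or3P[h|/eqP->//|h]; apply: h1; rewrite mem_cat h ?orbT.
  have E : s + (t + duration v) = s + t + duration v by rewrite addrA.
  rewrite !duration_cons /= E; split=> -[h1 h2]; split=> // a.
    rewrite mem_cat in_cons => /or3P[h|/eqP->|h]; first by apply: h1; rewrite mem_cat h.
      by split=> /=; [have [] := h1 (al, s) _; rewrite // mem_cat mem_head orbT|exact: addr_ge0].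
    by apply: h1; rewrite mem_cat !in_cons h !orbT.
  have [|Ual _] := h1 (al, s + t); first by rewrite mem_cat mem_head orbT.
  by rewrite mem_cat !in_cons => /or4P[h|/eqP->//|/eqP->//|h]; apply: h1; rewrite mem_cat ?in_cons h ?orbT.
- move=> u t [pcu du] /andP[t0 tu].
  suff [h1 h2] : pc_inputs U (restrict_input u t) /\ duration (restrict_input u t) <= t.
    by split=> //; apply: le_lt_trans h2 (le_lt_trans tu du).
  elim: u t t0 tu pcu {du} => [|[al s] u ih] t t0 tu pcu /=.
    by split=> //; rewrite /duration big_nil.
  have [Ual s0] : U al /\ 0 <= s by apply: (pcu (al, s)); rewrite mem_head.
  case: ifP => [ts|/negbT]; first by rewrite /duration big_seq1; split=> // a; rewrite mem_seq1 => /eqP->.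
  rewrite -ltNge => st; have [|||h1 h2] := ih (t - s).
  + by rewrite subr_ge0 ltW.
  + by move: tu; rewrite /duration big_cons /= lerBlDl.
  + by move=> a au; apply: pcu; rewrite in_cons au orbT.
  split; first by move=> a; rewrite in_cons => /orP[/eqP->//|]; apply: h1.
  by rewrite /duration big_cons /= addrC -lerBrDr.
- move=> u al [pcu du] Ual; exists ((tau - duration u) / 2); first by rewrite divr_gt0 // subr_gt0.
  split; last by rewrite duration_rcons; lra.
  move=> a; rewrite mem_rcons in_cons => /orP[/eqP->|]; last exact: pcu.
  by split=> //=; rewrite divr_ge0 // subr_ge0 ltW.
- move=> k al t [pct dt].
  have dE (t' : 'rV[R]_k) : duration (mkinput al t') = \sum_i t' 0 i.
    by rewrite /duration /mkinput big_map big_enum.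
  have k0 : (0 : R) < 2 * k.+1%:R by rewrite mulr_gt0.
  exists ((tau - duration (mkinput al t)) / (2 * k.+1%:R)); first by rewrite divr_gt0 // subr_gt0.
  set d := _ / _ => t' ht'; split.
    move=> a /mapP[i _ ->]; split; last by case/andP: (ht' i).
    by have [] := pct (al i, t 0 i) _; rewrite // (map_f (fun i => (al i, t 0 i))) // mem_enum.
  apply: (@le_lt_trans _ _ (\sum_i (t 0 i + d))); first by rewrite dE; apply: ler_sum => i _; case/andP: (ht' i).
  rewrite big_split /= -dE sumr_const card_ord -ltrBrDl -mulr_natl.
  have -> : tau - duration (mkinput al t) = d * (2 * k.+1%:R) by rewrite /d divfK // gt_eqF.
  have d0 : 0 < d by rewrite /d divr_gt0 // subr_gt0.
  rewrite mulrC ltr_pM2l // -natrM ltr_nat mul2n -addnn.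
  by rewrite addSn ltnS (leq_trans (leqnSn k)) // leq_addl.
Qed.

(** The set of all short inputs is admissible, so the largest admissible set contains it. This
    leaves enough inputs in [system_inputs] to recover jets from outputs. *)
Lemma short_system_inputs : exists2 tau : R, 0 < tau & short_inputs tau `<=` system_inputs U S.
Proof.
have [tau tau0 H] := short_traj; exists tau => // u su; exists (short_inputs tau) => //.
split; first exact: short_admissible.
move=> v [pcv dv]; split; first exact: H.
by move=> x y; apply: traj_unique.
Qed.

Lemma system_inputs_traj u : system_inputs U S u -> exists D', [/\ admissible U D', D' u, pc_inputs U u &
  exists x, trajectory S u x].
Proof.
move=> [D' [aD' D'U] Du]; exists D'; split=> //; last by have [] := D'U u Du.
by have [[_ h] _ _ _ _] := aD'; apply: h.
Qed.

End Systems.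

(** * Realizations in terms of jets *)

Section Realization.
Variables (R : realType) (m r n : nat) (U : set 'rV[R]_m).
Local Notation letter := {al : 'rV[R]_m | U al}.
Local Notation ops := (@input_ops R m U).
Implicit Types (u v : input R m) (al be : 'rV[R]_m) (x y : R -> 'rV[R]_n).

Section Jets.
Variable S : system R m r n.
Local Notation X := (state_space S).
Local Notation sv := (@sv R m r n U S).
Hypothesis U_fin : finite_set U.
Hypothesis oX : open X.
Hypothesis va : forall al, U al -> forall z, X z -> forall i, analytic_at z (fun z => dyn S al z 0 i).
Hypothesis X0 : X (init S).

Definition sjet := ljet sv (init S).

Lemma traj_end_in u x : pc_inputs U u -> trajectory S u x -> X (x (duration u)).
Proof. by move=> pcu [_ _ xX _]; apply: xX; rewrite (pc_ge0 pcu) lexx. Qed.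

Section OnDomain.
Variable D : set (input R m).
Hypothesis D_adm : admissible U D.

Lemma pc_cat u v : D (u ++ v) -> pc_inputs U v.
Proof. by move=> Duv a av; apply: (DU D_adm Duv); rewrite mem_cat av orbT. Qed.

(** Equality of jets is carried along each constant control by quasi-analyticity, applied to the
    difference between a function on the trajectory and one on the inputs. *)
Lemma jet_along_traj u p h : D u -> analytic_maps D p -> (forall z, X z -> analytic_at z h) ->
  sjet h = jetser ops u p ->
  forall v x, D (u ++ v) -> trajectory S v x -> ljet sv (x (duration v)) h = jetser ops (u ++ v) p.
Proof.
move=> Du pA ah hp v; elim/last_ind: v => [|v [al T] ih] x.
  by rewrite cats0 /duration big_nil => _ [-> _ _ _].
rewrite -rcons_cat => DT tx; have Duv := Dpre D_adm DT; have [Ua T0] := DUr D_adm DT.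
have pcv : pc_inputs U (rcons v (al, T)) by apply: (@pc_cat u); rewrite -rcons_cat.
have jv := ih x Duv (@traj_pre _ _ _ _ S v (al, T) x T0 tx).
have jv0 : ljet sv (x (duration v)) h = jetser ops (rcons (u ++ v) (al, 0)) p.
  by rewrite (jet_rcons0 D_adm Ua pA Duv).
have T1 : 0 <= T <= T by rewrite T0 lexx.
rewrite duration_rcons.
apply/funext => w; elim: w h p ah pA jv0 {hp jv ih} => [|[be Ub] w ih] h p ah pA jv0.
  have := @qa_zero _ T _ 0 (qa_sub (traj_qa va pcv tx ah) (line_qa D_adm pA DT)) _ _ 0%N T T1.
  rewrite lexx T0 /= => /(_ isT) H; apply/eqP; rewrite -subr_eq0; apply/eqP; apply: H => k.
  rewrite addr0; apply/eqP; rewrite subr_eq0; apply/eqP.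
  have -> : iter k (input_deriv al) p (rcons (u ++ v) (al, 0)) = 
      jetser ops (rcons (u ++ v) (al, 0)) p (nseq k (exist _ al Ua)).
    by elim: k (p) => [//|k ih] q; rewrite iterSr ih.
  rewrite -jv0; elim: k (h) => [//|k ih] q; by rewrite iterSr ih.
apply: (ih (lie_deriv (dyn S be) h) (input_deriv be p)).
- by move=> z Xz; apply: analytic_at_lie; [exact: ah|move=> i; apply: va].
- exact: input_deriv_analytic D_adm _ _ _ _.
- exact: (congr1 (sshift (exist _ be Ub)) jv0).
Qed.

(** The converse direction: equal values on short inputs are differentiated from the right, once for
    each letter of a word. *)
Lemma jet_of_short u p h tau : D u -> analytic_maps D p -> (forall z, X z -> analytic_at z h) -> 0 < tau ->
  (forall v x, D v -> D (u ++ v) -> duration v < tau -> trajectory S v x ->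
     p (u ++ v) = h (x (duration v))) ->
  sjet h = jetser ops u p.
Proof.
move=> Du pA ah tau0 H; apply/funext => w.
have G : forall v x, D v -> D (u ++ v) -> duration v < tau -> trajectory S v x ->
    jetser ops (u ++ v) p w = ljet sv (x (duration v)) h w.
  elim: w p h pA ah H => [|[al Ua] w ih] p h pA ah H; first exact: H.
  apply: (ih (input_deriv al p) (lie_deriv (dyn S al) h)).
  - exact: input_deriv_analytic D_adm _ _ _ _.
  - by move=> z Xz; apply: analytic_at_lie; [exact: ah|move=> i; apply: va].
  move=> v x Dv Duv dv tx; have pcv := pc_cat Duv; have Xe := traj_end_in pcv tx.
  have [q [T [K [q0 T0 K0 F]]]] := local_flow (va Ua Xe).
  have [|phi [phi0 dphi Kphi]] := F (x (duration v)); first by apply: box_refl; apply: ltW.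
  have [e e0 he] : exists2 e : R, 0 < e & box e (x (duration v)) `<=` X.
    by apply/near_box; apply: open_nbhs_nbhs.
  have [d1 d10 hd1] := Dext D_adm Dv Ua; have [d2 d20 hd2] := Dext D_adm Duv Ua.
  have K1 : 0 < K + 1 by rewrite ltr_wpDl.
  (* Appending (al, h') with h' <= d keeps both words in D, the flow in X and the duration below
     tau. *)
  pose d := Num.min (Num.min d1 d2) (Num.min (Num.min (T / 2) (e / (K + 1))) ((tau - duration v) / 2)).
  have d0 : 0 < d by rewrite !lt_min d10 d20 !divr_gt0 // subr_gt0.
  apply: (@right_deriv_R R _ (h \o phi) _ d d0).
    rewrite -phi0; apply: chain_derive; first by apply: dphi; rewrite normr0.
    by rewrite phi0; apply: analytic_at_diff; apply: ah.
  move=> h' /andP[h0]; rewrite !le_min => /andP[/andP[hd1' hd2'] /andP[/andP[hT he'] ht]].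
  have hT' : h' < T by apply: le_lt_trans hT _; rewrite ltr_pdivrMr // ltr_pMr // ltr1n.
  have [|y ty [yE _]] := traj_rcons pcv h0 hT' tx phi0 dphi.
    move=> t /andP[t0 th]; apply: he => i; rewrite -phi0.
    have tT : `|t| < T by rewrite ger0_norm // (le_lt_trans th).
    apply: le_trans (_ : K * `|t| <= _); first by rewrite phi0; apply: Kphi.
    rewrite ger0_norm //; apply: (@le_trans _ _ ((K + 1) * h')); first by apply: ler_pM => //; rewrite lerDl.
    by rewrite mulrC -ler_pdivlMr.
  rewrite rcons_cat (H _ y) ?duration_rcons ?yE //.
  - by apply: hd1; rewrite h0.
  - by rewrite -rcons_cat; apply: hd2; rewrite h0.
  - by move: ht; lra.
have := G [::] (fun=> init S) (Dnil D_adm); rewrite cats0 /duration big_nil => /(_ Du tau0 _)/esym.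
by apply; apply: traj_nil.
Qed.

End OnDomain.

(** A function vanishing on the reachable set realizes the zero map on inputs, so the comparison of
    jets in both directions applies to it. *)
Lemma reach_zero g : (forall z, X z -> analytic_at z g) ->
  ((forall z, reachable_set U S z -> g z = 0) <-> sjet g = 0).
Proof.
have cst0 D u : admissible U D -> D u -> jetser ops u (cst 0) = 0.
  by move=> aD Du; rewrite (jet_cst (input_frame aD)) // rmorph0.
have cstA D : admissible U D -> analytic_maps D (cst 0).
  by move=> aD; have [Ac _ _] := frame_alg (input_frame aD).
move=> ag; split=> [g0|g0 z [u /system_inputs_traj[D' [aD Du pcu [x tx]]] <-]].
  have [tau tau0 sub] := short_system_inputs U_fin oX va X0.
  have aD := short_admissible U tau0.
  have D0 : short_inputs U tau [::] by apply: Dnil aD.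
  rewrite -(cst0 _ _ aD D0); apply: (jet_of_short aD D0 (cstA _ aD) ag tau0) => v x Dv _ _ tx.
  have pcv : pc_inputs U v by case: Dv.
  rewrite -(end_stateE va pcv tx) g0 //; exists v => //; exact: sub.
rewrite (end_stateE va pcu tx).
have := @jet_along_traj D' aD [::] (cst 0) g (Dnil aD) (cstA _ aD) ag; rewrite g0 (cst0 D' [::] aD (Dnil aD)).
by move=> /(_ erefl u x Du tx)/(congr1 (fun F => F [::])).
Qed.

End Jets.

Lemma nash_system_dyn (S : system R m r n) : nash_system U S ->
  forall al, U al -> forall z, state_space S z -> forall i, analytic_at z (fun z => dyn S al z 0 i).
Proof. by move=> [[oX _ _] nf _ _] al Ua z Xz i; apply: nash_at oX (nf al Ua i) Xz. Qed.

Lemma realization_jets (D : set (input R m)) u (p : input R m -> 'rV[R]_r) (S : system R m r n) : finite_set U -> admissible U D -> D u ->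
  response_map D p -> (local_realization U (shift_dom D u) (shift_map p u) S <->
  nash_system U S /\ forall j, sjet S (fun z => output S z 0 j) = jetser ops u (fun v => p v 0 j)).
Proof.
move=> Uf aD Du pA.
suff H : nash_system U S -> ((forall v, shift_dom D u v -> system_inputs U S v ->
    shift_map p u v = output S (end_state S v)) <->
    forall j, sjet S (fun z => output S z 0 j) = jetser ops u (fun v => p v 0 j)).
  by split=> -[nS] /(H nS).
move=> nS; have va := nash_system_dyn nS; have [[oX cX sX] nf nh X0] := nS.
have ah j z : state_space S z -> analytic_at z (fun z => output S z 0 j).
  by move=> Xz; apply: nash_at oX (nh j) Xz.
split=> [H j|H v [Dv Duv] /system_inputs_traj[D' [aD' D'v pcv [x tx]]]].
  have [tau tau0 sub] := short_system_inputs Uf oX va X0.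
  apply: (jet_of_short oX va X0 aD Du (pA j) (ah j) tau0) => v x Dv Duv dv tx.
  have pcv := pc_cat aD Duv; rewrite -(end_stateE va pcv tx) -H //; by apply: sub.
rewrite (end_stateE va pcv tx); apply/rowP => j.
have := jet_along_traj va aD Du (pA j) (ah j) (H j) Duv tx.
by move=> /(congr1 (fun F => F [::])).
Qed.

End Realization.

Section Multivariate.
Variables (R : realType) (d : nat).

(** The way back from [uni]: it turns a factor found among polynomials in one variable into a
    relation in d + 1 variables. *)
Definition multi (q : {poly (mpoly d R)}) : mpoly d.+1 R :=
  (map_poly (mmap (@mpolyC d.+1 R) (fun i => polyvar R (lift ord_max i))) q).[polyvar R ord_max].

Lemma multi_eval (B : comNzRingType) (jm : {rmorphism R -> B}) (y : 'I_d -> B) z q :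
  mmap jm (extend_family y z) (multi q) = (map_poly (mmap jm y) q).[z].
Proof.
rewrite /multi -[LHS]horner_map /= -map_poly_comp /= mmapX mmap1U extend_family_max; congr (_.[_]).
apply: eq_map_poly => P /=; rewrite mmap_comp; congr mmap; apply/funext => i.
by rewrite mmapX mmap1U extend_family_lift.
Qed.

End Multivariate.

(** * Transcendence degree of algebras of Nash functions *)

Section AnalyticAlgebras.
Variables (R : realType) (n : nat) (X : set 'rV[R]_n) (x0 : 'rV[R]_n).
Hypothesis oX : open X.
Hypothesis cX : connected X.
Hypothesis X0 : X x0.
Local Notation tau := (ljet (@partials R n) x0).

Definition analytic_functions : set ('rV[R]_n -> R) := [set f | forall z, X z -> analytic_at z f].

Lemma tau_cst c : tau (cst c) = @scst R 'I_n c. Proof. exact: (ljetC (partials_near x0)). Qed.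

Lemma tauD f g : analytic_functions f -> analytic_functions g -> tau (f \+ g) = tau f + tau g.
Proof. by move=> af ag; apply: (ljetD (partials_near x0)); [exact: af|exact: ag]. Qed.

Lemma tauM f g : analytic_functions f -> analytic_functions g -> tau (f \* g) = tau f * tau g.
Proof. by move=> af ag; apply: (ljetM (partials_near x0)); [exact: af|exact: ag]. Qed.

Lemma tau_eq f g : analytic_functions f -> analytic_functions g ->
  (tau f = tau g <-> forall x, X x -> f x = g x).
Proof.
move=> af ag; have afg z : X z -> analytic_at z (fun y => f y - g y).
  by move=> Xz; apply: analytic_atB; [exact: af|exact: ag].
split=> [E y Xy|fg]; last first.
  apply: (ljet_ext (partials_near x0) (af _ X0)).
  have : nbhs x0 X by apply: open_nbhs_nbhs.
  by apply: filterS => z; apply: fg.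
apply/eqP; rewrite -subr_eq0; apply/eqP; apply: (partials_jet_inj cX afg X0 _ Xy).
by rewrite (ljetB (partials_near x0) (af _ X0) (ag _ X0)) E subrr.
Qed.

Lemma analytic_trdegP (A : set ('rV[R]_n -> R)) d : subalgebra A -> A `<=` analytic_functions ->
  (trdeg X A d <-> tdeg X A d).
Proof.
move=> sA Aan; split; first exact: trdeg_tdeg.
apply: (tdeg_trdeg_domain (sc := @scst R 'I_n) (tau := tau) sA) => //.
- exact: tau_cst.
- by move=> f g Af Ag; apply: tauD; apply: Aan.
- by move=> f g Af Ag; apply: tauM; apply: Aan.
- by move=> f g Af Ag; apply: tau_eq; apply: Aan.
Qed.

Hypothesis sX : semialgebraic X.

Lemma nash_subalgebra : subalgebra (nash X).
Proof.
split=> [c|f g nf ng|f g nf ng]; [exact: nash_cst|exact: nashD|exact: nashM].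
Qed.

Lemma nash_analytic : nash X `<=` analytic_functions.
Proof. by move=> g ng z Xz; apply: nash_at ng Xz. Qed.

Lemma coords_independent : ~ fdep X (fun (i : 'I_n) (x : 'rV[R]_n) => x 0 i).
Proof. by move=> [P P0 hP]; move/eqP: P0; apply; apply: mpoly_zero_on_open oX X0 hP. Qed.

Lemma nash_algebraic g : nash X g ->
  fdep X (extend_family (fun (i : 'I_n) (x : 'rV[R]_n) => x 0 i) g).
Proof.
move=> /nash_saf/saf_algebraic[P P0 hP].
exists (mmap (@mpolyC n.+1 R) (fun i => polyvar R (cast_ord (addn1 n) i)) P).
  apply: contraNneq P0 => /mmap_rename_inj-> //; exact: cast_ord_inj.
move=> x Xx; rewrite meval_mmap mmap_comp -[RHS](hP x Xx) [RHS]meval_mmap; congr mmap.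
apply/funext => i; rewrite mmapX mmap1U; case: (split_ordP i) => j ->.
  have -> : cast_ord (addn1 n) (lshift 1 j) = lift ord_max j.
    by apply: val_inj; rewrite /= /bump leqNgt ltn_ord.
  by rewrite extend_family_lift row_mxEl.
have -> : cast_ord (addn1 n) (rshift n j) = ord_max by apply: val_inj; rewrite /= ord1 addn0.
by rewrite extend_family_max row_mxEr mxE ord1 eqxx mulr1n.
Qed.

(** Nash functions are algebraic over the n coordinates. The exchange property is applied in the
    fraction field of the series on partial derivatives, in which they embed by [tau]. *)
Lemma nash_dependent (z : 'I_n.+1 -> 'rV[R]_n -> R) : (forall i, nash X (z i)) -> fdep X z.
Proof.
move=> nz; pose F : fieldType := {fraction (wseries R 'I_n)}.
pose jm : {rmorphism R -> F} := (@FracField.tofrac (wseries R 'I_n)) \o (@scst R 'I_n).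
pose t f : F := @FracField.tofrac (wseries R 'I_n) (tau f).
have dep k (w : 'I_k -> 'rV[R]_n -> R) P : (forall i, nash X (w i)) ->
    (mmap jm (fun i => t (w i)) P = 0 <-> forall u, X u -> meval (fun i => w i u) P = 0).
  move=> nw; apply: (embed_dep nash_subalgebra) => //.
  - by move=> c; rewrite /t tau_cst.
  - by move=> f g nf ng; rewrite /t tauD ?rmorphD //; apply: nash_analytic.
  - by move=> f g nf ng; rewrite /t tauM ?rmorphM //; apply: nash_analytic.
  - move=> f g nf ng; rewrite -(tau_eq (nash_analytic nf) (nash_analytic ng)).
    split=> [/eqP|E]; last by rewrite /t E.
    by rewrite /t tofrac_eq => /eqP.
pose co (i : 'I_n) (x : 'rV[R]_n) := x 0 i.
have nco i : nash X (co i) by apply: nash_coord.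
have alg g : nash X g -> exists2 P : mpoly n.+1 R, P != 0 &
    mmap jm (extend_family (fun i => t (co i)) (t g)) P = 0.
  move=> ng; have [P P0 hP] := nash_algebraic ng; exists P => //.
  pose w := extend_family co g.
  have nw i : nash X (w i).
    by rewrite /w; case: (unliftP ord_max i) => [j|] ->; rewrite ?extend_family_lift ?extend_family_max.
  have := (dep _ w P nw).2 hP; congr (mmap _ _ _ = _); apply/funext => i; rewrite /w.
  by case: (unliftP ord_max i) => [j|] ->; rewrite ?extend_family_lift ?extend_family_max.
have ico : alg_indep jm (fun i => t (co i)).
  by move=> P /(dep _ co P nco); apply: mpoly_zero_on_open oX X0.
have [||P P0 hP] := @indep_quotients_dependent R F jm n _ (fun i => t (z i)) (fun=> t (cst 1)) ico.
- move=> x [[i ->]|[i ->]]; apply: alg => //; exact: nash_cst.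
- by move=> _; rewrite /t tau_cst !rmorph1 oner_neq0.
exists P => //; apply/(dep _ z P nz); rewrite -hP; congr mmap; apply/funext => i.
by rewrite /t tau_cst !rmorph1 divr1.
Qed.

Lemma nash_tdeg : tdeg X (nash X) n.
Proof.
split; last exact: nash_dependent.
by exists (fun i x => x 0 i) => [i|]; [exact: nash_coord|exact: coords_independent].
Qed.

End AnalyticAlgebras.

(** * Observation algebras of a map and of a system *)

Section ObservationAlgebras.
Variables (R : realType) (m r : nat) (U : set 'rV[R]_m) (D : set (input R m)) (p : input R m -> 'rV[R]_r).
Hypothesis U_fin : finite_set U.
Hypothesis aD : admissible U D.
Hypothesis pA : response_map D p.
Local Notation letter := {al : 'rV[R]_m | U al}.
Local Notation ops := (@input_ops R m U).
Local Notation O := (obs_algebra_map U D p).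

Lemma O_ind (A : set (input R m -> R)) : subalgebra A -> A `<=` analytic_maps D ->
  (forall al f, U al -> A f -> A (input_deriv al f)) -> (forall j, A (fun u => p u 0 j)) -> O `<=` A.
Proof. by move=> h1 h2 h3 h4 f; apply; split=> // g [j _ <-]. Qed.

Lemma O_an : O `<=` analytic_maps D.
Proof.
apply: O_ind => //; first exact: analytic_maps_alg.
by move=> al f Ua fA; exact: (input_deriv_analytic aD Ua fA).
Qed.

Lemma O_alg : subalgebra O.
Proof.
split=> [c A|f g Of Og A|f g Of Og A] [[sA Aan Ad] pAA]; have [Ac AD AM] := sA.
- exact: Ac.
- by apply: AD; [apply: Of|apply: Og].
- by apply: AM; [apply: Of|apply: Og].
Qed.

Lemma O_deriv al f : U al -> O f -> O (input_deriv al f).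
Proof. by move=> Ua Of A [[sA Aan Ad] pAA]; apply: (Ad) => //; apply: Of. Qed.

Lemma O_gen j : O (fun u => p u 0 j).
Proof. by move=> A [_]; apply; exists j. Qed.

Lemma O_jets u : D u -> [/\ forall c, jetser ops u (cst c) = @scst R letter c,
  forall f g, O f -> O g -> jetser ops u (f \+ g) = jetser ops u f + jetser ops u g,
  forall f g, O f -> O g -> jetser ops u (f \* g) = jetser ops u f * jetser ops u g &
  forall f g, O f -> O g -> (jetser ops u f = jetser ops u g <-> forall v, D v -> f v = g v)].
Proof.
move=> Du; have fr := input_frame aD; split.
- by move=> c; apply: (jet_cst fr).
- by move=> f g /O_an fA /O_an gA; apply: (jetD fr).
- by move=> f g /O_an fA /O_an gA; apply: (jetM fr).
move=> f g /O_an fA /O_an gA; split=> [E v Dv|E]; last exact: (jet_ext fr).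
have [Ac Ad Am] := frame_alg fr.
have dA : analytic_maps D (f \+ (cst (-1) \* g)) by apply: Ad => //; apply: Am.
have := (jet_zeroP aD dA Du).1; rewrite (jetD fr) //; last exact: Am.
rewrite (jetM fr) // (jet_cst fr) // rmorphN1 mulN1r E subrr => /(_ erefl v Dv).
by rewrite /= mulN1r => /eqP; rewrite subr_eq0 => /eqP.
Qed.

Lemma O_trdegP d : trdeg D O d <-> tdeg D O d.
Proof.
split; first exact: trdeg_tdeg O_alg.
have [h1 h2 h3 h4] := O_jets (Dnil aD).
exact: (tdeg_trdeg_domain (sc := @scst R letter) O_alg h1 h2 h3 h4).
Qed.

(** By [jet_zeroP] the jets at a single input decide whether a relation holds on all of D. *)
Lemma O_dep u k (f : 'I_k -> input R m -> R) P : D u -> (forall i, O (f i)) ->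
  (mmap (@scst R letter) (fun i => jetser ops u (f i)) P = 0 <->
   forall v, D v -> meval (fun i => f i v) P = 0).
Proof.
move=> Du Of; have [h1 h2 h3 h4] := O_jets Du.
exact: (embed_dep (sc := @scst R letter) O_alg h1 h2 h3 h4).
Qed.

Section WithSystem.
Variables (n : nat) (S : system R m r n) (u : input R m).
Local Notation X := (state_space S).
Local Notation Obs := (obs_algebra_system U S).
Local Notation T := (@sjet R m r n U S).
Hypothesis nS : nash_system U S.
Hypothesis Du : D u.
Hypothesis hT : forall j, T (fun z => output S z 0 j) = jetser ops u (fun v => p v 0 j).

Let oX : open X. Proof. by have [[]] := nS. Qed.
Let cX : connected X. Proof. by have [[]] := nS. Qed.
Let sX : semialgebraic X. Proof. by have [[]] := nS. Qed.
Let X0 : X (init S). Proof. by have [] := nS. Qed.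
Let nf al : U al -> nash_map X (dyn S al). Proof. by have [_ h _ _] := nS; apply: h. Qed.
Let vx : vfnear (@sv R m r n U S) (init S). Proof. exact: sv_near oX (nash_system_dyn nS) _ X0. Qed.
Let na g : nash X g -> analytic_at (init S) g. Proof. by move=> ng; apply: nash_at ng X0. Qed.

Lemma Obs_ind (A : set ('rV[R]_n -> R)) : subalgebra A -> A `<=` nash X ->
  (forall al f, U al -> A f -> A (lie_deriv (dyn S al) f)) -> (forall j, A (fun z => output S z 0 j)) ->
  Obs `<=` A.
Proof. by move=> h1 h2 h3 h4 f; apply; split=> // g [j _ <-]. Qed.

Lemma Obs_nash : Obs `<=` nash X.
Proof.
have [_ _ nh _] := nS; apply: Obs_ind => //; first exact: nash_subalgebra.
by move=> al f Ua nf'; apply: nash_lie => //; apply: nf.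
Qed.

Lemma Obs_alg : subalgebra Obs.
Proof.
split=> [c A|f g Of Og A|f g Of Og A] [[sA Aan Ad] pAA]; have [Ac AD AM] := sA.
- exact: Ac.
- by apply: AD; [apply: Of|apply: Og].
- by apply: AM; [apply: Of|apply: Og].
Qed.

Lemma Obs_lie al f : U al -> Obs f -> Obs (lie_deriv (dyn S al) f).
Proof. by move=> Ua Of A [[sA Aan Ad] pAA]; apply: (Ad) => //; apply: Of. Qed.

Lemma Obs_gen j : Obs (fun z => output S z 0 j).
Proof. by move=> A [_]; apply; exists j. Qed.

Lemma T_cst c : T (cst c) = @scst R letter c. Proof. exact: (ljetC vx). Qed.
Lemma TD f g : nash X f -> nash X g -> T (f \+ g) = T f + T g.
Proof. by move=> h1 h2; apply: (ljetD vx); apply: na. Qed.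
Lemma TM f g : nash X f -> nash X g -> T (f \* g) = T f * T g.
Proof. by move=> h1 h2; apply: (ljetM vx); apply: na. Qed.

Lemma T_meval k (P : mpoly k R) (z : 'I_k -> 'rV[R]_n -> R) : (forall i, nash X (z i)) ->
  T (fun x => meval (fun i => z i x) P) = mmap (@scst R letter) (fun i => T (z i)) P.
Proof. by move=> nz; apply: (ljet_meval vx) => i; apply: na. Qed.

(** Both observation algebras arise from corresponding generators by corresponding operations, so
    each member of one has a partner in the other with the same jet. This replaces a homomorphism
    between the algebras. *)
Lemma Obs_to_O b : Obs b -> exists2 f, O f & T b = jetser ops u f.
Proof.
have [_ _ nh _] := nS; have [h1 h2 h3 h4] := O_jets Du; have [Oc Od Om] := O_alg.
pose A : set ('rV[R]_n -> R) := [set b | nash X b /\ exists2 f, O f & T b = jetser ops u f].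
suff : Obs `<=` A by move=> H /H[].
apply: Obs_ind.
- split=> [c|f g [nf' [f' Of' E]] [ng [g' Og' E']]|f g [nf' [f' Of' E]] [ng [g' Og' E']]].
  + by split; [exact: nash_cst|exists (cst c) => //; rewrite T_cst h1].
  + by split; [exact: nashD|exists (f' \+ g'); [exact: Od|rewrite TD // h2 // E E']].
  + by split; [exact: nashM|exists (f' \* g'); [exact: Om|rewrite TM // h3 // E E']].
- by move=> f [].
- move=> al f Ua [nf' [f' Of' E]]; split; first by apply: nash_lie => //; apply: nf.
  exists (input_deriv al f'); first exact: O_deriv.
  exact: (congr1 (sshift (exist _ al Ua)) E).
- by move=> j; split; [exact: nh|exists (fun v => p v 0 j); [exact: O_gen|exact: hT]].
Qed.

Lemma O_to_Obs f : O f -> exists2 b, Obs b & T b = jetser ops u f.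
Proof.
have [h1 h2 h3 h4] := O_jets Du; have [Oc Od Om] := Obs_alg; have [Oc' Od' Om'] := O_alg.
pose A : set (input R m -> R) := [set f | O f /\ exists2 b, Obs b & T b = jetser ops u f].
suff : O `<=` A by move=> H /H[].
apply: O_ind.
- split=> [c|f1 g [Of1 [f' Of' E]] [Og1 [g' Og' E']]|f1 g [Of1 [f' Of' E]] [Og1 [g' Og' E']]].
  + by split; [exact: Oc'|exists (cst c) => //; rewrite T_cst h1].
  + by split; [exact: Od'|exists (f' \+ g'); [exact: Od|rewrite TD ?h2 ?E ?E' //; exact: Obs_nash]].
  + by split; [exact: Om'|exists (f' \* g'); [exact: Om|rewrite TM ?h3 ?E ?E' //; exact: Obs_nash]].
- by move=> f' [/O_an].
- move=> al f' Ua [Of' [b Ob E]]; split; first exact: O_deriv.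
  exists (lie_deriv (dyn S al) b); first exact: Obs_lie.
  exact: (congr1 (sshift (exist _ al Ua)) E).
- by move=> j; split; [exact: O_gen|exists (fun z => output S z 0 j); [exact: Obs_gen|exact: hT]].
Qed.

(** Injectivity of the jet on Nash functions: the algebraic form of semialgebraic reachability, by
    [reach_Tinj]. *)
Definition Tinj := forall g, nash X g -> T g = 0 -> forall z, X z -> g z = 0.

Lemma O_fdep k (f : 'I_k -> input R m -> R) (b : 'I_k -> 'rV[R]_n -> R) : (forall i, O (f i)) ->
  (forall i, nash X (b i)) -> (forall i, T (b i) = jetser ops u (f i)) -> fdep X b -> fdep D f.
Proof.
move=> Of nb E [P P0 hP]; exists P => //; apply/(O_dep P Du Of).
rewrite (_ : (fun i => jetser ops u (f i)) = (fun i => T (b i))); last by apply/funext.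
rewrite -T_meval //; have -> : (0 : wseries R letter) = T (cst 0) by rewrite T_cst rmorph0.
apply: (ljet_ext vx).
  by apply: analytic_at_meval => i; apply: na.
have : nbhs (init S) X by apply: open_nbhs_nbhs.
by apply: filterS => z; apply: hP.
Qed.

Lemma Obs_fdep k (f : 'I_k -> input R m -> R) (b : 'I_k -> 'rV[R]_n -> R) : Tinj -> (forall i, O (f i)) ->
  (forall i, nash X (b i)) -> (forall i, T (b i) = jetser ops u (f i)) -> fdep D f -> fdep X b.
Proof.
move=> inj Of nb E [P P0 /(O_dep P Du Of) hP]; exists P => //; apply: inj.
  by apply: nash_meval => //.
by rewrite T_meval // -hP; congr mmap; apply/funext.
Qed.

Lemma choose_Obs k (f : 'I_k -> input R m -> R) : (forall i, O (f i)) ->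
  exists b : 'I_k -> 'rV[R]_n -> R, forall i, Obs (b i) /\ T (b i) = jetser ops u (f i).
Proof.
move=> Of; exists (fun i => s2val (cid2 (O_to_Obs (Of i)))) => i.
by split; [exact: (s2valP (cid2 (O_to_Obs (Of i))))|exact: (s2valP' (cid2 (O_to_Obs (Of i))))].
Qed.

(** The partners of n + 1 observations are Nash functions on a state space of dimension n, hence
    dependent. *)
Lemma O_bound (f : 'I_n.+1 -> input R m -> R) : (forall i, O (f i)) -> fdep D f.
Proof.
move=> Of; have [b hb] := choose_Obs Of; apply: (@O_fdep _ f b) => //.
- by move=> i; apply: Obs_nash; apply: (hb i).1.
- by move=> i; apply: (hb i).2.
by apply: (nash_dependent oX cX X0 sX) => i; apply: Obs_nash; apply: (hb i).1.
Qed.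

Lemma reach_Tinj : semialg_reachable U S <-> Tinj.
Proof.
have H g : nash X g -> (forall z, reachable_set U S z -> g z = 0) <-> T g = 0.
  by move=> ng; apply: (reach_zero U_fin oX (nash_system_dyn nS) X0) => z Xz; apply: nash_at ng Xz.
split=> h g ng; first by move=> /(H g ng); apply: h.
by move=> /(H g ng); apply: h.
Qed.

Lemma observable_tdeg : semialg_observable U S <-> tdeg X Obs n.
Proof.
have E1 d : trdeg X Obs d <-> tdeg X Obs d.
  apply: (@analytic_trdegP R n X (init S) oX cX X0 Obs d Obs_alg) => g /Obs_nash ng.
  exact: (nash_analytic oX ng).
have E2 d : trdeg X (nash X) d <-> tdeg X (nash X) d.
  apply: (@analytic_trdegP R n X (init S) oX cX X0 (nash X) d (nash_subalgebra oX sX)); exact: nash_analytic.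
have tn := nash_tdeg oX cX X0 sX.
split=> [[d [/E1 h1 /E2 h2]]|h]; first by rewrite (tdeg_unique h2 tn) in h1.
by exists n; split; [apply/E1|apply/E2].
Qed.

(** When jets are injective, relations pass between partners in both directions. *)
Lemma Tinj_tdeg : Tinj -> (tdeg X Obs n <-> tdeg D O n).
Proof.
move=> inj; split=> -[[b Ob nb] hb]; split=> //; last first.
- move=> z Oz; apply: (nash_dependent oX cX X0 sX) => i; exact: Obs_nash.
- have [c hc] := choose_Obs Ob; exists c => [i|fc]; first exact: (hc i).1.
  apply: nb; apply: (@O_fdep _ b c) => // i; [apply: Obs_nash; exact: (hc i).1|exact: (hc i).2].
- by move=> z Oz; apply: O_bound.
exists (fun i => s2val (cid2 (Obs_to_O (Ob i)))) => [i|fd].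
  exact: (s2valP (cid2 (Obs_to_O (Ob i)))).
apply: nb; apply: (@Obs_fdep _ _ b inj _ _ _ fd) => i.
- exact: (s2valP (cid2 (Obs_to_O (Ob i)))).
- exact: Obs_nash.
- exact: (s2valP' (cid2 (Obs_to_O (Ob i)))).
Qed.

(** Let b be partners of n independent observations and g a nonzero function with zero jet. The n +
    1 functions b and g satisfy a relation whose constant coefficient in the last variable is not
    zero; on jets only that coefficient remains, and the observations would be dependent. *)
Lemma tdeg_Tinj : tdeg D O n -> Tinj.
Proof.
move=> [[f Of nf'] _] g ng Tg; have [b hb] := choose_Obs Of.
have nb i : nash X (b i) by apply: Obs_nash; exact: (hb i).1.
apply: contrapT => gn0; pose w := extend_family b g.
have nw i : nash X (w i).
  by rewrite /w; case: (unliftP ord_max i) => [j|] ->; rewrite ?extend_family_lift ?extend_family_max.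
have [P P0 hP] := nash_dependent oX cX X0 sX nw.
pose tau := ljet (@partials R n) (init S).
have ta k (z : 'I_k -> 'rV[R]_n -> R) Q : (forall i, nash X (z i)) ->
    (mmap (@scst R 'I_n) (fun i => tau (z i)) Q = 0 <-> forall x, X x -> meval (fun i => z i x) Q = 0).
  move=> nz; apply: (embed_dep (sc := @scst R 'I_n) (nash_subalgebra oX sX)) => //.
  - by move=> c; apply: tau_cst.
  - by move=> f1 f2 h1 h2; apply: (tauD X0); apply: nash_analytic.
  - by move=> f1 f2 h1 h2; apply: (tauM X0); apply: nash_analytic.
  - by move=> f1 f2 h1 h2; apply: (tau_eq oX cX X0); apply: nash_analytic.
have wE : (fun i => tau (w i)) = extend_family (fun i => tau (b i)) (tau g).
  by apply/funext => i; rewrite /w; case: (unliftP ord_max i) => [j|] ->;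
    rewrite ?extend_family_lift ?extend_family_max.
have tg0 : tau g != 0.
  apply/eqP => tg; apply: gn0; apply: (partials_jet_inj cX _ X0 tg) => z Xz; exact: nash_at ng Xz.
(* Powers of the last variable are divided out of the relation. The quotient still annihilates g,
   because the series form a domain and g is not zero. *)
have [k [q q0 qE]] := multiplicity_XsubC (uni P) 0.
have {}q0 : q`_0 != 0.
  by move: q0; rewrite (uni_neq0 P0) /= rootE horner_coef0.
have hq : (map_poly (mmap (@scst R 'I_n) (fun i => tau (b i))) q).[tau g] = 0.
  have := (ta _ w P nw).2 hP; rewrite wE uni_eval qE rmorphM hornerM /= => /eqP.
  rewrite mulf_eq0 => /orP[/eqP//|]; rewrite polyC0 subr0 map_polyXn hornerXn expf_eq0 (negbTE tg0) andbF //.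
have hQ := (ta _ w (multi q) nw).1; rewrite wE multi_eval in hQ; have {hQ} hQ := hQ hq.
have TQ : T (fun x => meval (fun i => w i x) (multi q)) = 0.
  have -> : (0 : wseries R letter) = T (cst 0) by rewrite T_cst rmorph0.
  apply: (ljet_ext vx).
    by apply: analytic_at_meval => i; apply: na.
  have : nbhs (init S) X by apply: open_nbhs_nbhs.
  by apply: filterS => z; apply: hQ.
rewrite T_meval // in TQ.
have wT : (fun i => T (w i)) = extend_family (fun i => T (b i)) 0.
  by apply/funext => i; rewrite /w; case: (unliftP ord_max i) => [j|] ->;
    rewrite ?extend_family_lift ?extend_family_max.
rewrite wT multi_eval horner_coef0 coef_map /= in TQ.
case: nf'; exists q`_0 => //; apply/(O_dep _ Du Of); rewrite -TQ.
by congr mmap; apply/funext => i; rewrite (hb i).2.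
Qed.

End WithSystem.

End ObservationAlgebras.

(** * Changes of coordinates and frozen coordinates *)

Section Reductions.
Variables (R : realType) (m r : nat) (U : set 'rV[R]_m).
Local Notation letter := {al : 'rV[R]_m | U al}.
Local Notation series := (wseries R letter).

Lemma lie_coord n (f : 'rV[R]_n -> 'rV[R]_n) j : lie_deriv f (fun x => x 0 j) = fun x => f x 0 j.
Proof.
apply/funext => x; rewrite lie_pdE (bigD1 j) //= pd_coord eqxx mulr1 big1 ?addr0 // => i ij.
by rewrite pd_coord (negbTE ij) mulr0.
Qed.

(** The fields have to agree to order N only under the assumption that all compositions with y agree
    to order N. One derivative of the coordinates then raises N by one. *)
Lemma jets_agree n1 n2 (v1 : letter -> 'rV[R]_n1 -> 'rV[R]_n1) (v2 : letter -> 'rV[R]_n2 -> 'rV[R]_n2)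
    x1 (y : 'rV[R]_n1 -> 'rV[R]_n2) :
  vfnear v1 x1 -> vfnear v2 (y x1) -> (forall i, analytic_at x1 (fun x => y x 0 i)) ->
  (forall a i N, (forall G, analytic_at (y x1) G ->
      jet0 N (ljet v1 x1 (fun x => G (y x)) - ljet v2 (y x1) G)) ->
    jet0 N (ljet v1 x1 (lie_deriv (v1 a) (fun x => y x 0 i)) - ljet v2 (y x1) (fun z => v2 a z 0 i))) ->
  forall G, analytic_at (y x1) G -> ljet v1 x1 (fun x => G (y x)) = ljet v2 (y x1) G.
Proof.
move=> h1 h2 ay H G aG; apply/eqP; rewrite -subr_eq0; apply/eqP; apply: jet0_all => N.
have hred N' : (forall i, jet0 N' (ljet v1 x1 (fun x => y x 0 i) - ljet v2 (y x1) (fun z => z 0 i))) ->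
    forall G, analytic_at (y x1) G -> jet0 N' (ljet v1 x1 (fun x => G (y x)) - ljet v2 (y x1) G).
  move=> hi G' aG'; apply: (@ljet_comp_mod _ _ _ _ _ v1 v2 x1 (y x1) y id N' h1 h2 ay _ hi G' aG').
  by move=> i; apply: analytic_at_coord.
apply: (hred) => // {G aG}; elim: N => [|N ih] i.
  by apply/jet0_0; rewrite wsD wsN -[X in X - _]/(y x1 0 i) -[X in _ - X]/(y x1 0 i) subrr.
apply/jet0S; split; first by rewrite wsD wsN -[X in X - _]/(y x1 0 i) -[X in _ - X]/(y x1 0 i) subrr.
move=> a; have := H a i N (hred N ih).
by rewrite -[ljet v2 _ (fun z => v2 a z 0 i)]/(ljet v2 (y x1) (fun z => v2 a z 0 i)) -(lie_coord (v2 a)).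
Qed.

Definition nash_germ n k (x : 'rV[R]_n) (f : 'rV[R]_n -> 'rV[R]_k) :=
  exists2 e : R, 0 < e & nash_map (obox e x) f.

Lemma nash_germ_an n k (x : 'rV[R]_n) (f : 'rV[R]_n -> 'rV[R]_k) i : nash_germ x f ->
  analytic_at x (fun z => f z 0 i).
Proof. by move=> [e e0 nf]; apply: nash_at (@obox_open _ _ _ _) (nf i) (obox_center _ e0). Qed.

Lemma obox_sub n (a : 'rV[R]_n) (e e' : R) : e <= e' -> obox e a `<=` obox e' a.
Proof. by move=> ee x xa i; apply: lt_le_trans (xa i) ee. Qed.

Lemma nash_germ_restrict n k (x : 'rV[R]_n) (f : 'rV[R]_n -> 'rV[R]_k) (P : set 'rV[R]_n) :
  nash_germ x f -> nbhs x P -> exists e : R, [/\ 0 < e, nash_map (obox e x) f & obox e x `<=` P].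
Proof.
move=> [e e0 nf] /near_obox[d d0 dP]; exists (Num.min e d).
have m1 : Num.min e d <= e by rewrite ge_min lexx.
have m2 : Num.min e d <= d by rewrite ge_min lexx orbT.
split; first by rewrite lt_min e0.
  move=> i; apply: (nash_subset (@obox_open _ _ _ _) (@obox_open _ _ _ _) (obox_semialg _ _) _ (nf i)).
  exact: obox_sub.
by apply: subset_trans dP; apply: obox_sub.
Qed.

Lemma germ_near n k (x : 'rV[R]_n) (f : 'rV[R]_n -> 'rV[R]_k) (P : set 'rV[R]_k) :
  (forall i, analytic_at x (fun z => f z 0 i)) -> nbhs (f x) P -> \forall z \near x, P (f z).
Proof.
move=> af /near_box[d d0 dP]; have := analytic_at_close d0 af.
by apply: filterS => z; apply: dP.
Qed.

Lemma nash_germ_comp n k l (x : 'rV[R]_n) (f : 'rV[R]_n -> 'rV[R]_k) (g : 'rV[R]_k -> 'rV[R]_l) :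
  nash_germ x f -> nash_germ (f x) g -> nash_germ x (fun z => g (f z)).
Proof.
move=> nf [d d0 ng].
have [e [e0 nf' sub]] := nash_germ_restrict nf
  (germ_near (fun i => nash_germ_an i nf) (@obox_nbhs _ _ d (f x) d0)).
exists e => // i.
exact: (nash_comp (@obox_open _ _ _ _) (@obox_open _ _ _ _) (obox_semialg _ _) nf' (ng i) sub).
Qed.

Lemma sv_vfnear n (S : system R m r n) : nash_system U S -> vfnear (@sv R m r n U S) (init S).
Proof. by move=> nS; have [[oX _ _] _ _ X0] := nS; apply: (sv_near oX (nash_system_dyn nS)). Qed.

(** The map b becomes the coordinates: the new field is the derivative of b along the old one,
    transported by the local inverse psi, and psi (b x) = x makes the jets agree. *)
Lemma chart_system n (S : system R m r n) (b : 'rV[R]_n -> 'rV[R]_n) : nash_system U S ->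
  nash_map (state_space S) b -> jac b (init S) \in unitmx ->
  exists (S' : system R m r n) psi, [/\ nash_system U S', init S' = b (init S),
    forall G, analytic_at (b (init S)) G -> @sjet R m r _ U S' G = @sjet R m r _ U S (fun x => G (b x)),
    @sjet R m r _ U S' = @sjet R m r _ U S' /\ (forall j, @sjet R m r _ U S' (fun z => output S' z 0 j) = @sjet R m r _ U S (fun z => output S z 0 j)) &
    [/\ nash_germ (b (init S)) psi, psi (b (init S)) = init S,
      \forall x \near init S, psi (b x) = x & \forall y \near b (init S), b (psi y) = y]].
Proof.
move=> nS nb Ju; have [[oX cX sX] nf nh X0] := nS.
have [psi [e [s [[e0 s0] npsi psib bpsi [eX ebox]]]]] := nash_inverse oX nb X0 Ju.
pose F al (y : 'rV[R]_n) : 'rV[R]_n := \row_i lie_deriv (dyn S al) (fun x => b x 0 i) (psi y).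
pose S' : system R m r n := System (obox s (b (init S))) F (fun y => output S (psi y)) (b (init S)).
have oB := @obox_open R n s (b (init S)); have sB := @obox_semialg R n s (b (init S)).
have inX y : obox s (b (init S)) y -> state_space S (psi y) by move=> /bpsi[].
have nS' : nash_system U S'.
  split=> /=.
  - by split=> //; apply: obox_connected.
  - move=> al Ua i; apply: (@nash_ext _ _ _ (fun y => lie_deriv (dyn S al) (fun x => b x 0 i) (psi y))) => //.
      by move=> y _; rewrite mxE.
    by apply: (nash_comp oB oX sB npsi _ inX); apply: nash_lie => //; apply: nf.
  - by move=> j; apply: (nash_comp oB oX sB npsi (nh j) inX).
  - exact: obox_center.
have v1 := sv_vfnear nS; have v2 := sv_vfnear nS'.
have nx : \forall x \near init S, obox e (init S) x by apply: obox_nbhs.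
have ab i : analytic_at (init S) (fun x => b x 0 i) by apply: nash_at (nb i) X0.
have J G : analytic_at (b (init S)) G -> @sjet R m r _ U S' G = @sjet R m r _ U S (fun x => G (b x)).
  move=> aG; apply/esym; apply: (jets_agree v1 v2 ab) => // -[al Ua] i N H.
  have aF : analytic_at (b (init S)) (fun z => F al z 0 i).
    by have [_ nF _ B0] := nS'; apply: nash_at oB (nF al Ua i) B0.
  rewrite (@ljet_ext _ _ _ _ _ v1 _ (fun x => F al (b x) 0 i)); first exact: H.
    by apply: analytic_at_lie => // k; apply: (vfnear_at v1 (exist _ al Ua)).
  apply: filterS nx => x /ebox[_ h]; by rewrite mxE h.
exists S', psi; split=> //.
- split=> // j; rewrite J /=.
    apply/esym; apply: (ljet_ext v1); first exact: nash_at oX (nh j) X0.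
    by apply: filterS nx => x /ebox[_ ->].
  apply: (nash_at oB _ (obox_center _ s0)).
  exact: (nash_comp oB oX sB npsi (nh j) inX).
split=> //; first by exists s.
- by apply: filterS nx => x /ebox[].
- have := @obox_nbhs R n s (b (init S)) s0; by apply: filterS => y /bpsi[].
Qed.

Definition insert_coord n (l : 'I_n.+1) (c : R) (z : 'rV[R]_n) : 'rV[R]_n.+1 :=
  \row_i if unlift l i is Some j then z 0 j else c.

Lemma insert_lift n (l : 'I_n.+1) c (z : 'rV[R]_n) j : insert_coord l c z 0 (lift l j) = z 0 j.
Proof. by rewrite mxE liftK. Qed.

Lemma insert_at n (l : 'I_n.+1) c (z : 'rV[R]_n) : insert_coord l c z 0 l = c.
Proof. by rewrite mxE unlift_none. Qed.

(** The slice where coordinate l keeps its initial value, with the l-th component of the field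
    dropped. It need not be invariant under the dynamics; [freeze_ker] and [freeze_obs] give
    conditions under which the output jets survive. *)
Lemma slice_system n (S : system R m r n.+1) (l : 'I_n.+1) : nash_system U S ->
  let c := init S 0 l in
  exists S' : system R m r n, [/\ nash_system U S', insert_coord l c (init S') = init S,
    forall z, state_space S' z -> state_space S (insert_coord l c z),
    forall al z j, dyn S' al z 0 j = dyn S al (insert_coord l c z) 0 (lift l j) &
    forall z, output S' z = output S (insert_coord l c z)].
Proof.
move=> nS c; have [[oX cX sX] nf nh X0] := nS.
pose io := insert_coord (n := n) l c.
pose z0 : 'rV[R]_n := \row_j init S 0 (lift l j).
have io0 : io z0 = init S.
  by apply/rowP => i; case: (unliftP l i) => [j|] ->; [rewrite insert_lift mxE|rewrite insert_at].
have aio a i : analytic_at a (fun z => io z 0 i).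
  case: (unliftP l i) => [j|] ->.
    by under eq_fun do rewrite insert_lift; apply: analytic_at_coord.
  by under eq_fun do rewrite insert_at; apply: analytic_at_cst.
have [e e0 eX] : exists2 e, 0 < e & obox e z0 `<=` [set z | state_space S (io z)].
  apply: near_obox; apply: germ_near => //; rewrite io0; exact: open_nbhs_nbhs.
have oB := @obox_open R n e z0; have sB := @obox_semialg R n e z0.
have nio : nash_map (obox e z0) io.
  move=> i; case: (unliftP l i) => [j|] ->.
    by under eq_fun do rewrite insert_lift; apply: nash_coord.
  by under eq_fun do rewrite insert_at; apply: nash_cst.
exists (System (obox e z0) (fun al z => \row_j dyn S al (io z) 0 (lift l j)) (fun z => output S (io z)) z0).
split=> //; last by move=> al z j; rewrite mxE.
split=> /=; [by split=> //; apply: obox_connected| | |exact: obox_center].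
  move=> al Ua j; apply: (@nash_ext _ _ _ (fun z => dyn S al (io z) 0 (lift l j))) => //.
    by move=> z _; rewrite mxE.
  exact: (nash_comp oB oX sB nio (nf al Ua _) eX).
by move=> j; apply: (nash_comp oB oX sB nio (nh j) eX).
Qed.

Lemma insert_analytic n (l : 'I_n.+1) c (a : 'rV[R]_n) i : analytic_at a (fun z => insert_coord l c z 0 i).
Proof.
case: (unliftP l i) => [j|] ->.
  by under eq_fun do rewrite insert_lift; apply: analytic_at_coord.
by under eq_fun do rewrite insert_at; apply: analytic_at_cst.
Qed.

(** Dropping the l-th component costs exactly the term with the partial derivative in direction
    l. *)
Lemma lie_insert n (S : system R m r n.+1) (S' : system R m r n) l c al g z :
  (forall j, dyn S' al z 0 j = dyn S al (insert_coord l c z) 0 (lift l j)) ->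
  analytic_at (insert_coord l c z) g ->
  lie_deriv (dyn S' al) (fun z => g (insert_coord l c z)) z =
  lie_deriv (dyn S al) g (insert_coord l c z)
    - dyn S al (insert_coord l c z) 0 l * pd l g (insert_coord l c z).
Proof.
move=> hd ag; rewrite /lie_deriv.
have [||_ ->] := @diff_compE _ _ _ (insert_coord l c) g z (dyn S' al z).
- by move=> j; apply: analytic_at_diff; apply: insert_analytic.
- exact: analytic_at_diff.
rewrite !diff_pdE (bigD1 l) //= [X in _ = X - _](bigD1 l) //= [RHS]addrAC subrr add0r.
rewrite mxE (_ : (fun z => insert_coord l c z 0 l) = fun=> c); last by apply/funext => y; rewrite insert_at.
rewrite diff_cst0 mul0r add0r; apply: eq_bigr => i il; rewrite mxE; congr (_ * _).
case: (unliftP l i) il => [j ->|->]; last by rewrite eqxx.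
move=> _; rewrite (_ : (fun z => insert_coord l c z 0 (lift l j)) = fun z => z 0 j); last first.
  by apply/funext => y; rewrite insert_lift.
by rewrite -hd -[LHS]/(lie_deriv (fun=> dyn S' al z) (fun z => z 0 j) z) lie_coord.
Qed.

(** A coordinate with constant jet has a derivative with zero jet, and this derivative is the
    component of the field that the slice drops. *)
Lemma freeze_ker n (S : system R m r n.+1) (l : 'I_n.+1) c : nash_system U S ->
  @sjet R m r _ U S (fun x => x 0 l) = @scst R letter c ->
  exists S' : system R m r n, nash_system U S' /\
    forall j, @sjet R m r _ U S' (fun z => output S' z 0 j) = @sjet R m r _ U S (fun z => output S z 0 j).
Proof.
move=> nS hl; have cE : init S 0 l = c by have := congr1 (fun f : series => f [::]) hl.
have [S' [nS' i0 inX hd ho]] := slice_system l nS; rewrite cE in i0 inX hd ho.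
exists S'; split=> // j; have [[oX _ _] _ nh X0] := nS.
have v1 := sv_vfnear nS'; have v2 := sv_vfnear nS.
rewrite (_ : (fun z => output S' z 0 j) = fun z => output S (insert_coord l c z) 0 j); last first.
  by apply/funext => z; rewrite ho.
rewrite /sjet -i0.
apply: (@jets_agree _ _ _ _ (init S') (insert_coord l c) v1) => //; rewrite ?i0 //.
- by move=> i; apply: insert_analytic.
- move=> [al Ua] i N H; case: (unliftP l i) => [k|] ->.
    rewrite (_ : lie_deriv _ _ = fun z => dyn S al (insert_coord l c z) 0 (lift l k)).
      by apply: (H (fun x => dyn S al x 0 (lift l k))); apply: (vfnear_at v2 (exist _ al Ua)).
    apply/funext => z; under [X in lie_deriv _ X]eq_fun do rewrite insert_lift.
    by rewrite lie_coord -hd.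
  rewrite (_ : lie_deriv _ _ = fun=> 0); last first.
    apply/funext => z; under [X in lie_deriv _ X]eq_fun do rewrite insert_at.
    exact: diff_cst0.
  rewrite (ljetC v1) rmorph0 sub0r; apply: jet0N.
  have := congr1 (sshift (exist _ al Ua)) hl; rewrite sshift_cst => E.
  have E' : @sjet R m r _ U S (lie_deriv (dyn S al) (fun x => x 0 l)) = 0 := E.
  by rewrite -[X in jet0 _ X]/(@sjet R m r _ U S (fun x => dyn S al x 0 l)) -(lie_coord (dyn S al)) E'.
- exact: nash_at oX (nh j) X0.
Qed.

(** All columns but the j-th are those of the identity, so a vector in the left kernel has at most
    its j-th entry nonzero, and [pd j g] kills that entry. *)
Lemma jac_replace n (x : 'rV[R]_n) (g : 'rV[R]_n -> R) j : pd j g x != 0 ->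
  jac (fun x : 'rV[R]_n => \row_i if i == j then g x else x 0 i) x \in unitmx.
Proof.
move=> gj; rewrite -row_free_unit -kermx_eq0; apply/eqP/row_matrixP => i0; rewrite row0.
set v := row i0 _; have : v *m jac (fun x : 'rV[R]_n => \row_i if i == j then g x else x 0 i) x = 0.
  by apply/sub_kermxP; apply: row_sub.
move=> vJ; have E k : \sum_i v 0 i * pd i (fun z : 'rV[R]_n => if k == j then g z else z 0 k) x = 0.
  have /rowP/(_ k) := vJ; rewrite !mxE => E; rewrite -[RHS]E; apply: eq_bigr => i _; rewrite !mxE.
  by congr (_ * pd _ _ _); apply/funext => z; rewrite mxE.
have vk k : k != j -> v 0 k = 0.
  move=> kj; have := E k; under eq_bigr do under [X in pd _ X]eq_fun do rewrite (negbTE kj).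
  rewrite (bigD1 k) //= pd_coord eqxx mulr1 big1 ?addr0 // => i ik.
  by rewrite pd_coord (negbTE ik) mulr0.
apply/rowP => k; rewrite [RHS]mxE; have [->|] := eqVneq k j; last exact: vk.
have := E j; under eq_bigr do under [X in pd _ X]eq_fun do rewrite eqxx.
rewrite (bigD1 j) //= big1 ?addr0 => [/eqP|i ij]; last by rewrite vk ?mul0r.
by rewrite mulf_eq0 (negbTE gj) orbF => /eqP.
Qed.

(** For a field f, the derivative pd j of L_f g is the sum over i of (pd j f_i)(pd i g), plus L_f
    (pd j g). For j outside I this raises the order of vanishing of pd j g: if i is in I then f_i
    itself belongs to K, otherwise pd i g is covered by the induction. *)
Lemma rank_lemma n (S : system R m r n) (K : set ('rV[R]_n -> R)) (I : pred 'I_n) : nash_system U S ->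
  K `<=` nash (state_space S) ->
  (forall al g, U al -> K g -> K (lie_deriv (dyn S al) g)) ->
  (forall al l, U al -> I l -> K (fun x => dyn S al x 0 l)) ->
  (forall g j, K g -> ~~ I j -> pd j g (init S) = 0) ->
  forall g j, K g -> ~~ I j -> @sjet R m r _ U S (pd j g) = 0.
Proof.
move=> nS Kn Kl KI K0; have [[oX cX sX] nf nh X0] := nS; have v1 := sv_vfnear nS.
suff H N : forall g j, K g -> ~~ I j -> jet0 N (@sjet R m r _ U S (pd j g)).
  by move=> g j Kg Ij; apply: jet0_all => N; apply: H.
elim: N => [|N ih] g j Kg Ij; first by apply/jet0_0; apply: K0.
apply/jet0S; split; first exact: K0.
move=> [al Ua]; have ng := Kn g Kg; have nal := nf al Ua.
have aX f x : nash (state_space S) f -> state_space S x -> analytic_at x f by move=> nff; apply: nash_at.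
have ap k : analytic_at (init S) (pd k g) by apply: analytic_at_pd; apply: aX.
have apf k : analytic_at (init S) (pd j (fun x => dyn S al x 0 k)).
  by apply: analytic_at_pd; apply: aX.
have alie : analytic_at (init S) (lie_deriv (dyn S al) (pd j g)).
  by apply: analytic_at_lie => // k; apply: aX.
have E : @sjet R m r _ U S (pd j (lie_deriv (dyn S al) g)) =
    \sum_i @sjet R m r _ U S (pd j (fun x => dyn S al x 0 i)) * @sjet R m r _ U S (pd i g) +
    @sjet R m r _ U S (lie_deriv (dyn S al) (pd j g)).
  rewrite /sjet (eq_bigr _ (fun i _ => esym (ljetM v1 (apf i) (ap i)))) -(ljet_sum v1) => [|i]; last exact: analytic_atM.
  rewrite -(ljetD v1) //; last by apply: analytic_at_sum => i; apply: analytic_atM.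
  apply: (ljet_ext v1); first by apply: analytic_at_pd; apply: aX => //; apply: nash_lie.
  have : nbhs (init S) (state_space S) by apply: open_nbhs_nbhs.
  apply: filterS => x Xx.
  rewrite {1}/pd (_ : lie_deriv (dyn S al) g = fun x => \sum_i dyn S al x 0 i * pd i g x); last first.
    by apply/funext => y; rewrite lie_pdE.
  have df i : differentiable (fun x => dyn S al x 0 i) x by apply: analytic_at_diff; apply: aX.
  have dp i : differentiable (pd i g) x by apply: analytic_at_diff; apply: analytic_at_pd; apply: aX.
  have [|_ ->] := @diff_sumE R n _ (index_enum 'I_n) (fun i x => dyn S al x 0 i * pd i g x) x (delta_mx 0 j).
    move=> i; apply: analytic_at_diff; apply: analytic_atM; first exact: aX.
    by apply: analytic_at_pd; apply: aX.
  rewrite lie_pdE -big_split /=; apply: eq_bigr => i _; rewrite diffME //.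
  have [e [M [e0 hM]]] := aX g x ng Xx.
  have h0 : 0 <= e / 2 by rewrite divr_ge0 // ltW.
  have h1 : e / 2 < e by rewrite ltr_pdivrMr // ltr_pMr // ltr1n.
  have -> : 'd (pd i g) x (delta_mx 0 j) = pd i (pd j g) x.
    by rewrite -[LHS]/(pd j (pd i g) x) (pd_comm j i h0 h1 hM) //; apply: box_refl.
  rewrite -['d (fun x => dyn S al x 0 i) x (delta_mx 0 j)]/(pd j (fun x => dyn S al x 0 i) x).
  by rewrite addrC (mulrC (pd i g x)).
have -> : sshift (exist _ al Ua) (@sjet R m r _ U S (pd j g)) = @sjet R m r _ U S (pd j (lie_deriv (dyn S al) g)) -
    \sum_i @sjet R m r _ U S (pd j (fun x => dyn S al x 0 i)) * @sjet R m r _ U S (pd i g).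
  by rewrite E addrAC subrr add0r.
apply: jet0D; first by apply: ih => //; apply: Kl.
apply: jet0N; apply: jet0_sum => i; case: (boolP (I i)) => Ii.
  by apply: jet0Ml; apply: ih => //; apply: KI.
by apply: jet0Mr; apply: ih.
Qed.

End Reductions.

(** * Minimal realizations *)

Section Minimality.
Variables (R : realType) (m r : nat) (U : set 'rV[R]_m).
Local Notation letter := {al : 'rV[R]_m | U al}.
Local Notation series := (wseries R letter).
Local Notation T S := (@sjet R m r _ U S).

(** The functions in K do not depend on x_l, so the term lost in [lie_insert] is zero for them and
    all their derivatives. *)
Lemma freeze_obs n (S : system R m r n.+1) (l : 'I_n.+1) (K : set ('rV[R]_n.+1 -> R)) : nash_system U S ->
  K `<=` nash (state_space S) -> (forall al g, U al -> K g -> K (lie_deriv (dyn S al) g)) ->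
  (forall j, K (fun z => output S z 0 j)) ->
  (forall g x, K g -> state_space S x -> pd l g x = 0) ->
  exists S' : system R m r n, nash_system U S' /\
    forall j, T S' (fun z => output S' z 0 j) = T S (fun z => output S z 0 j).
Proof.
move=> nS Kn Kl Ko K0; have [S' [nS' i0 inX hd ho]] := slice_system l nS.
exists S'; split=> // j; have [[oX _ _] _ nh X0] := nS; have [[oX' _ _] _ _ X0'] := nS'.
have v1 := sv_vfnear nS'; set c := init S 0 l in i0 inX hd ho.
rewrite (_ : (fun z => output S' z 0 j) = fun z => output S (insert_coord l c z) 0 j); last first.
  by apply/funext => z; rewrite ho.
have aK g z : K g -> state_space S' z -> analytic_at (insert_coord l c z) g.
  by move=> Kg Xz; apply: nash_at oX (Kn g Kg) (inX z Xz).
have aK' g z : K g -> state_space S' z -> analytic_at z (fun z => g (insert_coord l c z)).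
  by move=> Kg Xz; apply: analytic_at_comp; [move=> i; exact: insert_analytic|exact: aK].
suff H w : forall g, K g -> T S' (fun z => g (insert_coord l c z)) w = T S g w.
  by apply/funext => w; apply: (H w (fun z => output S z 0 j)).
elim: w => [|[al Ua] w ih] g Kg.
  by rewrite -[LHS]/(g (insert_coord l c (init S'))) i0.
rewrite -[LHS]/(T S' (lie_deriv (dyn S' al) (fun z => g (insert_coord l c z))) w).
rewrite -[RHS]/(T S (lie_deriv (dyn S al) g) w) -ih; last exact: Kl.
congr (_ w); apply: (ljet_ext v1).
  by apply: analytic_at_lie => [|k]; [exact: aK'|exact: (vfnear_at v1 (exist _ al Ua))].
have : nbhs (init S') (state_space S') by apply: open_nbhs_nbhs.
apply: filterS => z Xz; rewrite (lie_insert (fun j => hd al z j)); last exact: aK.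
by rewrite (K0 g _ Kg (inX z Xz)) mulr0 subr0.
Qed.

Definition realizes (J : 'I_r -> series) n (S : system R m r n) :=
  nash_system U S /\ forall j, T S (fun z => output S z 0 j) = J j.

Definition minimal_dim (J : 'I_r -> series) n := forall n' (S' : system R m r n'), realizes J S' -> (n <= n')%N.

Lemma no_constant_coord J n (S : system R m r n) l c : realizes J S -> minimal_dim J n ->
  T S (fun x => x 0 l) <> @scst R letter c.
Proof.
case: n S l => [|n] S l; first by case: l.
move=> [nS hJ] mn hl; have [S' [nS' h']] := freeze_ker nS hl.
by have := mn n S' (conj nS' (fun j => etrans (h' j) (hJ j))); rewrite ltnn.
Qed.

Lemma replace_nash n (X : set 'rV[R]_n) g j : open X -> semialgebraic X -> nash X g ->
  nash_map X (fun x : 'rV[R]_n => \row_i if i == j then g x else x 0 i).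
Proof.
move=> oX sX ng i; apply: (@nash_ext _ _ _ (fun x => if i == j then g x else x 0 i)) => //.
  by move=> x _; rewrite mxE.
by case: (i == j) => //; apply: nash_coord.
Qed.

(** Let K be the kernel of the jet. If some g in K has pd j g nonzero at the initial state, it can
    replace coordinate j, which then has zero jet and can be frozen, against minimality. So all
    these gradients vanish there; [rank_lemma] with I empty makes K stable under partial
    derivatives, and every g in K has zero Taylor series. *)
Lemma minimal_Tinj J n (S : system R m r n) : realizes J S -> minimal_dim J n -> Tinj U S.
Proof.
move=> rS mn; have [nS hJ] := rS; have [[oX cX sX] nf nh X0] := nS; have v1 := sv_vfnear nS.
pose K := [set g | nash (state_space S) g /\ T S g = 0].
have Kl al g : U al -> K g -> K (lie_deriv (dyn S al) g).
  move=> Ua [ng Tg]; split; first by apply: nash_lie => //; apply: nf.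
  exact: (congr1 (sshift (exist _ al Ua)) Tg).
have K0 g j : K g -> pd j g (init S) = 0.
  move=> [ng Tg]; apply: contrapT => /eqP gj.
  have nb := replace_nash j oX sX ng.
  have [S' [psi [nS' i0 J' [_ ho] _]]] := chart_system nS nb (jac_replace gj).
  apply: (@no_constant_coord J n S' j 0) => //.
    by split=> // k; rewrite ho hJ.
  rewrite J'; last exact: analytic_at_coord.
  by rewrite rmorph0 -Tg; congr (T S); apply/funext => x; rewrite mxE eqxx.
have Kp g j : K g -> K (pd j g).
  move=> Kg; split; first by apply: nash_pd => //; case: Kg.
  apply: (rank_lemma (K := K) (I := pred0) nS) => //; first by move=> h [].
  by move=> h k Kh _; apply: K0.
move=> g ng Tg; apply: (partials_jet_inj cX _ X0) => [z Xz|]; first exact: nash_at ng Xz.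
apply/funext => w; have : K g by []. elim: w g {ng Tg} => [|i w ih] g Kg.
  exact: (congr1 (fun F : series => F [::]) Kg.2).
exact: (ih (pd i g) (Kp g i Kg)).
Qed.

Lemma nash_germ_id n (x : 'rV[R]_n) : nash_germ x id.
Proof. by exists 1 => // i; apply: nash_coord; [exact: obox_open|exact: obox_semialg]. Qed.

(** In the application, the jets at u of the members of the observation algebra. *)
Variable TT : set series.
Hypothesis TT_shift : forall a f, TT f -> TT (sshift a f).

Definition charted n (S S' : system R m r n) (be psi : 'rV[R]_n -> 'rV[R]_n) :=
  [/\ nash_germ (init S) be /\ be (init S) = init S', nash_germ (init S') psi /\ psi (init S') = init S,
      \forall x \near init S, psi (be x) = x &
      forall G, analytic_at (init S') G -> T S' G = T S (fun x => G (be x))].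

(** Coordinates are replaced one at a time by functions with jets in TT. If at some stage no such
    function depends to first order, at the initial state, on a remaining coordinate, then by
    [rank_lemma] and injectivity of jets none depends on it at all, and freezing it contradicts
    minimality. *)
Lemma minimal_coords J n (S : system R m r n) : (forall j, TT (J j)) -> realizes J S -> minimal_dim J n ->
  exists S' be psi, [/\ realizes J S', charted S S' be psi & forall i, TT (T S' (fun x : 'rV[R]_n => x 0 i))].
Proof.
move=> TJ rS mn.
suff H k : (k <= n)%N -> exists S' be psi (I : {set 'I_n}), [/\ realizes J S', charted S S' be psi,
    #|I| = k & forall i, i \in I -> TT (T S' (fun x : 'rV[R]_n => x 0 i))].
  have [S' [be [psi [I [h1 h2 h3 h4]]]]] := H n (leqnn n).
  exists S', be, psi; split=> // i; apply: h4.
  have -> : I = [set: 'I_n]%SET by apply/eqP; rewrite eqEcard finset.subsetT cardsT card_ord h3 leqnn.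
  by rewrite inE.
elim: k => [|k ih] kn.
  exists S, id, id, (finset.set0 : {set 'I_n}); split=> //; last by move=> i; rewrite inE.
    by split=> //; try (by split=> //; apply: nash_germ_id); apply: filterE.
  by rewrite cards0.
have [S1 [be [psi [I [r1 ch1 cI hI]]]]] := ih (ltnW kn).
have [n1 h1] := r1; have [[oX cX sX] nf nh X0] := n1; have inj := minimal_Tinj r1 mn.
pose K := [set g | nash (state_space S1) g /\ TT (T S1 g)].
have Kl al g : U al -> K g -> K (lie_deriv (dyn S1 al) g).
  move=> Ua [ng Tg]; split; first by apply: nash_lie => //; apply: nf.
  exact: (TT_shift (exist _ al Ua) Tg).
have Ko j : K (fun z => output S1 z 0 j) by split; [exact: nh|rewrite h1].
have KI al l : U al -> l \in I -> K (fun x => dyn S1 al x 0 l).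
  move=> Ua lI; rewrite -(lie_coord (dyn S1 al)); apply: Kl => //.
  by split; [exact: nash_coord|exact: hI].
(* Either some function with jet in TT can take the place of a coordinate outside I, or no such
   function can. *)
have [[g [j [Kg jI gj]]]|no] := pselect (exists g j, [/\ K g, j \notin I & pd j g (init S1) != 0]).
  have [ng Tg] := Kg; have nb := replace_nash j oX sX ng.
  pose b := fun x : 'rV[R]_n => \row_i (if i == j then g x else x 0 i) : 'rV[R]_n.
  have [S' [psi' [nS' i0 J' [_ ho] [np pb pbx bpy]]]] := chart_system n1 nb (jac_replace gj).
  have [[nbe be0] [npsi psi0] pbe Jb] := ch1.
  have nbg : nash_germ (init S1) b.
    have [e e0 eX] := near_obox (open_nbhs_nbhs (conj oX X0)).
    exists e => // i; exact: (nash_subset oX (@obox_open _ _ _ _) (obox_semialg _ _) eX (nb i)).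
  exists S', (fun x => b (be x)), (fun y => psi (psi' y)), (j |: I)%SET; split.
  - by split=> // k'; rewrite ho h1.
  - split.
    + split; last by rewrite be0 i0.
      by apply: nash_germ_comp => //; rewrite be0.
    + rewrite i0; split; last by rewrite pb psi0.
      by apply: nash_germ_comp => //; rewrite pb.
    + have := germ_near (fun i => nash_germ_an i nbe) (P := [set y | psi' (b y) = y]).
      rewrite be0 => /(_ pbx) h; apply: filterS2 h pbe => x h1' h2'.
      by rewrite h1' h2'.
    + move=> G; rewrite i0 => aG; rewrite J' // Jb //.
      apply: (analytic_at_comp (th := b)) => // i; exact: nash_germ_an nbg.
  - by rewrite cardsU1 jI cI.
  - move=> i; rewrite in_setU1 => iI; rewrite J'; last exact: analytic_at_coord.
    have [ij|ij] := eqVneq i j.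
      by rewrite (_ : (fun x => _) = g) //; apply/funext => x; rewrite mxE ij eqxx.
    rewrite (_ : (fun x => _) = fun x : 'rV[R]_n => x 0 i); last first.
      by apply/funext => x; rewrite mxE (negbTE ij).
    by apply: hI; move: iI; rewrite (negbTE ij).
have [j jI] : exists j, j \notin I.
  apply/existsP; rewrite -negb_forall; apply/negP => /forallP h.
  have : (#|[set: 'I_n]%SET| <= #|I|)%N by apply: subset_leq_card; apply/fintype.subsetP => i _; apply: h.
  by rewrite cardsT card_ord cI leqNgt kn.
have pK g x : K g -> state_space S1 x -> pd j g x = 0.
  move=> Kg; apply: inj; first by apply: nash_pd => //; case: Kg.
  apply: (rank_lemma (K := K) (I := fun i => i \in I) n1) => //; first by move=> h [].
  by move=> h i Kh iI; apply: contrapT => /eqP hi; apply: no; exists h, i.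
have Kn : K `<=` nash (state_space S1) by move=> h [].
(* The context is cleared so that the dimension can be made a successor, as [freeze_obs]
   requires. *)
exfalso; clear ih cI hI KI jI no I inj ch1; move: mn S1 r1 n1 h1 oX cX sX nf nh X0 K Kn Kl Ko j pK.
case: n {S rS kn be psi} => [|n] mn S1 r1 n1 h1 oX cX sX nf nh X0 K Kn Kl Ko j pK; first by case: j {pK}.
have [S' [nS' ho]] := @freeze_obs n S1 j K n1 Kn Kl Ko pK.
by have := mn n S' (conj nS' (fun j => etrans (ho j) (h1 j))); rewrite ltnn.
Qed.

End Minimality.

(** * Implicit Nash functions *)

Section Implicit.
Variables (R : realType) (d : nat).

Lemma mderiv_max0 (B : comNzRingType) (jm : {rmorphism R -> B}) (y : 'I_d -> B) z (Q : mpoly d.+1 R) :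
  mderiv ord_max Q = 0 -> mmap jm (extend_family y z) Q = mmap jm (extend_family y 0) Q.
Proof.
move=> dQ; apply: eq_big_seq => mu mQ; congr (_ * _); rewrite /mmap1; apply: eq_bigr => i _.
case: (unliftP ord_max i) => [j|] ->; first by rewrite !extend_family_lift.
suff -> : mu ord_max = 0%N by rewrite !expr0.
apply/eqP; rewrite -leqn0 leqNgt; apply/negP => h.
have := mcoeff_deriv ord_max (mnm_sub mu (mnm1 ord_max)) Q.
have -> : mnm_add (mnm_sub mu (mnm1 ord_max)) (mnm1 ord_max) = mu.
  by rewrite submK //; apply/mnm_lepP => j; rewrite mnm1E; case: eqP => [<-|//].
rewrite dQ mcoeff0 => /esym/eqP; rewrite -mulr_natl mulf_eq0 pnatr_eq0 /=.
by move: mQ; rewrite mcoeff_msupp => /negbTE->.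
Qed.

Definition drop_max (Q : mpoly d.+1 R) : mpoly d R :=
  mmap (@mpolyC d R) (extend_family (fun i => polyvar R i) 0) Q.

Lemma drop_max_eval (B : comNzRingType) (jm : {rmorphism R -> B}) (y : 'I_d -> B) (Q : mpoly d.+1 R) :
  mmap jm y (drop_max Q) = mmap jm (extend_family y 0) Q.
Proof.
rewrite mmap_comp; congr mmap; apply/funext => i; case: (unliftP ord_max i) => [j|] ->.
  by rewrite !extend_family_lift mmapX mmap1U.
by rewrite !extend_family_max rmorph0.
Qed.

Lemma msize_mderiv (Q : mpoly d.+1 R) i : mderiv i Q != 0 -> (msize (mderiv i Q) < msize Q)%N.
Proof.
move=> dQ0; have hm mu : mu \in msupp (mderiv i Q) -> ((mdeg mu).+1 < msize Q)%N.
  rewrite mcoeff_msupp mcoeff_deriv => h.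
  have h2 : mnm_add mu (mnm1 i) \in msupp Q by rewrite mcoeff_msupp; apply: contraNneq h => ->; rewrite mul0rn.
  by have := msize_mdeg_lt h2; rewrite mdegD mdeg1 addn1.
have Q0 : (0 < msize Q)%N.
  by rewrite lt0n msize_poly_eq0; apply: contraNneq dQ0 => ->; rewrite raddf0.
rewrite -(prednK Q0) ltnS mmeasureE; apply/bigmax_leqP_seq => mu mQ _.
by rewrite -ltnS (prednK Q0); apply: hm.
Qed.

(** For a relation of least size, the derivative in the last variable cannot be a smaller relation.
    It is not the zero polynomial either, since the last variable would then be absent and y
    dependent. *)
Lemma minimal_relation (T : Type) (D : set T) (y : 'I_d -> T -> R) f :
  ~ fdep D y -> fdep D (extend_family y f) ->
  exists Q : mpoly d.+1 R, (forall v, D v -> meval (fun i => extend_family y f i v) Q = 0) /\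
    exists2 v, D v & meval (fun i => extend_family y f i v) (mderiv ord_max Q) != 0.
Proof.
move=> ny [Q0 Q00 hQ0].
pose P k := `[< exists Q : mpoly d.+1 R, [/\ Q != 0, msize Q = k & forall v, D v ->
   meval (fun i => extend_family y f i v) Q = 0] >].
have exP : exists k, P k by exists (msize Q0); apply/asboolP; exists Q0.
case: (ex_minnP exP) => k /asboolP[Q [Qn0 Qk hQ]] mk; exists Q; split=> //.
apply: contrapT => no.
have dv v : D v -> meval (fun i => extend_family y f i v) (mderiv ord_max Q) = 0.
  by move=> Dv; apply: contrapT => /eqP h; apply: no; exists v.
have [dQ|dQ] := eqVneq (mderiv ord_max Q) 0; last first.
  have : P (msize (mderiv ord_max Q)) by apply/asboolP; exists (mderiv ord_max Q).
  by move=> /mk; rewrite leqNgt -Qk msize_mderiv.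
have evE v : (fun i => extend_family y f i v) = extend_family (fun i => y i v) (f v).
  by apply/funext => i; case: (unliftP ord_max i) => [j|] ->; rewrite ?extend_family_lift ?extend_family_max.
apply: ny; exists (drop_max Q) => [|v Dv].
  apply: contraNneq Qn0 => dr; have := mmap_id Q.
  rewrite -(@extend_familyE _ _ (fun i => polyvar R i)) (mderiv_max0 (@mpolyC d.+1 R)) //.
  by rewrite -drop_max_eval dr rmorph0 => <-.
rewrite meval_mmap (drop_max_eval (@idfun R)) -(mderiv_max0 _ _ (f v) dQ) -evE.
exact: hQ.
Qed.

Lemma pd_meval k (Q : mpoly k R) (x : 'rV[R]_k) i :
  pd i (fun x : 'rV[R]_k => meval (fun i => x 0 i) Q) x = meval (fun i => x 0 i) (mderiv i Q).
Proof.
have E (P : mpoly k R) : (fun x : 'rV[R]_k => meval (fun i => x 0 i) P) = (fun x => meval (disp 0 x) P).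
  by apply/funext => z; congr meval; apply/funext => j; rewrite /disp mxE subr0.
have [_ /(_ (delta_mx 0 i))] := poly_differentiable Q 0 x.
rewrite -E -[X in X = _ -> _]/(pd i (fun x : 'rV[R]_k => meval (fun i => x 0 i) Q) x) => ->.
rewrite (bigD1 i) //= big1 => [|j ji]; rewrite !mxE eqxx /=; last by rewrite (negbTE ji) mul0r.
by rewrite eqxx mul1r addr0 -[LHS]/((fun x => meval (disp 0 x) (mderiv i Q)) x) -E.
Qed.

(** The inverse of the map (y, z) to (y, Q (y, z)), evaluated at (y, 0). *)
Lemma implicit_nash (Q : mpoly d.+1 R) (y0 : 'rV[R]_d) z0 :
  meval (extend_family (fun i => y0 0 i) z0) Q = 0 ->
  meval (extend_family (fun i => y0 0 i) z0) (mderiv ord_max Q) != 0 ->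
  exists s (F : 'rV[R]_d -> R), [/\ 0 < s, nash (obox s y0) F, F y0 = z0 &
    forall y, obox s y0 y -> meval (extend_family (fun i => y 0 i) (F y)) Q = 0].
Proof.
move=> Q0 dQ0; pose g (x : 'rV[R]_d.+1) := meval (fun i => x 0 i) Q.
pose b (x : 'rV[R]_d.+1) : 'rV[R]_d.+1 := \row_i (if i == ord_max then g x else x 0 i).
pose x0 := ext_row y0 z0.
have xE y z : (fun i => ext_row y z 0 i) = extend_family (fun i => (y : 'rV[R]_d) 0 i) z.
  by apply/funext => i; rewrite mxE.
have ng : nash [set: 'rV[R]_d.+1] g by apply: nash_meval => [||i]; [exact: openT|exact: saT|exact: nash_coord openT (saT _ _)].
have nb := replace_nash ord_max openT (saT _ _) ng.
have Ju : jac b x0 \in unitmx by apply: jac_replace; rewrite /g pd_meval xE.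
have [psi [e [s [[e0 s0] npsi psib bpsi _]]]] := nash_inverse openT nb (I : [set: _] x0) Ju.
have bx0 : b x0 = ext_row y0 0.
  apply/rowP => i; rewrite mxE; case: (unliftP ord_max i) => [j|] ->.
    by rewrite eq_sym (negbTE (neq_lift _ _)) !ext_row_lift.
  by rewrite eqxx ext_row_max /g xE.
have oB := @obox_open R d s y0; have sB := @obox_semialg R d s y0.
have inB y : obox s y0 y -> obox s (b x0) (ext_row y 0).
  move=> ys i; rewrite bx0; case: (unliftP ord_max i) => [j|] ->.
    by rewrite !ext_row_lift.
  by rewrite !ext_row_max subrr normr0.
have next : nash_map (obox s y0) (fun y => ext_row y 0).
  move=> i; case: (unliftP ord_max i) => [j|] ->.
    by under eq_fun do rewrite ext_row_lift; apply: nash_coord.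
  by under eq_fun do rewrite ext_row_max; apply: nash_cst.
exists s, (fun y => psi (ext_row y 0) 0 ord_max); split=> //.
- exact: (nash_comp oB (@obox_open _ _ _ _) sB next (npsi ord_max) inB).
- by rewrite -bx0 psib ext_row_max.
move=> y ys; have [_ bE] := bpsi _ (inB y ys).
have <- : (fun i => psi (ext_row y 0) 0 i) = extend_family (fun i => y 0 i) (psi (ext_row y 0) 0 ord_max).
  apply/funext => i; case: (unliftP ord_max i) => [j|] ->; last by rewrite extend_family_max.
  rewrite extend_family_lift; have := congr1 (fun z : 'rV[R]_d.+1 => z 0 (lift ord_max j)) bE.
  by rewrite mxE eq_sym (negbTE (neq_lift _ _)) ext_row_lift.
have := congr1 (fun z : 'rV[R]_d.+1 => z 0 ord_max) bE.
by rewrite mxE eqxx ext_row_max.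
Qed.

End Implicit.

(** * Existence of a realization of dimension d *)

Section Existence.
Variables (R : realType) (m r : nat) (U : set 'rV[R]_m) (D : set (input R m)) (p : input R m -> 'rV[R]_r).
Hypothesis U_fin : finite_set U.
Hypothesis aD : admissible U D.
Hypothesis pA : response_map D p.
Local Notation letter := {al : 'rV[R]_m | U al}.
Local Notation ops := (@input_ops R m U).
Local Notation O := (obs_algebra_map U D p).

(** One function stands for finitely many genericity conditions, since jets lie in a domain. *)
Lemma O_prod_generic (I : Type) (s : seq I) (g : I -> input R m -> R) :
  (forall i, O (g i) /\ exists2 v, D v & g i v != 0) ->
  O (fun v => \prod_(i <- s) g i v) /\ jetser ops [::] (fun v => \prod_(i <- s) g i v) != 0.
Proof.
move=> hg; have [Oc Od Om] := O_alg U D p; have [h1 h2 h3 h4] := O_jets aD pA (Dnil aD).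
elim: s => [|i s [ih1 ih2]].
  under eq_fun do rewrite big_nil; split; first exact: Oc.
  by rewrite [X in X != 0](h1 1) rmorph1 oner_neq0.
under eq_fun do rewrite big_cons; have [Og [v Dv gv]] := hg i.
split; first exact: Om.
rewrite [X in X != 0](h3 _ _ Og ih1) mulf_neq0 //; apply/eqP => g0; case/eqP: gv.
by apply: ((h4 _ _ Og (Oc 0)).1 _ v Dv); rewrite h1 rmorph0.
Qed.

(* The coordinates of the realization are d independent elements of the
   observation algebra; the vector fields are the algebraic functions of
   these coordinates by which their derivatives are expressed. *)
Lemma generic_realization d eps : tdeg D O d -> 0 < eps ->
  exists u (S : system R m r d), [/\ D u, duration u < eps, nash_system U S &
    forall j, @sjet R m r d U S (fun z => output S z 0 j) = jetser ops u (fun v => p v 0 j)].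
Proof.
move=> [[phi Op np] hp] eps0; have [s sE] := (finite_seqP _).1 U_fin.
have [Oc Od Om] := O_alg U D p.
(* The functions to be expressed through the coordinates phi: the derivatives of each coordinate
   along each control, and the components of p. *)
pose I : finType := ('I_(size s) * 'I_d + 'I_r)%type.
pose fam (i : I) := match i with
  | inl (k, i) => input_deriv (nth 0 s k) (phi i) | inr j => fun v => p v 0 j end.
have Of i : O (fam i).
  case: i => [[k i]|j] /=; last exact: O_gen.
  apply: O_deriv => //; rewrite sE /=; exact: mem_nth.
pose w i := extend_family phi (fam i).
have Ow i k : O (w i k).
  by rewrite /w; case: (unliftP ord_max k) => [j|] ->; rewrite ?extend_family_lift ?extend_family_max.
have hQ i := minimal_relation np (hp (w i) (Ow i)).
pose Q i := sval (cid (hQ i)).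
have Q0 i v : D v -> meval (fun k => w i k v) (Q i) = 0 by have [h _] := svalP (cid (hQ i)); apply: h.
pose g i v := meval (fun k => w i k v) (mderiv ord_max (Q i)).
have gn i : O (g i) /\ exists2 v, D v & g i v != 0.
  by split; [exact: subalg_meval (O_alg U D p) (Ow i)|have [_] := svalP (cid (hQ i))].
have [OG JG] := O_prod_generic (enum I) gn.
have [h1 h2 h3 h4] := O_jets aD pA (Dnil aD).
(* At this input the implicit function theorem applies to all relations at once. *)
have [|u [Du du Gu]] := generic_short aD (O_an aD pA OG) _ eps0.
  apply: contrapT => no; case/eqP: JG; rewrite -(rmorph0 (@scst R letter)).
  transitivity (jetser ops [::] (cst 0)); last exact: h1.
  apply/(h4 _ _ OG (Oc 0)) => v Dv.
  by apply: contrapT => /eqP h; apply: no; exists v.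
have gu i : g i u != 0.
  by move: Gu; rewrite big_enum /= => /prodf_neq0; apply.
pose y0 : 'rV[R]_d := \row_i phi i u.
have wE i v : (fun k => w i k v) = extend_family (fun k => phi k v) (fam i v).
  by apply/funext => k; rewrite /w; case: (unliftP ord_max k) => [j|] ->; rewrite ?extend_family_lift ?extend_family_max.
have y0E : (fun k => y0 0 k) = fun k => phi k u by apply/funext => k; rewrite mxE.
have imp i : exists sF : R * ('rV[R]_d -> R), [/\ 0 < sF.1, nash (obox sF.1 y0) sF.2, sF.2 y0 = fam i u &
    forall y, obox sF.1 y0 y -> meval (extend_family (fun k => y 0 k) (sF.2 y)) (Q i) = 0].
  have [|| e [F h]] := @implicit_nash R d (Q i) y0 (fam i u).
  - by rewrite y0E -wE Q0.
  - by rewrite y0E -wE; apply: gu.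
  by exists (e, F).
pose sF i := sval (cid (imp i)); have sFP i := svalP (cid (imp i)); rewrite -/(sF _) in sFP.
pose F i := (sF i).2; pose e := \big[Num.min/1]_(i : I) (sF i).1.
have e0 : 0 < e by apply/bigmin_gtP; split=> // i _; have [] := sFP i.
have eB i : obox e y0 `<=` obox (sF i).1 y0 by apply: obox_sub; apply: bigmin_le_cond.
have oB := @obox_open R d e y0; have sB := @obox_semialg R d e y0.
have nF i : nash (obox e y0) (F i).
  by have [_ h _ _] := sFP i; apply: (nash_subset (@obox_open _ _ _ _) oB sB (eB i) h).
have F0 i : F i y0 = fam i u by have [] := sFP i.
have FQ i y : obox e y0 y -> meval (extend_family (fun k => y 0 k) (F i y)) (Q i) = 0.
  by move=> /(eB i); have [_ _ _] := sFP i; apply.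
(* The field has to be given for every vector al; controls are recognised by their index in s, and
   other vectors get 0. *)
pose dy (al : 'rV[R]_m) (y : 'rV[R]_d) : 'rV[R]_d :=
  \row_i if insub (index al s) is Some k then F (inl (k, i)) y else 0.
have dyE al i : U al -> exists2 k, (fun y => dy al y 0 i) = F (inl (k, i)) & nth 0 s k = al.
  rewrite sE /= => als; have hk : (index al s < size s)%N by rewrite index_mem.
  exists (Ordinal hk); last exact: nth_index.
  by apply/funext => y; rewrite mxE insubT.
pose S : system R m r d := System (obox e y0) dy (fun y => \row_j F (inr j) y) y0.
have outE j : (fun z => output S z 0 j) = F (inr j) by apply/funext => z; rewrite mxE.
have nS : nash_system U S.
  split=> /=; [by split=> //; apply: obox_connected| | |exact: obox_center].
    by move=> al Ua i; have [k -> _] := dyE al i Ua.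
  by move=> j; have := outE j; rewrite /= => ->.
have v1 := sv_vfnear nS; have X0 : obox e y0 y0 by apply: obox_center.
have aF i : analytic_at y0 (F i) by apply: nash_at oB (nF i) X0.
pose T := @sjet R m r d U S; pose J := jetser ops u.
(* Both [F i] and [fam i] solve the relation [Q i], over coordinates that agree to order N. By
   [mmap_difference] their difference, times a series with constant term [g i u], vanishes to order
   N; as that number is not zero the series cancels. *)
have stepF N : (forall i, jet0 N (T (fun y => y 0 i) - J (phi i))) -> forall i, jet0 N (T (F i) - J (fam i)).
  move=> hy i; pose x := extend_family (fun k => T (fun y => y 0 k)) (T (F i)).
  pose x' := extend_family (fun k => J (phi k)) (J (fam i)).
  have [|E hE eE] := @mmap_difference R letter _ (Q i) x x'.
    move=> k; rewrite /x /x'; case: (unliftP ord_max k) => [j|] ->; rewrite ?extend_family_lift ?extend_family_max.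
      by rewrite -[LHS]/(y0 0 j) mxE.
    by rewrite -[LHS]/(F i y0) F0.
  have mx : mmap (@scst R letter) x (Q i) = 0.
    pose z := extend_family (fun k (y : 'rV[R]_d) => y 0 k) (F i).
    have az k : analytic_at y0 (z k).
      by rewrite /z; case: (unliftP ord_max k) => [j|] ->; rewrite ?extend_family_lift ?extend_family_max //; apply: analytic_at_coord.
    have -> : x = fun k => ljet (@sv R m r d U S) y0 (z k).
      by apply/funext => k; rewrite /x /z; case: (unliftP ord_max k) => [j|] ->; rewrite ?extend_family_lift ?extend_family_max.
    rewrite -(ljet_meval v1 (Q i) az).
    have -> : (0 : wseries R letter) = ljet (@sv R m r d U S) y0 (fun=> 0) by rewrite (ljetC v1) rmorph0.
    apply: (ljet_ext v1); first exact: analytic_at_meval.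
    have : nbhs y0 (obox e y0) by apply: obox_nbhs.
    apply: filterS => y ye; rewrite -(FQ i y ye); congr meval; apply/funext => k.
    by rewrite /z; case: (unliftP ord_max k) => [j|] ->; rewrite ?extend_family_lift ?extend_family_max.
  have mx' : mmap (@scst R letter) x' (Q i) = 0.
    have := (O_dep aD pA (Q i) Du (Ow i)).2 (fun v Dv => Q0 i v Dv); congr (mmap _ _ _ = _).
    by apply/funext => k; rewrite /w /x'; case: (unliftP ord_max k) => [j|] ->; rewrite ?extend_family_lift ?extend_family_max.
  move: hE; rewrite mx mx' subrr (bigD1 ord_max) //= => /esym/eqP; rewrite addr_eq0 => /eqP hE.
  apply: (@jet0_cancel _ _ _ _ (E ord_max)).
    rewrite eE; have := gu i; rewrite /g wE; congr (meval _ _ != 0).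
    by apply/funext => k; rewrite /x'; case: (unliftP ord_max k) => [j|] ->; rewrite ?extend_family_lift ?extend_family_max.
  have -> : T (F i) - J (fam i) = x ord_max - x' ord_max by rewrite /x /x' !extend_family_max.
  rewrite mulrC hE; apply: jet0N.
  rewrite big_mkcond; apply: jet0_sum => k; rewrite /x /x'.
  case: (unliftP ord_max k) => [j|] ->; last by rewrite eqxx; apply: jet0_zero.
  by case: ifP => _; [rewrite !extend_family_lift; apply: jet0Mr|apply: jet0_zero].
(* The derivatives of the coordinates are among the [F i], so agreement to order N gives agreement
   to order N + 1. *)
have hy N : forall i, jet0 N (T (fun y => y 0 i) - J (phi i)).
  elim: N => [|N ih] i.
    by apply/jet0_0; rewrite wsD wsN -[X in X - _]/(y0 0 i) mxE -[X in _ - X]/(phi i u) subrr.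
  apply/jet0S; split; first by rewrite wsD wsN -[X in X - _]/(y0 0 i) mxE -[X in _ - X]/(phi i u) subrr.
  move=> [al Ua]; have [k dE kE] := dyE al i Ua; have := stepF N ih (inl (k, i)); rewrite /= kE.
  by rewrite -dE -(lie_coord (dy al)).
exists u, S; split=> // j; rewrite outE; apply/eqP; rewrite -subr_eq0; apply/eqP; apply: jet0_all => N.
exact: (stepF N (hy N) (inr j)).
Qed.

End Existence.

(** * Comparison of realizations *)

Section Comparison.
Variables (R : realType) (m r : nat) (U : set 'rV[R]_m) (D : set (input R m)) (p : input R m -> 'rV[R]_r).
Hypothesis U_fin : finite_set U.
Hypothesis aD : admissible U D.
Hypothesis pA : response_map D p.
Local Notation letter := {al : 'rV[R]_m | U al}.
Local Notation ops := (@input_ops R m U).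
Local Notation O := (obs_algebra_map U D p).
Local Notation T S := (@sjet R m r _ U S).
Local Notation J u := (fun j => jetser ops u (fun v => p v 0 j)).

Lemma realization_dim u n (S : system R m r n) n' : D u -> realizes (J u) S -> tdeg D O n' -> (n' <= n)%N.
Proof. by move=> Du [nS hT] h; apply: (tdeg_le h) => z Oz; apply: (O_bound aD pA nS Du hT). Qed.

Lemma obs_series_shift u : D u -> forall a f, [set jetser ops u f | f in O] f -> [set jetser ops u f | f in O] (sshift a f).
Proof. by move=> Du [al Ua] _ [f Of <-]; exists (input_deriv al f) => //; apply: O_deriv. Qed.

Lemma obs_series_gen u j : [set jetser ops u f | f in O] (J u j).
Proof. by exists (fun v => p v 0 j) => //; apply: O_gen. Qed.

(** In the chart of [minimal_coords] the n coordinates, which are independent, are partners of n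
    members of [O]. *)
Lemma minimal_tdeg u n (S : system R m r n) : D u -> realizes (J u) S -> minimal_dim (J u) n -> tdeg D O n.
Proof.
move=> Du rS mn.
have [S' [be [psi [r1 ch hc]]]] := minimal_coords (obs_series_shift Du) (obs_series_gen u) rS mn.
have [nS' hT'] := r1; have inj := minimal_Tinj r1 mn; have [[oX cX sX] _ _ X0] := nS'.
split; last by move=> z Oz; apply: (O_bound aD pA nS' Du hT').
pose f i := s2val (cid2 (hc i)); have Of i : O (f i) := s2valP (cid2 (hc i)).
have fE i : jetser ops u (f i) = T S' (fun x : 'rV[R]_n => x 0 i) := s2valP' (cid2 (hc i)).
exists f => // fd; apply: (coords_independent oX X0).
by apply: (Obs_fdep aD pA nS' Du inj Of _ _ fd) => // i; apply: nash_coord.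
Qed.

Lemma tdeg_minimal u n : D u -> tdeg D O n -> minimal_dim (J u) n.
Proof. by move=> Du h n' S' rS'; apply: realization_dim Du rS' h. Qed.

Section Germs.
Variables (n : nat) (u : input R m).
Hypothesis Du : D u.
Hypothesis tO : tdeg D O n.

Lemma restrict_nash (S : system R m r n) (V : set 'rV[R]_n) : nash_system U S -> open V ->
  semialgebraic V -> connected V -> V (init S) -> V `<=` state_space S ->
  nash_system U (System V (dyn S) (output S) (init S)).
Proof.
move=> [[oX cX sX] nf nh X0] oV sV cV V0 VX; split=> //=.
  by move=> al Ua i; apply: nash_subset oX oV sV VX (nf al Ua i).
by move=> j; apply: nash_subset oX oV sV VX (nh j).
Qed.

(** [tdeg_Tinj] for the system restricted to a cube, so that it applies to Nash functions defined
    only near the initial state. *)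
Lemma germ_injective (S : system R m r n) e g : realizes (J u) S -> 0 < e ->
  obox e (init S) `<=` state_space S -> nash (obox e (init S)) g -> T S g = 0 ->
  forall x, obox e (init S) x -> g x = 0.
Proof.
move=> [nS hT] e0 eX ng Tg.
have nV := restrict_nash nS (@obox_open _ _ _ _) (obox_semialg _ _) (@obox_connected _ _ _ _)
  (obox_center _ e0) eX.
exact: (tdeg_Tinj aD pA nV Du hT tO ng Tg).
Qed.

(** S2 has a chart whose coordinates have jets of members of [O], and S1 has functions b with these
    same jets. The germ is b followed by the inverse of the chart. *)
Lemma germ_map (S1 S2 : system R m r n) : realizes (J u) S1 -> realizes (J u) S2 ->
  exists th, [/\ nash_germ (init S1) th, th (init S1) = init S2 &
    forall G, analytic_at (init S2) G -> T S1 (fun x => G (th x)) = T S2 G].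
Proof.
move=> [nS1 hT1] r2; have mn := tdeg_minimal Du tO; have [nS2 hT2] := r2.
have [S' [be [psi [r' [[nbe be0] [npsi psi0] pb Jb] hc]]]] :=
  minimal_coords (obs_series_shift Du) (obs_series_gen u) r2 mn.
pose f i := s2val (cid2 (hc i)); have Of i : O (f i) := s2valP (cid2 (hc i)).
have fE i : jetser ops u (f i) = T S' (fun x : 'rV[R]_n => x 0 i) := s2valP' (cid2 (hc i)).
have [b0 hb] := choose_Obs aD pA nS1 Du hT1 Of.
pose b x : 'rV[R]_n := \row_i b0 i x.
have bE i : (fun x => b x 0 i) = b0 i by apply/funext => x; rewrite mxE.
have [[oX1 cX1 sX1] _ _ X01] := nS1.
have nb : nash_map (state_space S1) b by move=> i; rewrite bE; apply: (Obs_nash nS1); exact: (hb i).1.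
have nbg : nash_germ (init S1) b.
  have [e e0 eX] := near_obox (open_nbhs_nbhs (conj oX1 X01)).
  exists e => // i; exact: (nash_subset oX1 (@obox_open _ _ _ _) (obox_semialg _ _) eX (nb i)).
have jb i : T S1 (fun x => b x 0 i) = T S2 (fun x => be x 0 i).
  by rewrite bE (hb i).2 fE Jb //; apply: analytic_at_coord.
have b0E : b (init S1) = init S'.
  rewrite -be0; apply/rowP => i; exact: (congr1 (fun F : wseries R letter => F [::]) (jb i)).
have v1 := sv_vfnear nS1; have v2 := sv_vfnear nS2.
exists (fun x => psi (b x)); split; [|by rewrite b0E|].
  by apply: nash_germ_comp => //; rewrite b0E.
move=> G aG; have aGp : analytic_at (init S') (fun y => G (psi y)).
  by apply: analytic_at_comp => [i|]; [exact: nash_germ_an npsi|rewrite psi0].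
transitivity (T S2 (fun x => G (psi (be x)))).
  apply: (ljet_comp v1 v2 _ _ jb (G := fun y => G (psi y))).
  - by move=> i; exact: nash_germ_an nbg.
  - by move=> i; exact: nash_germ_an nbe.
  - by rewrite b0E.
apply/esym; apply: (ljet_ext v2 aG); apply: filterS pb => x ->; by [].
Qed.

(** The composite has the jets of the identity, and jets are injective on germs. *)
Lemma germ_inverse (S1 S2 : system R m r n) th et : realizes (J u) S1 ->
  nash_germ (init S1) th -> nash_germ (init S2) et -> th (init S1) = init S2 ->
  (forall G, analytic_at (init S2) G -> T S1 (fun x => G (th x)) = T S2 G) ->
  (forall i, T S2 (fun x => et x 0 i) = T S1 (fun x : 'rV[R]_n => x 0 i)) ->
  \forall x \near init S1, et (th x) = x.
Proof.
move=> r1 nth net th0 Jth Jet; have [nS1 _] := r1; have [[oX _ _] _ _ X0] := nS1.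
have ncomp : nash_germ (init S1) (fun x => et (th x)) by apply: nash_germ_comp => //; rewrite th0.
have [e [e0 ne eX]] := nash_germ_restrict ncomp (open_nbhs_nbhs (conj oX X0)).
have oB := @obox_open R n e (init S1); have sB := @obox_semialg R n e (init S1).
have v1 := sv_vfnear nS1.
have : nbhs (init S1) (obox e (init S1)) by apply: obox_nbhs.
apply: filterS => x xe; apply/rowP => i; apply/eqP; rewrite -subr_eq0; apply/eqP.
apply: (germ_injective (S := S1) (g := fun x => et (th x) 0 i - x 0 i) r1 e0 eX) => //.
  by apply: nashB => //; apply: nash_coord.
rewrite /sjet (ljetB v1); [|exact: nash_germ_an ncomp|exact: analytic_at_coord].
rewrite -[X in X - _]/(T S1 (fun x => et (th x) 0 i)) (Jth (fun y => et y 0 i)); last exact: nash_germ_an net.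
by rewrite Jet subrr.
Qed.

End Germs.

Lemma sa_nash_preimage n (B : set 'rV[R]_n) f a e : nash B f ->
  semialgebraic [set y | B y /\ `|f y - a| < e].
Proof.
move=> nf; have sf := nash_saf nf.
pose C := [set w : 'rV[R]_(n + 1) | graph B f w] `&` ([set w : 'rV[R]_(n + 1) | rsubmx w 0 0 < a + e] `&`
  [set w : 'rV[R]_(n + 1) | a - e < rsubmx w 0 0]).
have sC : semialgebraic C.
  apply: semialgebraicI => //; apply: semialgebraicI; apply: sa_lt; try exact: polyfun_cst;
    by apply: polyfun_rsub; apply: polyfun_id.
rewrite (_ : [set y | _] = [set y : 'rV[R]_n | exists c : 'rV[R]_1, C (row_mx y c)]); first exact: sa_ex sC.
apply/seteqP; split=> y /=.
  move=> [By]; rewrite ltr_norml => /andP[h1 h2]; exists (f y)%:M; split; first exact/graphP.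
  by rewrite /= row_mxKr mxE eqxx mulr1n; split; lra.
move=> [c]; rewrite (rv1_scalar c) => -[/graphP[By ->]]; rewrite /= row_mxKr mxE eqxx mulr1n => -[h1 h2].
by split=> //; rewrite ltr_norml; apply/andP; split; lra.
Qed.

Lemma local_isomorphism n (S1 S2 : system R m r n) : local_realization U D p S1 ->
  local_realization U D p S2 -> tdeg D O n -> forall eps : R, 0 < eps ->
  exists u (V1 V2 : set 'rV[R]_n),
    let S1V := restrict_system S1 V1 u in
    let S2V := restrict_system S2 V2 u in
    [/\ [/\ D u, duration u < eps, system_inputs U S1 u & system_inputs U S2 u],
        [/\ open V1, semialgebraic V1 & V1 `<=` state_space S1],
        [/\ open V2, semialgebraic V2 & V2 `<=` state_space S2],
        local_realization U (shift_dom D u) (shift_map p u) S1V /\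
        local_realization U (shift_dom D u) (shift_map p u) S2V &
        isomorphic U S1V S2V].
Proof.
move=> l1 l2 tO eps eps0; have Dn := Dnil aD.
have nilR (S : system R m r n) : local_realization U D p S ->
    local_realization U (shift_dom D [::]) (shift_map p [::]) S.
  by move=> [nS h]; split=> // v [Dv _] sv; apply: h.
have rl (S : system R m r n) : local_realization U D p S -> realizes (J [::]) S.
  by move=> /nilR /(realization_jets S U_fin aD Dn pA).
have [r1 r2] := (rl _ l1, rl _ l2); have [nS1 hT1] := r1; have [nS2 hT2] := r2.
have [[oX1 cX1 sX1] nf1 nh1 X01] := nS1; have [[oX2 cX2 sX2] nf2 nh2 X02] := nS2.
have [th [nth th0 Jth]] := germ_map Dn tO r1 r2.
have [et [net et0 Jet]] := germ_map Dn tO r2 r1.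
have i1 := germ_inverse Dn tO r1 nth net th0 Jth (fun i => Jet (fun x => x 0 i) (analytic_at_coord _ _)).
have i2 := germ_inverse Dn tO r2 net nth et0 Jet (fun i => Jth (fun x => x 0 i) (analytic_at_coord _ _)).
have nX1 : nbhs (init S1) (state_space S1) by apply: open_nbhs_nbhs.
have nX2 : nbhs (init S2) (state_space S2) by apply: open_nbhs_nbhs.
have [e2 [e20 ne2 h2]] := nash_germ_restrict net (filterI nX2 i2).
have tB : \forall x \near init S1, obox e2 (init S2) (th x).
  by apply: germ_near => [i|]; [exact: nash_germ_an nth|rewrite th0; apply: obox_nbhs].
have [e1 [e10 ne1 h1]] := nash_germ_restrict nth (filterI nX1 (filterI i1 tB)).
pose V1 := obox e1 (init S1); pose B2 := obox e2 (init S2).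
(* The points of [B2] that et sends into [V1], so that th and et become mutually inverse. Membership
   in [B2] is repeated for each coordinate to match [sa_nash_preimage]. *)
pose V2 := B2 `&` [set y | forall i, [set y | B2 y /\ `|et y 0 i - init S1 0 i| < e1] y].
have V2E y : V2 y <-> B2 y /\ V1 (et y).
  split; first by move=> [By h]; split=> // i; have [] := h i.
  by move=> [By h]; split=> [//|i /=]; split=> //; apply: (h i).
have oV1 : open V1 by apply: obox_open. have sV1 : semialgebraic V1 by apply: obox_semialg.
have V1X : V1 `<=` state_space S1 by move=> x /h1[].
have V2X : V2 `<=` state_space S2 by move=> x /V2E[/h2[]].
have thV x : V1 x -> V2 (th x) /\ et (th x) = x.
  by move=> xV; have [_ [E tb]] := h1 x xV; split=> //; apply/V2E; split=> //; rewrite E.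
have etV y : V2 y -> V1 (et y) /\ th (et y) = y.
  by move=> /V2E[By yV]; split=> //; have [_ E] := h2 y By.
have sV2 : semialgebraic V2.
  apply: semialgebraicI; first exact: obox_semialg.
  by apply: sa_bigcap => i; apply: sa_nash_preimage.
have vec_diff k (f : 'rV[R]_n -> 'rV[R]_n) (V : set 'rV[R]_n) x : open V -> nash_map V f -> V x -> k = f x ->
    differentiable f x /\ forall v, 'd f x v = \row_j 'd (fun x => f x 0 j) x v.
  move=> oV nV Vx _; have df j : differentiable (fun x => f x 0 j) x.
    by apply: analytic_at_diff; apply: nash_at oV (nV j) Vx.
  by split=> [|v]; have [] := @diff_rowE _ _ _ f x 0 df => // _ _; have [] := @diff_rowE _ _ _ f x v df.
have oB2 : open B2 by apply: obox_open.
have oV2 : open V2.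
  rewrite openE => y /V2E[By yV].
  have [df _] := vec_diff _ et B2 y oB2 ne2 By erefl.
  have h3 : \forall z \near y, V1 (et z).
    by apply: (differentiable_continuous df); apply: open_nbhs_nbhs.
  have h4 : \forall z \near y, B2 z by apply: open_nbhs_nbhs.
  by apply: filterS2 h3 h4 => z z1 z2; apply/V2E.
have cV2 : connected V2.
  rewrite (_ : V2 = th @` V1).
    apply: connected_continuous_connected; first exact: obox_connected.
    apply: continuous_in_subspaceT => x; rewrite inE => xV.
    by have [df _] := vec_diff _ th V1 x oV1 ne1 xV erefl; exact: differentiable_continuous.
  apply/seteqP; split=> [y /etV[h3 h4]|_ [x /thV[h3 _] <-] //]; by exists (et y).
have V10 : V1 (init S1) by apply: obox_center.
have V20 : V2 (init S2) by rewrite -th0; apply: (thV _ V10).1.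
have nV1 := restrict_nash nS1 oV1 sV1 (@obox_connected _ _ _ _) V10 V1X.
have nV2 := restrict_nash nS2 oV2 sV2 cV2 V20 V2X.
have endE (S : system R m r n) : nash_system U S -> end_state S [::] = init S.
  move=> nS; have [_ _ _ X0] := nS.
  by rewrite (end_stateE (nash_system_dyn nS) _ (traj_nil X0)).
have inS (S : system R m r n) : nash_system U S -> system_inputs U S [::].
  move=> nS; have [[oX _ _] _ _ X0] := nS.
  have [tau tau0 sub] := short_system_inputs U_fin oX (nash_system_dyn nS) X0.
  by apply: sub; split=> //; rewrite /duration big_nil.
(* The isomorphism exists already near the two initial states, so the empty input serves for every
   eps. *)
exists [::], V1, V2; rewrite /restrict_system !endE //=; split=> //.
- by split=> //; rewrite ?/duration ?big_nil //; apply: inS.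
- by split; apply/(realization_jets _ U_fin aD Dn pA); split.
have v1 := sv_vfnear nS1; have v2 := sv_vfnear nS2.
have ath i : analytic_at (init S1) (fun x => th x 0 i) by exact: nash_germ_an nth.
exists th, et; split=> //=.
- split=> //; by move=> i; apply: nash_subset oB2 oV2 sV2 _ (ne2 i) => y /V2E[].
(* Conjugacy of the dynamics, and then equality of outputs, are identities between Nash functions on
   the cube [V1] and may be checked on jets. *)
- move=> x al xV Ua; have [_ ->] := vec_diff _ th V1 x oV1 ne1 xV erefl.
  apply/rowP => i; rewrite mxE; apply/eqP; rewrite -subr_eq0; apply/eqP.
  have nd : nash V1 (fun x => dyn S2 al (th x) 0 i).
    by apply: (nash_comp oV1 oX2 sV1 ne1 (nf2 al Ua i)) => z /thV[/V2X].
  have nl : nash V1 (lie_deriv (dyn S1 al) (fun x => th x 0 i)).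
    by apply: nash_lie => //= k; apply: nash_subset oX1 oV1 sV1 V1X (nf1 al Ua k).
  apply: (germ_injective (g := fun x => dyn S2 al (th x) 0 i - lie_deriv (dyn S1 al) (fun x => th x 0 i) x)
    Dn tO r1 e10 V1X) => //; first exact: nashB.
  rewrite /sjet (ljetB v1); [|exact: nash_at oV1 nd V10|exact: nash_at oV1 nl V10].
  rewrite -[X in X - _]/(T S1 (fun x => dyn S2 al (th x) 0 i)) (Jth (fun y => dyn S2 al y 0 i)).
    rewrite -[X in _ - X]/(sshift (exist _ al Ua) (T S1 (fun x => th x 0 i))).
    rewrite (Jth (fun y => y 0 i)); last exact: analytic_at_coord.
    by rewrite -(lie_coord (dyn S2 al)) subrr.
  exact: nash_at oX2 (nf2 al Ua i) X02.
- move=> x xV; apply/rowP => j; apply/eqP; rewrite -subr_eq0; apply/eqP.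
  have no : nash V1 (fun x => output S2 (th x) 0 j).
    by apply: (nash_comp oV1 oX2 sV1 ne1 (nh2 j)) => z /thV[/V2X].
  have no1 : nash V1 (fun x => output S1 x 0 j) by apply: nash_subset oX1 oV1 sV1 V1X (nh1 j).
  apply: (germ_injective (g := fun x => output S2 (th x) 0 j - output S1 x 0 j) Dn tO r1 e10 V1X) => //.
    exact: nashB.
  rewrite /sjet (ljetB v1); [|exact: nash_at oV1 no V10|exact: nash_at oV1 no1 V10].
  rewrite -[X in X - _]/(T S1 (fun x => output S2 (th x) 0 j)) (Jth (fun y => output S2 y 0 j)).
    by rewrite hT2 -[X in _ - X]/(T S1 (fun x => output S1 x 0 j)) hT1 subrr.
  exact: nash_at oX2 (nh2 j) X02.
Qed.

Lemma realization_criteria u n (S : system R m r n) : D u ->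
  local_realization U (shift_dom D u) (shift_map p u) S ->
  (minimal_realization U (shift_dom D u) (shift_map p u) S <-> trdeg D O n) /\
  (trdeg D O n <-> semialg_reachable U S /\ semialg_observable U S).
Proof.
move=> Du lS; have [nS hT] := (realization_jets S U_fin aD Du pA).1 lS.
have Otd := O_trdegP aD pA n.
split; split.
- move=> [_ mn]; apply/Otd; apply: (minimal_tdeg Du (conj nS hT)) => n' S' r'.
  by apply: (mn n' S'); apply/(realization_jets _ U_fin aD Du pA).
- move=> /Otd tO; split=> // n' S' /(realization_jets _ U_fin aD Du pA) r'.
  exact: realization_dim Du r' tO.
- move=> /Otd tO; have inj := tdeg_Tinj aD pA nS Du hT tO.
  split; first by apply/(reach_Tinj U_fin nS).
  by apply/(observable_tdeg nS); apply/(Tinj_tdeg aD pA nS Du hT inj).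
move=> [/(reach_Tinj U_fin nS) inj /(observable_tdeg nS) h].
by apply/Otd; apply/(Tinj_tdeg aD pA nS Du hT inj).
Qed.

End Comparison.

Theorem mainTheorem1 (R : realType) (m r : nat) (U : set 'rV[R]_m)
    (D : set (input R m)) (p : input R m -> 'rV[R]_r)
    (U_finite : finite_set U) (D_adm : admissible U D)
    (p_resp : response_map D p) (p_ext : has_negative_extension U D p) :
  [/\ (* (i) *)
      (exists d, trdeg D (obs_algebra_map U D p) d) <->
      (exists2 u, D u & exists n (S : system R m r n),
         local_realization U (shift_dom D u) (shift_map p u) S),
      (* (ii) *)
      forall d, trdeg D (obs_algebra_map U D p) d ->
        forall eps : R, 0 < eps ->
        exists u (S : system R m r d),
          [/\ D u, duration u < eps,
              local_realization U (shift_dom D u) (shift_map p u) S,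
              semialg_reachable U S & semialg_observable U S],
      (* (iii) *)
      forall u n (S : system R m r n), D u ->
        local_realization U (shift_dom D u) (shift_map p u) S ->
        (minimal_realization U (shift_dom D u) (shift_map p u) S <->
           trdeg D (obs_algebra_map U D p) n) /\
        (trdeg D (obs_algebra_map U D p) n <->
           semialg_reachable U S /\ semialg_observable U S) &
      (* (iv) *)
      forall n1 n2 (S1 : system R m r n1) (S2 : system R m r n2),
        local_realization U D p S1 -> local_realization U D p S2 ->
        semialg_reachable U S1 -> semialg_observable U S1 ->
        semialg_reachable U S2 -> semialg_observable U S2 ->
        forall eps : R, 0 < eps ->
        exists u (V1 : set 'rV[R]_n1) (V2 : set 'rV[R]_n2),
          let S1V := restrict_system S1 V1 u in
          let S2V := restrict_system S2 V2 u in
          [/\ [/\ D u, duration u < eps, system_inputs U S1 u &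
                  system_inputs U S2 u],
              [/\ open V1, semialgebraic V1 & V1 `<=` state_space S1],
              [/\ open V2, semialgebraic V2 & V2 `<=` state_space S2],
              local_realization U (shift_dom D u) (shift_map p u) S1V /\
              local_realization U (shift_dom D u) (shift_map p u) S2V &
              isomorphic U S1V S2V]].
Proof.
have Dn := Dnil D_adm.
have crit u n (S : system R m r n) (Du : D u) := @realization_criteria R m r U D p U_finite D_adm p_resp u n S Du.
have gen d : trdeg D (obs_algebra_map U D p) d -> forall eps : R, 0 < eps ->
    exists u (S : system R m r d), [/\ D u, duration u < eps,
      local_realization U (shift_dom D u) (shift_map p u) S,
      semialg_reachable U S & semialg_observable U S].
  move=> td eps eps0; have tO := (O_trdegP D_adm p_resp d).1 td.
  have [u [S [Du du nS hT]]] := generic_realization U_finite D_adm p_resp tO eps0.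
  have lS := (realization_jets S U_finite D_adm Du p_resp).2 (conj nS hT).
  exists u, S; have [_ [h _]] := crit u d S Du lS; have [h1 h2] := h td; by split.
split=> //.
  split=> [[d td]|[u Du [n [S lS]]]].
    by have [u [S [Du _ lS _ _]]] := gen d td 1 ltr01; exists u => //; exists d, S.
  have [nS hT] := (realization_jets S U_finite D_adm Du p_resp).1 lS.
  (* A realization of dimension n bounds the number of independent observations, so a largest number
     exists. *)
  have [d _ td] := tdeg_exists (ex_intro _ _ Dn) (fun z Oz => O_bound D_adm p_resp nS Du hT Oz).
  by exists d; apply/(O_trdegP D_adm p_resp).
move=> n1 n2 S1 S2 l1 l2 re1 ob1 re2 ob2 eps eps0.
have tO n (S : system R m r n) : local_realization U D p S -> semialg_reachable U S ->
    semialg_observable U S -> tdeg D (obs_algebra_map U D p) n.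
  move=> [nS h] re ob; apply/(O_trdegP D_adm p_resp).
  have lS : local_realization U (shift_dom D [::]) (shift_map p [::]) S.
    by split=> // v [Dv _] sv; apply: h.
  by have [_ [_]] := crit [::] n S Dn lS; apply.
(* Both dimensions are the transcendence degree of the observation algebra, hence equal. *)
have t1 := tO _ _ l1 re1 ob1; have n12 := tdeg_unique t1 (tO _ _ l2 re2 ob2); subst n2.
exact: (local_isomorphism U_finite D_adm p_resp l1 l2 t1 eps0).
Qed.
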